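(* Let $T>0$ and let $u\in C([0,T]; \mathcal{Z}_{4,2})$ be a solution of the initial-value problem $$ \begin{cases} u_{t}+\mathcal{H}\partial_{x}^{2}u+u_{xyy}+uu_{x}=0, & (x,y)\in\mathbb{R}^2,\ t>0,\\ u(x,y,0)=\phi(x,y). \end{cases} $$ If there exist three different times $t_1, t_2, t_3 \in [0,T]$ such that $u(t_j)\in \mathcal{Z}_{7,7/2}$ for $j=1,2,3$, then $$ u(x,y,t)=0 $$ for all $x,y\in\mathbb{R}$ and all $t\in[0,T]$.
   Context: The function $u=u(x,y,t)$ is real-valued. $\mathcal{H}$ is the Hilbert transform in the $x$ variable, $\mathcal{H}u(x,y,t)=\mathrm{p.v.}\frac{1}{\pi}\int_{\mathbb{R}}\frac{u(z,y,t)}{x-z}\,dz$ (Fourier multiplier $-i\,\mathrm{sgn}(\xi)$). $\mathcal{Z}_{s,r}:=H^s(\mathbb{R}^2)\cap L^2((1+x^2+y^2)^{r}\,dx\,dy)$, with squared norm the sum of the squared norms of the two spaces. Solution means that the equation holds in the sense of distributions (with $uu_x=\frac12\partial_x(u^2)$), equivalently that the corresponding Duhamel integral equation holds. *)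

(* Defs.v *)
From HB Require Import structures.
From mathcomp Require Import all_boot all_order all_algebra.
From mathcomp Require Import all_classical all_reals all_analysis.
From mathcomp Require Import complex.

Set Implicit Arguments.
Unset Strict Implicit.
Unset Printing Implicit Defensive.

Import Order.TTheory GRing.Theory Num.Theory.
Import numFieldNormedType.Exports.

Local Open Scope classical_set_scope.
Local Open Scope ring_scope.

Section Defs.
Variable R : realType.

Notation leb := (@lebesgue_measure R).

(* R * R with the display carried by the product of the library's Lebesgue
   measures; the sigma-algebra is the Borel one. *)
Local Notation plane := (measurableTypeR R * measurableTypeR R)%type.

Definition leb2 : {measure set plane -> \bar R} := (leb \x leb)%E.

(* 1 + |p|^2 with the Euclidean norm (the library's norm on R * R is the max
   norm). *)
Definition bracket2 (p : R * R) : R := 1 + p.1 ^+ 2 + p.2 ^+ 2.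

(* For real-valued f, the truncated unitary Fourier integral
   (2 pi)^-1 \int_{[-n, n]^2} e^{-i (x xi + y eta)} f(x, y) dx dy,
   split into its real and imaginary parts. *)
Definition fourier_trunc (n : nat) (f : R * R -> R) (k : R * R) : R[i] :=
  let box : set (R * R) := `[- n%:R, n%:R] `*` `[- n%:R, n%:R] in
  Complex
    ((2 * pi)^-1 * \int[leb2]_(p in box) (cos (p.1 * k.1 + p.2 * k.2) * f p))
    (- ((2 * pi)^-1 *
        \int[leb2]_(p in box) (sin (p.1 * k.1 + p.2 * k.2) * f p))).

Definition is_fourier (f : R * R -> R) (g : R * R -> R[i]) : Prop :=
  [/\ measurable_fun [set: plane] (fun k => complex.Re (g k)),
      measurable_fun [set: plane] (fun k => complex.Im (g k)) &
      (\int[leb2]_k ((Normc.normc (fourier_trunc n f k - g k)) ^+ 2)%:E)%E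
        @[n --> \oo] --> 0%E].

(* The L^2 Fourier transform, by Plancherel's theorem well defined up to a null
   set when f is square integrable; it is only used for such f. *)
Definition fourier (f : R * R -> R) : R * R -> R[i] :=
  xget (fun=> 0) [set g | is_fourier f g].

Definition sobolev_norm2 (s : R) (f : R * R -> R) : \bar R :=
  (\int[leb2]_k (bracket2 k `^ s * Normc.normc (fourier f k) ^+ 2)%:E)%E.

Definition weighted_norm2 (r : R) (f : R * R -> R) : \bar R :=
  (\int[leb2]_p (bracket2 p `^ r * f p ^+ 2)%:E)%E.

(* Functions stand for their classes modulo equality almost everywhere, and
   s, r >= 0, so that both spaces consist of square integrable functions. *)
Definition sobolev (s : R) : set (R * R -> R) :=
  [set f | f \in Lfun leb2 2%:E /\ (sobolev_norm2 s f < +oo)%E].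

Definition weighted_L2 (r : R) : set (R * R -> R) :=
  [set f | measurable_fun [set: plane] f /\ (weighted_norm2 r f < +oo)%E].

Definition Z (s r : R) : set (R * R -> R) := sobolev s `&` weighted_L2 r.

Definition Z_norm2 (s r : R) (f : R * R -> R) : \bar R :=
  (sobolev_norm2 s f + weighted_norm2 r f)%E.

Definition continuous_in_Z (T s r : R) (u : R -> R * R -> R) : Prop :=
  forall t0, t0 \in `[0, T] ->
    Z s r (u t0) /\
    Z_norm2 s r (fun p => u t p - u t0 p)
      @[t --> within `[0, T] (nbhs t0)] --> 0%E.

(* C^infinity: every iterated directional derivative is differentiable
   everywhere. *)
Definition smooth (V : normedModType R) (f : V -> R) : Prop :=
  forall (vs : seq V) (x : V),
    differentiable (foldr (fun v g => 'D_v g) f vs) x.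

(* Test functions on (0, T) x R^2; points are written (t, (x, y)). *)
Definition test_function (T : R) (psi : R * (R * R) -> R) : Prop :=
  let supp := closure [set q | psi q != 0] in
  [/\ smooth psi, compact supp & supp `<=` [set q | 0 < q.1 < T]].

Definition dt (psi : R * (R * R) -> R) : R * (R * R) -> R := 'D_(1, (0, 0)) psi.
Definition dx (psi : R * (R * R) -> R) : R * (R * R) -> R := 'D_(0, (1, 0)) psi.
Definition dy (psi : R * (R * R) -> R) : R * (R * R) -> R := 'D_(0, (0, 1)) psi.

(* Hilbert transform in x. *)
Definition hilbert (psi : R * (R * R) -> R) (q : R * (R * R)) : R :=
  let: (t, (x, y)) := q in
  lim ((pi^-1 * \int[leb]_(z in [set z | e < `|x - z|])
                   (psi (t, (z, y)) / (x - z))) @[e --> 0^'+]).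

(* Iterated rather than joint integral: the representatives u t are not assumed
   to be jointly measurable in (t, p). *)
Definition pairing (T : R) (u : R -> R * R -> R) (psi : R * (R * R) -> R) : R :=
  \int[leb]_(t in `[0, T]) \int[leb2]_p (u t p * psi (t, p)).

(* u_t + H u_xx + u_xyy + (u^2)_x / 2 = 0 in the sense of distributions on
   (0, T) x R^2, all derivatives and the Hilbert transform being transposed onto
   the test function; the transpose of H is - H. *)
Definition weak_solution (T : R) (u : R -> R * R -> R) : Prop :=
  forall psi, test_function T psi ->
    - pairing T u (dt psi)
    - pairing T u (hilbert (dx (dx psi)))
    - pairing T u (dx (dy (dy psi)))
    - 2^-1 * pairing T (fun t p => u t p ^+ 2) (dx psi) = 0.

Definition ivp_solution (T : R) (u : R -> R * R -> R) (phi : R * R -> R) :=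
  weak_solution T u /\ {ae leb2, forall p, u 0 p = phi p}.

End Defs.

(* Main.v *)
(** Test the equation against [a(x / n) b(y)]. Letting [n] tend to infinity, with
    suitable powers of [n] in front, one finds for every [b] in C_c^oo(R) that the
    first moment I = \int x u b has derivative (1/2) \int u^2 b and, because of the
    slow decay of Hilbert transforms, that \int_s^t I = 0 whenever [u] has weight
    7/2 at the times [s] and [t]. With three such times, Rolle's theorem, used
    twice, gives a time at which \int u^2 b = 0. As [b] increases to 1, the L^2 norm
    of [u] at these times tends to 0.
    This norm is conserved. Indeed [u] is bounded and Lipschitz uniformly in time, by
    Fourier inversion (through Fejer means); in the evolution of
    \iint u(p) u(q) G(p - q) with an even kernel [G] the linear terms drop out by
    parity, and the nonlinear one, -(1/6) \iint (u(p) - u(q))^3 G_x(p - q), tends to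
    0 as [G] shrinks to a Dirac mass. *)

Require Import Defs.
From HB Require Import structures.
From mathcomp Require Import all_boot all_order all_algebra.
From mathcomp Require Import all_classical all_reals all_analysis.
From mathcomp Require Import measurable_realfun complex ring lra.
Import Order.TTheory GRing.Theory Num.Theory.
Import numFieldNormedType.Exports.
Set Implicit Arguments.
Unset Strict Implicit.
Unset Printing Implicit Defensive.
Local Open Scope classical_set_scope.
Local Open Scope ring_scope.

(** The first difficulty is to read off decay from test functions. If the profile a is supported in
    [1, 2], every local term tested against a(x / n) b(y) lives where x >= n, while the Hilbert
    transform of a'' survives near 0, where it is h0 + c x / n up to higher order. The amplitude n^3
    turns this into n h0 + c x: the first moment appears, below a divergent multiple of \int u b.
    That multiple is disposed of beforehand by the same device with the profile g' and the amplitude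
    n^2, whose limit is affine in time with slope c \int u b. The exponent 7/2 is critical: the
    square of n^3 a(x / n) integrates to order n^7, the size of the weight at x of order n, and the
    gain comes from the tail of a convergent integral. The second difficulty is that u is not an
    admissible test function. Doubling the variables freezes one of them, so that each slice is a
    moment to which the equation applies; the cubic identity then yields two Lipschitz factors
    against the single derivative that falls on the kernel. *)

Local Notation leb := lebesgue_measure.
Local Notation plane R := (measurableTypeR R * measurableTypeR R)%type.
Local Notation D1 f := (f^`()%classic).

(** * Real-valued integrals *)

Section rintegrable.
Context d {T : measurableType d} {R : realType}.
Variable mu : {measure set T -> \bar R}.
Implicit Types f g h : T -> R.

Definition rintegrable f := mu.-integrable [set: T] (EFin \o f).

Lemma rintegrable_measurable f : rintegrable f -> measurable_fun [set: T] f.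
Proof. by move/measurable_int/measurable_EFinP. Qed.

Lemma le_rintegrable f g : measurable_fun [set: T] f ->
  (forall x, `|f x| <= g x) -> rintegrable g -> rintegrable f.
Proof.
move=> mf fg ig; apply: (le_integrable measurableT _ _ ig).
  exact/measurable_EFinP.
by move=> x _ /=; rewrite lee_fin (le_trans (fg x))// ler_norm.
Qed.

Lemma rintegrableD f g : rintegrable f -> rintegrable g ->
  rintegrable (fun x => f x + g x).
Proof.
by move=> i j; have := integrableD measurableT i j;
  apply: eq_integrable => // x _ /=; rewrite EFinD.
Qed.

Lemma rintegrableB f g : rintegrable f -> rintegrable g ->
  rintegrable (fun x => f x - g x).
Proof.
by move=> i j; have := integrableB measurableT i j;
  apply: eq_integrable => // x _ /=; rewrite EFinB.
Qed.

Lemma rintegrableZ c f : rintegrable f -> rintegrable (fun x => c * f x).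
Proof.
by move=> i; have := integrableZl measurableT c i;
  apply: eq_integrable => // x _ /=; rewrite EFinM.
Qed.

Lemma rintegrableZr c f : rintegrable f -> rintegrable (fun x => f x * c).
Proof.
by move=> /(rintegrableZ c); under [X in _ -> rintegrable X]eq_fun do rewrite mulrC.
Qed.

Lemma rintegrable_norm f : rintegrable f -> rintegrable (fun x => `|f x|).
Proof. exact: integrable_norm. Qed.

Lemma le_norm_Rintegral f g : measurable_fun [set: T] f ->
  (forall x, `|f x| <= g x) -> rintegrable g ->
  `|\int[mu]_x f x| <= \int[mu]_x g x.
Proof.
move=> mf fg ig; have jf := le_rintegrable mf fg ig.
apply: (le_trans (le_normr_Rintegral measurableT jf)).
by apply: le_Rintegral => //; exact: rintegrable_norm.
Qed.

Lemma EFin_Rintegral f : rintegrable f ->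
  (\int[mu]_x f x)%:E = (\int[mu]_x (f x)%:E)%E.
Proof. by move=> jf; rewrite /Rintegral fineK//; exact: integrable_fin_num. Qed.

Lemma rintegrable_ge0P f : measurable_fun [set: T] f -> (forall x, 0 <= f x) ->
  (\int[mu]_x (f x)%:E < +oo)%E -> rintegrable f.
Proof.
move=> mf f0 fy; apply/integrableP; split; first exact/measurable_EFinP.
by under eq_integral do rewrite /= ger0_norm//.
Qed.

Lemma rintegrable_lty f : rintegrable f -> (forall x, 0 <= f x) ->
  (\int[mu]_x (f x)%:E < +oo)%E.
Proof. by move=> jf f0; rewrite -EFin_Rintegral// ltry. Qed.

Lemma cvg_Rintegral (f_ : nat -> T -> R) f g :
  (forall n, measurable_fun [set: T] (f_ n)) ->
  (forall x, f_ ^~ x @ \oo --> f x) ->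
  (forall n x, `|f_ n x| <= g x) -> rintegrable g ->
  \int[mu]_x f_ n x @[n --> \oo] --> \int[mu]_x f x.
Proof.
move=> mf ff fg ig.
have mf0 : measurable_fun [set: T] f.
  by apply: (@measurable_fun_cvg _ _ _ _ f_) => // x _; exact: ff.
have f0g x : `|f x| <= g x.
  have cf : `|f_ n x| @[n --> \oo] --> `|f x| by apply: cvg_norm; exact: ff.
  rewrite -(cvg_lim _ cf)//; apply: limr_le; first by apply/cvg_ex; eexists; exact: cf.
  by apply: nearW => n; exact: fg.
have [|||||_ _] := @dominated_convergence _ _ _ mu _ measurableT
  (fun n => EFin \o f_ n) (EFin \o f) (EFin \o g).
- by move=> n; exact/measurable_EFinP.
- exact/measurable_EFinP.
- by apply: aeW => x _ /=; apply/cvg_EFin; [exact: nearW|exact: ff].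
- exact: ig.
- by apply: aeW => x n _ /=; rewrite lee_fin.
move=> c; apply: fine_cvg; rewrite EFin_Rintegral//; exact: le_rintegrable ig.
Qed.

Lemma rintegrableM_sqr f g : measurable_fun [set: T] f ->
  measurable_fun [set: T] g -> rintegrable (fun x => f x ^+ 2) ->
  rintegrable (fun x => g x ^+ 2) -> rintegrable (fun x => f x * g x).
Proof.
move=> mf mg f2 g2; apply: (le_rintegrable _ _ (rintegrableD f2 g2)).
  exact: measurable_funM.
move=> x; rewrite ler_norml; apply/andP; split; nra.
Qed.

Lemma Rintegral_CauchySchwarz f g : measurable_fun [set: T] f ->
  measurable_fun [set: T] g -> rintegrable (fun x => f x ^+ 2) ->
  rintegrable (fun x => g x ^+ 2) ->
  (\int[mu]_x (f x * g x)) ^+ 2 <=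
  (\int[mu]_x f x ^+ 2) * \int[mu]_x g x ^+ 2.
Proof.
move=> mf mg f2 g2; have fg := rintegrableM_sqr mf mg f2 g2.
set A := \int[mu]_x f x ^+ 2; set B := \int[mu]_x g x ^+ 2.
set C := \int[mu]_x (f x * g x).
have A0 : 0 <= A by apply: Rintegral_ge0 => x _; exact: sqr_ge0.
have B0 : 0 <= B by apply: Rintegral_ge0 => x _; exact: sqr_ge0.
have q s t : 0 <= s ^+ 2 * A + 2 * s * t * C + t ^+ 2 * B.
  have i1 := rintegrableZ (s ^+ 2) f2; have i2 := rintegrableZ (2 * s * t) fg.
  have i3 := rintegrableZ (t ^+ 2) g2.
  rewrite -!RintegralZl// -RintegralD// -RintegralD//; last exact: rintegrableD.
  apply: Rintegral_ge0 => x _.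
  rewrite (_ : _ + _ = (s * f x + t * g x) ^+ 2); last by ring.
  exact: sqr_ge0.
have [A1|A1] := eqVneq A 0.
  rewrite A1 mul0r; have [->|C0] := eqVneq C 0; first by rewrite expr0n.
  (* With A = 0 the form is affine in s, and this choice gives it the value -1. *)
  have := q (- (B + 1) / (2 * C)) 1.
  rewrite A1 mulr0 add0r expr1n mul1r mulr1.
  by have -> : 2 * (- (B + 1) / (2 * C)) * C = - (B + 1); [field|lra].
(* The minimiser of the form up to scaling; the value there is A (A B - C^2). *)
have := q (- C) A.
have {}A0 : 0 < A by rewrite lt_neqAle eq_sym A1.
rewrite (_ : _ + _ + _ = A * (A * B - C ^+ 2)); last by ring.
by rewrite pmulr_rge0// subr_ge0.
Qed.

End rintegrable.

(** * Fubini's theorem for real-valued integrals *)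

Section real_fubini.
Context d1 d2 (T1 : measurableType d1) (T2 : measurableType d2) (R : realType).
Variable m1 : {sigma_finite_measure set T1 -> \bar R}.
Variable m2 : {sigma_finite_measure set T2 -> \bar R}.
Implicit Type f : T1 * T2 -> R.

(** The inner integral is [fine] of the difference of two Tonelli integrals, those of the positive
    and the negative part, and each of these is measurable in [x]. *)
Lemma measurable_Rintegral_snd f : measurable_fun [set: T1 * T2] f ->
  measurable_fun [set: T1] (fun x => \int[m2]_y f (x, y)).
Proof.
move=> mf; have mEf : measurable_fun [set: T1 * T2] (EFin \o f).
  exact/measurable_EFinP.
apply: (@measurableT_comp _ _ _ _ _ _ fine) => //.
rewrite (_ : (fun x => _) = (fun x => \int[m2]_y (EFin \o f)^\+ (x, y) -
    \int[m2]_y (EFin \o f)^\- (x, y))%E).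
  apply: emeasurable_funB.
    by apply: measurable_fun_fubini_tonelli_F => //; exact: measurable_funepos.
  by apply: measurable_fun_fubini_tonelli_F => //; exact: measurable_funeneg.
apply/funext => x; rewrite [LHS]integralE; congr (_ - _)%E.
  by apply: eq_integral => y _; exact: (congr1 (@^~ y)
    (funepos_comp (EFin \o f) (pair x))).
by apply: eq_integral => y _; exact: (congr1 (@^~ y)
  (funeneg_comp (EFin \o f) (pair x))).
Qed.

Lemma rintegrable_prodl f (G : T1 -> R) : measurable_fun [set: T1 * T2] f ->
  (forall x, rintegrable m2 (fun y => f (x, y))) ->
  (forall x, \int[m2]_y `|f (x, y)| <= G x) -> rintegrable m1 G ->
  rintegrable (m1 \x m2)%E f.
Proof.
move=> mf if2 fG iG; apply/integrable12ltyP; first exact/measurable_EFinP.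
have mG : (\int[m1]_x (`|G x|)%:E < +oo)%E.
  by apply: (rintegrable_lty (rintegrable_norm iG)).
apply: le_lt_trans mG; apply: ge0_le_integral => //.
- by move=> x _; exact: integral_ge0.
- apply: (measurable_fun_fubini_tonelli_F (fun z => `|(EFin \o f) z|%E)) => //.
  by apply: measurableT_comp => //; exact/measurable_EFinP.
- apply/measurable_EFinP/measurableT_comp => //.
  exact: rintegrable_measurable iG.
- move=> x _; rewrite -(EFin_Rintegral (rintegrable_norm (if2 x))) lee_fin.
  exact: le_trans (fG x) (ler_norm _).
Qed.

Lemma rintegrable_prodM f (g : T1 -> R) (h : T2 -> R) :
  measurable_fun [set: T1 * T2] f ->
  (forall x y, `|f (x, y)| <= g x * h y) ->
  rintegrable m1 g -> rintegrable m2 h -> rintegrable (m1 \x m2)%E f.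
Proof.
move=> mf fgh ig ih.
have m2f x : measurable_fun [set: T2] (fun y => f (x, y)).
  exact: measurableT_comp.
have i2 x : rintegrable m2 (fun y => f (x, y)).
  by apply: (le_rintegrable _ (fgh x)) => //; exact: rintegrableZ.
apply: (@rintegrable_prodl _ (fun x => g x * \int[m2]_y h y)) => //.
  move=> x; rewrite -RintegralZl//; apply: le_Rintegral => //.
  - exact: rintegrable_norm.
  - exact: rintegrableZ.
exact: rintegrableZr.
Qed.

Lemma Rintegral12 f : rintegrable (m1 \x m2)%E f ->
  \int[m1]_x (\int[m2]_y f (x, y)) = \int[(m1 \x m2)%E]_z f z.
Proof.
move=> if12; have mf := rintegrable_measurable if12.
rewrite /Rintegral -(integral12_prod_meas1 if12) /fubini_F; congr fine.
apply: ae_eq_integral => //.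
- exact/measurable_EFinP/(measurable_Rintegral_snd mf).
- exact: (measurable_fubini_F if12).
(* [fine] forgets whether an inner integral is infinite; that can happen only for a null set of
   [x]. *)
- have := ae_integrable1 if12; apply: filterS => x ix _ /=.
  by rewrite fineK//; exact: integrable_fin_num.
Qed.

End real_fubini.

Section real_fubini_swap.
Context d1 d2 (T1 : measurableType d1) (T2 : measurableType d2) (R : realType).
Variable m1 : {sigma_finite_measure set T1 -> \bar R}.
Variable m2 : {sigma_finite_measure set T2 -> \bar R}.
Implicit Type f : T1 * T2 -> R.

Lemma measurable_Rintegral_fst f : measurable_fun [set: T1 * T2] f ->
  measurable_fun [set: T2] (fun y => \int[m1]_x f (x, y)).
Proof.
move=> mf.
have mg : measurable_fun setT (fun q : T2 * T1 => f (q.2, q.1)).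
  by apply: (measurableT_comp mf); exact: measurable_fun_pair.
exact: (measurable_Rintegral_snd m1 mg).
Qed.

Lemma Rintegral21 f : rintegrable (m1 \x m2)%E f ->
  \int[m2]_y (\int[m1]_x f (x, y)) = \int[(m1 \x m2)%E]_z f z.
Proof.
move=> if12; have mf := rintegrable_measurable if12.
rewrite /Rintegral -(integral21_prod_meas1 if12) /fubini_G; congr fine.
apply: ae_eq_integral => //.
- exact/measurable_EFinP/(measurable_Rintegral_fst mf).
- exact: (measurable_fubini_G if12).
- have := ae_integrable2 if12; apply: filterS => x ix _ /=.
  by rewrite fineK//; exact: integrable_fin_num.
Qed.

Lemma Rintegral_swap f : rintegrable (m1 \x m2)%E f ->
  \int[m1]_x (\int[m2]_y f (x, y)) = \int[m2]_y (\int[m1]_x f (x, y)).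
Proof. by move=> if12; rewrite Rintegral12// Rintegral21. Qed.

Lemma Rintegral_prodM (g : T1 -> R) (h : T2 -> R) :
  rintegrable m1 g -> rintegrable m2 h ->
  \int[(m1 \x m2)%E]_z (g z.1 * h z.2) = \int[m1]_x g x * \int[m2]_y h y.
Proof.
move=> ig ih; rewrite -Rintegral12.
  under eq_Rintegral do rewrite /= RintegralZl//.
  by rewrite RintegralZr.
apply: (@rintegrable_prodM _ _ _ _ _ _ _ _ (fun x => `|g x|) (fun y => `|h y|)).
- apply: measurable_funM.
    by apply: measurableT_comp => //; exact: rintegrable_measurable ig.
  by apply: measurableT_comp => //; exact: rintegrable_measurable ih.
- by move=> x y; rewrite normrM.
- exact: rintegrable_norm.
- exact: rintegrable_norm.
Qed.

End real_fubini_swap.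

(** * Affine change of variable on the line *)

Section affine_change_of_variable.
Context {R : realType}.
Notation leb := (@lebesgue_measure R).
Variables (a b : R).
Hypothesis a0 : a != 0.

Let phi : measurableTypeR R -> measurableTypeR R := fun x => a * x + b.

Let measurable_phi : measurable_fun setT phi.
Proof. by apply: measurable_funD => //; exact: measurable_funM. Qed.

Let phiM : {mfun (measurableTypeR R) >-> (measurableTypeR R)} :=
  HB.pack phi (isMeasurableFun.Build _ _ _ _ _ measurable_phi).

(** Both sides are measures in [A], so it suffices that they agree on half-open intervals. For a < 0
    the preimage of such an interval is half-open at the other end, which does not change its
    length. *)
Lemma lebesgue_measure_affine (A : set (measurableTypeR R)) : measurable A ->
  leb A = (`|a|%:E * leb (phi @^-1` A))%E.
Proof.
move=> mA.
have := @lebesgue_measure_unique R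
  (mscale (NngNum (normr_ge0 a)) (pushforward leb phiM)) _ A mA.
apply => {A mA} X [[c e] _ <-]; rewrite -[RHS]/(`|a|%:E * leb (phi @^-1` [set` `]c, e]]))%E.
move: a0; rewrite neq_lt => /orP[an|ap].
  rewrite (_ : phi @^-1` _ = [set` `[(e - b) / a, (c - b) / a[]); last first.
    apply/seteqP; split => x /=; rewrite !in_itv/= /phi => /andP[h1 h2];
      apply/andP; split.
    - by rewrite ler_ndivrMr// lerBrDr mulrC.
    - by rewrite ltr_ndivlMr// ltrBlDr mulrC.
    - by move: h2; rewrite ltr_ndivlMr// ltrBlDr mulrC.
    - by move: h1; rewrite ler_ndivrMr// lerBrDr mulrC.
  rewrite !lebesgue_measure_itv/= !lte_fin ltr_nM2r ?invr_lt0// ltrD2r.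
  case: ifPn => ce; last by rewrite mule0.
  by rewrite -!EFinB -EFinM ltr0_norm//; congr EFin; field.
rewrite (_ : phi @^-1` _ = [set` `](c - b) / a, (e - b) / a]]); last first.
  apply/seteqP; split => x /=; rewrite !in_itv/= /phi => /andP[h1 h2];
    apply/andP; split.
  - by rewrite ltr_pdivrMr// ltrBlDr mulrC.
  - by rewrite ler_pdivlMr// lerBrDr mulrC.
  - by move: h1; rewrite ltr_pdivrMr// ltrBlDr mulrC.
  - by move: h2; rewrite ler_pdivlMr// lerBrDr mulrC.
rewrite !lebesgue_measure_itv/= !lte_fin ltr_pM2r ?invr_gt0// ltrD2r.
case: ifPn => ce; last by rewrite mule0.
by rewrite -!EFinB -EFinM gtr0_norm//; congr EFin; field.
Qed.

Lemma ge0_integral_affine (f : R -> \bar R) :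
  measurable_fun [set: R] f -> (forall x, 0 <= f x)%E ->
  (\int[leb]_x f x = `|a|%:E * \int[leb]_x f (a * x + b)%R)%E.
Proof.
move=> mf f0.
rewrite (eq_measure_integral
  (mscale (NngNum (normr_ge0 a)) (pushforward leb phiM))).
  by rewrite ge0_integral_mscale//= ge0_integral_pushforward// => x _.
by move=> A mA _; exact: lebesgue_measure_affine.
Qed.

Lemma measurable_affine (f : R -> R) : measurable_fun [set: R] f ->
  measurable_fun [set: R] (fun x => f (a * x + b)).
Proof. by move=> mf; exact: (measurableT_comp mf measurable_phi). Qed.

Lemma rintegrable_affine (f : R -> R) :
  rintegrable leb f -> rintegrable leb (fun x => f (a * x + b)).
Proof.
move=> jf; have mf := rintegrable_measurable jf; apply/integrableP; split.
  by apply/measurable_EFinP; exact: (measurable_affine mf).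
have /integrableP[_] := jf.
rewrite (ge0_integral_affine (f := fun x => `|(EFin \o f) x|%E))//=; last first.
  exact/measurable_EFinP/measurableT_comp.
have := @integral_ge0 _ _ _ leb setT (fun x => (`|f (a * x + b)|)%:E).
move=> /(_ (fun _ _ => normr_ge0 _)).
(* An infinite integral after the substitution would remain infinite when multiplied by
   [|a| > 0]. *)
case: (integral _ _ _) => [r| |]//=; rewrite ?ltry// gt0_muley ?lte_fin//.
by rewrite normr_gt0.
Qed.

Let ge0_Rintegral_affine (g : R -> R) : rintegrable leb g ->
  (forall x, 0 <= g x) ->
  \int[leb]_x g (a * x + b) = (\int[leb]_x g x) / `|a|.
Proof.
move=> ig g0; have iga := rintegrable_affine ig.
apply/eqP; rewrite eq_sym; apply/eqP.
apply/(mulIf (x := `|a|)); first by rewrite normr_eq0.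
rewrite divfK ?normr_eq0//; apply: EFin_inj.
rewrite EFinM !EFin_Rintegral// (ge0_integral_affine (f := EFin \o g))//=; first by rewrite muleC.
by apply/measurable_EFinP; exact: rintegrable_measurable ig.
Qed.

Lemma Rintegral_affine (f : R -> R) : rintegrable leb f ->
  \int[leb]_x f (a * x + b) = (\int[leb]_x f x) / `|a|.
Proof.
move=> jf.
have jfp : rintegrable leb (f^\+)%R by exact: integrable_funrpos.
have jfn : rintegrable leb (f^\-)%R by exact: integrable_funrneg.
have f_ x : f x = f^\+ x - f^\- x by rewrite -[in LHS](funrposBneg f).
under eq_Rintegral do rewrite f_.
rewrite RintegralB//; [|exact: (rintegrable_affine jfp)|
  exact: (rintegrable_affine jfn)].
under [X in _ = X / _]eq_Rintegral do rewrite f_.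
rewrite RintegralB// !ge0_Rintegral_affine//; first by rewrite mulrBl.
Qed.

End affine_change_of_variable.

(* The library equips product measures with a sigma-finite structure only when
   both factors are subprobabilities, hence this alias. *)
Definition planeleb {R : realType} : set (plane R) -> \bar R := leb2 R.

HB.instance Definition _ {R : realType} := Measure.on (@planeleb R).

Lemma sigma_finite_planeleb {R : realType} :
  sigma_finite [set: plane R] (@planeleb R).
Proof.
have /sigma_finiteP[F [TF ndF Foo]] := sigma_finiteT (@leb R).
exists (fun n => F n `*` F n).
  rewrite -setXTT [in LHS]TF predeqE => -[x y]; split.
    move=> [/= [n _ Fnx] [k _ Fky]]; exists (maxn n k) => //; split.
    - by move: x Fnx; exact/subsetPset/ndF/leq_maxl.
    - by move: y Fky; exact/subsetPset/ndF/leq_maxr.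
  by move=> _; split => /=; rewrite -TF.
move=> k; have [mF Fk] := Foo k; split; first exact: measurableX.
rewrite /planeleb /leb2/= product_measure1E//.
by rewrite lte_mul_pinfty// ge0_fin_numE.
Qed.

HB.instance Definition _ {R : realType} :=
  Measure_isSigmaFinite.Build _ _ _ (@planeleb R) sigma_finite_planeleb.

Section plane_measure.
Context {R : realType}.

Lemma leb2E : leb2 R = planeleb. Proof. by []. Qed.

Lemma rintegrable_plane (f : R * R -> R) (g h : R -> R) :
  measurable_fun [set: plane R] f ->
  (forall x y, `|f (x, y)| <= g x * h y) ->
  rintegrable leb g -> rintegrable leb h -> rintegrable planeleb f.
Proof. exact: rintegrable_prodM. Qed.

End plane_measure.

(** * Integrable weights on the line and on the plane *)

Section decay_weights.
Context {R : realType}.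

(** The derivative of the arctangent, serving throughout as the integrable majorant on the line. *)
Definition lorentz (x : R) : R := (1 + x ^+ 2)^-1.

Lemma onesqr_gt0 (x : R) : 0 < 1 + x ^+ 2.
Proof. by rewrite ltr_pwDl// sqr_ge0. Qed.

Lemma lorentz_gt0 x : 0 < lorentz x.
Proof. by rewrite invr_gt0 onesqr_gt0. Qed.

Lemma lorentz_ge0 x : 0 <= lorentz x. Proof. exact/ltW/lorentz_gt0. Qed.

Lemma continuous_lorentz : continuous lorentz.
Proof. exact: continuous_oneDsqrV. Qed.

Lemma rintegrable_lorentz : rintegrable leb lorentz.
Proof.
apply: rintegrable_ge0P; [|exact: lorentz_ge0|].
  exact: continuous_measurable_fun continuous_lorentz.
rewrite ge0_symfun_integralT; [|exact: lorentz_ge0|exact: continuous_lorentz|].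
  by rewrite -set_itvcy [X in (_ * X)%E](integral0y_oneDsqr R) -EFinM ltry.
by move=> x /=; rewrite /lorentz sqrrN.
Qed.

Definition lorentz2 (p : R * R) : R := lorentz p.1 * lorentz p.2.

Lemma lorentz2_gt0 p : 0 < lorentz2 p.
Proof. by rewrite mulr_gt0 ?lorentz_gt0. Qed.

Lemma measurable_lorentz : measurable_fun [set: R] lorentz.
Proof. exact: continuous_measurable_fun continuous_lorentz. Qed.

Lemma measurable_lorentz2 : measurable_fun [set: plane R] lorentz2.
Proof.
by apply: measurable_funM; apply: measurableT_comp => //;
  exact: measurable_lorentz.
Qed.

Lemma rintegrable_lorentz2 : rintegrable planeleb lorentz2.
Proof.
apply: (rintegrable_plane measurable_lorentz2 (g := lorentz) (h := lorentz)).
- by move=> x y; rewrite ger0_norm// ltW// lorentz2_gt0.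
- exact: rintegrable_lorentz.
- exact: rintegrable_lorentz.
Qed.

Lemma bracket2_ge1 (p : R * R) : 1 <= bracket2 p.
Proof. by rewrite /bracket2 -addrA lerDl addr_ge0// sqr_ge0. Qed.

Lemma bracket2_gt0 (p : R * R) : 0 < bracket2 p.
Proof. exact: lt_le_trans (bracket2_ge1 p). Qed.

Lemma measurable_bracket2 : measurable_fun [set: plane R] (@bracket2 R).
Proof.
by apply: measurable_funD; [apply: measurable_funD => //|];
  exact: measurable_funX.
Qed.

(** Expand (1 + x^2)(1 + y^2) <= (1 + x^2 + y^2)^2. The inverse square of the bracket is thus
    integrable in the plane, which embeds the weighted space of exponent 2 into L^1. *)
Lemma bracket2_sqrV_le (p : R * R) : (bracket2 p ^+ 2)^-1 <= lorentz2 p.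
Proof.
rewrite /lorentz2 /lorentz -invfM lef_pV2 ?posrE.
- rewrite /bracket2; have := sqr_ge0 p.1; have := sqr_ge0 p.2.
  set a := p.1 ^+ 2; set b := p.2 ^+ 2; nra.
- by rewrite exprn_gt0// bracket2_gt0.
- by rewrite mulr_gt0// onesqr_gt0.
Qed.

End decay_weights.

(** * Smooth functions with compact support *)

Section smooth_functions.
Context {R : realType}.
Implicit Types f g : R -> R.

(** Derivatives are computed pointwise with [is_derive] but used as equations between functions,
    since they get rewritten under further derivatives. *)
Lemma is_derive1P f g : (forall x : R, is_derive x 1 f (g x)) <->
  (forall x, derivable f x 1) /\ (D1 f) = g.
Proof.
split=> [fg|[df <-] x]; last by apply: DeriveDef => //; rewrite derive1E.
split=> [x|]; first exact: (@ex_derive _ _ _ _ _ _ _ (fg x)).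
by apply/funext => x; rewrite derive1E; exact: (@derive_val _ _ _ _ _ _ _ (fg x)).
Qed.

(** Smoothness in one variable by recursion on the order, so that closure properties are inductions
    on [n]; [smooth_tensor] makes the passage to [smooth] on space-time. *)
Fixpoint derivable_n n f : Prop :=
  if n is n'.+1 then (forall x, derivable f x 1) /\ derivable_n n' (D1 f)
  else True.

Definition smooth1 f := forall n, derivable_n n f.

Lemma smooth1_derivable f (x : R) : smooth1 f -> derivable f x 1.
Proof. by move=> /(_ 1%N) [+ _]; exact. Qed.

Lemma smooth1_derive f : smooth1 f -> smooth1 (D1 f).
Proof. by move=> sf n; have [] := sf n.+1. Qed.

Lemma smooth1_is_derive f (x : R) : smooth1 f -> is_derive x 1 f ((D1 f) x).
Proof.
by move=> sf; apply: DeriveDef; [exact: smooth1_derivable|rewrite derive1E].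
Qed.

Lemma smooth1_continuous f : smooth1 f -> continuous f.
Proof.
move=> sf x; apply/differentiable_continuous/derivable1_diffP.
exact: smooth1_derivable.
Qed.

Lemma smooth1_measurable f : smooth1 f -> measurable_fun [set: R] f.
Proof. by move=> sf; apply: continuous_measurable_fun; exact: smooth1_continuous. Qed.

Lemma derivable_nS n f : derivable_n n.+1 f -> derivable_n n f.
Proof.
by elim: n f => // n ih f [df /ih dnf].
Qed.

Lemma derivable_nD n f g : derivable_n n f -> derivable_n n g ->
  derivable_n n (fun x => f x + g x).
Proof.
elim: n f g => //= n ih f g [df dnf] [dg dng].
have /is_derive1P[? ->] : forall x : R, is_derive x 1 (fun x => f x + g x)
    ((D1 f) x + (D1 g) x).
  move=> x; have /(_ x) hf := (is_derive1P f (D1 f)).2 (conj df erefl).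
  by have /(_ x) hg := (is_derive1P g (D1 g)).2 (conj dg erefl); exact: is_deriveD.
by split => //; exact: ih.
Qed.

Lemma derivable_nM n f g : derivable_n n f -> derivable_n n g ->
  derivable_n n (fun x => f x * g x).
Proof.
elim: n f g => // n ih f g dnf dng.
have [[df df'] [dg dg']] := (dnf, dng).
have /is_derive1P[? E] : forall x : R, is_derive x 1 (fun x => f x * g x)
    (f x * (D1 g) x + (D1 f) x * g x).
  move=> x; have /(_ x) hf := (is_derive1P f (D1 f)).2 (conj df erefl).
  have /(_ x) hg := (is_derive1P g (D1 g)).2 (conj dg erefl).
  by apply: is_derive_eq; rewrite /GRing.scale/= [g x * _]mulrC.
split => //; rewrite E.
by apply: derivable_nD; apply: ih => //; exact: derivable_nS.
Qed.

Lemma is_derive1_cst (c x : R) : is_derive x 1 (fun=> c) 0.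
Proof. exact: is_derive_cst. Qed.

Lemma derivable_n_cst n (c : R) : derivable_n n (fun=> c).
Proof.
elim: n c => // n ih c.
have /is_derive1P[? E] := is_derive1_cst c.
by split => //; rewrite E.
Qed.

Lemma smooth1_cst (c : R) : smooth1 (fun=> c).
Proof. by move=> n; exact: derivable_n_cst. Qed.

Lemma smooth1D f g : smooth1 f -> smooth1 g -> smooth1 (fun x => f x + g x).
Proof. by move=> sf sg n; exact: derivable_nD. Qed.

Lemma smooth1M f g : smooth1 f -> smooth1 g -> smooth1 (fun x => f x * g x).
Proof. by move=> sf sg n; exact: derivable_nM. Qed.

Lemma smooth1Z (c : R) f : smooth1 f -> smooth1 (fun x => c * f x).
Proof. by move=> sf; apply: smooth1M => //; exact: smooth1_cst. Qed.

Lemma derive1Z (c : R) f : smooth1 f -> D1 (fun x => c * f x) = (fun x => c * (D1 f) x).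
Proof.
move=> sf; suff /is_derive1P[] : forall x : R, is_derive x 1 (fun x => c * f x)
    (c * (D1 f) x) by [].
by move=> x; have h := smooth1_is_derive x sf; exact: is_deriveZ.
Qed.

Lemma derive1D f g : smooth1 f -> smooth1 g ->
  D1 (fun x => f x + g x) = (fun x => (D1 f) x + (D1 g) x).
Proof.
move=> sf sg; suff /is_derive1P[] : forall x : R, is_derive x 1 (fun x => f x + g x)
    ((D1 f) x + (D1 g) x) by [].
by move=> x; have h := smooth1_is_derive x sf; have h' := smooth1_is_derive x sg;
  exact: is_deriveD.
Qed.

Lemma derive1M f g : smooth1 f -> smooth1 g ->
  D1 (fun x => f x * g x) = (fun x => (D1 f) x * g x + f x * (D1 g) x).
Proof.
move=> sf sg; suff /is_derive1P[] : forall x : R, is_derive x 1 (fun x => f x * g x)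
    ((D1 f) x * g x + f x * (D1 g) x) by [].
move=> x; have h := smooth1_is_derive x sf; have h' := smooth1_is_derive x sg.
by apply: is_derive_eq; rewrite /GRing.scale/= [g x * _]mulrC addrC.
Qed.

Lemma is_derive1_affine f (a b x : R) df : is_derive (a * x + b) 1 f df ->
  is_derive x 1 (fun x => f (a * x + b)) (a * df).
Proof.
move=> h; have h1 : is_derive x 1 (fun x => a * x + b) a.
  apply: is_derive_eq.
  by rewrite ?scaler0 /GRing.scale/= ?mulr1 ?mulr0 ?addr0 ?add0r.
have := @is_derive1_comp _ f (fun x => a * x + b) x df a h h1.
by rewrite mulrC.
Qed.

Lemma derivable_n_affine n f (a b : R) : derivable_n n f ->
  derivable_n n (fun x => f (a * x + b)).
Proof.
elim: n f => // n ih f [df dnf].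
have /is_derive1P[? E] : forall x : R, is_derive x 1 (fun x => f (a * x + b))
    (a * (D1 f) (a * x + b)).
  move=> x; apply: is_derive1_affine.
  by have := (is_derive1P f (D1 f)).2 (conj df erefl).
split => //; rewrite E; apply: derivable_nM; first exact: derivable_n_cst.
exact: ih.
Qed.

Lemma smooth1_affine (a b : R) f : smooth1 f -> smooth1 (fun x => f (a * x + b)).
Proof. by move=> sf n; exact: derivable_n_affine. Qed.

Lemma derive1_affine (a b : R) f : smooth1 f ->
  D1 (fun x => f (a * x + b)) = (fun x => a * (D1 f) (a * x + b)).
Proof.
move=> sf; suff /is_derive1P[] : forall x : R, is_derive x 1
    (fun x => f (a * x + b)) (a * (D1 f) (a * x + b)) by [].
by move=> x; apply: is_derive1_affine; exact: smooth1_is_derive.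
Qed.

Lemma derivable_n_id n : derivable_n n (fun x : R => x).
Proof.
case: n => // n; have /is_derive1P[? E] : forall x : R, is_derive x 1 (fun x : R => x) 1.
  by move=> x; exact: is_derive_id.
by split => //; rewrite E; exact: derivable_n_cst.
Qed.

Lemma smooth1_id : smooth1 (fun x : R => x).
Proof. by move=> n; exact: derivable_n_id. Qed.

Lemma smooth1_primitive f g : smooth1 g -> (forall x : R, is_derive x 1 f (g x)) ->
  smooth1 f.
Proof. by move=> sg /is_derive1P[df E] [//|n]; split => //; rewrite E. Qed.

End smooth_functions.

(** * A smooth bump *)

Section flat_function.
Context {R : realType}.
Implicit Type p : {poly R}.

(** The function p(1 / x) exp(- 1 / x), extended by 0. The polynomial makes the family stable under
    differentiation, p becoming X^2 (p - p'), so that smoothness follows by induction. *)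
Definition flat p (x : R) : R := if 0 < x then p.[x^-1] * expR (- x^-1) else 0.

Lemma expRN_inv_le m (x : R) : 0 < x -> expR (- x^-1) <= m.+1`!%:R * x ^+ m.+1.
Proof.
move=> x0; have y0 : 0 <= x^-1 by rewrite invr_ge0 ltW.
rewrite expRN -[leLHS]mul1r ler_pdivrMr ?expR_gt0// mulrAC.
have := expR_ge1Dxn m y0 => h.
have {}h : x^-1 ^+ m.+1 / m.+1`!%:R <= expR x^-1 by rewrite (le_trans _ h)// lerDr.
have F0 : (0 : R) < m.+1`!%:R by rewrite ltr0n fact_gt0.
have : m.+1`!%:R * x ^+ m.+1 * (x^-1 ^+ m.+1 / m.+1`!%:R) <=
       m.+1`!%:R * x ^+ m.+1 * expR x^-1.
  by rewrite ler_pM2l// mulr_gt0// exprn_gt0.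
rewrite [leLHS](_ : _ = 1); first by rewrite mulrAC.
rewrite exprVn; field; rewrite expf_neq0 ?gt_eqF//.
Qed.

Lemma horner_inv_le p : exists2 C, 0 <= C &
  forall x, 0 < x <= 1 -> `|p.[x^-1]| <= C * x^-1 ^+ (size p).
Proof.
elim/poly_ind: p => [|p c [C C0 h]].
  by exists 0 => // x _; rewrite horner0 normr0 mul0r.
exists (if p == 0 then `|c| else C + `|c|) => [|x /andP[x0 x1]].
  by case: ifPn => // _; rewrite addr_ge0.
have y1 : 1 <= x^-1 by rewrite invf_ge1.
rewrite hornerMXaddC size_MXaddC; have [->|p0] /= := eqVneq p 0.
  rewrite horner0 mul0r add0r; case: eqVneq => [->|_]; first by rewrite normr0 mul0r.
  by rewrite size_poly0 expr1 ler_peMr.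
rewrite (le_trans (ler_normD _ _))// mulrDl lerD//.
  rewrite normrM (ger0_norm (ltW (lt_le_trans ltr01 y1))) exprSr mulrA.
  by rewrite ler_pM2r ?invr_gt0// h// x0.
by rewrite ler_peMr// exprn_ege1.
Qed.

Lemma flat_le p : exists2 C, 0 <= C & forall x, `|x| <= 1 -> `|flat p x| <= C * x ^+ 2.
Proof.
(* The exponent [m.+1] equals [size p + 2]: the pole of order [size p] is absorbed and [x ^+ 2] is
   left over. *)
have [C C0 h] := horner_inv_le p; set m := (size p).+1.
exists (C * m.+1`!%:R) => [|x]; first by rewrite mulr_ge0.
rewrite ler_norml => /andP[_ x1]; rewrite /flat; case: ifPn => x0; last first.
  by rewrite normr0 mulr_ge0 ?sqr_ge0// mulr_ge0.
rewrite normrM (ger0_norm (expR_ge0 _)).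
have x01 : 0 < x <= 1 by rewrite x0.
apply: (le_trans (ler_pM (normr_ge0 _) (expR_ge0 _) (h _ x01) (expRN_inv_le m x0))).
rewrite -!mulrA ler_wpM2l// mulrCA ler_wpM2l//.
by rewrite /m -addn2 exprD mulrA -exprMn mulVf ?gt_eqF// expr1n mul1r.
Qed.

Lemma is_derive_flat p (x : R) : is_derive x 1 (flat p) (flat ('X^2 * (p - p^`())) x).
Proof.
have [x0|x0|->] := ltgtP x 0.
- rewrite {2}/flat ltNge (ltW x0)/=.
  apply: (@near_eq_is_derive _ _ _ (fun=> 0)).
    near=> z; rewrite /flat ifF//; apply/negbTE; rewrite -leNgt ltW//.
    by near: z; exact: lt_nbhsl.
- have xn0 : x != 0 by rewrite gt_eqF.
  have dV : is_derive x 1 (fun z : R => z^-1) (- x ^- 2).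
    have := @is_deriveV _ id x 1 1 xn0 (is_derive_id x 1).
    by rewrite /GRing.scale/= mulr1.
  have dp : is_derive x 1 (fun z => p.[z^-1]) ((p^`()).[x^-1] * - x ^- 2).
    exact: (@is_derive1_comp _ (horner p) (fun z => z^-1)).
  have de : is_derive x 1 (fun z => expR (- z^-1)) (expR (- x^-1) * (- - x ^- 2)).
    exact: (@is_derive1_comp _ expR (fun z => - z^-1)).
  have pe := is_deriveM dp de.
  have -> : flat ('X^2 * (p - p^`())) x = p.[x^-1] *: (expR (- x^-1) * - - x ^- 2)
      + expR (- x^-1) *: (p^`().[x^-1] * - x ^- 2).
    rewrite /flat x0 /GRing.scale/= hornerM hornerXn hornerD hornerN exprVn.
    by ring.
  apply: (near_eq_is_derive _ pe); near=> z.
  by rewrite /flat ifT//; near: z; exact: lt_nbhsr.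
- rewrite {2}/flat ltxx.
  have [C C0 h] := flat_le p.
  have f0 : flat p 0 = 0 by rewrite /flat ltxx.
  (* At the origin the quadratic bound makes the difference quotient O(t). *)
  have c0 : h^-1 *: (flat p (h *: 1 + 0) - flat p 0) @[h --> 0^'] --> (0 : R).
    apply/cvgr0Pnorm_le => e e0; near=> t.
    have t0 : t != 0 by near: t; exact: nbhs_dnbhs_neq.
    have t1 : `|t| <= 1.
      by near: t; apply: dnbhs0_le.
    have te : `|t| <= e / (C + 1).
      by near: t; apply: dnbhs0_le; rewrite divr_gt0// ltr_wpDl.
    rewrite f0 subr0 addr0 /GRing.scale/= mulr1 normrM normfV.
    rewrite ler_pdivrMl ?normr_gt0// (le_trans (h _ t1))//.
    have -> : t ^+ 2 = `|t| ^+ 2 by rewrite real_normK// num_real.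
    move: te; rewrite ler_pdivlMr ?ltr_wpDl// => te.
    have := normr_ge0 t; nra.
  apply: DeriveDef; first by apply/cvg_ex; exists 0; exact: c0.
  by apply/cvg_lim; [exact: Rhausdorff|exact: c0].
Unshelve. all: by end_near. Qed.

Lemma smooth1_flat p : smooth1 (flat p).
Proof.
move=> n; elim: n p => // n ih p.
by have /is_derive1P[? E] := is_derive_flat p; split => //; rewrite E.
Qed.

Definition bump01 (x : R) : R := flat 1 x * flat 1 (-1 * x + 1).

Lemma smooth1_bump01 : smooth1 bump01.
Proof.
by apply: smooth1M; [exact: smooth1_flat|apply: smooth1_affine; exact: smooth1_flat].
Qed.

Lemma bump01_ge0 x : 0 <= bump01 x.
Proof.
by rewrite /bump01 /flat; apply: mulr_ge0; case: ifPn => // _;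
  rewrite mulr_ge0 ?expR_ge0// hornerC.
Qed.

Lemma bump01_gt0 x : 0 < x < 1 -> 0 < bump01 x.
Proof.
move=> /andP[x0 x1]; rewrite /bump01 /flat x0 ifT; last by rewrite mulN1r addrC subr_gt0.
by rewrite !hornerC !mul1r mulr_gt0// expR_gt0.
Qed.

Lemma bump01_eq0 x : ~~ (0 < x < 1) -> bump01 x = 0.
Proof.
rewrite negb_and /bump01 /flat => /orP[/negbTE ->|]; first by rewrite mul0r.
by rewrite mulN1r addrC subr_gt0 => /negbTE ->; rewrite mulr0.
Qed.

End flat_function.

(** * Test functions of one variable *)

Section compactly_supported.
Context {R : realType}.
Implicit Types f g : R -> R.

Definition testfun f :=
  smooth1 f /\ exists K, forall x, K < `|x| -> f x = 0.

Lemma testfun_smooth f : testfun f -> smooth1 f. Proof. by case. Qed.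

Lemma testfun_measurable f : testfun f -> measurable_fun [set: R] f.
Proof. by case=> sf _; exact: smooth1_measurable. Qed.

Lemma near_norm_gt (K x : R) : K < `|x| -> \forall z \near x, K < `|z|.
Proof.
move=> Kx; have c : `|z| @[z --> x] --> `|x| by apply: cvg_norm; exact: cvg_id.
exact: (cvgr_gt _ c).
Qed.

Lemma testfun_derive f : testfun f -> testfun (D1 f).
Proof.
move=> [sf [K fK]]; split; first exact: smooth1_derive.
exists K => x Kx; rewrite derive1E.
suff : is_derive x 1 f 0 by move=> /@derive_val.
apply: (near_eq_is_derive _ (is_derive1_cst 0 x)).
by have := near_norm_gt Kx; apply: filterS => z /fK ->.
Qed.

Lemma testfunMl f g : smooth1 f -> testfun g -> testfun (fun x => f x * g x).
Proof.
move=> sf [sg [K gK]]; split; first exact: smooth1M.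
by exists K => x /gK ->; rewrite mulr0.
Qed.

Lemma testfunZ (c : R) f : testfun f -> testfun (fun x => c * f x).
Proof. by apply: testfunMl; exact: smooth1_cst. Qed.

Lemma testfun_affine (a b : R) f : a != 0 -> testfun f ->
  testfun (fun x => f (a * x + b)).
Proof.
move=> a0 [sf [K fK]]; split; first exact: smooth1_affine.
exists ((K + `|b|) / `|a|) => x; rewrite ltr_pdivrMr ?normr_gt0// => h.
apply: fK; have : `|x * a| <= `|a * x + b| + `|b|.
  by rewrite -(normrN b) (le_trans _ (ler_normD _ _))// addrK mulrC.
by rewrite normrM; lra.
Qed.

Lemma testfun_bounded f : testfun f -> exists2 C : R, 0 <= C & forall x, `|f x| <= C.
Proof.
move=> [sf [K fK]].
have cf : {within `[- `|K|, `|K|], continuous (fun x => `|f x|)}.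
  apply: continuous_subspaceT => x.
  by apply: cvg_norm; exact: smooth1_continuous.
have [//|c _ h] := EVT_max _ cf.
  by rewrite lerNl (le_trans _ (normr_ge0 K))// oppr_le0.
exists `|f c| => // x; have [xK|Kx] := leP `|x| `|K|.
  by apply: h; rewrite in_itv/= -ler_norml.
by rewrite fK ?normr0// (le_lt_trans _ Kx)// ler_norm.
Qed.

(** Both [f] and x^2 [f] are test functions, hence bounded, and their bounds add up to one for (1 +
    x^2) |f|. *)
Lemma testfun_lorentz f : testfun f ->
  exists2 C : R, 0 <= C & forall x, `|f x| <= C * lorentz x.
Proof.
move=> tf; have tg : testfun (fun x => (x * x) * f x).
  by apply: testfunMl => //; apply: smooth1M; exact: smooth1_id.
have [C C0 hC] := testfun_bounded tf; have [D D0 hD] := testfun_bounded tg.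
exists (C + D) => [|x]; first exact: addr_ge0.
rewrite /lorentz ler_pdivlMr ?onesqr_gt0// mulrDr mulr1 lerD//.
by rewrite (le_trans _ (hD x))// normrM expr2 mulrC -[x * x]expr2 ger0_norm ?sqr_ge0.
Qed.

Lemma testfun_rintegrable f : testfun f -> rintegrable leb f.
Proof.
move=> tf; have [C C0 h] := testfun_lorentz tf.
apply: (@le_rintegrable _ _ _ leb f (fun x => C * lorentz x)) => //.
  exact: testfun_measurable.
exact/rintegrableZ/rintegrable_lorentz.
Qed.

Lemma smooth1_MVT f (x y : R) : smooth1 f ->
  exists c, f x - f y = D1 f c * (x - y).
Proof.
move=> sf; wlog : x y / y <= x => [h|yx].
  have [yx|/ltW xy] := leP y x; first exact: h.
  have [c hc] := h y x xy; exists c.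
  by rewrite -(opprB y x) mulrN -hc opprB.
have cf : {within `[y, x], continuous f}.
  by apply: continuous_subspaceT; exact: smooth1_continuous.
have [c _ ->] := MVT_segment yx (fun z _ => smooth1_is_derive z sf) cf.
by exists c.
Qed.

Lemma testfun_lipschitz f : testfun f ->
  exists2 C : R, 0 <= C & forall x y, `|f x - f y| <= C * `|x - y|.
Proof.
move=> tf; have [C C0 h] := testfun_bounded (testfun_derive tf).
exists C => // x y; have [c ->] := smooth1_MVT x y (testfun_smooth tf).
by rewrite normrM ler_wpM2r.
Qed.

Lemma Rintegral_derive1 f (a b : R) : a < b -> smooth1 f ->
  (forall x, ~~ (a <= x <= b) -> D1 f x = 0) ->
  \int[leb]_x (D1 f x) = f b - f a.
Proof.
move=> ab sf f0; have cdf := smooth1_continuous (smooth1_derive sf).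
have df : derivable_oo_LRcontinuous f a b.
  split; first by move=> x _; exact: smooth1_derivable.
    by apply: cvg_at_right_filter; exact: smooth1_continuous.
  by apply: cvg_at_left_filter; exact: smooth1_continuous.
have := @continuous_FTC2 _ (D1 f) f a b ab (continuous_subspaceT cdf) df
  (fun _ _ => erefl).
have -> : \int[leb]_x (D1 f x) = \int[leb]_(x in `[a, b]) (D1 f x).
  rewrite [RHS]Rintegral_mkcond; apply: eq_Rintegral => x _.
  rewrite patchE; case: ifPn => // /negP.
  by rewrite inE/= in_itv/= => /negP/f0 ->.
by rewrite /Rintegral => ->.
Qed.

Lemma testfun_primitive f : testfun f ->
  exists2 F, smooth1 F & D1 F = f.
Proof.
move=> tf; have jf := testfun_rintegrable tf.
pose F x := \int[leb]_(t in [set` `]-oo, x]]) f t.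
have FE x : derivable F x 1 /\ D1 F x = f x.
  apply: (@continuous_FTC1 R f -oo%O x (x + 1)) => //.
  - by rewrite ltrDl.
  - exact: integrableS jf.
  - exact: ltNyr.
  - exact: (smooth1_continuous (testfun_smooth tf)).
have dF : D1 F = f by apply/funext => x; have [] := FE x.
exists F => //; apply: (@smooth1_primitive _ _ f (testfun_smooth tf)).
by apply/is_derive1P; split => // x; have [] := FE x.
Qed.

End compactly_supported.

Section step_function.
Context {R : realType}.

Lemma testfun_bump01 : testfun (@bump01 R).
Proof.
split; first exact: smooth1_bump01.
exists 1 => x x1; apply: bump01_eq0; apply/negP => /andP[x0 /ltW].
by rewrite leNgt -(gtr0_norm x0) x1.
Qed.

(** The normalised primitive of [bump01]: a smooth version of the Heaviside function, from which the
    cutoffs in time are made. *)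
Lemma smooth_step : exists S : R -> R, [/\ smooth1 S, testfun (D1 S),
  (forall x, 0 <= D1 S x), (forall x, x <= 0 -> S x = 0) &
  (forall x, 1 <= x -> S x = 1) ].
Proof.
have [F sF FE] := testfun_primitive testfun_bump01.
have cF : forall a b : R, {within `[a, b], continuous F}.
  by move=> a b; apply: continuous_subspaceT; exact: smooth1_continuous.
have dF (x : R) : is_derive x 1 F (bump01 x) by rewrite -FE; exact: smooth1_is_derive.
have F01 : F 0 < F 1.
  have [|c c01 E] := MVT ltr01 (fun x _ => dF x); first exact: cF.
  by rewrite -subr_gt0 E subr0 mulr1 bump01_gt0.
have F0 x : x <= 0 -> F x = F 0.
  move=> x0; have [|c c01 E] := MVT_segment x0 (fun x _ => dF x); first exact: cF.
  apply/esym/eqP; rewrite -subr_eq0 E bump01_eq0 ?mul0r//.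
  by move: c01; rewrite in_itv/= => /andP[_ c0]; rewrite ltNge c0.
have F1 x : 1 <= x -> F x = F 1.
  move=> x1; have [|c c01 E] := MVT_segment x1 (fun x _ => dF x); first exact: cF.
  apply/eqP; rewrite -subr_eq0 E bump01_eq0 ?mul0r//.
  by move: c01; rewrite in_itv/= => /andP[c1 _]; rewrite [_ < 1]ltNge c1 andbF.
have S0 : 0 < F 1 - F 0 by rewrite subr_gt0.
pose S x := (F 1 - F 0)^-1 * (F x + - F 0).
have dS : D1 S = fun x => (F 1 - F 0)^-1 * bump01 x.
  rewrite /S derive1Z; last by apply: smooth1D => //; exact: smooth1_cst.
  rewrite derive1D ?FE//; last exact: smooth1_cst.
  by apply/funext => x; rewrite derive1_cst addr0.
exists S; split.
- by apply: smooth1Z; apply: smooth1D => //; exact: smooth1_cst.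
- by rewrite dS; apply: testfunZ; exact: testfun_bump01.
- by move=> x; rewrite dS mulr_ge0 ?bump01_ge0// invr_ge0 ltW.
- by move=> x x0; rewrite /S (F0 x x0) subrr mulr0.
- by move=> x x1; rewrite /S (F1 x x1) mulVf// gt_eqF.
Qed.

End step_function.

Section measurability.
Context {R : realType}.

Definition b2r (b : bool) : R := if b then 1 else 0.

(** With the convention [0^-1 = 0] the inverse is total; it is continuous away from 0, and the
    single point 0 is measurable. *)
Lemma measurable_invr : measurable_fun [set: R] (fun x : R => x^-1).
Proof.
have -> : [set: R] = [set 0] `|` ~` [set 0] by rewrite setUv.
have m0 : measurable [set (0 : R)] by exact: measurable_set1.
apply/measurable_funU => //; first exact: measurableC.
split; first exact: measurable_fun_set1.
apply: open_continuous_measurable_fun.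
  by apply: closed_openC; exact: closed_eq.
move=> x; rewrite inE/= => /eqP x0; exact: inv_continuous.
Qed.

Lemma measurable_b2r d (T : measurableType d) (b : T -> bool) :
  measurable_fun [set: T] b -> measurable_fun [set: T] (fun x => b2r (b x)).
Proof. by move=> mb; exact: measurable_fun_ifT. Qed.

Lemma measurable_funV d (T : measurableType d) (f : T -> R) :
  measurable_fun [set: T] f -> measurable_fun [set: T] (fun x => (f x)^-1).
Proof. by move=> mf; exact: (measurableT_comp measurable_invr mf). Qed.

Lemma measurable_fst_comp d1 d2 (T1 : measurableType d1) (T2 : measurableType d2)
  (f : T1 -> R) : measurable_fun [set: T1] f ->
  measurable_fun [set: T1 * T2] (fun q => f q.1).
Proof. by move=> mf; exact: (measurableT_comp mf). Qed.

Lemma measurable_snd_comp d1 d2 (T1 : measurableType d1) (T2 : measurableType d2)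
  (f : T2 -> R) : measurable_fun [set: T2] f ->
  measurable_fun [set: T1 * T2] (fun q => f q.2).
Proof. by move=> mf; exact: (measurableT_comp mf). Qed.

End measurability.

(** * The Hilbert transform *)

Section hilbert_transform.
Context {R : realType}.
Implicit Types (f : R -> R) (x z e : R).

Definition htrunc f x e : R :=
  \int[leb]_z (b2r (e < `|x - z|) * (f z / (x - z))).

Lemma htruncE f x e :
  \int[leb]_(z in [set z | e < `|x - z|]) (f z / (x - z)) = htrunc f x e.
Proof.
rewrite Rintegral_mkcond; apply: eq_Rintegral => z _.
rewrite patchE; case: ifPn; first by rewrite inE/= => ->; rewrite mul1r.
by move=> /negP; rewrite inE/= => /negP/negbTE ->; rewrite mul0r.
Qed.

(** As 1 / (x - z) is odd about x, subtracting f(x) on the unit interval around x leaves the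
    principal value unchanged; for a Lipschitz integrable f the integral then converges
    absolutely. *)
Definition hker f x z : R := (f z - b2r (`|x - z| < 1) * f x) / (x - z).

Definition hilb f x : R := pi^-1 * \int[leb]_z hker f x z.

Lemma measurable_hker f : measurable_fun [set: R] f ->
  measurable_fun [set: plane R] (fun q => hker f q.1 q.2).
Proof.
move=> mf; apply: measurable_funM; last first.
  by apply: measurable_funV; exact: measurable_funB.
apply: measurable_funB; first exact: measurable_snd_comp.
apply: measurable_funM; last exact: measurable_fst_comp.
apply: measurable_b2r; apply: measurable_fun_ltr => //.
by apply: measurableT_comp => //; exact: measurable_funB.
Qed.

Lemma measurable_hker2 f x : measurable_fun [set: R] f ->
  measurable_fun [set: R] (hker f x).
Proof.
move=> mf; have mp : measurable_fun [set: R] (fun z => (x, z)).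
  exact: measurable_fun_pair.
exact: (measurableT_comp (measurable_hker mf) mp).
Qed.

Lemma measurable_hilb f : measurable_fun [set: R] f ->
  measurable_fun [set: R] (hilb f).
Proof.
move=> /measurable_hker mf; apply: measurable_funM => //.
exact: (measurable_Rintegral_snd leb mf).
Qed.

Lemma rintegrable_lorentzB x : rintegrable leb (fun z => lorentz (x - z)).
Proof.
have := @rintegrable_affine R (-1) x _ _ rintegrable_lorentz.
rewrite oppr_eq0 oner_eq0 => /(_ isT).
by under eq_fun do rewrite mulN1r addrC.
Qed.

Lemma Rintegral_lorentzB x :
  \int[leb]_z lorentz (x - z) = \int[leb]_z (lorentz z : R).
Proof.
have := @Rintegral_affine R (-1) x _ _ rintegrable_lorentz.
rewrite oppr_eq0 oner_eq0 => /(_ isT); rewrite normrN normr1 divr1 => <-.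
by apply: eq_Rintegral => z _; rewrite mulN1r addrC.
Qed.

Lemma lorentz_ge_half (w : R) : `|w| < 1 -> 1 <= 2 * lorentz w.
Proof.
move=> w1; rewrite /lorentz ler_pdivlMr ?onesqr_gt0// mul1r.
have : w ^+ 2 <= 1 by rewrite -real_normK ?num_real// expr_le1// ltW.
by lra.
Qed.

Section bounds.
Variables (f : R -> R) (L : R).
Hypotheses (L0 : 0 <= L) (fL : forall x y, `|f x - f y| <= L * `|x - y|).
Hypothesis mf : measurable_fun [set: R] f.

Lemma hker_le_near x z : `|x - z| < 1 -> `|hker f x z| <= L.
Proof.
move=> xz; rewrite /hker xz mul1r; have [->|zx] := eqVneq x z.
  by rewrite subrr mul0r normr0.
rewrite normrM normfV ler_pdivrMr ?normr_gt0 ?subr_eq0//.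
by rewrite distrC [leRHS]mulrC mulrC.
Qed.

(** Near the diagonal the Lipschitz constant bounds the quotient, and [2 * lorentz] dominates the
    indicator of the unit ball; elsewhere the denominator is at least 1. *)
Lemma hker_le x z : `|hker f x z| <= 2 * L * lorentz (x - z) + `|f z|.
Proof.
have [xz|xz] := ltP `|x - z| 1.
  rewrite (le_trans (hker_le_near xz))// -[leLHS]addr0 lerD//.
  by rewrite mulrAC mulrC ler_peMr// lorentz_ge_half.
rewrite /hker ltNge xz mul0r subr0 -[leLHS]add0r lerD//.
  by rewrite mulr_ge0 ?mulr_ge0// lorentz_ge0.
rewrite normrM normfV ler_pdivrMr ?(lt_le_trans ltr01)//.
by rewrite ler_peMr.
Qed.

Hypothesis jf : rintegrable leb f.

Lemma rintegrable_hker x : rintegrable leb (hker f x).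
Proof.
apply: (@le_rintegrable _ _ _ leb _ (fun z => 2 * L * lorentz (x - z) + `|f z|)).
- exact: measurable_hker2.
- exact: hker_le.
- apply: rintegrableD; last exact: rintegrable_norm.
  exact/rintegrableZ/rintegrable_lorentzB.
Qed.

Lemma hilb_le x : `|hilb f x| <=
  pi^-1 * (2 * L * \int[leb]_z lorentz z + \int[leb]_z `|f z|).
Proof.
rewrite /hilb normrM normfV (ger0_norm (pi_ge0 _)) ler_wpM2l ?invr_ge0 ?pi_ge0//.
have jl := rintegrableZ (2 * L) (rintegrable_lorentzB x).
have jn := rintegrable_norm jf.
have := @le_norm_Rintegral _ _ _ leb _ _ (measurable_hker2 x mf) (hker_le x)
  (rintegrableD jl jn).
by rewrite RintegralD// RintegralZl ?Rintegral_lorentzB//; exact: rintegrable_lorentzB.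
Qed.

Lemma rintegrable_near x r : rintegrable leb (fun z => b2r (`|x - z| <= r)).
Proof.
have := @integrable_indic_itv R (x - r) (x + r) true false.
apply: eq_integrable => // z _ /=; congr EFin.
rewrite indicE mem_setE in_itv/= /b2r.
by rewrite ler_distl [(z - r <= _)%R]lerBlDr -[(x <= _)%R]lerBlDr andbC; case: ifP.
Qed.

Lemma Rintegral_near x r : 0 <= r ->
  \int[leb]_z (b2r (`|x - z| <= r) : R) = 2 * r.
Proof.
move=> r0; rewrite /Rintegral.
rewrite (_ : (fun z => _) = (fun z => (\1_`[x - r, x + r] z)%:E)).
  rewrite integral_indic// setIT. rewrite [X in fine X](lebesgue_measure_itv `[x - r, x + r]%R)/= lte_fin.
  case: ltP => [_|h]; first by rewrite -EFinB/=; lra.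
  have -> : r = 0 by lra.
  by rewrite mulr0.
apply/funext => z; congr EFin; rewrite indicE mem_setE in_itv/= /b2r.
by rewrite ler_distl [(z - r <= _)%R]lerBlDr -[(x <= _)%R]lerBlDr andbC; case: ifP.
Qed.

(** The reflection z -> 2 x - z preserves the annulus and changes the sign of the integrand. *)
Lemma htrunc_odd x e : 0 < e ->
  \int[leb]_z (b2r (e < `|x - z| < 1) / (x - z)) = 0.
Proof.
move=> e0; pose o z : R := b2r (e < `|x - z| < 1) / (x - z).
have mo : measurable_fun [set: R] o.
  apply: measurable_funM; last by apply: measurable_funV; exact: measurable_funB.
  apply: measurable_b2r; apply: measurable_and;
    apply: measurable_fun_ltr => //; apply: measurableT_comp => //;
    exact: measurable_funB.
have jo : rintegrable leb o.
  apply: (@le_rintegrable _ _ _ leb _ (fun z => e^-1 * b2r (`|x - z| <= 1))) => //.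
    move=> z; rewrite /o normrM normfV /b2r; case: ifPn => [/andP[ez z1]|_].
      rewrite normr1 mul1r (ltW z1) mulr1 lef_pV2 ?posrE// ?ltW//.
      exact: lt_trans ez.
    by rewrite normr0 mul0r mulr_ge0 ?invr_ge0 ?(ltW e0)//; case: ifP.
  exact/rintegrableZ/rintegrable_near.
have := @Rintegral_affine R (-1) (2 * x) _ o jo.
rewrite oppr_eq0 oner_eq0 => /(_ isT); rewrite normrN normr1 divr1.
under eq_Rintegral => z _.
  have -> : o (-1 * z + 2 * x) = -1 * o z.
    rewrite /o (_ : x - _ = - (x - z)); last by ring.
    by rewrite normrN invrN mulrN mulN1r.
  over.
rewrite RintegralZl// -/(o _) => h; rewrite -[LHS]/(\int[leb]_z o z); lra.
Qed.

Lemma htrunc_hilb x e : 0 < e < 1 ->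
  `|pi^-1 * htrunc f x e - hilb f x| <= pi^-1 * (L * (2 * e)).
Proof.
move=> /andP[e0 e1].
rewrite /hilb -mulrBr normrM normfV (ger0_norm (pi_ge0 _)) ler_wpM2l ?invr_ge0 ?pi_ge0//.
have jh := rintegrable_hker x.
pose o z : R := b2r (e < `|x - z| < 1) / (x - z).
have mb : measurable_fun [set: R] (fun z => `|x - z|).
  by apply: measurableT_comp => //; exact: measurable_funB.
pose n z : R := b2r (`|x - z| <= e) * hker f x z.
have mn : measurable_fun [set: R] n.
  apply: measurable_funM; last exact: measurable_hker2.
  by apply: measurable_b2r; exact: measurable_fun_ler.
have nle z : `|n z| <= L * b2r (`|x - z| <= e).
  rewrite /n /b2r; case: ifPn => ze; last by rewrite mul0r normr0 mulr0.
  by rewrite mul1r mulr1 hker_le_near// (le_lt_trans ze).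
have jL := rintegrableZ L (rintegrable_near x e).
have jn : rintegrable leb n by exact: (@le_rintegrable _ _ _ leb n _ mn nle jL).
have jo : rintegrable leb o.
  apply: (@le_rintegrable _ _ _ leb _ (fun z => e^-1 * b2r (`|x - z| <= 1))) => //.
  - apply: measurable_funM; last by apply: measurable_funV; exact: measurable_funB.
    by apply: measurable_b2r; apply: measurable_and; exact: measurable_fun_ltr.
  - move=> z; rewrite /o normrM normfV /b2r; case: ifPn => [/andP[ez z1]|_].
      rewrite normr1 mul1r (ltW z1) mulr1 lef_pV2 ?posrE// ?ltW//.
      exact: lt_trans ez.
    by rewrite normr0 mul0r mulr_ge0 ?invr_ge0 ?(ltW e0)//; case: ifP.
  - exact/rintegrableZ/rintegrable_near.
(* The two integrals differ only by the regularised kernel within distance [e] of [x], since the odd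
   part, multiplied by [f x], integrates to 0. *)
have -> : htrunc f x e - \int[leb]_z hker f x z = - \int[leb]_z n z.
  have -> : htrunc f x e = \int[leb]_z (hker f x z - n z + f x * o z).
    apply: eq_Rintegral => z _; rewrite /n /o /hker /b2r ltNge.
    case: (leP `|x - z| e) => ze /=; first by rewrite !(mul0r, mulr0, mul1r) subrr addr0.
    by case: ifPn => _; rewrite !(mul0r, mulr0, mul1r, subr0, addr0)//; ring.
  rewrite RintegralD//; [|exact: rintegrableB|exact: rintegrableZ].
  rewrite RintegralB// RintegralZl// htrunc_odd// mulr0 addr0; ring.
rewrite normrN; have := @le_norm_Rintegral _ _ _ leb _ _ mn nle jL.
by rewrite RintegralZl ?Rintegral_near ?(ltW e0)//; exact: rintegrable_near.
Qed.

Lemma cvg_hilb x : pi^-1 * htrunc f x e @[e --> 0^'+] --> hilb f x.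
Proof.
apply/cvgrPdist_le => d d0; near=> e.
have e0 : 0 < e by near: e; exact: nbhs_right_gt.
have e1 : e < 1 by near: e; exact: nbhs_right_lt.
have ed : e < d * (2 * (pi^-1 * L) + 1)^-1.
  near: e; apply: nbhs_right_lt; rewrite divr_gt0//.
  by rewrite ltr_wpDl// mulr_ge0// mulr_ge0// invr_ge0 pi_ge0.
rewrite distrC (le_trans (htrunc_hilb _ _))// ?e0//.
move: ed; rewrite ltr_pdivlMr; last first.
  by rewrite ltr_wpDl// mulr_ge0// mulr_ge0// invr_ge0 pi_ge0.
by move=> /ltW; lra.
Unshelve. all: by end_near. Qed.

End bounds.
End hilbert_transform.

Section hilbert_testfun.
Context {R : realType}.
Implicit Types (f g : R -> R) (x z e : R).

Lemma testfun_cvg_hilb f x : testfun f ->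
  pi^-1 * htrunc f x e @[e --> 0^'+] --> hilb f x.
Proof.
move=> tf; have [L L0 fL] := testfun_lipschitz tf.
exact: (cvg_hilb L0 fL (testfun_measurable tf) (testfun_rintegrable tf)).
Qed.

Lemma testfun_measurable_hilb f : testfun f -> measurable_fun [set: R] (hilb f).
Proof. by move=> tf; apply: measurable_hilb; exact: testfun_measurable. Qed.

Lemma testfun_hilb_bounded f : testfun f ->
  exists2 C : R, 0 <= C & forall x, `|hilb f x| <= C.
Proof.
move=> tf; have [L L0 fL] := testfun_lipschitz tf.
have h := hilb_le L0 fL (testfun_measurable tf) (testfun_rintegrable tf).
by eexists; last exact: h; exact: le_trans (h 0).
Qed.

(** The factors in time and in [y] come out of the principal value. The limit exists by
    [testfun_cvg_hilb], so that [lim] in [hilbert] has its genuine value. *)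
Lemma hilbert_prod (th f b : R -> R) (t x y : R) : testfun f ->
  hilbert (fun q => th q.1 * (f q.2.1 * b q.2.2)) (t, (x, y)) =
  th t * (hilb f x * b y).
Proof.
move=> tf; rewrite /hilbert; apply: cvg_lim => //.
have jz e : 0 < e -> rintegrable leb
    (fun z => b2r (e < `|x - z|) * (f z / (x - z))).
  move=> e0; have jf := rintegrableZ (e^-1) (rintegrable_norm (testfun_rintegrable tf)).
  apply: (@le_rintegrable _ _ _ leb _ _ _ _ jf).
    apply: measurable_funM.
      apply: measurable_b2r; apply: measurable_fun_ltr => //.
      by apply: measurableT_comp => //; exact: measurable_funB.
    apply: measurable_funM; first exact: testfun_measurable.
    by apply: measurable_funV; exact: measurable_funB.
  move=> z; rewrite /b2r; case: ifPn => ez; last first.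
    by rewrite mul0r normr0 mulr_ge0// invr_ge0 ltW.
  rewrite mul1r normrM normfV mulrC ler_wpM2r// lef_pV2 ?posrE ?(ltW ez)//.
  exact: lt_trans ez.
have E : \forall e \near 0^'+, th t * b y * (pi^-1 * htrunc f x e) =
   pi^-1 * \int[leb]_(z in [set z | e < `|x - z|])
      (th t * (f z * b y) / (x - z)).
  near=> e; have e0 : 0 < e by near: e; exact: nbhs_right_gt.
  have -> : \int[leb]_(z in [set z | e < `|x - z|]) (th t * (f z * b y) / (x - z)) =
      htrunc (fun z => th t * (f z * b y)) x e by rewrite htruncE.
  rewrite mulrCA /htrunc -RintegralZl//; last exact: jz.
  congr (_ * _); apply: eq_Rintegral => z _.
  rewrite mulrCA; congr (_ * _); rewrite [LHS]mulrA; congr (_ * _).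
  by rewrite -[LHS]mulrA [b y * _]mulrC.
apply: cvg_trans; first by apply: near_eq_cvg; exact: E.
rewrite (_ : th t * (hilb f x * b y) = th t * b y * hilb f x); last by ring.
by apply: cvgM; [exact: cvg_cst|exact: testfun_cvg_hilb].
Unshelve. all: by end_near. Qed.

(** The form dz / (x - z) is invariant under dilations and translations, and a reflection reverses
    its sign. The truncation level [e] turns into [|a| e], which still tends to 0 from the right. *)
Lemma hilb_affine (a b : R) f x : a != 0 -> testfun f ->
  hilb (fun x => f (a * x + b)) x = Num.sg a * hilb f (a * x + b).
Proof.
move=> a0 tf; have tg := testfun_affine b a0 tf.
have an : 0 < `|a| by rewrite normr_gt0.
set y := a * x + b.
have E e : 0 < e -> htrunc (fun x => f (a * x + b)) x e =
    Num.sg a * htrunc f y (`|a| * e).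
  move=> e0; pose G w := b2r (`|a| * e < `|y - w|) * (f w / (y - w)).
  have jG : rintegrable leb G.
    have jf := rintegrableZ ((`|a| * e)^-1)
      (rintegrable_norm (testfun_rintegrable tf)).
    apply: (@le_rintegrable _ _ _ leb _ _ _ _ jf).
      apply: measurable_funM.
        apply: measurable_b2r; apply: measurable_fun_ltr => //.
        by apply: measurableT_comp => //; exact: measurable_funB.
      apply: measurable_funM; first exact: testfun_measurable.
      by apply: measurable_funV; exact: measurable_funB.
    have ae : 0 < `|a| * e by rewrite mulr_gt0.
    move=> z; rewrite /G /b2r; case: ifPn => ez; last first.
      by rewrite mul0r normr0 mulr_ge0// invr_ge0 ltW.
    rewrite mul1r normrM normfV mulrC ler_wpM2r// lef_pV2 ?posrE ?(ltW ez)//.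
    exact: lt_trans ez.
  rewrite /htrunc (_ : (fun z => _) = (fun z => a * G (a * z + b))).
    rewrite RintegralZl//; last exact: rintegrable_affine.
    rewrite Rintegral_affine// mulrA mulrAC (_ : a / `|a| = Num.sg a).
      by rewrite mulrC.
    by rewrite {1}[a]numEsg mulfK// gt_eqF.
  apply/funext => z; rewrite /G /y (_ : a * x + b - _ = a * (x - z)); last by ring.
  rewrite normrM ltr_pM2l// invfM; have [->|xz] := eqVneq (x - z) 0.
    by rewrite invr0 !mulr0.
  by field; rewrite xz.
have c1 := @testfun_cvg_hilb _ x tg.
have c2 : pi^-1 * htrunc f y (`|a| * e) @[e --> 0^'+] --> hilb f y.
  have := @testfun_cvg_hilb _ y tf; apply: cvg_trans.
  move=> A [d /= d0 dA]; exists (d / `|a|) => /=; first exact: divr_gt0.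
  move=> e /=; rewrite sub0r normrN => ed e0; apply: dA => /=; last exact: mulr_gt0.
  by rewrite sub0r normrN normrM normr_id mulrC -ltr_pdivlMr.
have c3 : pi^-1 * htrunc (fun x => f (a * x + b)) x e @[e --> 0^'+] -->
    Num.sg a * hilb f y.
  have c4 : Num.sg a * (pi^-1 * htrunc f y (`|a| * e)) @[e --> 0^'+] -->
      Num.sg a * hilb f y by apply: cvgM; [exact: cvg_cst|exact: c2].
  apply: cvg_trans c4; apply: near_eq_cvg; near=> e => /=.
  by rewrite E 1?mulrCA//; near: e; exact: nbhs_right_gt.
exact: (cvg_unique _ c1 c3).
Unshelve. all: by end_near. Qed.

Lemma hilbZ (c : R) f x : testfun f -> hilb (fun x => c * f x) x = c * hilb f x.
Proof.
move=> tf; have [L L0 fL] := testfun_lipschitz tf.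
rewrite /hilb mulrCA -(RintegralZl c)//; last first.
  exact: (rintegrable_hker L0 fL (testfun_measurable tf) (testfun_rintegrable tf)).
by congr (_ * _); apply: eq_Rintegral => z _; rewrite /hker; ring.
Qed.

End hilbert_testfun.

(** * Far field of the Hilbert transform *)

Section far_field.
Context {R : realType}.
Implicit Types (f g : R -> R) (x z : R).

(** Being away from 0, such a support makes 1 / (x - z) smooth in x near 0, and the rescaled profile
    f(x / n) lives on n <= x <= 2 n. *)
Definition supp12 f := forall z : R, ~~ (1 <= z <= 2) -> f z = 0.

Lemma supp12_derive g : testfun g -> supp12 g -> supp12 (D1 g).
Proof.
move=> tg sg z; rewrite negb_and -!ltNge => zz; rewrite derive1E.
suff : is_derive z 1 g 0 by move=> /@derive_val.
apply: (near_eq_is_derive _ (is_derive1_cst 0 z)).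
case/orP : zz => zz; near=> w; rewrite sg// negb_and -!ltNge; apply/orP.
  by left; near: w; exact: lt_nbhsl.
by right; near: w; exact: lt_nbhsr.
Unshelve. all: by end_near. Qed.

Lemma Rintegral_supp12 f : supp12 f ->
  \int[leb]_z f z = \int[leb]_(z in `[1, 2]) f z.
Proof.
move=> sf; rewrite [RHS]Rintegral_mkcond; apply: eq_Rintegral => x _.
rewrite patchE; case: ifPn => // /negP.
by rewrite inE/= in_itv/= => /negP/sf ->.
Qed.

Lemma rintegrable_supp12 f k : testfun f -> supp12 f ->
  rintegrable leb (fun z => f z * z^-1 ^+ k).
Proof.
move=> tf sf; have jf := rintegrable_norm (testfun_rintegrable tf).
apply: (@le_rintegrable _ _ _ leb _ _ _ _ jf).
  apply: measurable_funM; first exact: testfun_measurable.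
  by apply: measurable_funX; exact: measurable_invr.
move=> z; rewrite normrM; have [/andP[z1 z2]|/sf ->] := boolP (1 <= z <= 2).
  rewrite ler_piMr// normrX normfV exprn_ile1 ?invr_ge0//.
  by rewrite invf_le1 ?normr_gt0 ?gt_eqF ?(lt_le_trans _ z1)// ger0_norm// (le_trans _ z1).
by rewrite normr0 mul0r.
Qed.

(** Integration by parts on [1, 2], where [g] vanishes at both ends. It relates the expansion
    coefficients at 0 of the Hilbert transforms of successive derivatives of [g]. *)
Lemma ibp_supp12 g k : testfun g -> supp12 g ->
  \int[leb]_z (D1 g z * z^-1 ^+ k) = k%:R * \int[leb]_z (g z * z^-1 ^+ k.+1).
Proof.
move=> tg sg; have sdg := supp12_derive tg sg; have tdg := testfun_derive tg.
pose F z := g z * z^-1 ^+ k.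
pose F' z := D1 g z * z^-1 ^+ k - k%:R * (g z * z^-1 ^+ k.+1).
have dF z : z != 0 -> is_derive z 1 F (F' z).
  move=> z0; have h1 := smooth1_is_derive z (testfun_smooth tg).
  have h2 := @is_deriveV _ id z 1 1 z0 (is_derive_id z 1).
  have h3 : is_derive z 1 (fun z => z^-1 ^+ k) (k%:R * z^-1 ^+ k.-1 * (- z ^- 2)).
    have := @is_deriveX _ _ (fun z : R => z^-1) k z 1 _ h2.
    by rewrite exprfctE /GRing.scale/= mulr1.
  apply: (is_derive_eq (is_deriveM h1 h3)); rewrite /F' /GRing.scale/=.
  case: k {F F' h3} => [|k]/=; first by rewrite !expr0; ring.
  by rewrite -exprVn !exprS; ring.
have cF z : z != 0 -> {for z, continuous F'}.
  move=> z0.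
  have cX n : {for z, continuous (fun z : R => z^-1 ^+ n)}.
    apply: (@continuous_comp _ _ _ (fun z : R => z^-1) (fun w => w ^+ n)).
      exact: inv_continuous.
    exact: exprn_continuous.
  have c1 : continuous (D1 g) by apply: smooth1_continuous; exact: testfun_smooth.
  have c2 : continuous g by apply: smooth1_continuous; exact: testfun_smooth.
  apply: cvgB; first by apply: cvgM; [exact: c1|exact: cX].
  apply: cvgM; first exact: cvg_cst.
  by apply: cvgM; [exact: c2|exact: cX].
have zn z : z \in `[1, 2] -> z != 0.
  by rewrite in_itv/= => /andP[z1 _]; rewrite gt_eqF// (lt_le_trans _ z1).
have j1 := rintegrable_supp12 k tdg sdg.
have j2 := rintegrable_supp12 k.+1 tg sg.
suff : \int[leb]_z F' z = 0.
  by rewrite RintegralB ?RintegralZl//; [lra|exact: rintegrableZ].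
rewrite Rintegral_supp12; last first.
  by move=> z hz; rewrite /F' sdg// sg// !mul0r mulr0 subrr.
have cg : continuous g by apply: smooth1_continuous; exact: testfun_smooth.
have F1 : F 1 = 0.
  (* [supp12] leaves the endpoint free; the value there is 0 by continuity from outside the
     interval. *)
  suff g1 : g 1 = 0 by rewrite /F g1 mul0r.
  have c1 : g z @[z --> 1^'-] --> g 1 by apply: cvg_at_left_filter; exact: cg.
  rewrite -(cvg_lim _ c1)//; apply: cvg_lim => //; apply: cvg_near_cst.
  near=> z; rewrite sg// negb_and -ltNge; apply/orP; left.
  by near: z; exact: nbhs_left_lt.
have F2 : F 2 = 0.
  suff g2 : g 2 = 0 by rewrite /F g2 mul0r.
  have c2 : g z @[z --> 2^'+] --> g 2 by apply: cvg_at_right_filter; exact: cg.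
  rewrite -(cvg_lim _ c2)//; apply: cvg_lim => //; apply: cvg_near_cst.
  near=> z; rewrite sg// negb_and -!ltNge; apply/orP; right.
  by near: z; exact: nbhs_right_gt.
have lt12 : (1 : R) < 2 by rewrite ltr1n.
have cF12 : {within `[1, 2], continuous F'}.
  by apply: continuous_in_subspaceT => z; rewrite inE => /zn; exact: cF.
have cvF z : z != 0 -> F w @[w --> z] --> F z.
  move=> /dF[dFz _]; exact/differentiable_continuous/derivable1_diffP.
have dF12 : derivable_oo_LRcontinuous F 1 2.
  split; first by move=> z /subset_itv_oo_cc/zn/dF[].
    by apply: cvg_at_right_filter; exact: cvF.
  by apply: cvg_at_left_filter; exact: cvF.
have F'F : {in `]1, 2[, D1 F =1 F'}.
  by move=> z /subset_itv_oo_cc/zn/dF[_ E]; rewrite derive1E.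
by rewrite /Rintegral (continuous_FTC2 lt12 cF12 dF12 F'F) F1 F2 subee.
Unshelve. all: by end_near. Qed.

End far_field.

(** * Expansion of the Hilbert transform at the origin *)

Section far_field_expansion.
Context {R : realType}.
Implicit Types (f g : R -> R) (x z : R).

Lemma hilb_supp12 f x : testfun f -> supp12 f -> `|x| < 2^-1 ->
  rintegrable leb (fun z => f z / (x - z)) /\
  hilb f x = pi^-1 * \int[leb]_z (f z / (x - z)).
Proof.
move=> tf sf; rewrite ltr_norml => /andP[xl xr].
have jf := rintegrableZ 2 (rintegrable_norm (testfun_rintegrable tf)).
split.
  apply: (@le_rintegrable _ _ _ leb _ _ _ _ jf).
    apply: measurable_funM; first exact: testfun_measurable.
    by apply: measurable_funV; exact: measurable_funB.
  move=> z; have [/andP[z1 z2]|/sf ->] := boolP (1 <= z <= 2); last first.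
    by rewrite mul0r normr0 mulr0.
  rewrite normrM mulrC ler_wpM2r// normfV -[leRHS]invrK lef_pV2 ?posrE//.
    by rewrite distrC ger0_norm; lra.
  by rewrite normr_gt0 subr_eq0 lt_eqF//; lra.
rewrite /hilb; congr (_ * _); apply: eq_Rintegral => z _; rewrite /hker.
suff -> : f x = 0 by rewrite mulr0 subr0.
by apply: sf; rewrite negb_and -ltNge; apply/orP; left; lra.
Qed.

(** Integrate 1 / (x - z) = - 1 / z - x / z^2 + x^2 / (z^2 (x - z)) against [f]. After rescaling,
    the quadratic bound on the remainder gives pointwise limits, and the linear one a majorant that
    is uniform in the scale. *)
Lemma hilb_expansion f : testfun f -> supp12 f ->
  hilb f 0 = - (pi^-1 * \int[leb]_z (f z * z^-1 ^+ 1)) /\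
  let c := - (pi^-1 * \int[leb]_z (f z * z^-1 ^+ 2)) in
  exists2 C : R, 0 <= C & forall x, `|hilb f x - hilb f 0 - c * x| <= C * x ^+ 2 /\
    `|hilb f x - hilb f 0 - c * x| <= C * `|x|.
Proof.
move=> tf sf.
have pi0 : 0 <= (pi : R)^-1 by rewrite invr_ge0 pi_ge0.
have jf := testfun_rintegrable tf; have jn := rintegrable_norm jf.
have j1 := rintegrable_supp12 1 tf sf; have j2 := rintegrable_supp12 2 tf sf.
have h0 : hilb f 0 = - (pi^-1 * \int[leb]_z (f z * z^-1 ^+ 1)).
  have [|_ ->] := hilb_supp12 tf sf (x := 0); first by rewrite normr0 invr_gt0.
  rewrite -mulrN; congr (_ * _); rewrite -mulN1r -RintegralZl//.
  by apply: eq_Rintegral => z _; rewrite expr1 sub0r invrN mulrN mulN1r.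
split=> // c; set I := \int[leb]_z `|f z|.
have I0 : 0 <= I by apply: Rintegral_ge0.
have [B B0 hB] := testfun_hilb_bounded tf.
(* The first summand serves |x| < 1/2, where |x - z| >= 1/2 on the support. The others serve |x| >=
   1/2, where 1 <= 4 x^2 and |x| <= 2 x^2 allow each term to be bounded on its own. *)
pose C := pi^-1 * (2 * I) + 4 * (B + B) + 2 * `|c|.
have C1 : pi^-1 * (2 * I) <= C.
  by rewrite /C -addrA lerDl addr_ge0// mulr_ge0// addr_ge0.
have C2 : 4 * (B + B) + 2 * `|c| <= C.
  by rewrite /C -addrA lerDr mulr_ge0// mulr_ge0.
have C0 : 0 <= C by rewrite (le_trans _ C1)// mulr_ge0// mulr_ge0.
exists C => // x; have [xs|xl] := ltP `|x| 2^-1; last first.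
  have b : `|hilb f x - hilb f 0 - c * x| <= B + B + `|c| * `|x|.
    rewrite (le_trans (ler_normB _ _))// normrM lerD//.
    by rewrite (le_trans (ler_normB _ _))// lerD.
  have x2 : x ^+ 2 = `|x| ^+ 2 by rewrite real_normK// num_real.
  have [aux1 aux2] : 0 <= 4 * `|x| ^+ 2 - 1 /\ 0 <= 2 * `|x| ^+ 2 - `|x|.
    have : 0 <= 2 * `|x| - 1 by lra.
    by clear; set a := `|x| => h; split; nra.
  have c0 := normr_ge0 c; rewrite x2; split; apply: (le_trans b).
    have a2 : 0 <= `|x| ^+ 2 by exact: sqr_ge0.
    have e1 : 0 <= (B + B) * (4 * `|x| ^+ 2 - 1).
      by rewrite mulr_ge0// addr_ge0.
    have e2 : 0 <= `|c| * (2 * `|x| ^+ 2 - `|x|) by rewrite mulr_ge0.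
    have e3 : 0 <= (C - (4 * (B + B) + 2 * `|c|)) * `|x| ^+ 2.
      by rewrite mulr_ge0// subr_ge0.
    lra.
  have e1 : 0 <= (B + B) * (2 * `|x| - 1).
    by apply: mulr_ge0; [exact: addr_ge0|lra].
  have e3 : 0 <= (C - (4 * (B + B) + 2 * `|c|)) * `|x|.
    by rewrite mulr_ge0// subr_ge0.
  have e4 : 0 <= B * `|x| by rewrite mulr_ge0.
  have e5 : 0 <= `|c| * `|x| by rewrite mulr_ge0.
  lra.
have key : `|hilb f x - hilb f 0 - c * x| <= pi^-1 * (2 * I) * x ^+ 2.
  have [jx ->] := hilb_supp12 tf sf xs.
  have -> : pi^-1 * \int[leb]_z (f z / (x - z)) - hilb f 0 - c * x =
      pi^-1 * \int[leb]_z (f z / (x - z) + f z * z^-1 ^+ 1 + x * (f z * z^-1 ^+ 2)).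
    have i1 := rintegrableD jx j1; have i2 := rintegrableZ x j2.
    by rewrite RintegralD// RintegralD// RintegralZl// h0 /c; ring.
  rewrite normrM ger0_norm// -!mulrA ler_wpM2l//.
  have jn2 := rintegrableZ (2 * x ^+ 2) jn.
  rewrite (_ : 2 * _ = \int[leb]_z (2 * x ^+ 2 * `|f z|)); last first.
    by rewrite RintegralZl// -/I; ring.
  apply: (@le_norm_Rintegral _ _ _ leb) => //.
    exact: rintegrable_measurable (rintegrableD (rintegrableD jx j1) (rintegrableZ x j2)).
  move=> z; have [/andP[z1 z2]|/sf ->] := boolP (1 <= z <= 2); last first.
    by rewrite !mul0r mulr0 !addr0 normr0 mulr0.
  move: xs; rewrite ltr_norml => /andP[xa xb].
  have z0 : z != 0 by rewrite gt_eqF; lra.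
  have xz : x - z != 0 by rewrite lt_eqF; lra.
  rewrite (_ : _ + _ + _ = x ^+ 2 * (z ^- 2 * (x - z)^-1) * f z); last first.
    by field; rewrite xz z0.
  rewrite normrM ler_wpM2r// [2 * _]mulrC normrM (ger0_norm (sqr_ge0 x)).
  rewrite ler_wpM2l ?sqr_ge0//.
  rewrite normrM -[leRHS]mul1r ler_pM// ?normfV.
    rewrite invf_le1 ?normr_gt0 ?sqrf_eq0// ger0_norm ?sqr_ge0// exprn_ege1//.
  rewrite -[leRHS]invrK lef_pV2 ?posrE ?normr_gt0//.
  by rewrite distrC ger0_norm; lra.
split; first by apply: (le_trans key); rewrite ler_wpM2r ?sqr_ge0.
apply: (le_trans key).
have -> : x ^+ 2 = `|x| ^+ 2 by rewrite real_normK// num_real.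
rewrite expr2 mulrA ler_wpM2r// (le_trans _ C1)// ler_piMr//; last by lra.
by rewrite mulr_ge0// mulr_ge0.
Qed.

Lemma Rintegral_gt0 f x : rintegrable leb f -> (forall z, 0 <= f z) ->
  f z @[z --> x] --> f x -> 0 < f x -> 0 < \int[leb]_z f z.
Proof.
move=> jf f0 cf fx.
have [r /= r0 hr] : \forall z \near x, f x / 2 < f z.
  by apply: (cvgr_gt _ cf); lra.
have r2 : 0 < r / 2 by rewrite divr_gt0.
have jr := rintegrableZ (f x / 2) (rintegrable_near x (r / 2)).
apply: (@lt_le_trans _ _ (f x / 2 * (2 * (r / 2)))); first by rewrite !mulr_gt0//; lra.
rewrite -(Rintegral_near x (ltW r2)) -RintegralZl//; last exact: rintegrable_near.
apply: le_Rintegral => // z _; rewrite /b2r; case: ifPn => zr; last by rewrite mulr0.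
by rewrite mulr1 ltW// hr//= (le_lt_trans zr)//; lra.
Qed.

(** Two integrations by parts give c = - (6 / pi) \int g z^-4, nonzero because g >= 0. One
    integration by parts identifies c with the Hilbert transform of g''' at 0, so that the same
    constant governs the profiles g and g'. *)
Lemma far_field_profile : exists g (c C : R), [/\ testfun g, supp12 g, c != 0,
  forall x, `|hilb (D1 (D1 g)) x - hilb (D1 (D1 g)) 0 - c * x| <= C * x ^+ 2 /\
    `|hilb (D1 (D1 g)) x - hilb (D1 (D1 g)) 0 - c * x| <= C * `|x| &
  forall x, `|hilb (D1 (D1 (D1 g))) x - c| <= C * `|x| ].
Proof.
pose g x : R := bump01 (1 * x + -1).
have tg : testfun g.
  by apply: testfun_affine; [rewrite oner_eq0|exact: testfun_bump01].
have sg : supp12 g.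
  move=> z; apply: contraNeq => /eqP.
  rewrite /g mul1r => gz; apply: contraPT gz => hz.
  apply; apply: bump01_eq0; apply: contra hz => /andP[a b].
  by apply/andP; split; lra.
have td := testfun_derive tg; have sd := supp12_derive tg sg.
have tdd := testfun_derive td; have sdd := supp12_derive td sd.
have tddd := testfun_derive tdd; have sddd := supp12_derive tdd sdd.
pose c : R := - (pi^-1 * \int[leb]_z (D1 (D1 g) z * z^-1 ^+ 2)).
have [_ [C1 C10 hC1]] := hilb_expansion tdd sdd.
have [E3 [C2 C20 hC2]] := hilb_expansion tddd sddd.
have c3 : hilb (D1 (D1 (D1 g))) 0 = c.
  by rewrite E3 ibp_supp12// mul1r.
set c4 := - (pi^-1 * \int[leb]_z (D1 (D1 (D1 g)) z * z^-1 ^+ 2)) in hC2.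
exists g, c, (C1 + C2 + `|c4|); split; [exact: tg|exact: sg| | |].
- rewrite /c !ibp_supp12// oppr_eq0 !mulf_neq0//.
  + by rewrite invr_neq0// gt_eqF// pi_gt0.
  have jg := rintegrable_supp12 4 tg sg.
  rewrite gt_eqF//; apply: (Rintegral_gt0 (x := 3 / 2)) => //.
  + move=> z; have [/andP[z1 _]|/sg ->] := boolP (1 <= z <= 2); last by rewrite mul0r.
    by rewrite mulr_ge0 ?bump01_ge0// exprn_ge0// invr_ge0 (le_trans _ z1).
  + apply: cvgM; first exact: (smooth1_continuous (testfun_smooth tg)).
    apply: (@continuous_comp _ _ _ (fun z : R => z^-1) (fun w => w ^+ 4)).
      by apply: inv_continuous; lra.
    exact: exprn_continuous.
  + by rewrite mulr_gt0 ?exprn_gt0 ?invr_gt0// ?bump01_gt0 ?divr_gt0//; lra.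
- move=> x; have [h1 h2] := hC1 x; split.
    by rewrite (le_trans h1)// ler_wpM2r ?sqr_ge0// -addrA lerDl addr_ge0.
  by rewrite (le_trans h2)// ler_wpM2r// -addrA lerDl addr_ge0.
- move=> x; have [_ h2] := hC2 x; rewrite -c3.
  rewrite -[X in `|X|](subrK (c4 * x)) (le_trans (ler_normD _ _))//.
  rewrite normrM !mulrDl lerD// (le_trans h2)// lerDr.
  exact: mulr_ge0.
Qed.

End far_field_expansion.

(** * Tensor products as test functions *)

Section tensor_test_functions.
Context {R : realType}.
Notation space := (R * (R * R))%type.

(** The coordinates are named so as to carry a linear structure, through which their differentials
    are obtained. *)
Definition time_coord (q : space) : R := q.1.
Definition x_coord (q : space) : R := q.2.1.
Definition y_coord (q : space) : R := q.2.2.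

Fact time_coord_is_linear : linear time_coord. Proof. by []. Qed.
Fact x_coord_is_linear : linear x_coord. Proof. by []. Qed.
Fact y_coord_is_linear : linear y_coord. Proof. by []. Qed.

HB.instance Definition _ :=
  GRing.isLinear.Build R space R _ time_coord time_coord_is_linear.
HB.instance Definition _ :=
  GRing.isLinear.Build R space R _ x_coord x_coord_is_linear.
HB.instance Definition _ :=
  GRing.isLinear.Build R space R _ y_coord y_coord_is_linear.

Lemma continuous_time_coord : continuous time_coord.
Proof. by move=> q; exact: cvg_fst. Qed.

Lemma continuous_x_coord : continuous x_coord.
Proof.
move=> q; apply: (@continuous_comp _ _ _ (@snd R (R * R)%type) fst).
  exact: cvg_snd.
exact: cvg_fst.
Qed.

Lemma continuous_y_coord : continuous y_coord.
Proof.
move=> q; apply: (@continuous_comp _ _ _ (@snd R (R * R)%type) snd).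
  exact: cvg_snd.
exact: cvg_snd.
Qed.

Lemma smooth1_comp_linear (l : {linear space -> R}) (f : R -> R) q v :
  continuous l -> smooth1 f ->
  differentiable (f \o l) q /\ 'D_v (f \o l) q = l v * D1 f (l q).
Proof.
move=> cl sf; have dl : differentiable l q by exact: linear_differentiable.
have df : differentiable f (l q) by apply/derivable1_diffP; exact: smooth1_derivable.
have dfl : differentiable (f \o l) q by exact: differentiable_comp.
split => //; rewrite deriveE// diff_comp// diff_lin//=.
by rewrite (diff1E df).
Qed.

Definition tensor (th a b : R -> R) (q : space) : R :=
  th q.1 * (a q.2.1 * b q.2.2).

Lemma tensor_derive th a b q v : smooth1 th -> smooth1 a -> smooth1 b ->
  differentiable (tensor th a b) q /\
  'D_v (tensor th a b) q = v.1 * tensor (D1 th) a b q +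
    v.2.1 * tensor th (D1 a) b q + v.2.2 * tensor th a (D1 b) q.
Proof.
move=> sth sa sb.
have [dt et] := smooth1_comp_linear q v continuous_time_coord sth.
have [dx ex] := smooth1_comp_linear q v continuous_x_coord sa.
have [dy ey] := smooth1_comp_linear q v continuous_y_coord sb.
have dab : differentiable ((a \o x_coord) * (b \o y_coord)) q.
  exact: differentiableM.
have dd : differentiable ((th \o time_coord) * ((a \o x_coord) * (b \o y_coord))) q.
  exact: differentiableM.
split; first exact: dd.
rewrite -[tensor th a b]/((th \o time_coord) * ((a \o x_coord) * (b \o y_coord))).
rewrite deriveM; [|exact: diff_derivable..].
rewrite deriveM; [|exact: diff_derivable..].
rewrite et ex ey /tensor /GRing.scale/= /time_coord /x_coord /y_coord.
by rewrite -[(_ * _) q]/(a q.2.1 * b q.2.2); ring.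
Qed.

(** A directional derivative of a tensor product is a combination of tensor products. The span is
    therefore stable under differentiation, which handles all iterated derivatives at once. *)
Inductive tensor_span : (space -> R) -> Prop :=
| tensor_span_prod th a b : smooth1 th -> smooth1 a -> smooth1 b ->
    tensor_span (tensor th a b)
| tensor_span_add f g : tensor_span f -> tensor_span g ->
    tensor_span (fun q => f q + g q)
| tensor_span_scale c f : tensor_span f -> tensor_span (fun q => c * f q).

Lemma tensor_span_derive f v : tensor_span f ->
  (forall q, differentiable f q) /\ tensor_span ('D_v f).
Proof.
elim=> [th a b sth sa sb|{}f g sf [df s'f] sg [dg s'g]|c {}f sf [df s'f]].
- split; first by move=> q; have [] := tensor_derive q v sth sa sb.
  rewrite (_ : 'D_v _ = fun q => (v.1 * tensor (D1 th) a b q +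
    v.2.1 * tensor th (D1 a) b q) + v.2.2 * tensor th a (D1 b) q).
    apply: tensor_span_add; first apply: tensor_span_add;
      apply: tensor_span_scale; apply: tensor_span_prod => //;
      exact: smooth1_derive.
  by apply/funext => q; have [] := tensor_derive q v sth sa sb.
- split; first by move=> q; exact: differentiableD.
  rewrite (_ : 'D_v _ = fun q => 'D_v f q + 'D_v g q).
    exact: tensor_span_add.
  by apply/funext => q; rewrite deriveD//; exact: diff_derivable.
- split; first by move=> q; exact: (differentiableZ c).
  rewrite (_ : 'D_v _ = fun q => c * 'D_v f q).
    exact: tensor_span_scale.
  by apply/funext => q; rewrite (deriveZ c)//; exact: diff_derivable.
Qed.

Lemma smooth_tensor th a b : smooth1 th -> smooth1 a -> smooth1 b ->
  smooth (tensor th a b).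
Proof.
move=> sth sa sb vs q.
suff : tensor_span (foldr (fun v g => 'D_v g) (tensor th a b) vs).
  by move=> /(tensor_span_derive 0)[].
elim: vs => [|v vs ih] /=; first exact: tensor_span_prod.
by have [] := tensor_span_derive v ih.
Qed.

Lemma dt_tensor th a b : smooth1 th -> smooth1 a -> smooth1 b ->
  dt (tensor th a b) = tensor (D1 th) a b.
Proof.
move=> sth sa sb; apply/funext => q; rewrite /dt.
by have [_ ->] := tensor_derive q (1, (0, 0)) sth sa sb; rewrite /= mul1r !mul0r !addr0.
Qed.

Lemma dx_tensor th a b : smooth1 th -> smooth1 a -> smooth1 b ->
  dx (tensor th a b) = tensor th (D1 a) b.
Proof.
move=> sth sa sb; apply/funext => q; rewrite /dx.
by have [_ ->] := tensor_derive q (0, (1, 0)) sth sa sb;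
  rewrite /= mul1r !mul0r addr0 add0r.
Qed.

Lemma dy_tensor th a b : smooth1 th -> smooth1 a -> smooth1 b ->
  dy (tensor th a b) = tensor th a (D1 b).
Proof.
move=> sth sa sb; apply/funext => q; rewrite /dy.
by have [_ ->] := tensor_derive q (0, (0, 1)) sth sa sb;
  rewrite /= mul1r !mul0r addr0 add0r.
Qed.

Lemma test_function_tensor (T s t : R) th a b : 0 < s -> t < T ->
  smooth1 th -> (forall z, ~~ (s <= z <= t) -> th z = 0) ->
  testfun a -> testfun b -> test_function T (tensor th a b).
Proof.
move=> s0 tT sth th0 [sa [K aK]] [sb [L bL]].
have cbox : compact (`[s, t] `*` (`[- K, K] `*` `[- L, L])).
  by do 2?[apply: compact_setX]; exact: segment_compact.
have sub : closure [set q : space | tensor th a b q != 0] `<=`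
    `[s, t] `*` (`[- K, K] `*` `[- L, L]).
  have /closure_id -> : closed (`[s, t] `*` (`[- K, K] `*` `[- L, L])).
    by apply: compact_closed => //; exact: norm_hausdorff.
  apply: closureS => -[z [x y]] /=; rewrite /tensor/= !mulf_eq0 !negb_or.
  move=> /and3P[zn xn yn]; rewrite !in_itv/= -!ler_norml; split; last split.
  - by apply: contraNT zn => /th0 ->.
  - by rewrite leNgt; apply: contraNN xn => /aK ->.
  - by rewrite leNgt; apply: contraNN yn => /bL ->.
split; first exact: smooth_tensor.
- exact: (subclosed_compact (@closed_closure _ _) cbox sub).
- move=> q /sub[/=]; rewrite in_itv/= => /andP[sq qt] _.
  by rewrite (lt_le_trans s0 sq) (le_lt_trans qt tT).
Qed.

End tensor_test_functions.

(** * The weighted space of exponent 2 and its dual *)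

Section weighted_space.
Context {R : realType}.
Implicit Types (v w Psi : R * R -> R).

Definition wsq v := \int[planeleb]_p (bracket2 p * v p) ^+ 2.

Definition in_weighted v := measurable_fun [set: plane R] v /\
  rintegrable planeleb (fun p => (bracket2 p * v p) ^+ 2).

Lemma wsq_ge0 v : 0 <= wsq v.
Proof. by apply: Rintegral_ge0 => p _; exact: sqr_ge0. Qed.

Lemma weighted_norm2E v : weighted_norm2 2 v =
  (\int[planeleb]_p ((bracket2 p * v p) ^+ 2)%:E)%E.
Proof.
apply: eq_integral => p _; congr EFin.
by rewrite powR_mulrn ?ltW ?bracket2_gt0// exprMn.
Qed.

Lemma weighted_L2_2P v : weighted_L2 2 v -> in_weighted v.
Proof.
move=> [mv]; rewrite weighted_norm2E => vy; split => //.
apply: rintegrable_ge0P vy => [|p]; last exact: sqr_ge0.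
by apply: measurable_funX; apply: measurable_funM => //; exact: measurable_bracket2.
Qed.

Lemma weighted_norm2_wsq v : in_weighted v -> weighted_norm2 2 v = (wsq v)%:E.
Proof. by move=> [mv iv]; rewrite weighted_norm2E EFin_Rintegral. Qed.

Lemma in_weightedD v w : in_weighted v -> in_weighted w ->
  in_weighted (fun p => v p + w p).
Proof.
move=> [mv iv] [mw iw]; split; first exact: measurable_funD.
have j := rintegrableD (rintegrableZ 2 iv) (rintegrableZ 2 iw).
apply: (@le_rintegrable _ _ _ planeleb _ _ _ _ j).
  apply: measurable_funX; apply: measurable_funM; first exact: measurable_bracket2.
  exact: measurable_funD.
move=> p; rewrite ger0_norm ?sqr_ge0// mulrDr.
set x := _ * v p; set y := _ * w p; have := sqr_ge0 (x - y); nra.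
Qed.

Lemma in_weightedN v : in_weighted v -> in_weighted (fun p => - v p).
Proof.
move=> [mv iv]; split; first exact: measurableT_comp.
by under eq_fun do rewrite mulrN sqrrN.
Qed.

Lemma in_weightedB v w : in_weighted v -> in_weighted w ->
  in_weighted (fun p => v p - w p).
Proof. by move=> hv hw; apply: in_weightedD => //; exact: in_weightedN. Qed.

Lemma wsqD_le v w : in_weighted v -> in_weighted w ->
  wsq (fun p => v p + w p) <= 2 * wsq v + 2 * wsq w.
Proof.
move=> hv hw; have [_ ivw] := in_weightedD hv hw; move: hv hw => [mv iv] [mw iw].
rewrite /wsq -!RintegralZl// -RintegralD//; [|exact: rintegrableZ..].
apply: le_Rintegral => //; first by apply: rintegrableD; exact: rintegrableZ.
move=> p _; rewrite mulrDr.
set x := _ * v p; set y := _ * w p; have := sqr_ge0 (x - y); nra.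
Qed.

(** Square integrability against the inverse weight; by Cauchy-Schwarz such functions pair with the
    weighted space. *)
Definition in_dual Psi := measurable_fun [set: plane R] Psi /\
  rintegrable planeleb (fun p => (Psi p / bracket2 p) ^+ 2).

Definition dualsq Psi := \int[planeleb]_p (Psi p / bracket2 p) ^+ 2.

Let mulB v Psi p : bracket2 p * v p * (Psi p / bracket2 p) = v p * Psi p.
Proof. by field; rewrite gt_eqF// bracket2_gt0. Qed.

Lemma rintegrable_dual v Psi : in_weighted v -> in_dual Psi ->
  rintegrable planeleb (fun p => v p * Psi p).
Proof.
move=> [mv iv] [mP iP]; under eq_fun do rewrite -mulB.
apply: rintegrableM_sqr => //.
  by apply: measurable_funM => //; exact: measurable_bracket2.
by apply: measurable_funM => //; apply: measurable_funV; exact: measurable_bracket2.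
Qed.

Lemma dual_CauchySchwarz v Psi : in_weighted v -> in_dual Psi ->
  (\int[planeleb]_p (v p * Psi p)) ^+ 2 <= wsq v * dualsq Psi.
Proof.
move=> [mv iv] [mP iP]; under eq_Rintegral do rewrite -mulB.
apply: Rintegral_CauchySchwarz => //.
  by apply: measurable_funM => //; exact: measurable_bracket2.
by apply: measurable_funM => //; apply: measurable_funV; exact: measurable_bracket2.
Qed.

Lemma in_dual_le Psi C : measurable_fun [set: plane R] Psi ->
  (forall p, Psi p ^+ 2 <= C * (bracket2 p ^+ 2 * lorentz2 p)) -> in_dual Psi.
Proof.
move=> mP PC; split => //; have j := rintegrableZ C rintegrable_lorentz2.
apply: (@le_rintegrable _ _ _ planeleb _ _ _ _ j).
  by apply: measurable_funX; apply: measurable_funM => //;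
    apply: measurable_funV; exact: measurable_bracket2.
move=> p; rewrite ger0_norm ?sqr_ge0// expr_div_n ler_pdivrMr ?exprn_gt0 ?bracket2_gt0//.
by rewrite mulrAC -mulrA.
Qed.

Lemma in_dual_bounded Psi C : measurable_fun [set: plane R] Psi ->
  (forall p, `|Psi p| <= C) -> in_dual Psi.
Proof.
move=> mP PC; apply: (in_dual_le (C := C ^+ 2)) => // p.
have C0 : 0 <= C by exact: le_trans (PC p).
rewrite -[leLHS]mulr1 ler_pM ?sqr_ge0//.
  by rewrite -real_normK ?num_real// lerXn2r// nnegrE.
rewrite -ler_pdivrMl ?exprn_gt0 ?bracket2_gt0// mulr1.
exact: bracket2_sqrV_le.
Qed.

End weighted_space.

Section curve_in_weighted.
Context {R : realType}.
Variable w : R -> R * R -> R.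
Hypothesis ww : forall t, in_weighted (w t).
Hypothesis cw : forall t0, wsq (fun p => w t p - w t0 p) @[t --> t0] --> (0 : R).

Lemma dist_pair_le Psi t t0 : in_dual Psi ->
  `|\int[planeleb]_p (w t p * Psi p) - \int[planeleb]_p (w t0 p * Psi p)| <=
  Num.sqrt (wsq (fun p => w t p - w t0 p)) * Num.sqrt (dualsq Psi).
Proof.
move=> dP; have wB := in_weightedB (ww t) (ww t0).
rewrite -RintegralB//; [|exact: rintegrable_dual..].
rewrite -sqrtr_sqr -sqrtrM ?wsq_ge0//; apply: ler_wsqrtr.
apply: le_trans (dual_CauchySchwarz wB dP); rewrite le_eqVlt; apply/orP; left.
by apply/eqP; congr (_ ^+ 2); apply: eq_Rintegral => p _; rewrite mulrBl.
Qed.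

Lemma cvg_sqrt_wsq t0 :
  Num.sqrt (wsq (fun p => w t p - w t0 p)) @[t --> t0] --> (0 : R).
Proof.
rewrite -[X in _ --> X](sqrtr0 R).
by apply: (cvg_comp _ _ (@cw t0)); exact: sqrt_continuous.
Qed.

Lemma continuous_pair Psi : in_dual Psi ->
  continuous (fun t => \int[planeleb]_p (w t p * Psi p)).
Proof.
move=> dP t0; apply/cvgrPdist_le => e e0.
have c : Num.sqrt (wsq (fun p => w t p - w t0 p)) * Num.sqrt (dualsq Psi)
    @[t --> t0] --> (0 : R).
  by rewrite -[X in _ --> X](mul0r (Num.sqrt (dualsq Psi)));
    apply: cvgM; [exact: cvg_sqrt_wsq|exact: cvg_cst].
move/cvgr0Pnorm_le : c => /(_ _ e0); apply: filterS => t h.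
rewrite distrC (le_trans (dist_pair_le _ _ dP))//.
by move: h; rewrite ger0_norm// mulr_ge0// sqrtr_ge0.
Qed.

Section quadratic.
Variables (Psi : R * R -> R) (K : R).
Hypothesis mPsi : measurable_fun [set: plane R] Psi.
Hypothesis PsiK : forall p, `|Psi p| <= K * bracket2 p ^+ 2.

Lemma rintegrable_quad v : in_weighted v ->
  rintegrable planeleb (fun p => v p ^+ 2 * Psi p).
Proof.
move=> [mv iv]; have j := rintegrableZ K iv.
apply: (@le_rintegrable _ _ _ planeleb _ _ _ _ j).
  by apply: measurable_funM => //; exact: measurable_funX.
move=> p; rewrite normrM ger0_norm ?sqr_ge0// exprMn mulrA [leRHS]mulrC.
by rewrite ler_wpM2l ?sqr_ge0.
Qed.

Lemma quad_le v : in_weighted v ->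
  `|\int[planeleb]_p (v p ^+ 2 * Psi p)| <= K * wsq v.
Proof.
move=> hv; have [mv iv] := hv; rewrite /wsq -RintegralZl//.
apply: (@le_norm_Rintegral _ _ _ planeleb) => //.
- exact: rintegrable_measurable (rintegrable_quad hv).
- move=> p; rewrite normrM ger0_norm ?sqr_ge0// exprMn mulrA [leRHS]mulrC.
  by rewrite ler_wpM2l ?sqr_ge0.
- exact: rintegrableZ.
Qed.

(** Factor the difference of squares and apply Cauchy-Schwarz to w t - w t0 and w t + w t0. The
    latter is (w t - w t0) + 2 w t0, whence the coefficient 8 = 2 * 2^2. *)
Lemma dist_quad_le t t0 :
  `|\int[planeleb]_p (w t p ^+ 2 * Psi p) - \int[planeleb]_p (w t0 p ^+ 2 * Psi p)|
  <= K * (Num.sqrt (wsq (fun p => w t p - w t0 p)) *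
      Num.sqrt (2 * wsq (fun p => w t p - w t0 p) + 8 * wsq (w t0))).
Proof.
have K0 : 0 <= K.
  have := le_trans (normr_ge0 _) (PsiK 0).
  by rewrite pmulr_lge0// exprn_gt0// bracket2_gt0.
have wB := in_weightedB (ww t) (ww t0).
have wD := in_weightedD (ww t) (ww t0).
rewrite -RintegralB//; [|exact: rintegrable_quad..].
pose f p := bracket2 p * (w t p - w t0 p).
pose g p := bracket2 p * (w t p + w t0 p).
have [mB iB] := wB; have [mD iD] := wD.
have mf : measurable_fun [set: plane R] f.
  by apply: measurable_funM => //; exact: measurable_bracket2.
have mg : measurable_fun [set: plane R] g.
  by apply: measurable_funM => //; exact: measurable_bracket2.
have mnf : measurable_fun [set: plane R] (fun p => `|f p|).
  exact: measurableT_comp.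
have mng : measurable_fun [set: plane R] (fun p => `|g p|).
  exact: measurableT_comp.
have if2 : rintegrable planeleb (fun p => `|f p| ^+ 2).
  by under eq_fun do rewrite real_normK ?num_real//; exact: iB.
have ig2 : rintegrable planeleb (fun p => `|g p| ^+ 2).
  by under eq_fun do rewrite real_normK ?num_real//; exact: iD.
have ifg := rintegrableM_sqr mnf mng if2 ig2.
have h1 : `|\int[planeleb]_p (w t p ^+ 2 * Psi p - w t0 p ^+ 2 * Psi p)| <=
    \int[planeleb]_p (K * (`|f p| * `|g p|)).
  apply: (@le_norm_Rintegral _ _ _ planeleb).
  - apply: rintegrable_measurable; apply: rintegrableB; exact: rintegrable_quad.
  - move=> p; rewrite -mulrBl subr_sqr normrM mulrC.
    rewrite (_ : K * _ = K * bracket2 p ^+ 2 * `|(w t p - w t0 p) * (w t p + w t0 p)|).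
      by rewrite ler_wpM2r.
    rewrite /f /g !normrM (gtr0_norm (bracket2_gt0 p)); ring.
  - exact: rintegrableZ.
apply: (le_trans h1); rewrite RintegralZl// ler_wpM2l//.
rewrite -sqrtrM ?wsq_ge0//.
have fg0 : 0 <= \int[planeleb]_p (`|f p| * `|g p|).
  by apply: Rintegral_ge0 => p _; rewrite mulr_ge0.
rewrite -(ger0_norm fg0) -sqrtr_sqr; apply: ler_wsqrtr.
apply: le_trans (Rintegral_CauchySchwarz mnf mng if2 ig2) _.
apply: ler_pM.
- by apply: Rintegral_ge0 => p _; exact: sqr_ge0.
- by apply: Rintegral_ge0 => p _; exact: sqr_ge0.
- rewrite /wsq le_eqVlt; apply/orP; left; apply/eqP; apply: eq_Rintegral => p _.
  by rewrite real_normK ?num_real.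
apply: (@le_trans _ _ (2 * wsq (fun p => w t p - w t0 p) +
    2 * wsq (fun p => 2 * w t0 p))).
  have w2 : in_weighted (fun p => 2 * w t0 p).
    have := in_weightedD (ww t0) (ww t0).
    by under eq_fun do rewrite -mulr2n -mulr_natl.
  apply: le_trans (wsqD_le wB w2); rewrite le_eqVlt; apply/orP; left; apply/eqP.
  apply: eq_Rintegral => p _; rewrite real_normK ?num_real// /g.
  by congr ((_ * _) ^+ 2); ring.
rewrite lerD2l (_ : 8 = 2 * 4) -?mulrA; last by rewrite -natrM.
rewrite ler_wpM2l// /wsq -RintegralZl//; last by have [] := ww t0.
rewrite le_eqVlt; apply/orP; left; apply/eqP; apply: eq_Rintegral => p _.
by ring.
Qed.

Lemma continuous_quad : continuous (fun t => \int[planeleb]_p (w t p ^+ 2 * Psi p)).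
Proof.
move=> t0; apply/cvgrPdist_le => e e0.
have c : K * (Num.sqrt (wsq (fun p => w t p - w t0 p)) *
      Num.sqrt (2 * wsq (fun p => w t p - w t0 p) + 8 * wsq (w t0)))
    @[t --> t0] --> (0 : R).
  rewrite -[X in _ --> X](mulr0 K); apply: cvgM; first exact: cvg_cst.
  rewrite -[X in _ --> X](mul0r (Num.sqrt (2 * 0 + 8 * wsq (w t0)))).
  apply: cvgM; first exact: cvg_sqrt_wsq.
  apply: (@cvg_comp _ _ _ _ Num.sqrt _ (nbhs (2 * 0 + 8 * wsq (w t0)))).
    by apply: cvgD; [apply: cvgM; [exact: cvg_cst|exact: cw]|exact: cvg_cst].
  exact: sqrt_continuous.
move/cvgr0Pnorm_le : c => /(_ _ e0); apply: filterS => t h.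
rewrite distrC (le_trans (dist_quad_le _ _))//.
exact: le_trans (ler_norm _) h.
Qed.

End quadratic.

Lemma continuous_wsq : continuous (fun t => wsq (w t)).
Proof.
have := @continuous_quad (fun p => bracket2 p ^+ 2) 1.
under [X in continuous X]eq_fun do under eq_Rintegral do rewrite -exprMn mulrC.
apply; first by apply: measurable_funX; exact: measurable_bracket2.
by move=> p; rewrite mul1r ger0_norm// sqr_ge0.
Qed.

End curve_in_weighted.

(** * Calculus in the time variable *)

Section primitives.
Context {R : realType}.

Lemma continuous_primitive (D : R -> R) (a : R) : continuous D ->
  exists P, forall x : R, a < x -> is_derive x 1 P (D x).
Proof.
move=> cD; exists (fun x => \int[leb]_(t in [set` `[a, x]]) D t) => x ax.
have [//||dP E] := @continuous_FTC1_closed R D a x (x + 1) _ _ ax (cD x).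
- by rewrite ltrDl.
- by apply: continuous_compact_integrable;
    [exact: segment_compact|exact: continuous_subspaceT].
by apply: DeriveDef; [exact: dP|rewrite -derive1E; exact: E].
Qed.

Lemma Rintegral_itv_derive (P D : R -> R) (s t : R) : s < t -> continuous D ->
  (forall x, s <= x <= t -> is_derive x 1 P (D x)) ->
  \int[leb]_(x in `[s, t]) D x = P t - P s.
Proof.
move=> st cD dP.
have cP z : s <= z <= t -> P w @[w --> z] --> P z.
  move=> /dP[dPz _]; exact/differentiable_continuous/derivable1_diffP.
have dP' : derivable_oo_LRcontinuous P s t.
  split; first by move=> z /subset_itv_oo_cc; rewrite in_itv/= => /dP[].
    by apply: cvg_at_right_filter; apply: cP; rewrite lexx ltW.
  by apply: cvg_at_left_filter; apply: cP; rewrite lexx ltW.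
have DP : {in `]s, t[, D1 P =1 D}.
  by move=> z /subset_itv_oo_cc; rewrite in_itv/= => /dP[_ E]; rewrite derive1E.
by rewrite /Rintegral (continuous_FTC2 st (continuous_subspaceT cD) dP' DP).
Qed.

Lemma derive_bound_lipschitz (F D : R -> R) (T d : R) :
  {within `[0, T], continuous F} ->
  (forall x, 0 < x < T -> is_derive x 1 F (D x)) ->
  (forall x, 0 < x < T -> `|D x| <= d) ->
  forall s t, 0 <= s <= T -> 0 <= t <= T -> `|F t - F s| <= d * `|t - s|.
Proof.
move=> cF dF Dd s t; wlog : s t / s <= t => [h|].
  have [st|/ltW ts] := leP s t; first exact: h.
  by move=> sT tT; rewrite distrC [`|t - s|]distrC; exact: h.
rewrite le_eqVlt => /predU1P[-> _ _|st /andP[s0 sT] /andP[t0 tT]].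
  by rewrite !subrr normr0 mulr0.
have sub : `[s, t] `<=` `[0, T].
  by move=> x /=; rewrite !in_itv/= => /andP[sx xt]; rewrite (le_trans s0)// (le_trans xt).
have [x|c c01 ->] := @MVT R F D s t st _ (continuous_subspaceW sub cF).
  rewrite in_itv/= => /andP[sx xt]; apply: dF.
  by rewrite (le_lt_trans s0 sx) (lt_le_trans xt).
rewrite normrM ler_wpM2r// Dd//; move: c01; rewrite in_itv/= => /andP[sc ct].
by rewrite (le_lt_trans s0 sc) (lt_le_trans ct).
Qed.

(** The rescaled derivative of the step is an approximate identity supported in [s, s + 1 / kap n].
    The offset [k] makes this interval as short as wanted from the first index on. *)
Lemma cvg_mollified (S F : R -> R) (B s : R) (k : nat) : smooth1 S ->
  testfun (D1 S) -> (forall x, x <= 0 -> S x = 0) ->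
  (forall x, 1 <= x -> S x = 1) -> continuous F -> (forall x, `|F x| <= B) ->
  let kap n : R := (n + k).+1%:R in
  (forall n, rintegrable leb
    (fun t => kap n * D1 S (kap n * t - kap n * s) * F t)) /\
  \int[leb]_t (kap n * D1 S (kap n * t - kap n * s) * F t) @[n --> \oo] --> F s.
Proof.
move=> sS tS S0 S1 cF FB kap.
have kap0 n : 0 < kap n by rewrite ltr0n.
have kapn0 n : kap n != 0 by rewrite gt_eqF.
have mF : measurable_fun [set: R] F by exact: continuous_measurable_fun.
pose G n x := D1 S x * F (x / kap n + s).
have mG n : measurable_fun [set: R] (G n).
  apply: measurable_funM; first exact: testfun_measurable.
  under eq_fun do rewrite mulrC.
  exact: (measurable_affine (kap n)^-1 s mF).
have jB : rintegrable leb (fun x => `|D1 S x| * B).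
  by apply: rintegrableZr; apply: rintegrable_norm; exact: testfun_rintegrable.
have GB n x : `|G n x| <= `|D1 S x| * B by rewrite normrM ler_wpM2l.
have jG n : rintegrable leb (G n) by exact: (@le_rintegrable _ _ _ leb _ _ (mG n) (GB n) jB).
have E n : (fun t => kap n * D1 S (kap n * t - kap n * s) * F t) =
    (fun t => kap n * G n (kap n * t - kap n * s)).
  apply/funext => t; rewrite /G -mulrA; congr (_ * (_ * F _)).
  by move: (kap n) (kapn0 n) => q q0; field.
split=> [n|].
  by rewrite E; apply: rintegrableZ; exact: (rintegrable_affine _ (kapn0 n) (jG n)).
rewrite (_ : (fun n => _) = (fun n => \int[leb]_x G n x)); last first.
  apply/funext => n; rewrite E RintegralZl//.
    rewrite (Rintegral_affine _ (kapn0 n) (jG n)) gtr0_norm// mulrCA divff ?mulr1//.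
  exact: (rintegrable_affine _ (kapn0 n) (jG n)).
have -> : F s = \int[leb]_x (D1 S x * F s).
  rewrite RintegralZr//; last exact: testfun_rintegrable.
  rewrite (@Rintegral_derive1 _ S 0 1)// ?(S0 0 (lexx 0)) ?(S1 1 (lexx 1)) ?subr0 ?mul1r//.
  move=> x; rewrite negb_and -!ltNge => x01.
  rewrite derive1E; suff : is_derive x 1 S 0 by move=> /@derive_val.
  case/orP : x01 => x01.
    apply: (near_eq_is_derive _ (is_derive1_cst 0 x)).
    by near=> z; rewrite S0// ltW//; near: z; exact: lt_nbhsl.
  apply: (near_eq_is_derive _ (is_derive1_cst 1 x)).
  by near=> z; rewrite S1// ltW//; near: z; exact: lt_nbhsr.
apply: (@cvg_Rintegral _ _ _ leb _ _ _ mG _ GB jB) => x.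
apply: cvgM; first exact: cvg_cst.
have c : x / kap n + s @[n --> \oo] --> s.
  rewrite -[X in _ --> X]add0r; apply: cvgD; last exact: cvg_cst.
  rewrite -[X in _ --> X](mulr0 x); apply: cvgM; first exact: cvg_cst.
  by have := @cvg_harmonic R; rewrite -(cvg_shiftn k).
exact: (cvg_comp _ _ c (@cF s)).
Unshelve. all: by end_near. Qed.

End primitives.

Section clamping.
Context {R : realType}.
Variable T : R.
Hypothesis T0 : 0 < T.

(** Freezing the curve outside [0, T] extends it to all real times, so that continuity and bounds in
    time need no relative neighbourhoods. *)
Definition clamp (t : R) : R := Num.max 0 (Num.min t T).

Lemma clamp_itv t : 0 <= clamp t <= T.
Proof. by rewrite /clamp le_max lexx/= ge_max (ltW T0) ge_min lexx orbT. Qed.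

Lemma clamp_id t : 0 <= t <= T -> clamp t = t.
Proof. by move=> /andP[t0 tT]; rewrite /clamp (min_idPl tT) (max_idPr t0). Qed.

Lemma continuous_clamp : continuous clamp.
Proof.
move=> t; apply: (@continuous_max _ _ (fun=> 0) (fun t => Num.min t T)).
  exact: cst_continuous.
apply: (@continuous_min _ _ id (fun=> T)); first exact: cvg_id.
exact: cst_continuous.
Qed.

Lemma clamp_bounded (F : R -> R) : continuous F ->
  exists2 B : R, 0 <= B & forall t, `|F (clamp t)| <= B.
Proof.
move=> cF; have cn : {within `[0, T], continuous (fun t => `|F t|)}.
  by apply: continuous_subspaceT => t; apply: cvg_norm; exact: cF.
have [c _ h] := EVT_max (ltW T0) cn.
by exists `|F c| => // t; apply: h; rewrite in_itv/= clamp_itv.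
Qed.

End clamping.

(** * Evolution of moments *)

Section evolution.
Context {R : realType}.
Variables (T : R) (u : R -> R * R -> R).
Hypotheses (T0 : 0 < T) (hu : continuous_in_Z T 4 2 u).

Definition uc (t : R) : R * R -> R := u (clamp T t).

Lemma uc_id t : 0 <= t <= T -> uc t = u t.
Proof. by move=> tT; rewrite /uc clamp_id. Qed.

Lemma uc_in_weighted t : in_weighted (uc t).
Proof.
have [|[_ hw] _] := hu (t0 := clamp T t); first by rewrite in_itv/= clamp_itv.
exact: weighted_L2_2P.
Qed.

Lemma uc_cvg t0 : wsq (fun p => uc t p - uc t0 p) @[t --> t0] --> (0 : R).
Proof.
have [|_ hc] := hu (t0 := clamp T t0); first by rewrite in_itv/= clamp_itv.
have c : Z_norm2 4 2 (fun p => uc t p - uc t0 p) @[t --> t0] --> 0%E.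
  have cc : clamp T s @[s --> t0] --> within `[0, T] (nbhs (clamp T t0)).
    move=> A hA; have : \forall s \near t0, [set` `[0, T]] (clamp T s) -> A (clamp T s).
      exact: (@continuous_clamp _ T t0 _ hA).
    by apply: filterS => s; apply; rewrite /= in_itv/= clamp_itv.
  exact: (cvg_comp _ _ cc hc).
suff : (wsq (fun p => uc t p - uc t0 p))%:E @[t --> t0] --> (0 : R)%:E.
  by move=> /fine_cvg.
apply: (squeeze_cvge _ (cvg_cst 0%E) c).
apply: nearW => t; rewrite lee_fin wsq_ge0/=.
rewrite -weighted_norm2_wsq; last exact: in_weightedB (uc_in_weighted _) (uc_in_weighted _).
by rewrite /Z_norm2 leeDr// integral_ge0// => k _; rewrite lee_fin mulr_ge0 ?powR_ge0// sqr_ge0.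
Qed.

Implicit Types a b th : R -> R.

Definition tens (a b : R -> R) (p : R * R) : R := a p.1 * b p.2.

Lemma measurable_tens a b : measurable_fun [set: R] a ->
  measurable_fun [set: R] b -> measurable_fun [set: plane R] (tens a b).
Proof.
by move=> ma mb; apply: measurable_funM;
  [exact: measurable_fst_comp|exact: measurable_snd_comp].
Qed.

Lemma in_dual_tens a b (A B : R) : measurable_fun [set: R] a ->
  measurable_fun [set: R] b -> (forall x, `|a x| <= A) ->
  (forall x, `|b x| <= B) -> in_dual (tens a b).
Proof.
move=> ma mb aA bB; apply: (in_dual_bounded (C := A * B)).
  exact: measurable_tens.
by move=> p; rewrite normrM ler_pM.
Qed.

Lemma testfun_dual a b : testfun a -> testfun b -> in_dual (tens a b).
Proof.
move=> ta tb; have [A _ hA] := testfun_bounded ta.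
have [B _ hB] := testfun_bounded tb.
exact: (in_dual_tens (testfun_measurable ta) (testfun_measurable tb) hA hB).
Qed.

Lemma hilb_dual a b : testfun a -> testfun b -> in_dual (tens (hilb a) b).
Proof.
move=> ta tb; have [A _ hA] := testfun_hilb_bounded ta.
have [B _ hB] := testfun_bounded tb.
exact: (in_dual_tens (testfun_measurable_hilb ta) (testfun_measurable tb) hA hB).
Qed.

Lemma testfun_quad a b : testfun a -> testfun b ->
  exists K, forall p, `|tens a b p| <= K * bracket2 p ^+ 2.
Proof.
move=> ta tb; have [A A0 hA] := testfun_bounded ta.
have [B B0 hB] := testfun_bounded tb.
exists (A * B) => p; rewrite -[leLHS]mulr1 ler_pM//.
  by rewrite normrM ler_pM.
by rewrite exprn_ege1// bracket2_ge1.
Qed.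

(** Freezing time by [clamp] is invisible here, as [th] vanishes outside [0, T]. *)
Lemma pairing_tensor (v : R -> R * R -> R) th a b :
  (forall t, 0 <= t <= T -> rintegrable planeleb (fun p => v t p * tens a b p)) ->
  (forall t, ~~ (0 <= t <= T) -> th t = 0) ->
  pairing T v (tensor th a b) =
  \int[leb]_t (th t * \int[planeleb]_p (v (clamp T t) p * tens a b p)).
Proof.
move=> iv th0; rewrite /pairing Rintegral_mkcond; apply: eq_Rintegral => t _.
rewrite patchE; case: ifPn => [|/negP]; rewrite inE/= in_itv/=.
  move=> tT; rewrite clamp_id// -RintegralZl//; last exact: iv.
  by apply: eq_Rintegral => p _; rewrite /tensor /tens/= mulrCA.
by move=> /negP/th0 ->; rewrite mul0r.
Qed.

Hypothesis hsol : weak_solution T u.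

(** The time derivative that the equation prescribes for the moment of a(x) b(y). Once transposed
    onto the test function, all three terms carry a plus sign. *)
Definition flux a b t : R :=
  \int[planeleb]_p (uc t p * tens (hilb (D1 (D1 a))) b p) +
  \int[planeleb]_p (uc t p * tens (D1 a) (D1 (D1 b)) p) +
  2^-1 * \int[planeleb]_p (uc t p ^+ 2 * tens (D1 a) b p).

Section fixed_test_function.
Variables a b : R -> R.
Hypotheses (ta : testfun a) (tb : testfun b).

Let F t := \int[planeleb]_p (uc t p * tens a b p).
Let F1 t := \int[planeleb]_p (uc t p * tens (hilb (D1 (D1 a))) b p).
Let F2 t := \int[planeleb]_p (uc t p * tens (D1 a) (D1 (D1 b)) p).
Let F3 t := \int[planeleb]_p (uc t p ^+ 2 * tens (D1 a) b p).

Let tda := testfun_derive ta.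
Let tdda := testfun_derive tda.
Let tddb := testfun_derive (testfun_derive tb).

Lemma continuous_moment : continuous F.
Proof. exact: (continuous_pair uc_in_weighted uc_cvg (testfun_dual ta tb)). Qed.

Let cF1 : continuous F1.
Proof. exact: (continuous_pair uc_in_weighted uc_cvg (hilb_dual tdda tb)). Qed.

Let cF2 : continuous F2.
Proof. exact: (continuous_pair uc_in_weighted uc_cvg (testfun_dual tda tddb)). Qed.

Let cF3 : continuous F3.
Proof.
have [K hK] := testfun_quad tda tb.
exact: (continuous_quad uc_in_weighted uc_cvg
  (measurable_tens (testfun_measurable tda) (testfun_measurable tb)) hK).
Qed.

Lemma continuous_flux : continuous (flux a b).
Proof.
move=> t; apply: cvgD; first by apply: cvgD; [exact: cF1|exact: cF2].
by apply: cvgM; [exact: cvg_cst|exact: cF3].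
Qed.

Let uc_clamp t : uc (clamp T t) = uc t.
Proof. by rewrite /uc clamp_id// clamp_itv. Qed.

Let bounded_uc (G : R -> R) : continuous G -> (forall t, G (clamp T t) = G t) ->
  exists2 B : R, 0 <= B & forall t, `|G t| <= B.
Proof.
by move=> cG GE; have [B B0 h] := clamp_bounded T0 cG; exists B => // t; rewrite -GE.
Qed.

Lemma weak_form th s t : 0 < s -> t < T -> smooth1 th ->
  (forall z, ~~ (s <= z <= t) -> th z = 0) ->
  \int[leb]_t (D1 th t * F t) = - \int[leb]_t (th t * flux a b t).
Proof.
move=> s0 tT sth th0.
have aux (x0 x1 x2 x3 : R) :
  - x0 - x1 - x2 - 2^-1 * x3 = 0 -> x0 = - (x1 + x2 + 2^-1 * x3) by lra.
have sdth := smooth1_derive sth.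
have [sa _] := ta; have [sb _] := tb.
have th0' z : ~~ (0 <= z <= T) -> th z = 0.
  move=> hz; apply: th0; apply: contra hz => /andP[sz zt].
  by rewrite (le_trans (ltW s0) sz) (le_trans zt (ltW tT)).
have tth : testfun th.
  split => //; exists T => z zT; apply: th0'; apply: contraL zT.
  by move=> /andP[z0 zT]; rewrite -leNgt ger0_norm.
have dth0 z : ~~ (0 <= z <= T) -> D1 th z = 0.
  rewrite negb_and -!ltNge => hz; rewrite derive1E.
  suff : is_derive z 1 th 0 by move=> /@derive_val.
  apply: (near_eq_is_derive _ (is_derive1_cst 0 z)).
  case/orP : hz => hz; near=> y; rewrite th0'// negb_and -!ltNge; apply/orP.
    by left; near: y; exact: lt_nbhsl.
  by right; near: y; exact: lt_nbhsr.
have := hsol (test_function_tensor s0 tT sth th0 ta tb).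
rewrite dt_tensor// !dx_tensor//; last exact: smooth1_derive.
rewrite !dy_tensor//; last exact: smooth1_derive.
rewrite dx_tensor//; last by do 2 apply: smooth1_derive.
have -> : hilbert (tensor th (D1 (D1 a)) b) = tensor th (hilb (D1 (D1 a))) b.
  by apply/funext => -[r [x y]]; rewrite (hilbert_prod _ _ _ _ _ tdda).
have iu t' c e : 0 <= t' <= T -> in_dual (tens c e) ->
    rintegrable planeleb (fun p => u t' p * tens c e p).
  by move=> t'T; rewrite -(uc_id t'T); apply: rintegrable_dual; exact: uc_in_weighted.
rewrite (@pairing_tensor u (D1 th) a b) => [|r rT|//]; last exact: iu (testfun_dual ta tb).
rewrite (@pairing_tensor u th (hilb (D1 (D1 a))) b) => [|r rT|//]; last exact: iu (hilb_dual tdda tb).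
rewrite (@pairing_tensor u th (D1 a) (D1 (D1 b))) => [|r rT|//]; last exact: iu (testfun_dual tda tddb).
rewrite pairing_tensor => [|r rT|//]; last first.
  have [K hK] := testfun_quad tda tb; rewrite -(uc_id rT).
  exact: (rintegrable_quad (measurable_tens (testfun_measurable tda)
    (testfun_measurable tb)) hK (uc_in_weighted _)).
have mth : measurable_fun [set: R] th by exact: smooth1_measurable.
have ith (G : R -> R) : continuous G -> (forall t, G (clamp T t) = G t) ->
    rintegrable leb (fun t => th t * G t).
  move=> cG GE; have [B B0 hB] := bounded_uc cG GE.
  have j := rintegrableZr B (rintegrable_norm (testfun_rintegrable tth)).
  apply: (@le_rintegrable _ _ _ leb _ _ _ _ j).
    by apply: measurable_funM => //; exact: continuous_measurable_fun.
  by move=> z; rewrite normrM ler_wpM2l.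
have j1 : rintegrable leb (fun t => th t * F1 t).
  by apply: ith => // r; rewrite /F1 uc_clamp.
have j2 : rintegrable leb (fun t => th t * F2 t).
  by apply: ith => // r; rewrite /F2 uc_clamp.
have j3 : rintegrable leb (fun t => th t * F3 t).
  by apply: ith => // r; rewrite /F3 uc_clamp.
have -> : \int[leb]_t (th t * flux a b t) = \int[leb]_t (th t * F1 t) +
    \int[leb]_t (th t * F2 t) + 2^-1 * \int[leb]_t (th t * F3 t).
  have i12 := rintegrableD j1 j2; have i3 := rintegrableZ 2^-1 j3.
  rewrite -RintegralZl// -RintegralD// -RintegralD//.
  by apply: eq_Rintegral => r _; rewrite /flux -/(F1 r) -/(F2 r) -/(F3 r); ring.
rewrite -/(F _).
rewrite -[\int[leb]_t (D1 th t * \int[planeleb]_p _)]/(\int[leb]_t (D1 th t * F t)).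
rewrite -[\int[leb]_t (th t * \int[planeleb]_p (u _ p * tens (hilb _) b p))]/(\int[leb]_t (th t * F1 t)).
rewrite -[\int[leb]_t (th t * \int[planeleb]_p (u _ p * tens (D1 a) _ p))]/(\int[leb]_t (th t * F2 t)).
rewrite -[\int[leb]_t (th t * \int[planeleb]_p (u _ p ^+ 2 * _))]/(\int[leb]_t (th t * F3 t)).
exact: aux.
Unshelve. all: by end_near. Qed.

End fixed_test_function.
End evolution.

Section evolution_derivative.
Context {R : realType}.
Variables (T : R) (u : R -> R * R -> R).
Hypotheses (T0 : 0 < T) (hu : continuous_in_Z T 4 2 u).
Hypothesis hsol : weak_solution T u.
Variables a b : R -> R.
Hypotheses (ta : testfun a) (tb : testfun b).

Let F t := \int[planeleb]_p (uc T u t p * tens a b p).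
Let D := flux T u a b.

Let uc_clamp t : uc T u (clamp T t) = uc T u t.
Proof. by rewrite /uc clamp_id// clamp_itv. Qed.

Lemma smooth_step_bounds (S : R -> R) : smooth1 S -> (forall x, 0 <= D1 S x) ->
  (forall x, x <= 0 -> S x = 0) -> (forall x, 1 <= x -> S x = 1) ->
  forall x, 0 <= S x <= 1.
Proof.
move=> sS dS S0 S1 x; apply/andP; split.
  have [c] := smooth1_MVT x (Num.min x 0) sS.
  rewrite (S0 (Num.min x 0)) ?ge_min ?lexx ?orbT// subr0 => ->.
  by rewrite mulr_ge0// subr_ge0 ge_min lexx.
have [c] := smooth1_MVT (Num.max x 1) x sS.
rewrite (S1 (Num.max x 1)) ?le_max ?lexx ?orbT// => E.
by rewrite -subr_ge0 E mulr_ge0// subr_ge0 le_max lexx.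
Qed.

Lemma near_harmonic_le (e : R) (k : nat) : 0 < e ->
  \forall n \near \oo, (n + k).+1%:R^-1 <= e.
Proof.
move=> e0; have : (n + k).+1%:R^-1 @[n --> \oo] --> (0 : R).
  by have := @cvg_harmonic R; rewrite -(cvg_shiftn k).
move=> /cvgr0Pnorm_le /(_ _ e0); apply: filterS => n; exact: le_trans (ler_norm _).
Qed.

(** Test in time with the difference of two smoothed steps, at [s] and at [t]: it tends to the
    indicator of ]s, t], and its derivative to the difference of two Dirac masses. *)
Lemma moment_diff (s t : R) : 0 < s -> s < t -> t < T ->
  F t - F s = \int[leb]_(x in `[s, t]) D x.
Proof.
move=> s0 st tT.
have [S [sS tS dS S0 S1]] := @smooth_step R.
have SB := smooth_step_bounds sS dS S0 S1.
have cF : continuous F := continuous_moment T0 hu ta tb.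
have cD : continuous D := continuous_flux T0 hu ta tb.
have [B B0 hB'] := clamp_bounded T0 cF.
have hB x : `|F x| <= B by have := hB' x; rewrite /F uc_clamp.
have [E E0 hE'] := clamp_bounded T0 cD.
have hE x : `|D x| <= E by have := hE' x; rewrite /D /flux !uc_clamp.
(* Room between [t] and [T]: the later step is spread over [t, t + 1 / kap n], which must stay
   inside the open time interval. *)
have [k hk] : exists k : nat, t + (k.+1%:R)^-1 < T.
  have Tt : 0 < T - t by rewrite subr_gt0.
  have [k] := ltr_add_invr (y := t) (x := T) tT.
  by exists k.
have [is_ cs] := cvg_mollified s k sS tS S0 S1 cF hB.
have [it_ ct] := cvg_mollified t k sS tS S0 S1 cF hB.
pose kap n : R := (n + k).+1%:R.
have kap0 n : 0 < kap n by rewrite ltr0n.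
have kapV n : (kap n)^-1 <= k.+1%:R^-1.
  by rewrite lef_pV2 ?posrE ?ltr0n// ler_nat ltnS leq_addl.
pose th n x := S (kap n * x + - (kap n * s)) + -1 * S (kap n * x + - (kap n * t)).
have sth n : smooth1 (th n).
  by apply: smooth1D; [|apply: smooth1Z]; exact: smooth1_affine.
have dth n : D1 (th n) = fun x => kap n * D1 S (kap n * x - kap n * s) +
    -1 * (kap n * D1 S (kap n * x - kap n * t)).
  rewrite derive1D; [|exact: smooth1_affine|by apply: smooth1Z; exact: smooth1_affine].
  by rewrite derive1Z ?derive1_affine//; exact: smooth1_affine.
have th0 n z : ~~ (s <= z <= t + k.+1%:R^-1) -> th n z = 0.
  rewrite negb_and -!ltNge => /orP[zs|zt]; rewrite /th -!mulrBr.
    rewrite !S0 ?mulr0 ?addr0//; rewrite mulr_ge0_le0 ?(ltW (kap0 n))// subr_le0 ltW//.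
    exact: lt_trans zs st.
  have zt' : (kap n)^-1 <= z - t by rewrite (le_trans (kapV n))// lerBrDl ltW.
  have h1 : 1 <= kap n * (z - t) by rewrite mulrC -ler_pdivrMr// mul1r.
  rewrite !S1 ?mulr1 ?subrr// (le_trans h1)// ler_pM2l// lerB// ltW//.
have WF n := weak_form T0 hu hsol ta tb s0 hk (sth n) (th0 n).
have cl : (\int[leb]_t (D1 (th n) t * F t)) @[n --> \oo] --> F s - F t.
  rewrite (_ : (fun n => _) = fun n =>
    \int[leb]_x (kap n * D1 S (kap n * x - kap n * s) * F x) -
    \int[leb]_x (kap n * D1 S (kap n * x - kap n * t) * F x)).
    by apply: cvgB.
  apply/funext => n; rewrite -(RintegralB measurableT (is_ n) (it_ n)).
  by apply: eq_Rintegral => x _; rewrite dth; ring.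
pose K := [set` `]s, t]].
have cr : (- \int[leb]_x (th n x * D x)) @[n --> \oo] -->
    - \int[leb]_x ((D \_ K) x).
  apply: cvgN.
  have jE : rintegrable leb (fun x => b2r (`|s - x| <= T) * E).
    by apply: rintegrableZr; exact: rintegrable_near.
  apply: (@cvg_Rintegral _ _ _ leb _ _ _ _ _ _ jE).
  - by move=> m; apply: measurable_funM; [exact: smooth1_measurable|exact: continuous_measurable_fun].
  (* Both steps are 0 up to and including their base points, so at each [x] the sequence is
     eventually constant, with the indicator open at [s] and closed at [t] as limit. *)
  - move=> x; rewrite patchE; case: ifPn => xK; last first.
      have [xs|sx] := leP x s.
        apply: cvg_near_cst; apply: nearW => m.
        suff -> : th m x = 0 by rewrite mul0r.
        have xt : x <= t by rewrite (le_trans xs)// ltW.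
        rewrite /th -!mulrBr.
        by rewrite !S0 ?mulr0 ?addr0// mulr_ge0_le0 ?(ltW (kap0 m))// subr_le0.
      have tx : 0 < x - t.
        rewrite subr_gt0 ltNge; apply: contra xK => xt; rewrite inE /K/= in_itv/=.
        by rewrite sx.
      apply: cvg_near_cst; apply: filterS (near_harmonic_le k tx) => m hm.
      suff -> : th m x = 0 by rewrite mul0r.
      have h1 : 1 <= kap m * (x - t) by rewrite mulrC -ler_pdivrMr// mul1r.
      rewrite /th -!mulrBr !S1 ?mulr1 ?subrr// (le_trans h1)// ler_pM2l// lerB//.
      exact: ltW.
    move: xK; rewrite inE /K/= in_itv/= => /andP[sx xt].
    rewrite -subr_gt0 in sx.
    apply: cvg_near_cst; apply: filterS (near_harmonic_le k sx) => m hm.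
    rewrite /th -!mulrBr.
    rewrite (S0 (_ * (x - t))); last by rewrite mulr_ge0_le0 ?(ltW (kap0 m))// subr_le0.
    by rewrite S1 ?mulr0 ?addr0 ?mul1r// mulrC -ler_pdivrMr// mul1r.
  - move=> m x; have [hx|/th0 ->] := boolP (s <= x <= t + k.+1%:R^-1); last first.
      by rewrite mul0r normr0 mulr_ge0// /b2r; case: ifP.
    rewrite /b2r ifT; last first.
      move: hx hk; set q := _^-1 => /andP[h1 h2] hq.
      by rewrite ler_norml; apply/andP; split; lra.
    rewrite normrM ler_pM// /th mulN1r.
    have /andP[a0 a1] := SB (kap m * x + - (kap m * s)).
    have /andP[c0 c1] := SB (kap m * x + - (kap m * t)).
    by rewrite ler_norml; apply/andP; split; lra.
have E1 : F s - F t = - \int[leb]_x ((D \_ K) x).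
  apply: (cvg_unique _ cl); first exact: Rhausdorff.
  by rewrite (_ : (fun n => _) = (fun n => - \int[leb]_x (th n x * D x)))//;
    apply/funext => n; exact: WF.
rewrite -[LHS]opprB E1 opprK -Rintegral_mkcond.
apply: Rintegral_itv_obnd_cbnd.
have := continuous_compact_integrable (@segment_compact _ s t) (continuous_subspaceT cD).
by apply: integrableS => //; exact: subset_itv_oc_cc.
Qed.

(** On ]0, T[ the moment differs by a constant from a primitive of the flux, which is continuous. *)
Lemma moment_derive t : 0 < t < T -> is_derive t 1 F (D t).
Proof.
move=> /andP[t0 tT].
have cD : continuous D := continuous_flux T0 hu ta tb.
have [P hP] := continuous_primitive 0 cD.
have E s r : 0 < s -> s < r -> r < T -> F r - F s = P r - P s.
  move=> s0 sr rT; rewrite moment_diff//; apply: Rintegral_itv_derive => // x /andP[sx _].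
  by apply: hP; rewrite (lt_le_trans s0).
have EP : \forall s \near t, P s + (F t - P t) = F s.
  near=> s; have s0 : 0 < s by near: s; exact: lt_nbhsr.
  have sT : s < T by near: s; exact: lt_nbhsl.
  have [st|ts|->] := ltgtP s t; last by ring.
    by have := E s t s0 st tT; lra.
  by have := E t s t0 ts sT; lra.
apply: (near_eq_is_derive EP); rewrite -[D t]addr0.
by have h := hP t t0; apply: is_deriveD.
Unshelve. all: by end_near. Qed.

End evolution_derivative.

(** * Convergence uniform in time *)

Section vanishing.
Context {R : realType}.

(** Uniform convergence to 0 over all times, with the rate exposed so that rates from different
    terms can be added. *)
Definition vanish (f : nat -> R -> R) :=
  exists2 d : nat -> R, d n @[n --> \oo] --> 0 & forall n t, `|f n t| <= d n.

Lemma eq_vanish f g : (forall n t, g n t = f n t) -> vanish f -> vanish g.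
Proof. by move=> gf [d d0 fd]; exists d => // n t; rewrite gf. Qed.

Lemma vanishD f g : vanish f -> vanish g -> vanish (fun n t => f n t + g n t).
Proof.
move=> [d d0 fd] [e e0 ge]; exists (fun n => d n + e n).
  by rewrite -[X in _ --> X](addr0 0); exact: cvgD.
by move=> n t; rewrite (le_trans (ler_normD _ _))// lerD.
Qed.

Lemma vanishZ c f : vanish f -> vanish (fun n t => c * f n t).
Proof.
move=> [d d0 fd]; exists (fun n => `|c| * d n).
  by rewrite -[X in _ --> X](mulr0 `|c|); apply: cvgM => //; exact: cvg_cst.
by move=> n t; rewrite normrM ler_wpM2l.
Qed.

Definition scale_inv (n : nat) : R := n.+1%:R^-1.

Lemma scale_inv_gt0 n : 0 < scale_inv n. Proof. by rewrite invr_gt0 ltr0n. Qed.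

Lemma scale_inv_neq0 n : scale_inv n != 0.
Proof. by rewrite gt_eqF// scale_inv_gt0. Qed.

Lemma cvg_scale_inv : scale_inv n @[n --> \oo] --> 0.
Proof. exact: cvg_harmonic. Qed.

Lemma vanish_scale_inv (f : nat -> R -> R) (C : R) :
  (forall n t, `|f n t| <= C * scale_inv n) -> vanish f.
Proof.
move=> h; exists (fun n => C * scale_inv n) => //.
rewrite -[X in _ --> X](mulr0 C); apply: cvgM; first exact: cvg_cst.
exact: cvg_scale_inv.
Qed.

(** By the mean value theorem the increments of [F_ n - P] are at most [T] times the rate at which
    the derivatives approach each other; the endpoints 0 and [T] are reached by continuity. This is
    how every limit n to infinity in the evolution equations is taken. *)
Lemma vanish_limit_evolution T (F_ D_ : nat -> R -> R) (P L : R -> R) : 0 < T ->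
  (forall n, continuous (F_ n)) -> {within `[0, T], continuous P} ->
  (forall n t, 0 < t < T -> is_derive t 1 (F_ n) (D_ n t)) ->
  (forall t, 0 < t < T -> is_derive t 1 P (L t)) ->
  vanish (fun n t => D_ n t - L t) ->
  exists2 d : nat -> R, d n @[n --> \oo] --> 0 &
    forall n s t, 0 <= s <= T -> 0 <= t <= T ->
    `|(F_ n t - P t) - (F_ n s - P s)| <= d n.
Proof.
move=> T0 cF cP dF dP [d d0 hd]; exists (fun n => d n * T).
  by rewrite -[X in _ --> X](mul0r T); apply: cvgM => //; exact: cvg_cst.
move=> n s t sT tT.
have dn0 : 0 <= d n by exact: le_trans (hd n 0).
apply: (@le_trans _ _ (d n * `|t - s|)); last first.
  rewrite ler_wpM2l// ler_norml; move: sT tT => /andP[? ?] /andP[? ?].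
  by apply/andP; split; lra.
apply: (@derive_bound_lipschitz _ (fun t => F_ n t - P t)
  (fun t => D_ n t - L t) T) => //.
- move=> x; apply: cvgB; last exact: cP.
  exact: (continuous_subspaceT (@cF n)).
- by move=> x xT; have h1 := dF n x xT; have h2 := dP x xT; exact: is_deriveB.
Qed.

End vanishing.

Section dual_decay.
Context {R : realType}.

(** [K] depends on [b] alone, so that one majorant serves a whole sequence of factors of the same
    linear growth. *)
Lemma testfun_dom (b : R -> R) : testfun b -> exists2 K : R, 0 <= K &
  forall (c : R -> R) (C : R), (forall x, `|c x| <= C * (1 + `|x|)) ->
  forall p, tens c b p ^+ 2 <= K * C ^+ 2 * (bracket2 p ^+ 2 * lorentz2 p).
Proof.
move=> tb; have [B B0 hB] := testfun_lorentz tb.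
exists (2 * B ^+ 2) => [|c C cC [x y]]; first by rewrite mulr_ge0// sqr_ge0.
rewrite /tens/= exprMn.
have c2 : c x ^+ 2 <= C ^+ 2 * (2 * (1 + x ^+ 2)).
  have C0 : 0 <= C * (1 + `|x|) by exact: le_trans (cC x).
  have : `|c x| ^+ 2 <= (C * (1 + `|x|)) ^+ 2 by rewrite lerXn2r// nnegrE.
  rewrite real_normK ?num_real// exprMn => /le_trans; apply.
  rewrite ler_wpM2l ?sqr_ge0//.
  have -> : x ^+ 2 = `|x| ^+ 2 by rewrite real_normK// num_real.
  have := sqr_ge0 (`|x| - 1); nra.
have l0 := lorentz_gt0 y.
have b2 : b y ^+ 2 <= B ^+ 2 * lorentz y.
  have : `|b y| ^+ 2 <= (B * lorentz y) ^+ 2.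
    by rewrite lerXn2r// nnegrE// mulr_ge0// ltW.
  rewrite real_normK ?num_real// exprMn => /le_trans; apply.
  rewrite ler_wpM2l ?sqr_ge0// expr2 ler_piMl ?(ltW l0)//.
  by rewrite /lorentz invf_le1 ?onesqr_gt0// lerDl sqr_ge0.
apply: (le_trans (ler_pM (sqr_ge0 _) (sqr_ge0 _) c2 b2)).
have key : (1 + x ^+ 2) * lorentz y <= bracket2 (x, y) ^+ 2 * lorentz2 (x, y).
  rewrite /lorentz2 mulrA ler_wpM2r ?(ltW l0)//= /lorentz ler_pdivlMr ?onesqr_gt0//.
  rewrite /bracket2/= -expr2.
  have h1 : 0 <= 1 + x ^+ 2 by rewrite ltW// onesqr_gt0.
  have h2 : 1 + x ^+ 2 <= 1 + x ^+ 2 + y ^+ 2 by rewrite lerDl sqr_ge0.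
  have h3 := le_trans h1 h2.
  by rewrite lerXn2r// nnegrE.
rewrite (_ : C ^+ 2 * (2 * (1 + x ^+ 2)) * (B ^+ 2 * lorentz y) =
  2 * B ^+ 2 * C ^+ 2 * ((1 + x ^+ 2) * lorentz y)); last by ring.
by rewrite ler_wpM2l// mulr_ge0 ?sqr_ge0// mulr_ge0// sqr_ge0.
Qed.

Lemma dualsq_cvg0 (Psi_ : nat -> R * R -> R) (C : R) :
  (forall n, measurable_fun [set: plane R] (Psi_ n)) ->
  (forall n p, Psi_ n p ^+ 2 <= C * (bracket2 p ^+ 2 * lorentz2 p)) ->
  (forall p, Psi_ n p @[n --> \oo] --> 0) ->
  dualsq (Psi_ n) @[n --> \oo] --> 0.
Proof.
move=> mP PC P0; have j := rintegrableZ C (@rintegrable_lorentz2 R).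
have -> : (0 : R) = \int[planeleb]_p (cst 0 (p : R * R)).
  by rewrite /cst Rintegral_cst// mul0r.
apply: (@cvg_Rintegral _ _ _ planeleb _ _ _ _ _ _ j).
- by move=> n; apply: measurable_funX; apply: measurable_funM => //;
    apply: measurable_funV; exact: measurable_bracket2.
- move=> p; have c : Psi_ n p / bracket2 p @[n --> \oo] --> 0 / bracket2 p.
    by apply: cvgM => //; exact: cvg_cst.
  have := cvg_comp _ _ c (@exprn_continuous _ 2 (0 / bracket2 p)).
  by rewrite mul0r expr0n.
- move=> n p; rewrite ger0_norm ?sqr_ge0// expr_div_n.
  by rewrite ler_pdivrMr ?exprn_gt0 ?bracket2_gt0// mulrAC -mulrA.
Qed.

End dual_decay.

Section curve_vanish.
Context {R : realType}.
Variables (T : R) (u : R -> R * R -> R).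
Hypotheses (T0 : 0 < T) (hu : continuous_in_Z T 4 2 u).

Definition mom (Psi : R * R -> R) (t : R) : R :=
  \int[planeleb]_p (uc T u t p * Psi p).

Lemma uc_bounded : exists2 V : R, 0 <= V & forall t, wsq (uc T u t) <= V.
Proof.
have c := continuous_wsq (uc_in_weighted T0 hu) (uc_cvg T0 hu).
have [V V0 h] := clamp_bounded T0 c; exists V => // t.
have := h t; rewrite /uc clamp_id ?clamp_itv//.
exact: le_trans (ler_norm _).
Qed.

(** Cauchy-Schwarz separates time from the test function: the weighted norm of the curve is bounded
    in time, and the dual norm of [Psi_ n] tends to 0 by dominated convergence. *)
Lemma vanish_mom (Psi_ : nat -> R * R -> R) (C : R) :
  (forall n, measurable_fun [set: plane R] (Psi_ n)) ->
  (forall n p, Psi_ n p ^+ 2 <= C * (bracket2 p ^+ 2 * lorentz2 p)) ->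
  (forall p, Psi_ n p @[n --> \oo] --> 0) ->
  vanish (fun n => mom (Psi_ n)).
Proof.
move=> mP PC P0; have [V V0 hV] := uc_bounded.
exists (fun n => Num.sqrt (V * dualsq (Psi_ n))).
  have c : V * dualsq (Psi_ n) @[n --> \oo] --> V * 0.
    by apply: cvgM; [exact: cvg_cst|exact: dualsq_cvg0 PC P0].
  have := cvg_comp _ _ c (@sqrt_continuous _ (V * 0)).
  by rewrite mulr0 sqrtr0.
move=> n t; rewrite -sqrtr_sqr; apply: ler_wsqrtr.
have dP := in_dual_le (mP n) (PC n).
apply: (le_trans (dual_CauchySchwarz (uc_in_weighted T0 hu t) dP)).
by rewrite ler_wpM2r//; apply: Rintegral_ge0 => p _; exact: sqr_ge0.
Qed.

Lemma vanish_tens (c_ : nat -> R -> R) (b : R -> R) (C : R) :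
  (forall n, measurable_fun [set: R] (c_ n)) ->
  (forall n x, `|c_ n x| <= C * (1 + `|x|)) ->
  (forall x, c_ n x @[n --> \oo] --> 0) -> testfun b ->
  vanish (fun n => mom (tens (c_ n) b)).
Proof.
move=> mc cC c0 tb; have [K K0 hK] := testfun_dom tb.
apply: (vanish_mom (C := K * C ^+ 2)).
- by move=> n; apply: measurable_tens => //; exact: testfun_measurable.
- by move=> n; apply: hK; exact: cC.
- move=> p; rewrite /tens -[X in _ --> X](mul0r (b p.2)).
  by apply: cvgM => //; exact: cvg_cst.
Qed.

(** Both factors of the square carry a power of the bracket, so the test function may grow like the
    square of the bracket. *)
Lemma vanish_quad (Psi_ : nat -> R * R -> R) (C : R) :
  (forall n, measurable_fun [set: plane R] (Psi_ n)) ->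
  (forall n p, `|Psi_ n p| <= C * scale_inv n * bracket2 p ^+ 2) ->
  vanish (fun n t => \int[planeleb]_p (uc T u t p ^+ 2 * Psi_ n p)).
Proof.
move=> mP PC; have [V V0 hV] := uc_bounded.
have C0 : 0 <= C.
  have := le_trans (normr_ge0 _) (PC 0%N 0).
  rewrite pmulr_lge0 ?exprn_gt0 ?bracket2_gt0//.
  by rewrite pmulr_lge0// scale_inv_gt0.
apply: (@vanish_scale_inv _ _ (C * V)) => n t.
apply: (le_trans (quad_le (mP n) (PC n) (uc_in_weighted T0 hu t))).
by rewrite mulrAC ler_wpM2r ?(ltW (scale_inv_gt0 _))// ler_wpM2l.
Qed.

End curve_vanish.

Section moment_tools.
Context {R : realType}.
Variables (T : R) (u : R -> R * R -> R).
Hypotheses (T0 : 0 < T) (hu : continuous_in_Z T 4 2 u).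
Notation mom := (mom T u).
Notation r_ := (@scale_inv R).

Lemma scale_inv_le1 n : r_ n <= 1.
Proof. by rewrite invf_le1 ?ltr0n// ler1n. Qed.

Lemma vanish_tens_small (c_ : nat -> R -> R) (b : R -> R) (C : R) :
  (forall n, measurable_fun [set: R] (c_ n)) ->
  (forall n x, `|c_ n x| <= C * r_ n * (1 + `|x|)) -> testfun b ->
  vanish (fun n => mom (tens (c_ n) b)).
Proof.
move=> mc cC tb.
have C0 : 0 <= C.
  have := le_trans (normr_ge0 _) (cC 0%N 0).
  by rewrite normr0 addr0 mulr1 pmulr_lge0// scale_inv_gt0.
apply: (vanish_tens T0 hu (C := C)) => //.
- move=> n x; rewrite (le_trans (cC n x))// ler_wpM2r ?addr_ge0//.
  by rewrite ler_piMr// scale_inv_le1.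
- move=> x; apply/norm_cvg0P.
  have c1 : C * r_ n * (1 + `|x|) @[n --> \oo] --> C * 0 * (1 + `|x|).
    by apply: cvgM; [apply: cvgM; [exact: cvg_cst|exact: cvg_scale_inv]|exact: cvg_cst].
  rewrite mulr0 mul0r in c1.
  apply: (squeeze_cvgr _ (cvg_cst 0) c1).
  by apply: nearW => n; rewrite normr_ge0 cC.
Qed.

(** The bound with the small factor gives the pointwise limit, the linear one the domination. *)
Lemma vanish_tens_quad (c_ : nat -> R -> R) (b : R -> R) (C : R) :
  (forall n, measurable_fun [set: R] (c_ n)) ->
  (forall n x, `|c_ n x| <= C * `|x|) ->
  (forall n x, `|c_ n x| <= C * r_ n * x ^+ 2) -> testfun b ->
  vanish (fun n => mom (tens (c_ n) b)).
Proof.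
move=> mc cC cC2 tb.
have C0 : 0 <= C by have := le_trans (normr_ge0 _) (cC 0%N 1); rewrite normr1 mulr1.
apply: (vanish_tens T0 hu (C := C)) => //.
- by move=> n x; rewrite (le_trans (cC n x))// ler_wpM2l// lerDr.
- move=> x; apply/norm_cvg0P.
  have c1 : C * r_ n * x ^+ 2 @[n --> \oo] --> C * 0 * x ^+ 2.
    by apply: cvgM; [apply: cvgM; [exact: cvg_cst|exact: cvg_scale_inv]|exact: cvg_cst].
  rewrite mulr0 mul0r in c1.
  apply: (squeeze_cvgr _ (cvg_cst 0) c1).
  by apply: nearW => n; rewrite normr_ge0 cC2.
Qed.

Lemma in_dual_linear (c b : R -> R) (C : R) : measurable_fun [set: R] c ->
  (forall x, `|c x| <= C * (1 + `|x|)) -> testfun b -> in_dual (tens c b).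
Proof.
move=> mc cC tb; have [K K0 hK] := testfun_dom tb.
apply: (in_dual_le (C := K * C ^+ 2)); last exact: hK.
by apply: measurable_tens => //; exact: testfun_measurable.
Qed.

Lemma momB (P Q : R * R -> R) t : in_dual P -> in_dual Q ->
  mom (fun p => P p - Q p) t = mom P t - mom Q t.
Proof.
move=> dP dQ; rewrite /mom -RintegralB//;
  [|exact: rintegrable_dual (uc_in_weighted T0 hu t) _..].
by apply: eq_Rintegral => p _; rewrite mulrBr.
Qed.

Lemma momZ (c : R) (P : R * R -> R) t : in_dual P ->
  mom (fun p => c * P p) t = c * mom P t.
Proof.
move=> dP; rewrite /mom -RintegralZl//;
  last exact: rintegrable_dual (uc_in_weighted T0 hu t) _.
by apply: eq_Rintegral => p _; rewrite mulrCA.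
Qed.

Lemma testfun_scaled (a : R -> R) (k r : R) : r != 0 -> testfun a ->
  testfun (fun x => k * a (r * x + 0)).
Proof. by move=> r0 ta; apply: testfunZ; exact: testfun_affine. Qed.

Lemma D1_scaled (a : R -> R) (k r : R) : testfun a -> r != 0 ->
  D1 (fun x => k * a (r * x + 0)) = fun x => k * r * D1 a (r * x + 0).
Proof.
move=> [sa _] r0; rewrite derive1Z; last exact: smooth1_affine.
by rewrite derive1_affine//; apply/funext => x; rewrite mulrA.
Qed.

Lemma hilb_scaled (f : R -> R) (k r : R) : 0 < r -> testfun f ->
  hilb (fun x => k * f (r * x + 0)) = fun x => k * hilb f (r * x + 0).
Proof.
move=> r0 tf; have rn0 : r != 0 by rewrite gt_eqF.
apply/funext => x; rewrite hilbZ; last exact: testfun_affine.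
by rewrite hilb_affine// gtr0_sg// mul1r.
Qed.

(** Only x is rescaled: two derivatives in x produce r^2, one produces r, and the Hilbert transform
    commutes with the dilation. *)
Lemma flux_scaled (a b : R -> R) (k r : R) t : 0 < r -> testfun a ->
  flux T u (fun x => k * a (r * x + 0)) b t =
  mom (tens (fun x => k * r ^+ 2 * hilb (D1 (D1 a)) (r * x + 0)) b) t +
  mom (tens (fun x => k * r * D1 a (r * x + 0)) (D1 (D1 b))) t +
  2^-1 * \int[planeleb]_p (uc T u t p ^+ 2 *
    tens (fun x => k * r * D1 a (r * x + 0)) b p).
Proof.
move=> r0 ta; have rn0 : r != 0 by rewrite gt_eqF.
have tda := testfun_derive ta; have tdda := testfun_derive tda.
have flux_eq (f g h : R -> R) : D1 f = g -> hilb (D1 g) = h ->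
  flux T u f b t = mom (tens h b) t + mom (tens g (D1 (D1 b))) t +
    2^-1 * \int[planeleb]_p (uc T u t p ^+ 2 * tens g b p).
  by rewrite /flux => -> ->.
apply: flux_eq; first exact: D1_scaled.
rewrite (_ : k * r ^+ 2 = k * r * r); last by rewrite expr2 mulrA.
by rewrite D1_scaled// hilb_scaled.
Qed.

End moment_tools.

(** * Rescaled moments at a time of strong decay *)

Section strong_decay.
Context {R : realType}.
Notation r_ := (@scale_inv R).

Lemma near_scale_inv_gt (x : R) : \forall n \near \oo, x < (r_ n)^-1.
Proof.
near=> n; rewrite /scale_inv invrK; apply: (@lt_le_trans _ _ n%:R); last first.
  by rewrite ler_nat.
by near: n; exact: nbhs_infty_gtr.
Unshelve. all: by end_near. Qed.

Lemma rintegrable_plane_prodM (g h : R -> R) :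
  rintegrable leb g -> rintegrable leb h ->
  rintegrable planeleb (fun p : R * R => g p.1 * h p.2) /\
  \int[@planeleb R]_p (g p.1 * h p.2) =
    \int[leb]_x g x * \int[leb]_y h y.
Proof.
move=> ig ih; split; last exact: Rintegral_prodM.
apply: (@rintegrable_plane _ _ (fun x => `|g x|) (fun y => `|h y|)).
- apply: measurable_funM.
    by apply: measurable_fst_comp; exact: rintegrable_measurable ig.
  by apply: measurable_snd_comp; exact: rintegrable_measurable ih.
- by move=> x y; rewrite normrM.
- exact: rintegrable_norm.
- exact: rintegrable_norm.
Qed.

Lemma bracket2_powR_ge (x y N : R) : 1 <= N -> N <= `|x| ->
  N ^+ 7 <= bracket2 (x, y) `^ (7 / 2).
Proof.
move=> N1 Nx; have N0 : 0 <= N by rewrite (le_trans _ N1).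
have -> : N ^+ 7 = (N ^+ 2) `^ (7 / 2).
  rewrite -(powR_mulrn 2 N0) -powRrM (_ : 2%:R * (7 / 2) = 7%:R).
    by rewrite powR_mulrn.
  by field.
apply: ge0_ler_powR; rewrite ?nnegrE ?sqr_ge0 ?divr_ge0//.
  by rewrite ltW// bracket2_gt0.
have : N ^+ 2 <= `|x| ^+ 2 by rewrite lerXn2r// nnegrE.
rewrite real_normK ?num_real// /bracket2/= => /le_trans; apply.
by rewrite -addrA addrCA lerDl addr_ge0// sqr_ge0.
Qed.

(** Cauchy-Schwarz with the square root [q] of the weight; write N for n + 1. The factor [f n] is
    the part of [v * q] on x >= N and tends to 0 in L^2. The square of [g n] is at most a constant
    times N^6 / N^7 on an x-interval of length N, so its integral stays bounded: 7 / 2 is just what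
    the amplitude N^3 demands. *)
Lemma strong_decay (v : R * R -> R) (a b : R -> R) : weighted_L2 (7 / 2) v ->
  testfun a -> supp12 a -> testfun b ->
  \int[planeleb]_p (v p * tens (fun x => (r_ n)^-1 ^+ 3 * a (r_ n * x + 0)) b p)
    @[n --> \oo] --> 0.
Proof.
move=> [mv vy] ta sa tb.
pose q (p : R * R) := bracket2 p `^ (7 / 4).
have q0 p : 0 < q p by rewrite powR_gt0// bracket2_gt0.
have q2 p : q p ^+ 2 = bracket2 p `^ (7 / 2).
  rewrite -powR_mulrn ?powR_ge0// -powRrM; congr (_ `^ _); by field.
have mq : measurable_fun [set: plane R] q.
  by apply: (measurableT_comp (measurable_powR (7 / 4))); exact: measurable_bracket2.
have [A A0 hA] := testfun_bounded ta.
have jb2 : rintegrable leb (fun y => b y ^+ 2).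
  have [B B0 hB] := testfun_bounded tb.
  have j := rintegrableZ B (rintegrable_norm (testfun_rintegrable tb)).
  apply: (@le_rintegrable _ _ _ leb _ _ _ _ j).
    by apply: measurable_funX; exact: testfun_measurable.
  by move=> y; rewrite normrX expr2 ler_wpM2r.
pose J := \int[leb]_y b y ^+ 2.
have jv : rintegrable planeleb (fun p => (v p * q p) ^+ 2).
  apply: rintegrable_ge0P => [|p|]; last 2 first.
  - exact: sqr_ge0.
  - by move: vy; congr (_ < _)%E; apply: eq_integral => p _; rewrite exprMn q2 mulrC.
  by apply: measurable_funX; exact: measurable_funM.
pose f n p := v p * q p * b2r ((r_ n)^-1 <= p.1).
pose g n p := tens (fun x => (r_ n)^-1 ^+ 3 * a (r_ n * x + 0)) b p / q p.
have mf n : measurable_fun [set: plane R] (f n).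
  apply: measurable_funM; first exact: measurable_funM.
  by apply: measurable_b2r; exact: measurable_fun_ler.
have mg n : measurable_fun [set: plane R] (g n).
  apply: measurable_funM; last exact: measurable_funV.
  apply: measurable_tens; last exact: testfun_measurable.
  by apply: testfun_measurable; apply: testfun_scaled => //; exact: scale_inv_neq0.
have fle n p : `|f n p ^+ 2| <= (v p * q p) ^+ 2.
  rewrite /f normrX normrM exprMn real_normK ?num_real//.
  rewrite /b2r; case: ifP => _; first by rewrite normr1 expr1n mulr1.
  by rewrite normr0 expr0n mulr0 sqr_ge0.
have jf n : rintegrable planeleb (fun p => f n p ^+ 2).
  by apply: (@le_rintegrable _ _ _ planeleb _ _ _ (fle n) jv); exact: measurable_funX.
have cf : \int[planeleb]_p (f n p ^+ 2) @[n --> \oo] --> (0 : R).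
  have -> : (0 : R) = \int[@planeleb R]_p (cst 0 p).
    by rewrite /cst Rintegral_cst// mul0r.
  apply: (@cvg_Rintegral _ _ _ planeleb _ _ _ _ _ fle jv).
    by move=> n; exact: measurable_funX.
  move=> p; apply: cvg_near_cst; near=> n; rewrite /f /b2r ifF ?mulr0 ?expr0n//.
  apply/negbTE; rewrite -ltNge; near: n.
  exact: near_scale_inv_gt.
(* Majorant of [g n p ^+ 2]: the indicator of [N, 2 N], written as the ball of centre 3 N / 2 and
   radius N / 2, times A^2 / N, so that its integral does not depend on [n]. *)
pose h n p : R := (A ^+ 2 * r_ n * b2r (`|3 / 2 * (r_ n)^-1 - p.1| <= (r_ n)^-1 / 2))
    * (b p.2) ^+ 2.
have jh n : rintegrable planeleb (h n) /\ \int[planeleb]_p h n p = A ^+ 2 * J.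
  have rn := scale_inv_gt0 (R := R) n.
  have j1 := rintegrableZ (A ^+ 2 * r_ n) (rintegrable_near (3 / 2 * (r_ n)^-1) ((r_ n)^-1 / 2)).
  have [i1 ->] := rintegrable_plane_prodM j1 jb2; split => //.
  rewrite RintegralZl//; last exact: rintegrable_near.
  rewrite Rintegral_near ?divr_ge0 ?invr_ge0 ?ltW// -/J; congr (_ * _).
  by field; rewrite gt_eqF.
have gh n p : `|g n p ^+ 2| <= h n p.
  have rn := scale_inv_gt0 (R := R) n.
  rewrite ger0_norm ?sqr_ge0// /g /h /tens expr_div_n q2.
  have [/andP[a1 a2]|/sa ->] := boolP (1 <= r_ n * p.1 + 0 <= 2); last first.
    rewrite mulr0 mul0r expr0n mul0r mulr_ge0 ?sqr_ge0// mulr_ge0//.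
      by rewrite mulr_ge0 ?sqr_ge0// ltW.
    by rewrite /b2r; case: ifP.
  rewrite addr0 in a1 a2.
  have N1 : (r_ n)^-1 <= p.1 by rewrite -[leLHS]mulr1 ler_pdivrMl.
  have N2 : p.1 <= 2 * (r_ n)^-1 by rewrite mulrC ler_pdivlMl.
  have N0 : 1 <= (r_ n)^-1 by rewrite invf_ge1// scale_inv_le1.
  set N := (r_ n)^-1 in N1 N2 N0 *.
  have NE : r_ n = N^-1 by rewrite /N invrK.
  have N00 : 0 < N by rewrite (lt_le_trans _ N0).
  have B7 : N ^+ 7 <= bracket2 p `^ (7 / 2).
    by case: (p) N1 => x y /= N1; apply: bracket2_powR_ge => //; rewrite (le_trans N1)// ler_norm.
  rewrite /b2r ifT; last by rewrite ler_norml; apply/andP; split; lra.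
  rewrite ler_pdivrMr; last by rewrite powR_gt0// bracket2_gt0.
  rewrite mulr1 addr0 NE; set W := _ `^ _ in B7 *; set aa := a _; set bb := b _.
  rewrite [leLHS](_ : _ = (N ^+ 3) ^+ 2 * aa ^+ 2 * bb ^+ 2); last by ring.
  rewrite [leRHS](_ : _ = A ^+ 2 * N^-1 * W * bb ^+ 2); last by ring.
  rewrite ler_wpM2r ?sqr_ge0//.
  have a2A : aa ^+ 2 <= A ^+ 2.
    have : `|aa| ^+ 2 <= A ^+ 2 by rewrite lerXn2r ?nnegrE// /aa hA.
    by rewrite real_normK ?num_real.
  apply: (@le_trans _ _ (A ^+ 2 * N^-1 * N ^+ 7)); last first.
    by rewrite ler_wpM2l// mulr_ge0 ?sqr_ge0// invr_ge0 ltW.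
  rewrite (_ : A ^+ 2 * N^-1 * N ^+ 7 = (N ^+ 3) ^+ 2 * A ^+ 2).
    by rewrite ler_wpM2l// sqr_ge0.
  by field; rewrite gt_eqF.
have jg n : rintegrable planeleb (fun p => g n p ^+ 2).
  by have [j _] := jh n; apply: (@le_rintegrable _ _ _ planeleb _ _ _ (gh n) j); exact: measurable_funX.
have Ig n : \int[planeleb]_p (g n p ^+ 2) <= A ^+ 2 * J.
  have [j <-] := jh n; apply: (le_Rintegral measurableT (jg n) j) => p _.
  exact: le_trans (ler_norm _) (gh n p).
(* The cutoff put into [f] costs nothing, because the rescaled profile vanishes for x < N. *)
have fg n p : f n p * g n p =
    v p * tens (fun x => (r_ n)^-1 ^+ 3 * a (r_ n * x + 0)) b p.
  rewrite /f /g /b2r; case: ifPn => [_|]; first by field; rewrite gt_eqF.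
  rewrite -ltNge => pn; rewrite mulr0 mul0r /tens sa ?mulr0 ?mul0r ?mulr0//.
  rewrite addr0 negb_and -ltNge; apply/orP; left.
  by rewrite mulrC -ltr_pdivlMr ?scale_inv_gt0// mul1r.
under eq_cvg do under eq_Rintegral do rewrite -fg.
have c1 : Num.sqrt ((\int[planeleb]_p (f n p ^+ 2)) * (A ^+ 2 * J)) @[n --> \oo] --> (0 : R).
  have c : (\int[planeleb]_p (f n p ^+ 2)) * (A ^+ 2 * J) @[n --> \oo] -->
      (0 * (A ^+ 2 * J) : R) by apply: cvgM => //; exact: cvg_cst.
  have := cvg_comp _ _ c (@sqrt_continuous _ (0 * (A ^+ 2 * J))).
  by rewrite mul0r sqrtr0.
apply/norm_cvg0P; apply: (squeeze_cvgr _ (cvg_cst 0) c1).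
apply: nearW => n; rewrite normr_ge0 -sqrtr_sqr; apply: ler_wsqrtr.
apply: (le_trans (Rintegral_CauchySchwarz (mf n) (mg n) (jf n) (jg n))).
by rewrite ler_wpM2l//; apply: Rintegral_ge0 => p _; exact: sqr_ge0.
Unshelve. all: by end_near. Qed.

End strong_decay.

(** * Moment identities and zeros of the local energy *)

Section moment_identities.
Context {R : realType}.
Variables (T : R) (u : R -> R * R -> R).
Hypotheses (T0 : 0 < T) (hu : continuous_in_Z T 4 2 u).
Hypothesis hsol : weak_solution T u.
Notation mom := (mom T u).
Implicit Types a b f : R -> R.
Notation r_ := (@scale_inv R).

Let rn0 n : r_ n != 0 := scale_inv_neq0 n.
Let rgt0 n : 0 < r_ n := scale_inv_gt0 n.
Let rV0 n : 0 <= (r_ n)^-1.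
Proof. by rewrite invr_ge0 ltW. Qed.

Let rle1 n : r_ n <= 1 := scale_inv_le1 n.

Definition mass (b : R -> R) := mom (tens (fun=> 1) b).
(** The cutoff [b] matters: the function x alone misses the dual of the weighted space by a
    logarithm. *)
Definition xmoment (b : R -> R) := mom (tens id b).
Definition energy (b : R -> R) t :=
  \int[planeleb]_p (uc T u t p ^+ 2 * tens (fun=> 1) b p).

Let one_le (x : R) : `|1 : R| <= 1 * (1 + `|x|).
Proof. by rewrite normr1 mul1r lerDl. Qed.

Let id_le (x : R) : `|x| <= 1 * (1 + `|x|).
Proof. by rewrite mul1r lerDr. Qed.

Lemma mass_dual b : testfun b -> in_dual (tens (fun=> 1) b).
Proof. by move=> tb; exact: (in_dual_linear _ one_le). Qed.

Lemma xmoment_dual b : testfun b -> in_dual (tens id b).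
Proof. by move=> tb; exact: (in_dual_linear _ id_le). Qed.

Lemma continuous_xmoment b : testfun b -> continuous (xmoment b).
Proof.
by move=> tb; exact: (continuous_pair (uc_in_weighted T0 hu) (uc_cvg T0 hu) (xmoment_dual tb)).
Qed.

Lemma energy_quad b : testfun b ->
  exists K, forall p, `|tens (fun=> 1) b p| <= K * bracket2 p ^+ 2.
Proof.
move=> tb; have [B B0 hB] := testfun_bounded tb; exists B => p.
rewrite /tens mul1r -[leLHS]mulr1; apply: ler_pM => //.
by rewrite exprn_ege1// bracket2_ge1.
Qed.

Lemma continuous_energy b : testfun b -> continuous (energy b).
Proof.
move=> tb; have [K hK] := energy_quad tb.
apply: (continuous_quad (uc_in_weighted T0 hu) (uc_cvg T0 hu) _ hK).
by apply: measurable_tens => //; exact: testfun_measurable.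
Qed.

Let Sc (k : nat -> R) a n (x : R) : R := k n * a (r_ n * x + 0).

Let evo (k : nat -> R) a b n (t : R) : testfun a -> testfun b -> 0 < t < T ->
  is_derive t 1 (mom (tens (Sc k a n) b))
   (mom (tens (fun x => k n * r_ n ^+ 2 * hilb (D1 (D1 a)) (r_ n * x + 0)) b) t +
    mom (tens (fun x => k n * r_ n * D1 a (r_ n * x + 0)) (D1 (D1 b))) t +
    2^-1 * \int[planeleb]_p (uc T u t p ^+ 2 *
      tens (fun x => k n * r_ n * D1 a (r_ n * x + 0)) b p)).
Proof.
move=> ta tb tT; rewrite -flux_scaled//.
exact: (moment_derive T0 hu hsol (testfun_scaled (k n) (rn0 n) ta) tb tT).
Qed.

Let cSc (k : nat -> R) a b n : testfun a -> testfun b -> continuous (mom (tens (Sc k a n) b)).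
Proof.
by move=> ta tb; exact: (continuous_moment T0 hu (testfun_scaled (k n) (rn0 n) ta) tb).
Qed.

Let msc (f : R -> R) (k : R) n : measurable_fun [set: R] f ->
  measurable_fun [set: R] (fun x => k * f (r_ n * x + 0)).
Proof. by move=> mf; apply: measurable_funM => //; exact: measurable_affine. Qed.

(** For [chi] the bump is recentred and normalised at 0. For [b] an affine map sends [-N, N] to
    [1/4, 3/4], where the bump has a positive minimum, and one divides by that minimum. *)
Lemma exists_cutoff : exists chi : R -> R, [/\ testfun chi, chi 0 = 1 &
  forall N : R, 0 < N -> exists b, [/\ testfun b, forall y, 0 <= b y &
    forall y, `|y| <= N -> 1 <= b y] ].
Proof.
have h2 : 0 < (bump01 (2^-1) : R).
  by rewrite bump01_gt0// invr_gt0 ltr0n invf_lt1// ltr1n.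
pose chi (x : R) := (bump01 2^-1)^-1 * bump01 (1 * x + 2^-1) : R.
exists chi; split.
- by apply: testfunZ; apply: testfun_affine; [rewrite oner_eq0|exact: testfun_bump01].
- by rewrite /chi mulr0 add0r mulVf// gt_eqF.
move=> N N0.
have cb : {within `[(4^-1 : R), 3 / 4], continuous bump01}.
  by apply: continuous_subspaceT; apply: smooth1_continuous; exact: smooth1_bump01.
have [|c c01 hc] := EVT_min _ cb; first by lra.
have c0 : 0 < (bump01 c : R).
  by apply: bump01_gt0; move: c01; rewrite in_itv/= => /andP[? ?]; apply/andP; split; lra.
have n0 : (4 * N)^-1 != 0 by rewrite invr_neq0// gt_eqF// mulr_gt0.
exists (fun y => (bump01 c)^-1 * bump01 ((4 * N)^-1 * y + 2^-1)); split.
- by apply: testfunZ; apply: testfun_affine => //; exact: testfun_bump01.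
- by move=> y; rewrite mulr_ge0 ?bump01_ge0// invr_ge0 ltW.
- move=> y; rewrite ler_norml => /andP[y1 y2].
  rewrite -[leLHS](mulVf (lt0r_neq0 c0)) ler_pM2l ?invr_gt0//; apply: hc.
  rewrite in_itv/=.
  have e : (4 * N)^-1 * y = (y / N) / 4 by field; rewrite gt_eqF.
  have e1 : -1 <= y / N by rewrite ler_pdivlMr// mulN1r.
  have e2 : y / N <= 1 by rewrite ler_pdivrMr// mul1r.
  by rewrite e; apply/andP; split; lra.
Qed.

Let scaled_bound (f : R -> R) (A k : R) n x : (forall x, `|f x| <= A) -> 0 <= k ->
  k <= r_ n -> `|k * f (r_ n * x + 0)| <= A * r_ n * (1 + `|x|).
Proof.
move=> fA k0 kr; have A0 : 0 <= A by exact: le_trans (fA 0).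
rewrite normrM ger0_norm// mulrC -[leLHS]mulr1; apply: ler_pM => //.
- by rewrite mulr_ge0.
- by rewrite ler_pM.
- by rewrite lerDl.
Qed.

Let quad_small (f : R -> R) (A B : R) b k n (p : R * R) : (forall x, `|f x| <= A) ->
  (forall x, `|b x| <= B) -> 0 <= k -> k <= r_ n ->
  `|tens (fun x => k * f (r_ n * x + 0)) b p| <= A * B * r_ n * bracket2 p ^+ 2.
Proof.
move=> fA bB k0 kr; have A0 : 0 <= A by exact: le_trans (fA 0).
have B0 : 0 <= B by exact: le_trans (bB 0).
rewrite /tens !normrM (ger0_norm k0) -[leLHS]mulr1; apply: ler_pM => //.
- by rewrite !mulr_ge0.
- rewrite (_ : A * B * r_ n = r_ n * A * B); last by ring.
  by apply: ler_pM => //; [rewrite mulr_ge0|exact: ler_pM].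
- by rewrite exprn_ege1// bracket2_ge1.
Qed.

Let limit_evolution := @vanish_limit_evolution R T.

Let cwithin (f : R -> R) : continuous f -> {within `[0, T], continuous f}.
Proof. by move=> cf; exact: continuous_subspaceT. Qed.

Let lim0 (x : R) (d : nat -> R) : d n @[n --> \oo] --> 0 ->
  (forall n, `|x| <= d n) -> x = 0.
Proof.
move=> d0 h; apply/normr0_eq0/eqP; rewrite eq_le normr_ge0 andbT.
by rewrite -(cvg_lim _ d0)//; apply: limr_ge; [apply/cvg_ex; exists 0|exact: nearW].
Qed.

(** With the profile chi(x / n) every term of the flux carries at least one factor 1 / n, while
    chi(x / n) tends to chi(0) = 1. *)
Lemma mass_const b s t : testfun b -> 0 <= s <= T -> 0 <= t <= T ->
  mass b t = mass b s.
Proof.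
move=> tb sT tT; have [chi [tchi chi0 _]] := exists_cutoff.
have tdd := testfun_derive (testfun_derive tchi).
have [H H0 hH] := testfun_hilb_bounded tdd.
have [A A0 hA] := testfun_bounded (testfun_derive tchi).
have [B B0 hB] := testfun_bounded tb.
have [L L0 hL] := testfun_lipschitz tchi.
pose k n : R := 1 + 0 * n%:R.
have kE n : k n = 1 by rewrite /k mul0r addr0.
have tb2 := testfun_derive (testfun_derive tb).
have czero : continuous (fun _ : R => 0 : R) by move=> x; exact: cvg_cst.
have [|d d0 hd] := @limit_evolution (fun n => mom (tens (Sc k chi n) b)) _
    (fun=> 0) (fun=> 0) T0 (fun n => @cSc k chi b n tchi tb)
    (cwithin czero) (fun n t => @evo k chi b n t tchi tb).
- under [X in vanish X]eq_fun do under eq_fun do rewrite subr0 kE !mul1r.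
  apply: vanishD; first apply: vanishD.
  + apply: (vanish_tens_small T0 hu (C := H)) => //.
      by move=> n; apply: msc; exact: testfun_measurable_hilb.
    move=> n x; apply: scaled_bound => //; first exact: sqr_ge0.
    by rewrite expr2 ler_piMr// ltW.
  + apply: (vanish_tens_small T0 hu (C := A)) => //.
      by move=> n; apply: msc; exact: testfun_measurable (testfun_derive tchi).
    by move=> n x; apply: scaled_bound => //; exact: ltW.
  + apply: vanishZ; apply: (vanish_quad T0 hu (C := A * B)).
      move=> n; apply: measurable_tens; last exact: testfun_measurable.
      by apply: msc; exact: testfun_measurable (testfun_derive tchi).
    by move=> n p; apply: quad_small => //; exact: ltW.
(* Replacing the cutoff by 1 costs at most L |x| times [r_ n], which the weight of the curve can
   absorb. *)
have [e e0 he] : vanish (fun n => mom (tens (fun x => Sc k chi n x - 1) b)).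
  apply: (vanish_tens_small T0 hu (C := L)) => //.
    move=> n; apply: measurable_funB => //.
    by apply: msc; exact: testfun_measurable.
  move=> n x; rewrite /Sc kE mul1r -[X in _ - X]chi0 (le_trans (hL _ _))//.
  rewrite -mulrA ler_wpM2l// addr0 subr0 normrM (ger0_norm (ltW (rgt0 n))).
  by rewrite ler_wpM2l ?(ltW (rgt0 n))// lerDr.
have E n t' : mom (tens (fun x => Sc k chi n x - 1) b) t' =
    mom (tens (Sc k chi n) b) t' - mass b t'.
  rewrite -(momB T0 hu t' (testfun_dual (testfun_scaled (k n) (rn0 n) tchi) tb)
    (mass_dual tb)).
  by congr (mom _ t'); apply/funext => p; rewrite /tens mulrBl.
apply/eqP; rewrite -subr_eq0; apply/eqP.
apply: (lim0 (d := fun n => d n + e n + e n)).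
  by rewrite -[X in _ --> X]addr0 -[X in _ --> X + _]addr0; apply: cvgD => //; exact: cvgD.
move=> n; have h1 := he n t; have h2 := he n s; have h3 := hd n s t sT tT.
move: h1 h2 h3; rewrite !E !subr0 => h1 h2 h3.
rewrite (_ : mass b t - mass b s = (mom (tens (Sc k chi n) b) t - mom (tens (Sc k chi n) b) s)
  - (mom (tens (Sc k chi n) b) t - mass b t) + (mom (tens (Sc k chi n) b) s - mass b s)); last by ring.
rewrite (le_trans (ler_normD _ _))// lerD//.
by rewrite (le_trans (ler_normB _ _))// lerD.
Qed.

Let tens_momB c1 c2 b t : in_dual (tens c1 b) -> in_dual (tens c2 b) ->
  mom (tens (fun x => c1 x - c2 x) b) t = mom (tens c1 b) t - mom (tens c2 b) t.
Proof.
move=> d1 d2; rewrite -(momB T0 hu t d1 d2).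
by congr (mom _ t); apply/funext => p; rewrite /tens mulrBl.
Qed.

Let tens_momZ (k : R) f b t : in_dual (tens f b) ->
  mom (tens (fun x => k * f x) b) t = k * mom (tens f b) t.
Proof.
move=> d1; rewrite -(momZ T0 hu k t d1).
by congr (mom _ t); apply/funext => p; rewrite /tens mulrA.
Qed.

Let Sc_dual (k : nat -> R) a b n : testfun a -> testfun b ->
  in_dual (tens (Sc k a n) b).
Proof. by move=> ta tb; exact: (testfun_dual (testfun_scaled (k n) (rn0 n) ta) tb). Qed.

(** Wherever [f] is nonzero its argument is at least 1, so powers of the argument may be inserted.
    After rescaling, each power of r x so gained pays for one negative power of r in the
    amplitude. *)
Lemma supp12_le f (A s : R) : supp12 f -> (forall x, `|f x| <= A) ->
  [/\ `|f s| <= A * `|s|, `|f s| <= A * s ^+ 2 & `|f s| <= A * s ^+ 4].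
Proof.
move=> sf fA; have A0 : 0 <= A by exact: le_trans (fA 0).
have [/andP[s1 _]|/sf ->] := boolP (1 <= s <= 2); last first.
  rewrite normr0; split; rewrite mulr_ge0//; first exact: sqr_ge0.
  by rewrite -[4%N]/(2 * 2)%N exprM sqr_ge0.
have AA x : 1 <= x -> `|f s| <= A * x.
  by move=> x1; rewrite (le_trans (fA s))// ler_peMr.
by split; apply: AA; [rewrite ger0_norm// (le_trans _ s1)|exact: exprn_ege1|exact: exprn_ege1].
Qed.

Let inv_supp12_le f (A : R) n x : supp12 f -> (forall x, `|f x| <= A) ->
  `|(r_ n)^-1 * f (r_ n * x + 0)| <= A * (r_ n * x ^+ 2).
Proof.
move=> sf fA; have [_ h _] := supp12_le (r_ n * x + 0) sf fA.
rewrite normrM (ger0_norm (rV0 n)) ler_pdivrMl// (le_trans h)//.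
by rewrite addr0 exprMn expr2 -!mulrA mulrCA.
Qed.

Let inv_bracket_le (n : nat) (x y : R) :
  r_ n * (x ^+ 2) <= r_ n * bracket2 (x, y) ^+ 2.
Proof.
rewrite ler_wpM2l// ?(ltW (rgt0 n))// (@le_trans _ _ (bracket2 (x, y)))//.
  by rewrite /bracket2/= -addrA addrCA lerDl addr_ge0// sqr_ge0.
by rewrite expr2 ler_peMr// ?bracket2_ge1// ltW// bracket2_gt0.
Qed.

Let norm_le_bracket (x y : R) : `|x| <= bracket2 (x, y) ^+ 2.
Proof.
have b1 := bracket2_ge1 (x, y).
apply: (@le_trans _ _ (bracket2 (x, y))); last by rewrite expr2 ler_peMr// ltW// bracket2_gt0.
rewrite /bracket2/= -(real_normK (num_real x)).
have := sqr_ge0 (`|x| - 1); have := sqr_ge0 y; have := normr_ge0 x.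
by rewrite sqrrB1 => ? ? ?; lra.
Qed.

Let pow4_le_bracket (x y : R) : x ^+ 4 <= bracket2 (x, y) ^+ 2.
Proof.
rewrite -[4%N]/(2 * 2)%N exprM ler_sqr ?nnegrE ?sqr_ge0 ?(ltW (bracket2_gt0 _))//.
by rewrite /bracket2/= -addrA addrCA lerDl addr_ge0// sqr_ge0.
Qed.

Section strong_times.
Variables g : R -> R.
Variables c C : R.
Hypotheses (tg : testfun g) (sg : supp12 g) (c0 : c != 0).
Hypothesis H2 :  forall x,
  `|hilb (D1 (D1 g)) x - hilb (D1 (D1 g)) 0 - c * x| <= C * x ^+ 2 /\
  `|hilb (D1 (D1 g)) x - hilb (D1 (D1 g)) 0 - c * x| <= C * `|x|.
Hypothesis H3 : forall x, `|hilb (D1 (D1 (D1 g))) x - c| <= C * `|x|.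

Let tdg := testfun_derive tg.
Let sdg := supp12_derive tg sg.
Let tddg := testfun_derive tdg.
Let sddg := supp12_derive tdg sdg.
Let tdddg := testfun_derive tddg.

(** The amplitude n^2 brings the value c of the Hilbert transform of g''' at 0 to order 1; the
    amplitude n^3 does so for the linear term c x in the expansion of that of g''. *)
Let k2 (n : nat) : R := (r_ n)^-1 ^+ 2.
Let k3 (n : nat) : R := (r_ n)^-1 ^+ 3.

Let C_ b n := mom (tens (Sc k2 (D1 g) n) b).
Let A_ b n := mom (tens (Sc k3 g n) b).

Let strong t := weighted_L2 (7 / 2) (uc T u t).

Let A_strong b t : testfun b -> strong t -> A_ b n t @[n --> \oo] --> 0.
Proof. by move=> tb st; exact: (strong_decay st tg sg tb). Qed.

Let C_strong b t : testfun b -> strong t -> C_ b n t @[n --> \oo] --> 0.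
Proof.
move=> tb st; have := strong_decay st tdg sdg tb => h.
have := cvgM (@cvg_scale_inv R) h; rewrite mul0r => c1.
rewrite (_ : (fun n => C_ b n t) =
  (fun n => r_ n * mom (tens (Sc k3 (D1 g) n) b) t)); first exact: c1.
apply/funext => n.
rewrite -tens_momZ; last exact: Sc_dual.
congr (mom (tens _ _) t); apply/funext => x; rewrite /Sc /k2 /k3.
by field; exact: rn0.
Qed.

(** The Hilbert term tends to c times the mass, which is constant in time. The two local terms have
    amplitude n but live at x >= n, and inserting powers of x / n by [supp12_le] makes them
    vanish. *)
Let C_evolution b : testfun b -> exists2 d : nat -> R, d n @[n --> \oo] --> 0 &
  forall n s t, 0 <= s <= T -> 0 <= t <= T ->
  `|(C_ b n t - c * mass b 0 * t) - (C_ b n s - c * mass b 0 * s)| <= d n.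
Proof.
move=> tb; have tb2 := testfun_derive (testfun_derive tb).
have [A A0 hA] := testfun_bounded tddg.
have [B B0 hB] := testfun_bounded tb.
have cl : continuous (fun t : R => c * mass b 0 * t).
  by move=> x; apply: cvgM; [exact: cvg_cst|exact: cvg_id].
have dl (t : R) : is_derive t 1 (fun t => c * mass b 0 * t) (c * mass b 0).
  by apply: is_derive_eq; rewrite ?scaler0 /GRing.scale/= ?mulr1 ?addr0.
have mH3 : measurable_fun [set: R] (hilb (D1 (D1 (D1 g)))).
  exact: testfun_measurable_hilb.
have [Hb Hb0 hHb] := testfun_hilb_bounded tdddg.
have kr (n : nat) : k2 n * r_ n ^+ 2 = 1 by rewrite /k2; field; exact: rn0.
have kr1 (n : nat) : k2 n * r_ n = (r_ n)^-1 by rewrite /k2; field; exact: rn0.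
pose e (n : nat) t := mom (tens (fun x => hilb (D1 (D1 (D1 g))) (r_ n * x + 0) - c) b) t +
   mom (tens (fun x => (r_ n)^-1 * D1 (D1 g) (r_ n * x + 0)) (D1 (D1 b))) t +
   2^-1 * \int[planeleb]_p (uc T u t p ^+ 2 *
      tens (fun x => (r_ n)^-1 * D1 (D1 g) (r_ n * x + 0)) b p).
have ev n (t : R) : 0 < t < T -> is_derive t 1 (C_ b n) (e n t + c * mass b 0).
  move=> tT; apply: (is_derive_eq (@evo k2 (D1 g) b n t tdg tb tT)).
  rewrite kr kr1 /e; under [X in mom (tens X _)]eq_fun do rewrite mul1r.
  have tT' : 0 <= t <= T by move: tT => /andP[/ltW -> /ltW ->].
  have T00 : 0 <= (0 : R) <= T by rewrite lexx ltW.
  rewrite tens_momB.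
  - rewrite (_ : (fun=> c) = (fun x => c * (fun=> 1) x)); last by apply/funext => x; rewrite mulr1.
    rewrite (tens_momZ c t (mass_dual tb)).
    by rewrite -/(mass b t) (mass_const tb T00 tT'); ring.
  - apply: (in_dual_tens (A := Hb) (B := B)) => //; last exact: testfun_measurable.
    exact: (measurable_affine _ _ mH3).
  - apply: (in_dual_tens (A := `|c|) (B := B)) => //; exact: testfun_measurable.
apply: (limit_evolution T0 (fun n => @cSc k2 (D1 g) b n tdg tb)
  (cwithin cl) ev (fun t _ => dl t)).
under [X in vanish X]eq_fun do under eq_fun do rewrite addrK.
apply: vanishD; first apply: vanishD.
- apply: (vanish_tens_small T0 hu (C := C)) => //.
    by move=> n; apply: measurable_funB => //; exact: (measurable_affine _ _ mH3).
  move=> n x; rewrite (le_trans (H3 _))// addr0 normrM (ger0_norm (ltW (rgt0 n))).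
  have C0 : 0 <= C by have := le_trans (normr_ge0 _) (H3 1); rewrite normr1 mulr1.
  by rewrite mulrA ler_wpM2l ?mulr_ge0 ?(ltW (rgt0 n))// lerDr.
- apply: (vanish_tens_quad T0 hu (C := A)) => //.
  + by move=> n; apply: msc; exact: testfun_measurable.
  + move=> n x; have [h _ _] := supp12_le (r_ n * x + 0) sddg hA.
    rewrite normrM (ger0_norm (rV0 n)) ler_pdivrMl// (le_trans h)//.
    by rewrite addr0 normrM (ger0_norm (ltW (rgt0 n))) mulrCA.
  + by move=> n x; rewrite -mulrA; exact: inv_supp12_le.
- apply: vanishZ; apply: (vanish_quad T0 hu (C := A * B)).
    move=> n; apply: measurable_tens; last exact: testfun_measurable.
    by apply: msc; exact: testfun_measurable.
  move=> n [x y]; rewrite /tens/= normrM -!mulrA.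
  apply: (@le_trans _ _ (A * (r_ n * x ^+ 2) * B)).
    by apply: ler_pM => //; exact: inv_supp12_le.
  by rewrite mulrAC -mulrA ler_wpM2l// ler_wpM2l.
Qed.

Let uc_clamp t : uc T u (clamp T t) = uc T u t.
Proof. by rewrite /uc clamp_id// clamp_itv. Qed.

Variables s1 s2 : R.
Hypotheses (s1T : 0 <= s1 <= T) (s2T : 0 <= s2 <= T) (s12 : s1 != s2).
Hypotheses (st1 : strong s1) (st2 : strong s2).

(** The moment with profile g' tends to 0 at both strong times, while its limiting motion is affine
    with slope c times the mass; hence the slope is 0. *)
Lemma mass0_eq0 b : testfun b -> mass b 0 = 0.
Proof.
move=> tb; have [d d0 hd] := C_evolution tb.
have c1 := C_strong tb st1; have c2 := C_strong tb st2.
have e : c * mass b 0 * (s2 - s1) = 0.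
  have h n : `|c * mass b 0 * (s2 - s1)| <= d n + `|C_ b n s1| + `|C_ b n s2|.
    rewrite (_ : c * _ * _ = - ((C_ b n s2 - c * mass b 0 * s2) -
      (C_ b n s1 - c * mass b 0 * s1)) - C_ b n s1 + C_ b n s2); last by ring.
    rewrite (le_trans (ler_normD _ _))// lerD// (le_trans (ler_normB _ _))// lerD//.
    by rewrite normrN hd.
  apply: lim0 h; rewrite -[X in _ --> X]addr0; apply: cvgD; last exact/norm_cvg0P.
  by rewrite -[X in _ --> X]addr0; apply: cvgD => //; exact/norm_cvg0P.
move/eqP : e; rewrite !mulf_eq0 (negbTE c0)/= subr_eq0 [s2 == _]eq_sym (negbTE s12) orbF.
by move/eqP.
Qed.

Lemma mass_eq0 b t : testfun b -> mass b t = 0.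
Proof.
move=> tb; rewrite -[LHS]/(mom _ t) /mom -uc_clamp -/(mom _ _) -/(mass b _).
have T00 : 0 <= (0 : R) <= T by rewrite lexx ltW.
by rewrite (mass_const tb T00 (clamp_itv T0 t)) mass0_eq0.
Qed.

(** Since the slope is 0, smallness at [s1] spreads to all times. It will be applied to b'' in place
    of b. *)
Let C_vanish b : testfun b -> vanish (C_ b).
Proof.
move=> tb; have [d d0 hd] := C_evolution tb.
exists (fun n => d n + `|C_ b n s1|).
  rewrite -[X in _ --> X]addr0; apply: cvgD => //.
  by apply/norm_cvg0P; exact: C_strong.
move=> n t; have -> : C_ b n t = C_ b n (clamp T t) by rewrite /C_ /mom uc_clamp.
have := hd n s1 (clamp T t) s1T (clamp_itv T0 t).
rewrite mass0_eq0// mulr0 !mul0r !subr0 => h.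
by rewrite -[X in `|X|](subrK (C_ b n s1)) (le_trans (ler_normD _ _))// lerD.
Qed.

(** The profile eta = x chi with amplitude n is x chi(x / n), which tends to x. The Hilbert term is
    of order 1 / n, the term in b'' tends to the mass of b'', which vanishes, and in the quadratic
    term eta'(x / n) tends to 1. *)
Lemma xmoment_increment b s t (P : R -> R) : testfun b ->
  {within `[0, T], continuous P} ->
  (forall t, 0 < t < T -> is_derive t 1 P (2^-1 * energy b t)) ->
  0 <= s <= T -> 0 <= t <= T -> xmoment b t - xmoment b s = P t - P s.
Proof.
move=> tb cP dP sT tT; have [chi [tchi chi0 _]] := exists_cutoff.
pose eta x : R := x * chi x.
have teta : testfun eta by apply: testfunMl => //; exact: smooth1_id.
have deta : D1 eta 0 = 1.
  rewrite /eta derive1M; [|exact: smooth1_id|exact: testfun_smooth].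
  by rewrite mul0r addr0 derive1_id mul1r.
have tdeta := testfun_derive teta.
have [H H0 hH] := testfun_hilb_bounded (testfun_derive tdeta).
have [A A0 hA] := testfun_bounded tdeta.
have [B B0 hB] := testfun_bounded tb.
have [X X0 hX] := testfun_bounded tchi.
have [L L0 hL] := testfun_lipschitz tdeta.
have [L' L'0 hL'] := testfun_lipschitz tchi.
have tb2 := testfun_derive (testfun_derive tb).
pose k (n : nat) := (r_ n)^-1.
have kr (n : nat) : k n * r_ n ^+ 2 = r_ n by rewrite /k; field; exact: rn0.
have kr1 (n : nat) : k n * r_ n = 1 by rewrite /k mulVf.
have [|d d0 hd] := @limit_evolution (fun n => mom (tens (Sc k eta n) b)) _
    P _ T0 (fun n => @cSc k eta b n teta tb) cP (fun n t => @evo k eta b n t teta tb) dP.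
  have dEta n : in_dual (tens (fun x => D1 eta (r_ n * x + 0)) (D1 (D1 b))).
    apply: testfun_dual => //; exact: testfun_affine.
  apply: (@eq_vanish _ (fun n t => mom (tens (fun x => r_ n * hilb (D1 (D1 eta)) (r_ n * x + 0)) b) t +
     mom (tens (fun x => D1 eta (r_ n * x + 0) - 1) (D1 (D1 b))) t +
     2^-1 * \int[planeleb]_p (uc T u t p ^+ 2 *
       tens (fun x => D1 eta (r_ n * x + 0) - 1) b p))).
    move=> n t'; rewrite kr kr1; under [X in mom (tens X (D1 _))]eq_fun do rewrite mul1r.
    rewrite (tens_momB t' (dEta n) (mass_dual tb2)) -/(mass _ t') mass_eq0// subr0.
    rewrite -addrA -mulrBr /energy; congr (_ + _ * _).
    have [K1 hK1] := testfun_quad (testfun_affine 0 (rn0 n) tdeta) tb.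
    have [K2 hK2] := energy_quad tb.
    have j1 := @rintegrable_quad _ _ _ (measurable_tens (measurable_affine _ _
      (testfun_measurable tdeta)) (testfun_measurable tb)) hK1 _ (uc_in_weighted T0 hu t').
    have j2 := @rintegrable_quad _ _ _ (measurable_tens (@measurable_cst _ _ _ _ _ (1 : R))
      (testfun_measurable tb)) hK2 _ (uc_in_weighted T0 hu t').
    rewrite (_ : tens (fun x => 1 * _) b = tens (fun x => D1 eta (r_ n * x + 0)) b); last first.
      by congr tens; apply/funext => x; rewrite mul1r.
    rewrite -(RintegralB measurableT j1 j2); apply: eq_Rintegral => p _.
    by rewrite /tens mulrBl mulrBr.
  apply: vanishD; first apply: vanishD.
  - apply: (vanish_tens_small T0 hu (C := H)) => //.
      by move=> n; exact: (msc _ _ (testfun_measurable_hilb (testfun_derive tdeta))).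
    by move=> n x; apply: scaled_bound => //; exact: ltW.
  - apply: (vanish_tens_small T0 hu (C := L)) => //.
      move=> n; apply: measurable_funB => //.
      exact: (measurable_affine _ _ (testfun_measurable tdeta)).
    move=> n x; rewrite -[X in _ - X]deta (le_trans (hL _ _))//.
    rewrite -mulrA ler_wpM2l// addr0 subr0 normrM (ger0_norm (ltW (rgt0 n))).
    by rewrite ler_wpM2l ?(ltW (rgt0 n))// lerDr.
  - apply: vanishZ; apply: (vanish_quad T0 hu (C := L * B)).
      move=> n; apply: measurable_tens; last exact: (testfun_measurable tb).
      apply: measurable_funB => //.
      exact: (measurable_affine _ _ (testfun_measurable tdeta)).
    move=> n [x y]; rewrite /tens/= normrM.
    apply: (@le_trans _ _ (L * (r_ n * (bracket2 (x, y)) ^+ 2) * B)).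
      apply: ler_pM => //; rewrite -[X in _ - X]deta (le_trans (hL _ _))//.
      rewrite ler_wpM2l// addr0 subr0 normrM (ger0_norm (ltW (rgt0 n))).
      rewrite ler_wpM2l ?(ltW (rgt0 n))// (le_trans _ (norm_le_bracket x y))//.
    by rewrite le_eqVlt; apply/orP; left; apply/eqP; ring.
have [e e0 he] : vanish (fun n => mom (tens (fun x => Sc k eta n x - x) b)).
  apply: (vanish_tens_quad T0 hu (C := L' + X + 1)) => //.
  + by move=> n; apply: measurable_funB => //; exact: (msc _ _ (testfun_measurable teta)).
  + move=> n x; rewrite /Sc /eta /k addr0 (_ : _ - x = x * (chi (r_ n * x) - 1)).
      rewrite normrM mulrC ler_wpM2r// (le_trans (ler_normB _ _))// normr1 lerD//.
      by rewrite (le_trans (hX _))// lerDr.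
    by field; exact: rn0.
  + move=> n x; rewrite /Sc /eta /k addr0 (_ : _ - x = x * (chi (r_ n * x) - 1)).
      rewrite normrM -[X in _ - X]chi0.
      apply: (@le_trans _ _ (`|x| * (L' * (r_ n * `|x|)))).
        rewrite ler_wpM2l// (le_trans (hL' _ _))// subr0 normrM.
        by rewrite (ger0_norm (ltW (rgt0 n))).
      have -> : x ^+ 2 = `|x| ^+ 2 by rewrite real_normK// num_real.
      rewrite (_ : `|x| * _ = L' * (r_ n * `|x| ^+ 2)); last by ring.
      rewrite -mulrA ler_wpM2r//; first by rewrite mulr_ge0 ?sqr_ge0// ltW.
      by rewrite -addrA lerDl addr_ge0.
    by field; exact: rn0.
have E n t' : mom (tens (fun x => Sc k eta n x - x) b) t' =
    mom (tens (Sc k eta n) b) t' - xmoment b t'.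
  exact: (tens_momB t' (Sc_dual k n teta tb) (xmoment_dual tb)).
apply/eqP; rewrite -subr_eq0; apply/eqP.
apply: (lim0 (d := fun n => d n + e n + e n)).
  by rewrite -[X in _ --> X]addr0 -[X in _ --> X + _]addr0; apply: cvgD => //; exact: cvgD.
move=> n; have h1 := he n t; have h2 := he n s; have h3 := hd n s t sT tT.
move: h1 h2 h3; rewrite !E => h1 h2 h3.
rewrite (_ : _ - _ - _ = ((mom (tens (Sc k eta n) b) t - P t) - (mom (tens (Sc k eta n) b) s - P s))
  - (mom (tens (Sc k eta n) b) t - xmoment b t) + (mom (tens (Sc k eta n) b) s - xmoment b s)); last by ring.
rewrite (le_trans (ler_normD _ _))// lerD//.
by rewrite (le_trans (ler_normB _ _))// lerD.
Qed.

(** The profile is g, with amplitude n^3. The Hilbert term is n h0 + c x up to C x^2 / n: the first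
    part meets the vanishing mass, the second gives c times the first moment. The term in b'' is the
    moment with profile g', already known to vanish. Since the tested quantity tends to 0 at both
    strong times, the first moment has integral 0 between them. *)
Lemma xmoment_integral b (J : R -> R) : testfun b ->
  {within `[0, T], continuous J} ->
  (forall t, 0 < t < T -> is_derive t 1 J (xmoment b t)) -> J s1 = J s2.
Proof.
move=> tb cJ dJ; have tb2 := testfun_derive (testfun_derive tb).
have [A A0 hA] := testfun_bounded tdg.
have [B B0 hB] := testfun_bounded tb.
have [G G0 hG] := testfun_bounded tg.
pose h0 := hilb (D1 (D1 g)) 0.
have mH2 : measurable_fun [set: R] (hilb (D1 (D1 g))) by exact: testfun_measurable_hilb.
have [Hb Hb0 hHb] := testfun_hilb_bounded tddg.
have kr (n : nat) : k3 n * r_ n ^+ 2 = (r_ n)^-1 by rewrite /k3; field; exact: rn0.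
have kr1 (n : nat) : k3 n * r_ n = k2 n by rewrite /k3 /k2; field; exact: rn0.
have dcJ t : 0 < t < T -> is_derive t 1 (fun t => c * J t) (c * xmoment b t).
  by move=> /dJ h; exact: is_deriveZ.
have ccJ : {within `[0, T], continuous (fun t => c * J t)}.
  by move=> x; apply: cvgM; [exact: cvg_cst|exact: cJ].
have [|d d0 hd] := @limit_evolution (A_ b) _ _ _ T0
    (fun n => @cSc k3 g b n tg tb) ccJ (fun n t => @evo k3 g b n t tg tb) dcJ.
  apply: (@eq_vanish _ (fun n t => mom (tens (fun x => (r_ n)^-1 *
      (hilb (D1 (D1 g)) (r_ n * x + 0) - h0 - c * (r_ n * x + 0))) b) t +
     C_ (D1 (D1 b)) n t +
     2^-1 * \int[planeleb]_p (uc T u t p ^+ 2 *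
       tens (fun x => k2 n * D1 g (r_ n * x + 0)) b p))).
    have alg (x y z w : R) : x + y + z - w = x - w + y + z by ring.
    move=> n t; rewrite kr kr1 alg; congr (_ + _ + _).
    pose c1 := tens (fun x => (r_ n)^-1 * hilb (D1 (D1 g)) (r_ n * x + 0)) b.
    have d1 : in_dual c1.
      apply: (in_dual_tens (A := (r_ n)^-1 * Hb) (B := B)) => //.
      - by apply: msc.
      - exact: testfun_measurable.
      - by move=> x; rewrite normrM (ger0_norm (rV0 n)) ler_wpM2l.
    have d2 : in_dual (tens (fun x => (r_ n)^-1 * h0 * (fun=> 1) x) b).
      have m2 : measurable_fun [set: R] (fun x : R => (r_ n)^-1 * h0 * (fun=> 1) x).
        exact: measurable_funM.
      apply: (in_dual_tens (A := `|(r_ n)^-1 * h0|) m2 (testfun_measurable tb) _ hB).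
      by move=> x; rewrite mulr1.
    have d3 : in_dual (tens (fun x => c * id x) b).
      apply: (@in_dual_linear _ _ _ `|c|) => //.
      - by apply: measurable_funM.
      - by move=> x; rewrite normrM ler_wpM2l// lerDr.
    rewrite (_ : tens (fun x => (r_ n)^-1 * (_ - c * _)) b = tens (fun x =>
      ((r_ n)^-1 * hilb (D1 (D1 g)) (r_ n * x + 0) - (r_ n)^-1 * h0 * (fun=> 1) x)
      - c * id x) b); last first.
      by apply/funext => p; rewrite /tens; field; exact: rn0.
    have d12 : in_dual (tens (fun x => (r_ n)^-1 * hilb (D1 (D1 g)) (r_ n * x + 0)
        - (r_ n)^-1 * h0 * (fun=> 1) x) b).
      apply: (in_dual_tens (A := (r_ n)^-1 * Hb + `|(r_ n)^-1 * h0|) (B := B)) => //.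
      - by apply: measurable_funB; [exact: msc|exact: measurable_funM].
      - exact: testfun_measurable.
      - move=> x; rewrite mulr1 (le_trans (ler_normB _ _))// lerD2r.
        by rewrite normrM (ger0_norm (rV0 n)) ler_wpM2l.
    rewrite (tens_momB t d12 d3) (tens_momB t d1 d2).
    rewrite (tens_momZ _ t (mass_dual tb)) (tens_momZ _ t (xmoment_dual tb)).
    by rewrite -/(mass b t) mass_eq0// mulr0 subr0.
  apply: vanishD; first apply: vanishD; last 2 first.
  - exact: C_vanish.
  - apply: vanishZ; apply: (vanish_quad T0 hu (C := A * B)).
      move=> n; apply: measurable_tens; last exact: testfun_measurable.
      by apply: msc; exact: testfun_measurable.
    move=> n [x y]; rewrite /tens/= normrM.
    (* The fourth power is taken against the amplitude n^2: what is left is x^4 / n^2, within the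
       square of the bracket. *)
    have [_ _ h] := supp12_le (r_ n * x + 0) sdg hA.
    apply: (@le_trans _ _ (A * (r_ n * bracket2 (x, y) ^+ 2) * B)); last first.
      by rewrite le_eqVlt; apply/orP; left; apply/eqP; ring.
    apply: ler_pM => //; rewrite normrM ger0_norm ?sqr_ge0// /k2.
    rewrite exprVn ler_pdivrMl ?exprn_gt0// (le_trans h)// addr0 exprMn.
    rewrite (_ : r_ n ^+ 2 * _ = A * (r_ n ^+ 3 * bracket2 (x, y) ^+ 2)); last by ring.
    rewrite ler_wpM2l//; apply: ler_pM => //.
    - by rewrite exprn_ge0// ltW.
    - by rewrite -[4%N]/(2 * 2)%N exprM sqr_ge0.
    - by rewrite [leLHS]exprS ler_piMl// exprn_ge0// ltW.
  - have C0 : 0 <= C.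
      by have [_ h] := H2 1; have := le_trans (normr_ge0 _) h; rewrite normr1 mulr1.
    apply: (vanish_tens_quad T0 hu (C := C)) => //.
    + move=> n; apply: measurable_funM => //; apply: measurable_funB.
        by apply: measurable_funB => //; exact: measurable_affine.
      by apply: measurable_funM => //; apply: measurable_funD => //; exact: measurable_funM.
    + move=> n x; have [_ h] := H2 (r_ n * x + 0).
      rewrite normrM (ger0_norm (rV0 n)) ler_pdivrMl// (le_trans h)// addr0.
      by rewrite normrM (ger0_norm (ltW (rgt0 n))) mulrCA.
    + move=> n x; have [h _] := H2 (r_ n * x + 0).
      rewrite normrM (ger0_norm (rV0 n)) ler_pdivrMl// (le_trans h)// addr0.
      by rewrite exprMn le_eqVlt; apply/orP; left; apply/eqP; ring.
have c1 := A_strong tb st1; have c2 := A_strong tb st2.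
have e : c * (J s2 - J s1) = 0.
  have h n : `|c * (J s2 - J s1)| <= d n + `|A_ b n s1| + `|A_ b n s2|.
    rewrite (_ : c * _ = - ((A_ b n s2 - c * J s2) -
      (A_ b n s1 - c * J s1)) - A_ b n s1 + A_ b n s2); last by ring.
    rewrite (le_trans (ler_normD _ _))// lerD// (le_trans (ler_normB _ _))// lerD//.
    by rewrite normrN hd.
  apply: lim0 h; rewrite -[X in _ --> X]addr0; apply: cvgD; last exact/norm_cvg0P.
  by rewrite -[X in _ --> X]addr0; apply: cvgD => //; exact/norm_cvg0P.
by move/eqP : e; rewrite mulf_eq0 (negbTE c0)/= subr_eq0 => /eqP.
Qed.

End strong_times.

Lemma energy_vanishes b (s1 s2 s3 : R) : testfun b ->
  0 <= s1 -> s1 < s2 -> s2 < s3 -> s3 <= T ->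
  weighted_L2 (7 / 2) (uc T u s1) -> weighted_L2 (7 / 2) (uc T u s2) ->
  weighted_L2 (7 / 2) (uc T u s3) ->
  exists2 s : R, 0 <= s <= T & energy b s = 0.
Proof.
move=> tb s1_ s12 s23 s3T w1 w2 w3.
have [g [c [C [tg sg c0 H2 H3]]]] := @far_field_profile R.
(* The base point -1 makes the primitives differentiable on all of [0, T], both endpoints
   included. *)
have [J dJ] := @continuous_primitive R _ (-1) (continuous_xmoment tb).
have cE : continuous (fun t => 2^-1 * energy b t).
  by move=> t; apply: cvgM; [exact: cvg_cst|exact: continuous_energy].
have [P dP] := @continuous_primitive R _ (-1) cE.
have cont (F D : R -> R) (x y : R) : (forall x : R, -1 < x -> is_derive x 1 F (D x)) ->
    0 <= x -> {within `[x, y], continuous F}.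
  move=> dF x0; apply: derivable_within_continuous => z; rewrite in_itv/= => /andP[z0 _].
  by have [] := dF z; [rewrite (lt_le_trans _ (le_trans x0 z0))// oppr_lt0|].
have rolle (F D : R -> R) (x y : R) : (forall x : R, -1 < x -> is_derive x 1 F (D x)) ->
    0 <= x -> x < y -> F x = F y -> exists2 z : R, x < z < y & D z = 0.
  move=> dF x0 xy e.
  have gt1 z : x < z -> -1 < z.
    by move=> xz; rewrite (lt_trans _ (le_lt_trans x0 xz))// oppr_lt0.
  have [z|z] := Rolle xy _ (cont F D x y dF x0) e.
    by rewrite in_itv/= => /andP[/gt1/dF []].
  rewrite in_itv/= => /andP[xz zy] dz; exists z; first by rewrite xz.
  have dz' := dF z (gt1 z xz).
  by rewrite -(@derive_val _ _ _ _ _ _ _ dz') (@derive_val _ _ _ _ _ _ _ dz).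
have lt0m1 t : 0 < t < T -> -1 < t.
  by move=> /andP[t0 _]; rewrite (lt_trans _ t0)// oppr_lt0.
have s1T : 0 <= s1 <= T by rewrite s1_ (le_trans (ltW s12))// (le_trans (ltW s23)).
have s2T : 0 <= s2 <= T by rewrite (le_trans s1_ (ltW s12)) (le_trans (ltW s23)).
have s3T' : 0 <= s3 <= T by rewrite s3T (le_trans s1_)// (le_trans (ltW s12))// ltW.
have e12 : J s1 = J s2.
  apply: (xmoment_integral tg sg c0 H2 H3 s1T s2T (negbT (lt_eqF s12)) w1 w2 tb) => //.
    exact: (cont J _ _ _ dJ).
  by move=> t /lt0m1; exact: dJ.
have e23 : J s2 = J s3.
  apply: (xmoment_integral tg sg c0 H2 H3 s2T s3T' (negbT (lt_eqF s23)) w2 w3 tb) => //.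
    exact: (cont J _ _ _ dJ).
  by move=> t /lt0m1; exact: dJ.
have [x1 /andP[a1 b1] z1] := rolle J _ s1 s2 dJ s1_ s12 e12.
have [x2 /andP[a2 b2] z2] := rolle J _ s2 s3 dJ (le_trans s1_ (ltW s12)) s23 e23.
have x1p : 0 <= x1 by rewrite (le_trans s1_)// ltW.
have x12 : x1 < x2 by exact: lt_trans a2.
have x1T : 0 <= x1 <= T by rewrite x1p (le_trans (ltW b1))// (le_trans (ltW s23)).
have x2T : 0 <= x2 <= T by rewrite (le_trans x1p (ltW x12)) (le_trans (ltW b2)).
have e : P x1 = P x2.
  have := xmoment_increment tg sg c0 H3 s1T s2T (negbT (lt_eqF s12)) w1 w2 tb
    (cont P _ 0 T dP (lexx 0)) (fun t h => dP t (lt0m1 t h)) x1T x2T.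
  by rewrite z1 z2 subrr => /esym/eqP; rewrite subr_eq0 => /eqP.
have [s /andP[sx1 sx2] /eqP] := rolle P _ x1 x2 dP x1p x12 e.
rewrite mulf_eq0 invr_eq0 pnatr_eq0/= => /eqP es; exists s => //.
by case/andP : x2T => _ h; rewrite (le_trans x1p (ltW sx1)) (le_trans (ltW sx2)).
Qed.

End moment_identities.


(** * Fejer means and Plancherel's inequality *)

Section fejer.
Context {R : realType}.
Implicit Types k z : R.

(** A frequency cutoff whose transform [fejer] is non-negative, so that its averages can be bounded
    by the mass of the kernel. *)
Definition tent k : R := Num.max 0 (1 - `|k|).

Lemma tent_ge0 k : 0 <= tent k. Proof. by rewrite /tent le_max lexx. Qed.

Lemma tent_le1 k : tent k <= 1.
Proof. by rewrite /tent ge_max ler01 gerBl normr_ge0. Qed.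

Lemma tent_eq0 k : 1 <= `|k| -> tent k = 0.
Proof. by move=> h; apply/max_idPl; rewrite subr_le0. Qed.

Lemma tentN k : tent (- k) = tent k. Proof. by rewrite /tent normrN. Qed.

Lemma continuous_tent : continuous tent.
Proof.
move=> k; apply: (@continuous_max _ _ (fun=> 0) (fun k : R => 1 - `|k|)).
  exact: cst_continuous.
by apply: cvgB; [exact: cvg_cst|exact: norm_continuous].
Qed.

Lemma measurable_tent : measurable_fun [set: R] tent.
Proof. exact: continuous_measurable_fun continuous_tent. Qed.

Lemma rintegrable_tent : rintegrable leb tent.
Proof.
apply: (@le_rintegrable _ _ _ leb _ (fun k => 2 * lorentz k)).
- exact: measurable_tent.
- move=> k; rewrite ger0_norm ?tent_ge0// /tent ge_max.
  rewrite mulr_ge0 ?lorentz_ge0//=.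
  rewrite /lorentz ler_pdivlMr ?onesqr_gt0// -(real_normK (num_real k)).
  have := normr_ge0 k; set a := `|k| => a0.
  nra.
- exact/rintegrableZ/rintegrable_lorentz.
Qed.

Definition fejer z : R := \int[leb]_k (tent k * cos (k * z)).

Lemma measurable_cosM z : measurable_fun [set: R] (fun k => cos (k * z)).
Proof.
by apply: measurableT_comp; [exact: continuous_measurable_fun (@continuous_cos R)|
  exact: measurable_funM].
Qed.

Lemma rintegrable_tent_cos z : rintegrable leb (fun k => tent k * cos (k * z)).
Proof.
apply: (@le_rintegrable _ _ _ leb _ _ _ _ rintegrable_tent).
  by apply: measurable_funM; [exact: measurable_tent|exact: measurable_cosM].
by move=> k; rewrite normrM ger0_norm ?tent_ge0// ler_piMr ?tent_ge0// ler_norml cos_geN1 cos_le1.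
Qed.

(** The primitive found by parts; s = 1 and s = -1 serve the two halves of the tent. *)
Lemma is_derive_tent_cos (s z k : R) : z != 0 -> is_derive k 1
  (fun k => (1 - s * k) * (sin (k * z) / z) - s * (cos (k * z) / z ^+ 2))
  ((1 - s * k) * cos (k * z)).
Proof.
move=> z0.
have d1 : is_derive k 1 (fun k => sin (k * z) / z) (cos (k * z)).
  have h := @is_derive1_affine _ sin z 0 k _ (is_derive_sin _).
  have h2 := is_deriveM h (is_derive1_cst z^-1 k).
  rewrite (_ : (fun k => sin (k * z) / z) =
    (fun x => sin (z * x + 0)) * (fun=> z^-1)); last first.
    by apply/funext => x; rewrite fctE/= addr0 [z * _]mulrC.
  by apply: (is_derive_eq h2); rewrite /GRing.scale/= addr0 [z * k]mulrC mulr0 add0r mulrA mulVf// mul1r.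
have d2 : is_derive k 1 (fun k => cos (k * z) / z ^+ 2) (- sin (k * z) / z).
  have h := @is_derive1_affine _ cos z 0 k _ (is_derive_cos _).
  have h2 := is_deriveM h (is_derive1_cst (z ^+ 2)^-1 k).
  rewrite (_ : (fun k => cos (k * z) / z ^+ 2) =
    (fun x => cos (z * x + 0)) * (fun=> (z ^+ 2)^-1)); last first.
    by apply/funext => x; rewrite fctE/= addr0 [z * _]mulrC.
  apply: (is_derive_eq h2); rewrite /GRing.scale/= addr0 [z * k]mulrC mulr0 add0r.
  by field.
have d3 : is_derive k 1 (fun k => 1 - s * k) (- s).
  have := @is_derive1_affine _ id (- s) 1 k 1 (is_derive_id _ _).
  by rewrite mulr1; congr is_derive; apply/funext => x; rewrite mulNr addrC.
have d4 := is_deriveB (is_deriveM d3 d1) (is_deriveM (is_derive1_cst s k) d2).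
by apply: (is_derive_eq d4); rewrite /GRing.scale/=; field.
Qed.

Lemma fejerE z : z != 0 -> fejer z = 2 * (1 - cos z) / z ^+ 2.
Proof.
move=> z0.
have j := rintegrable_tent_cos z.
have cD (s : R) : continuous (fun k => (1 - s * k) * cos (k * z)).
  move=> k; have c1 : (1 - s * x) @[x --> k] --> 1 - s * k.
    by apply: cvgB; [exact: cvg_cst|apply: cvgM; [exact: cvg_cst|exact: cvg_id]].
  have c2 : cos (x * z) @[x --> k] --> cos (k * z).
    have c3 : x * z @[x --> k] --> k * z by apply: cvgM; [exact: cvg_id|exact: cvg_cst].
    exact: (cvg_comp _ _ c3 (@continuous_cos R _)).
  exact: (cvgM c1 c2).
have -> : fejer z = \int[leb]_(k in `[(-1 : R), 1]) (tent k * cos (k * z)).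
  rewrite Rintegral_mkcond; apply: eq_Rintegral => k _; rewrite patchE.
  case: ifPn => // /negP; rewrite inE/= in_itv/= -ler_norml => /negP.
  by rewrite -ltNge => /ltW k1; rewrite tent_eq0// mul0r.
have h01 : \int[leb]_(k in `[(0 : R), 1]) (tent k * cos (k * z)) = (1 - cos z) / z ^+ 2.
  rewrite (@eq_Rintegral _ _ _ leb _ (fun k => (1 - 1 * k) * cos (k * z))); last first.
    move=> k; rewrite inE/= in_itv/= => /andP[k0 k1]; rewrite /tent ger0_norm// mul1r.
    by rewrite (max_idPr _)// subr_ge0.
  rewrite (Rintegral_itv_derive ltr01 (cD 1) (fun k _ => is_derive_tent_cos 1 k z0)).
  by rewrite !mul0r !mul1r sin0 cos0; field.
have h10 : \int[leb]_(k in `[(-1 : R), 0]) (tent k * cos (k * z)) = (1 - cos z) / z ^+ 2.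
  rewrite (@eq_Rintegral _ _ _ leb _ (fun k => (1 - (-1) * k) * cos (k * z))); last first.
    move=> k; rewrite inE/= in_itv/= => /andP[k0 k1]; rewrite /tent ler0_norm// mulN1r.
    by rewrite (max_idPr _)// subr_ge0 lerNl.
  rewrite (Rintegral_itv_derive (ltrN10 R) (cD (-1)) (fun k _ => is_derive_tent_cos (-1) k z0)).
  by rewrite mul0r sin0 cos0 !mulN1r cosN; field.
have := @Rintegral_itvB R (fun k => tent k * cos (k * z)) (BLeft (-1)) (BRight 1) 0.
move=> /(_ (integrableS measurableT _ (@subsetT _ _) j)) h.
have /h : (measurable `[(-1 : R), 1]%classic) by [].
rewrite !bnd_simp => /(_ (ltW (ltrN10 R)) ler01) {}h.
move: h; rewrite Rintegral_itv_obnd_cbnd.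
  by rewrite h01 h10 => /eqP; rewrite subr_eq => /eqP ->; field.
exact: (integrableS measurableT _ (@subsetT _ _) j).
Qed.

Lemma fejer_ge0 z : 0 <= fejer z.
Proof.
have [->|z0] := eqVneq z 0.
  by apply: Rintegral_ge0 => k _; rewrite mulr0 cos0 mulr1 tent_ge0.
by rewrite fejerE// divr_ge0 ?sqr_ge0// mulr_ge0// subr_ge0 cos_le1.
Qed.

Lemma fejerN z : fejer (- z) = fejer z.
Proof. by apply: eq_Rintegral => k _; rewrite mulrN cosN. Qed.

Lemma measurable_fejer : measurable_fun [set: R] fejer.
Proof.
apply: (@measurable_Rintegral_fst _ _ _ _ _ leb (fun p => tent p.1 * cos (p.1 * p.2))).
apply: measurable_funM; first by apply: measurable_fst_comp; exact: measurable_tent.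
apply: measurableT_comp; first exact: continuous_measurable_fun (@continuous_cos R).
exact: measurable_funM.
Qed.

(** Near 0 the kernel is at most the integral of the tent, and elsewhere at most 4 / z^2. *)
Lemma fejer_le : exists2 C : R, 0 <= C & forall z, fejer z <= C * lorentz z.
Proof.
set m := \int[leb]_k tent k.
have m0 : 0 <= m by apply: Rintegral_ge0 => k _; exact: tent_ge0.
exists (2 * m + 8) => [|z]; first by rewrite addr_ge0// mulr_ge0.
rewrite /lorentz ler_pdivlMr ?onesqr_gt0//.
have b1 : fejer z <= m.
  apply: (le_trans (ler_norm _)); apply: (@le_norm_Rintegral _ _ _ leb).
  - by apply: measurable_funM; [exact: measurable_tent|exact: measurable_cosM].
  - by move=> k; rewrite normrM ger0_norm ?tent_ge0// ler_piMr ?tent_ge0// ler_norml cos_geN1 cos_le1.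
  - exact: rintegrable_tent.
have b2 : 1 < z ^+ 2 -> fejer z * z ^+ 2 <= 4.
  move=> z1; have z0 : z != 0 by apply: contraTneq z1 => ->; rewrite expr0n/= ltNge ler01.
  rewrite fejerE// divfK ?expf_neq0//; have := cos_geN1 z; lra.
have := fejer_ge0 z; have := sqr_ge0 z.
move: (fejer z) (z ^+ 2) b1 b2 => F y b1 b2 y0 F0.
rewrite mulrDr mulr1; have [y1|/b2 {}b2] := leP y 1; last by lra.
have : F * y <= F by rewrite ler_piMr.
lra.
Qed.

Lemma rintegrable_fejer : rintegrable leb fejer.
Proof.
have [C C0 h] := fejer_le; apply: (@le_rintegrable _ _ _ leb _ (fun z => C * lorentz z)).
- exact: measurable_fejer.
- by move=> z; rewrite ger0_norm ?fejer_ge0.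
- exact/rintegrableZ/rintegrable_lorentz.
Qed.

(* This is [2 * pi], but only its positivity matters: inversion is needed up to a
   constant factor. *)
Definition fejer_mass : R := \int[leb]_z fejer z.

(** For |z - pi| <= pi / 2 the cosine is non-positive, so the kernel is at least 2 / z^2, with z <=
    3 pi / 2. *)
Lemma fejer_mass_gt0 : 0 < fejer_mass.
Proof.
have p0 := pi_gt0 R.
set c : R := 2 / (3 * pi / 2) ^+ 2.
have c0 : 0 < c by rewrite divr_gt0// exprn_gt0// divr_gt0// mulr_gt0.
have low z : c * b2r (`|pi - z| <= pi / 2) <= fejer z.
  rewrite /b2r; case: ifPn => [|_]; last by rewrite mulr0 fejer_ge0.
  rewrite ler_norml => /andP[h1 h2]; rewrite mulr1.
  have z0 : z != 0 by apply: contraTneq h2 => ->; rewrite subr0 -ltNge; lra.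
  have cz : cos z <= 0.
    have -> : z = (z - pi) + pi by rewrite subrK.
    by rewrite cosDpi oppr_le0 cos_ge0_pihalf//; lra.
  rewrite fejerE// /c; apply: ler_pM.
  - by [].
  - by rewrite invr_ge0 sqr_ge0.
  - lra.
  - rewrite lef_pV2 ?posrE; [|by apply: exprn_gt0; lra..].
    by rewrite lerXn2r ?nnegrE//; lra.
have j := rintegrable_near pi (pi / 2 : R).
have h : 0 < \int[leb]_z (c * b2r (`|pi - z| <= pi / 2)).
  by rewrite RintegralZl// Rintegral_near; [rewrite pmulr_rgt0//|]; lra.
rewrite (lt_le_trans h)//.
by apply: le_Rintegral => //; [exact: rintegrableZ|exact: rintegrable_fejer].
Qed.

Lemma Rintegral_odd (f : R -> R) : rintegrable leb f -> (forall x, f (- x) = - f x) ->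
  \int[leb]_x f x = 0.
Proof.
move=> jf fo; have := @Rintegral_affine _ (-1) 0 (negbT (lt_eqF (ltrN10 R))) f jf.
rewrite normrN1 divr1.
under eq_Rintegral do rewrite mulN1r addr0 fo -mulN1r.
by rewrite RintegralZl// mulN1r => h; lra.
Qed.

Lemma tent_scaled_cos (r z : R) : 0 < r ->
  \int[leb]_k (tent (r * k) * cos (k * z)) = r^-1 * fejer (r^-1 * z).
Proof.
move=> r0; have rn : r != 0 by rewrite gt_eqF.
have := Rintegral_affine 0 rn (rintegrable_tent_cos (r^-1 * z)).
rewrite gtr0_norm// -/(fejer _) [_ / r]mulrC => <-; apply: eq_Rintegral => k _.
by rewrite addr0; congr (_ * cos _); field.
Qed.

Lemma rintegrable_tent_scaled (r : R) : 0 < r -> rintegrable leb (fun k => tent (r * k)).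
Proof.
move=> r0; have rn : r != 0 by rewrite gt_eqF.
have := @rintegrable_affine _ r 0 rn _ rintegrable_tent.
by under eq_fun do rewrite addr0.
Qed.

Lemma rintegrable_tent_scaledM (r : R) (g : R -> R) : 0 < r -> measurable_fun [set: R] g ->
  (forall x, `|g x| <= 1) -> rintegrable leb (fun k => tent (r * k) * g k).
Proof.
move=> r0 mg g1; apply: (@le_rintegrable _ _ _ leb _ _ _ _ (rintegrable_tent_scaled r0)).
  apply: measurable_funM => //; apply: measurableT_comp; first exact: measurable_tent.
  exact: measurable_funM.
by move=> k; rewrite normrM ger0_norm ?tent_ge0// ler_piMr ?tent_ge0.
Qed.

Lemma tent_scaled_sin (r z : R) : 0 < r ->
  \int[leb]_k (tent (r * k) * sin (k * z)) = 0.
Proof.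
move=> r0; apply: Rintegral_odd => [|k].
  apply: rintegrable_tent_scaledM => // [|k]; last by rewrite ler_norml sin_geN1 sin_le1.
  by apply: measurableT_comp; [exact: continuous_measurable_fun (@continuous_sin R)|
    exact: measurable_funM].
by rewrite mulNr sinN mulrN mulrN tentN.
Qed.

End fejer.

(** * Fourier integrals in the plane and their Fejer means *)

Section plane_fourier.
Context {R : realType}.
Implicit Types (f : R * R -> R) (p q k z : R * R).

Definition phase p k : R := p.1 * k.1 + p.2 * k.2.

Definition tent2 (r : R) k : R := tent (r * k.1) * tent (r * k.2).

(** The kernel for the frequency cutoff 1 / r. As r tends to 0 it concentrates at the origin, its
    mass remaining [fejer_mass ^+ 2]. *)
Definition fejer2 (r : R) z : R :=
  (r^-1 * fejer (r^-1 * z.1)) * (r^-1 * fejer (r^-1 * z.2)).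

Lemma tent2_ge0 r k : 0 <= tent2 r k. Proof. by rewrite mulr_ge0 ?tent_ge0. Qed.

Lemma tent2_le1 r k : tent2 r k <= 1.
Proof. by rewrite mulr_ile1 ?tent_ge0 ?tent_le1. Qed.

Lemma measurable_tent2 r : measurable_fun [set: plane R] (tent2 r).
Proof.
apply: measurable_funM; (apply: measurableT_comp; first exact: measurable_tent);
  exact: measurable_funM.
Qed.

Lemma rintegrable_tent2 r : 0 < r -> rintegrable planeleb (tent2 r).
Proof.
move=> r0; apply: (rintegrable_plane (measurable_tent2 r)
  _ (rintegrable_tent_scaled r0) (rintegrable_tent_scaled r0)) => x y.
by rewrite ger0_norm ?tent2_ge0.
Qed.

Lemma fejer2_ge0 r z : 0 < r -> 0 <= fejer2 r z.
Proof. by move=> r0; rewrite !mulr_ge0 ?fejer_ge0// invr_ge0 ltW. Qed.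

Lemma fejer2N r p q : fejer2 r (p - q) = fejer2 r (q - p).
Proof.
rewrite -(opprB q p) /fejer2; congr (_ * _ * (_ * _)).
  by rewrite -[in RHS]fejerN -mulrN.
by rewrite -[in RHS]fejerN -mulrN.
Qed.

Lemma measurable_phase_l p : measurable_fun [set: plane R] (phase p).
Proof. by apply: measurable_funD; exact: measurable_funM. Qed.

Lemma tent2_cos r z : 0 < r ->
  \int[planeleb]_k (tent2 r k * cos (phase z k)) = fejer2 r z.
Proof.
move=> r0.
have mc (y : R) : measurable_fun [set: R] (fun x => cos (x * y)) by exact: measurable_cosM.
have ms (y : R) : measurable_fun [set: R] (fun x => sin (x * y)).
  by apply: measurableT_comp; [exact: continuous_measurable_fun (@continuous_sin R)|
    exact: measurable_funM].
have bc (y x : R) : `|cos (x * y)| <= 1 by rewrite ler_norml cos_geN1 cos_le1.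
have bs (y x : R) : `|sin (x * y)| <= 1 by rewrite ler_norml sin_geN1 sin_le1.
have jc y := rintegrable_tent_scaledM r0 (mc y) (bc y).
have js y := rintegrable_tent_scaledM r0 (ms y) (bs y).
have E (k : R * R) : tent2 r k * cos (phase z k) =
    (tent (r * k.1) * cos (k.1 * z.1)) * (tent (r * k.2) * cos (k.2 * z.2)) -
    (tent (r * k.1) * sin (k.1 * z.1)) * (tent (r * k.2) * sin (k.2 * z.2)).
  rewrite /phase cosD /tent2 [z.1 * _]mulrC [z.2 * _]mulrC; ring.
have [jcc _] := rintegrable_plane_prodM (jc z.1) (jc z.2).
have [jss _] := rintegrable_plane_prodM (js z.1) (js z.2).
under eq_Rintegral do rewrite E; rewrite RintegralB//.
rewrite (Rintegral_prodM (jc z.1) (jc z.2)) (Rintegral_prodM (js z.1) (js z.2)).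
by rewrite !tent_scaled_cos// !tent_scaled_sin// mul0r subr0.
Qed.

(** The transform without normalisation, split into a cosine and a sine part so that all integrals
    stay real. *)
Definition cosT f k : R := \int[planeleb]_p (cos (phase p k) * f p).
Definition sinT f k : R := \int[planeleb]_p (sin (phase p k) * f p).


Lemma measurable_phase : measurable_fun [set: plane R * plane R] (fun x => phase x.1 x.2).
Proof.
apply: measurable_funD; apply: measurable_funM.
- by apply: (measurable_fst_comp (f := fst)).
- by apply: (measurable_snd_comp (f := fst)).
- by apply: (measurable_fst_comp (f := snd)).
- by apply: (measurable_snd_comp (f := snd)).
Qed.

Lemma measurable_cos_phase :
  measurable_fun [set: plane R * plane R] (fun x => cos (phase x.1 x.2)).
Proof.
apply: measurableT_comp; last exact: measurable_phase.
exact: continuous_measurable_fun (@continuous_cos R).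
Qed.

Lemma measurable_sin_phase :
  measurable_fun [set: plane R * plane R] (fun x => sin (phase x.1 x.2)).
Proof.
apply: measurableT_comp; last exact: measurable_phase.
exact: continuous_measurable_fun (@continuous_sin R).
Qed.

Section transform.
Variable f : R * R -> R.
Hypothesis jf : rintegrable planeleb f.

Let mf : measurable_fun [set: plane R] f. Proof. exact: rintegrable_measurable jf. Qed.

Let mf1 : measurable_fun [set: plane R * plane R] (fun x => f x.1).
Proof. exact: measurable_fst_comp. Qed.

Lemma measurable_cosT : measurable_fun [set: plane R] (cosT f).
Proof.
apply: (@measurable_Rintegral_fst _ _ _ _ _ planeleb (fun x => cos (phase x.1 x.2) * f x.1)).
by apply: measurable_funM => //; exact: measurable_cos_phase.
Qed.

Lemma measurable_sinT : measurable_fun [set: plane R] (sinT f).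
Proof.
apply: (@measurable_Rintegral_fst _ _ _ _ _ planeleb (fun x => sin (phase x.1 x.2) * f x.1)).
by apply: measurable_funM => //; exact: measurable_sin_phase.
Qed.

Lemma cos_phase_le k p : `|cos (phase p k) * f p| <= `|f p|.
Proof. by rewrite normrM ler_piMl// ler_norml cos_geN1 cos_le1. Qed.

Lemma sin_phase_le k p : `|sin (phase p k) * f p| <= `|f p|.
Proof. by rewrite normrM ler_piMl// ler_norml sin_geN1 sin_le1. Qed.

Lemma measurable_cosM2 k : measurable_fun [set: plane R] (fun p => cos (phase p k) * f p).
Proof.
apply: measurable_funM => //; apply: measurableT_comp.
  exact: continuous_measurable_fun (@continuous_cos R).
by apply: measurable_funD; exact: measurable_funM.
Qed.

Lemma measurable_sinM2 k : measurable_fun [set: plane R] (fun p => sin (phase p k) * f p).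
Proof.
apply: measurable_funM => //; apply: measurableT_comp.
  exact: continuous_measurable_fun (@continuous_sin R).
by apply: measurable_funD; exact: measurable_funM.
Qed.

Lemma rintegrable_cosT k : rintegrable planeleb (fun p => cos (phase p k) * f p).
Proof.
exact: (@le_rintegrable _ _ _ planeleb _ _ (measurable_cosM2 k) (cos_phase_le k)
  (rintegrable_norm jf)).
Qed.

Lemma rintegrable_sinT k : rintegrable planeleb (fun p => sin (phase p k) * f p).
Proof.
exact: (@le_rintegrable _ _ _ planeleb _ _ (measurable_sinM2 k) (sin_phase_le k)
  (rintegrable_norm jf)).
Qed.

Lemma cosT_le k : `|cosT f k| <= \int[planeleb]_p `|f p|.
Proof.
exact: (@le_norm_Rintegral _ _ _ planeleb _ _ (measurable_cosM2 k) (cos_phase_le k)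
  (rintegrable_norm jf)).
Qed.

Lemma sinT_le k : `|sinT f k| <= \int[planeleb]_p `|f p|.
Proof.
exact: (@le_norm_Rintegral _ _ _ planeleb _ _ (measurable_sinM2 k) (sin_phase_le k)
  (rintegrable_norm jf)).
Qed.

Definition fejer_mean (r : R) z : R := \int[planeleb]_p (f p * fejer2 r (z - p)).

Lemma phaseBl z p k : phase (z - p) k = phase z k - phase p k.
Proof. by rewrite /phase/=; ring. Qed.

(** Fubini's theorem, [tent2] making the double integral absolutely convergent; the formula for the
    cosine of a difference recombines the two phases into the kernel. *)
Lemma fejer_mean_inversion r z : 0 < r ->
  \int[planeleb]_k (tent2 r k * (cos (phase z k) * cosT f k + sin (phase z k) * sinT f k)) =
  fejer_mean r z.
Proof.
move=> r0; pose G (x : (R * R) * (R * R)) := tent2 r x.1 * (f x.2 * cos (phase (z - x.2) x.1)).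
have mz : measurable_fun [set: plane R * plane R] (fun x => phase (z - x.2) x.1).
  under eq_fun do rewrite phaseBl.
  apply: measurable_funB; first exact: (measurable_fst_comp (measurable_phase_l z)).
  have := measurableT_comp measurable_phase (@measurable_swap _ _ (plane R) (plane R)).
  exact.
have mG : measurable_fun [set: plane R * plane R] G.
  apply: measurable_funM; first exact: (measurable_fst_comp (measurable_tent2 r)).
  apply: measurable_funM; first exact: (measurable_snd_comp mf).
  apply: measurableT_comp mz; exact: continuous_measurable_fun (@continuous_cos R).
have jG : rintegrable (planeleb \x planeleb)%E G.
  apply: (rintegrable_prodM mG _ (rintegrable_tent2 r0) (rintegrable_norm jf)) => k p.
  rewrite /G/= normrM [`|f p * _|]normrM (ger0_norm (tent2_ge0 r k)) ler_wpM2l ?tent2_ge0//.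
  by rewrite ler_piMr// ler_norml cos_geN1 cos_le1.
have := Rintegral_swap jG; rewrite /G/=.
have -> : \int[planeleb]_x \int[planeleb]_y (tent2 r x * (f y * cos (phase (z - y) x))) =
    \int[planeleb]_k (tent2 r k * (cos (phase z k) * cosT f k + sin (phase z k) * sinT f k)).
  apply: eq_Rintegral => k _.
  have jc := rintegrableZ (cos (phase z k)) (rintegrable_cosT k).
  have js := rintegrableZ (sin (phase z k)) (rintegrable_sinT k).
  rewrite -RintegralZl//; last exact: rintegrable_cosT.
  rewrite -RintegralZl//; last exact: rintegrable_sinT.
  rewrite -RintegralD// -RintegralZl//; last exact: rintegrableD.
  by apply: eq_Rintegral => p _; rewrite phaseBl cosB; ring.
move=> ->; apply: eq_Rintegral => p _.
rewrite -tent2_cos// -RintegralZl//; first by apply: eq_Rintegral => k _; ring.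
apply: (@le_rintegrable _ _ _ planeleb _ _ _ _ (rintegrable_tent2 r0)).
  apply: measurable_funM; first exact: measurable_tent2.
  apply: measurableT_comp; first exact: continuous_measurable_fun (@continuous_cos R).
  exact: measurable_phase_l.
move=> k; rewrite normrM ger0_norm ?tent2_ge0// ler_piMr ?tent2_ge0//.
by rewrite ler_norml cos_geN1 cos_le1.
Qed.

End transform.
End plane_fourier.

Section real_fubini_second.
Context d1 d2 (T1 : measurableType d1) (T2 : measurableType d2) (R : realType).
Variable m1 : {sigma_finite_measure set T1 -> \bar R}.
Variable m2 : {sigma_finite_measure set T2 -> \bar R}.

Lemma rintegrable_prodr (f : T1 * T2 -> R) (G : T2 -> R) :
  measurable_fun [set: T1 * T2] f ->
  (forall y, rintegrable m1 (fun x => f (x, y))) ->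
  (forall y, \int[m1]_x `|f (x, y)| <= G y) -> rintegrable m2 G ->
  rintegrable (m1 \x m2)%E f.
Proof.
move=> mf if1 fG iG; apply/integrable21ltyP; first exact/measurable_EFinP.
have mG : (\int[m2]_y (`|G y|)%:E < +oo)%E.
  by apply: (rintegrable_lty (rintegrable_norm iG)).
apply: le_lt_trans mG; apply: ge0_le_integral => //.
- by move=> y _; exact: integral_ge0.
- apply: (measurable_fun_fubini_tonelli_G (fun z => `|(EFin \o f) z|%E)) => //.
  by apply: measurableT_comp => //; exact/measurable_EFinP.
- apply/measurable_EFinP/measurableT_comp => //.
  exact: rintegrable_measurable iG.
- move=> y _; rewrite -(EFin_Rintegral (rintegrable_norm (if1 y))) lee_fin.
  exact: le_trans (fG y) (ler_norm _).
Qed.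

End real_fubini_second.

(** * Plancherel's inequality *)

Section plancherel.
Context {R : realType}.
Implicit Types (f : R * R -> R).

Lemma fejer_shift (r z : R) : 0 < r ->
  rintegrable leb (fun x => r^-1 * fejer (r^-1 * (z - x))) /\
  \int[leb]_x (r^-1 * fejer (r^-1 * (z - x))) = fejer_mass.
Proof.
move=> r0; have rn : - r^-1 != 0 by rewrite oppr_eq0 invr_eq0 gt_eqF.
have E : (fun x => fejer (r^-1 * (z - x))) = (fun x => fejer (- r^-1 * x + r^-1 * z)).
  by apply/funext => x; congr fejer; ring.
have j := @rintegrable_affine _ (- r^-1) (r^-1 * z) rn _ rintegrable_fejer.
rewrite -E in j; split; first exact: rintegrableZ.
rewrite RintegralZl// E (Rintegral_affine (r^-1 * z) rn rintegrable_fejer).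
rewrite normrN gtr0_norm ?invr_gt0// invrK mulrCA mulVf ?mulr1//.
by rewrite gt_eqF.
Qed.

Lemma rintegrable_fejer2 r z : 0 < r -> rintegrable planeleb (fun p : R * R => fejer2 r (z - p)).
Proof.
move=> r0; have [j1 _] := fejer_shift z.1 r0; have [j2 _] := fejer_shift z.2 r0.
apply: (rintegrable_plane _ _ j1 j2).
  apply: measurable_funM; first exact: (measurable_fst_comp (rintegrable_measurable j1)).
  exact: (measurable_snd_comp (rintegrable_measurable j2)).
by move=> x y; rewrite ger0_norm// fejer2_ge0.
Qed.

Lemma Rintegral_fejer2 r z : 0 < r ->
  \int[planeleb]_p fejer2 r (z - p) = fejer_mass ^+ 2 :> R.
Proof.
move=> r0; have [j1 e1] := fejer_shift z.1 r0; have [j2 e2] := fejer_shift z.2 r0.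
by rewrite (Rintegral_prodM j1 j2) e1 e2 expr2.
Qed.

Lemma measurable_fejer2 r : measurable_fun [set: plane R] (fejer2 r).
Proof.
apply: measurable_funM; apply: measurable_funM => //;
  by apply: measurableT_comp; [exact: measurable_fejer|exact: measurable_funM].
Qed.

Lemma measurable_fejer2B r :
  measurable_fun [set: plane R * plane R] (fun x => fejer2 r (x.1 - x.2)).
Proof.
apply: (measurableT_comp (measurable_fejer2 r)).
apply: measurable_fun_pair => /=; apply: measurable_funB.
- by apply: (measurable_fst_comp (f := fst)).
- by apply: (measurable_snd_comp (f := fst)).
- by apply: (measurable_fst_comp (f := snd)).
- by apply: (measurable_snd_comp (f := snd)).
Qed.

Lemma fejer2_bounded r : exists B : R, forall z : R * R, `|fejer2 r z| <= B.
Proof.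
have [C C0 h] := @fejer_le R.
have hC x : fejer x <= C.
  rewrite (le_trans (h x))// ler_piMr// /lorentz invf_le1 ?onesqr_gt0//.
  by rewrite lerDl sqr_ge0.
exists ((`|r^-1| * C) * (`|r^-1| * C)) => z.
rewrite /fejer2 !normrM !(ger0_norm (fejer_ge0 _)).
by rewrite !ler_pM// ?mulr_ge0 ?fejer_ge0.
Qed.

Section square_integrable.
Variable f : R * R -> R.
Hypothesis jf : rintegrable planeleb f.
Hypothesis jf2 : rintegrable planeleb (fun p => f p ^+ 2).

Let mf : measurable_fun [set: plane R] f. Proof. exact: rintegrable_measurable jf. Qed.

Let bf2 r (x : (R * R) * (R * R)) : 0 < r ->
  `|f x.1 * (f x.2 * fejer2 r (x.1 - x.2))| <=
  2^-1 * (f x.1 ^+ 2 * fejer2 r (x.1 - x.2)) + 2^-1 * (f x.2 ^+ 2 * fejer2 r (x.1 - x.2)).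
Proof.
move=> r0; have := @fejer2_ge0 _ r (x.1 - x.2) r0; move: (fejer2 _ _) => k k0.
rewrite mulrA normrM (ger0_norm k0) -mulrDr -mulrDl [leRHS]mulrA ler_wpM2r// normrM.
rewrite -(real_normK (num_real (f x.1))) -(real_normK (num_real (f x.2))).
by have := sqr_ge0 (`|f x.1| - `|f x.2|); lra.
Qed.

Let ja r : 0 < r -> rintegrable (planeleb \x planeleb)%E
  (fun x : (R * R) * (R * R) => f x.1 ^+ 2 * fejer2 r (x.1 - x.2)).
Proof.
move=> r0; have j := rintegrableZr (fejer_mass ^+ 2) jf2.
apply: (rintegrable_prodl _ _ _ j).
- apply: measurable_funM; last exact: measurable_fejer2B.
  by apply: measurable_funX; exact: measurable_fst_comp.
- by move=> p; exact: (rintegrableZ (f p ^+ 2) (rintegrable_fejer2 p r0)).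
- move=> p; rewrite /= le_eqVlt; apply/orP; left; apply/eqP.
  under eq_Rintegral do rewrite normrM (ger0_norm (sqr_ge0 _)) (ger0_norm (fejer2_ge0 _ r0)).
  by rewrite RintegralZl ?Rintegral_fejer2//; exact: rintegrable_fejer2.
Qed.

Let ea r : 0 < r ->
  \int[(planeleb \x planeleb)%E]_x (f x.1 ^+ 2 * fejer2 r (x.1 - x.2)) =
  fejer_mass ^+ 2 * \int[planeleb]_p (f p ^+ 2).
Proof.
move=> r0; rewrite -(Rintegral12 (ja r0))/= -RintegralZl//; apply: eq_Rintegral => p _.
by rewrite RintegralZl ?Rintegral_fejer2// 1?mulrC//; exact: rintegrable_fejer2.
Qed.

Lemma rintegrable_fejer_mean r z : rintegrable planeleb (fun p => f p * fejer2 r (z - p)).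
Proof.
have [B hB] := fejer2_bounded r; apply: (@le_rintegrable _ _ _ planeleb _ _ _ _
    (rintegrableZr B (rintegrable_norm jf))).
  apply: measurable_funM => //; apply: (measurableT_comp (measurable_fejer2 r)).
  by apply: measurable_fun_pair => /=; exact: measurable_funB.
by move=> p; rewrite normrM ler_wpM2l.
Qed.

Let jb r : 0 < r -> rintegrable (planeleb \x planeleb)%E
  (fun x : (R * R) * (R * R) => f x.2 ^+ 2 * fejer2 r (x.1 - x.2)).
Proof.
move=> r0; have j := rintegrableZr (fejer_mass ^+ 2) jf2.
apply: (rintegrable_prodr _ _ _ j).
- apply: measurable_funM; last exact: measurable_fejer2B.
  by apply: measurable_funX; exact: measurable_snd_comp.
- move=> p; under eq_fun do rewrite /= fejer2N.
  exact: (rintegrableZ (f p ^+ 2) (rintegrable_fejer2 p r0)).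
- move=> p; rewrite /= le_eqVlt; apply/orP; left; apply/eqP.
  under eq_Rintegral do rewrite normrM (ger0_norm (sqr_ge0 _)) (ger0_norm (fejer2_ge0 _ r0)) fejer2N.
  by rewrite RintegralZl ?Rintegral_fejer2//; exact: rintegrable_fejer2.
Qed.

Let eb r : 0 < r ->
  \int[(planeleb \x planeleb)%E]_x (f x.2 ^+ 2 * fejer2 r (x.1 - x.2)) =
  fejer_mass ^+ 2 * \int[planeleb]_p (f p ^+ 2).
Proof.
move=> r0; rewrite -(Rintegral21 (jb r0))/= -RintegralZl//; apply: eq_Rintegral => p _.
under eq_Rintegral do rewrite fejer2N.
by rewrite RintegralZl ?Rintegral_fejer2// 1?mulrC//; exact: rintegrable_fejer2.
Qed.

Let jc r : 0 < r -> rintegrable (planeleb \x planeleb)%E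
  (fun x : (R * R) * (R * R) => f x.1 * (f x.2 * fejer2 r (x.1 - x.2))).
Proof.
move=> r0; have j := rintegrableD (rintegrableZ 2^-1 (ja r0)) (rintegrableZ 2^-1 (jb r0)).
apply: (le_rintegrable _ _ j); last by move=> x; exact: bf2.
apply: measurable_funM; first exact: (measurable_fst_comp mf).
by apply: measurable_funM; [exact: (measurable_snd_comp mf)|exact: measurable_fejer2B].
Qed.

(** Bound f(p) f(q) by half the sum of the squares and integrate the kernel in the other
    variable. *)
Lemma fejer_mean_pair_le r : 0 < r ->
  \int[planeleb]_q (f q * fejer_mean f r q) <= fejer_mass ^+ 2 * \int[planeleb]_p (f p ^+ 2).
Proof.
move=> r0; set S := _ * _.
have -> : \int[planeleb]_q (f q * fejer_mean f r q) =
    \int[(planeleb \x planeleb)%E]_x (f x.1 * (f x.2 * fejer2 r (x.1 - x.2))).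
  rewrite -(Rintegral12 (jc r0)); apply: eq_Rintegral => q _.
  by rewrite /fejer_mean -RintegralZl//; exact: rintegrable_fejer_mean.
have -> : S = 2^-1 * S + 2^-1 * S by lra.
rewrite -{1}[S](ea r0) -[S](eb r0) -RintegralZl//; last exact: ja.
rewrite -RintegralZl//; last exact: jb.
rewrite -RintegralD//; [|exact: rintegrableZ (ja r0)|exact: rintegrableZ (jb r0)].
apply: le_Rintegral => //.
- exact: jc.
- by apply: rintegrableD; apply: rintegrableZ; [exact: ja|exact: jb].
- by move=> x _; apply: le_trans (bf2 _ r0); exact: ler_norm.
Qed.

Let M := \int[planeleb]_p `|f p|.

Let hc k : `|cosT f k| <= M. Proof. exact: cosT_le. Qed.
Let hs k : `|sinT f k| <= M. Proof. exact: sinT_le. Qed.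

Lemma power_spectrum_fejer r : 0 < r ->
  \int[planeleb]_k (tent2 r k * (cosT f k ^+ 2 + sinT f k ^+ 2)) =
  \int[planeleb]_q (f q * fejer_mean f r q).
Proof.
move=> r0; pose G (x : (R * R) * (R * R)) := tent2 r x.1 *
  (f x.2 * (cos (phase x.2 x.1) * cosT f x.1 + sin (phase x.2 x.1) * sinT f x.1)).
have sw := @measurable_swap _ _ (plane R) (plane R).
have mG : measurable_fun [set: plane R * plane R] G.
  apply: measurable_funM; first exact: (measurable_fst_comp (measurable_tent2 r)).
  apply: measurable_funM; first exact: (measurable_snd_comp mf).
  apply: measurable_funD; apply: measurable_funM.
  - exact: (measurableT_comp (@measurable_cos_phase R) sw).
  - exact: (measurable_fst_comp (measurable_cosT jf)).
  - exact: (measurableT_comp (@measurable_sin_phase R) sw).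
  - exact: (measurable_fst_comp (measurable_sinT jf)).
have jG : rintegrable (planeleb \x planeleb)%E G.
  apply: (rintegrable_prodM mG _ (rintegrable_tent2 r0)
    (rintegrableZr (M + M) (rintegrable_norm jf))) => k q.
  rewrite /G/= normrM (ger0_norm (tent2_ge0 r k)) ler_wpM2l ?tent2_ge0//.
  rewrite normrM ler_wpM2l// (le_trans (ler_normD _ _))// lerD//.
    by rewrite normrM (le_trans _ (hc k))// ler_piMl// ler_norml cos_geN1 cos_le1.
  by rewrite normrM (le_trans _ (hs k))// ler_piMl// ler_norml sin_geN1 sin_le1.
transitivity (\int[planeleb]_k \int[planeleb]_q G (k, q)).
  apply: eq_Rintegral => k _; rewrite /G/=.
  have jc' := rintegrableZ (cosT f k) (rintegrable_cosT jf k).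
  have js' := rintegrableZ (sinT f k) (rintegrable_sinT jf k).
  rewrite !expr2 {2}/cosT {2}/sinT -RintegralZl//; last exact: rintegrable_cosT.
  rewrite -RintegralZl//; last exact: rintegrable_sinT.
  rewrite -RintegralD// -RintegralZl//; last exact: rintegrableD.
  by apply: eq_Rintegral => p _; rewrite -/(cosT f k) -/(sinT f k); ring.
rewrite (Rintegral_swap jG); apply: eq_Rintegral => q _; rewrite /G/=.
rewrite -fejer_mean_inversion// -RintegralZl//; first by apply: eq_Rintegral => k _; ring.
apply: (@le_rintegrable _ _ _ planeleb _ _ _ _ (rintegrableZr (M + M) (rintegrable_tent2 r0))).
  apply: measurable_funM; first exact: measurable_tent2.
  apply: measurable_funD; apply: measurable_funM.
  - apply: measurableT_comp; first exact: continuous_measurable_fun (@continuous_cos R).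
    exact: measurable_phase_l.
  - exact: measurable_cosT.
  - apply: measurableT_comp; first exact: continuous_measurable_fun (@continuous_sin R).
    exact: measurable_phase_l.
  - exact: measurable_sinT.
move=> k; rewrite normrM ger0_norm ?tent2_ge0// ler_wpM2l ?tent2_ge0//.
rewrite (le_trans (ler_normD _ _))// lerD//.
  by rewrite normrM (le_trans _ (hc k))// ler_piMl// ler_norml cos_geN1 cos_le1.
by rewrite normrM (le_trans _ (hs k))// ler_piMl// ler_norml sin_geN1 sin_le1.
Qed.

End square_integrable.

Lemma cvg_tent2 (k : R * R) : tent2 (scale_inv n) k @[n --> \oo] --> (1 : R).
Proof.
have h (x : R) : tent (scale_inv n * x) @[n --> \oo] --> (1 : R).
  have -> : (1 : R) = tent 0 by rewrite /tent normr0 subr0 (max_idPr _).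
  have c : scale_inv n * x @[n --> \oo] --> (0 : R).
    by rewrite -[X in _ --> X](mul0r x); apply: cvgM; [exact: cvg_scale_inv|exact: cvg_cst].
  exact: (cvg_comp _ _ c (@continuous_tent R 0)).
by rewrite -[X in _ --> X](mul1r 1); apply: cvgM; exact: h.
Qed.

Lemma nondecreasing_tent2 (k : R * R) m n : (m <= n)%N ->
  tent2 (scale_inv m) k <= tent2 (scale_inv n) k.
Proof.
move=> mn; have h (x : R) : tent (scale_inv m * x) <= tent (scale_inv n * x).
  rewrite /tent le_max ge_max lexx/=; case: leP => //= h.
  rewrite lerB// !normrM ler_wpM2r// !gtr0_norm ?scale_inv_gt0//.
  by rewrite lef_pV2 ?posrE ?ltr0n// ler_nat.
by rewrite ler_pM ?tent_ge0.
Qed.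

(** [tent2] increases to 1 as the cutoff is removed, so by monotone convergence uniform bounds on
    the cut-off integrals give integrability. *)
Lemma tent2_summable (G : R * R -> R) (B : R) : measurable_fun [set: plane R] G ->
  (forall k, 0 <= G k) ->
  (forall n, rintegrable planeleb (fun k => tent2 (scale_inv n) k * G k)) ->
  (forall n, \int[planeleb]_k (tent2 (scale_inv n) k * G k) <= B) ->
  rintegrable planeleb G /\ \int[planeleb]_k G k <= B.
Proof.
move=> mG G0 jG hB.
have h : (\int[planeleb]_k (G k)%:E <= B%:E)%E.
  have := @cvg_monotone_convergence _ _ _ planeleb setT measurableT
    (fun n k => (tent2 (scale_inv n) k * G k)%:E) _ _ _.
  have -> : (fun k => limn (fun n => (tent2 (scale_inv n) k * G k)%:E)) = (fun k => (G k)%:E).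
    apply/funext => k; apply/cvg_lim => //; apply: cvg_EFin; first exact: nearW.
    rewrite -[X in _ --> X]mul1r; apply: cvgM; [exact: cvg_tent2|exact: cvg_cst].
  move=> h; have {h} c : (\int[planeleb]_k (tent2 (scale_inv n) k * G k)%:E)%E @[n --> \oo]
      --> (\int[planeleb]_k (G k)%:E)%E.
    apply: h => [n|n k _|k _ m n mn].
    - by apply/measurable_EFinP; exact: rintegrable_measurable (jG n).
    - by rewrite lee_fin mulr_ge0 ?tent2_ge0.
    - by rewrite lee_fin ler_wpM2r ?nondecreasing_tent2.
  rewrite -(cvg_lim _ c)//; apply: lime_le; first by apply/cvg_ex; eexists; exact: c.
  by apply: nearW => n; rewrite -EFin_Rintegral// lee_fin.
have j : rintegrable planeleb G by apply: rintegrable_ge0P => //; rewrite (le_lt_trans h) ?ltry.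
by split => //; rewrite -lee_fin EFin_Rintegral.
Qed.

Lemma plancherel_le f : rintegrable planeleb f ->
  rintegrable planeleb (fun p => f p ^+ 2) ->
  rintegrable planeleb (fun k => cosT f k ^+ 2 + sinT f k ^+ 2) /\
  \int[planeleb]_k (cosT f k ^+ 2 + sinT f k ^+ 2) <=
    fejer_mass ^+ 2 * \int[planeleb]_p (f p ^+ 2).
Proof.
move=> jf jf2.
have mG : measurable_fun [set: plane R] (fun k => cosT f k ^+ 2 + sinT f k ^+ 2).
  by apply: measurable_funD; apply: measurable_funX; [exact: measurable_cosT|exact: measurable_sinT].
apply: tent2_summable => // [k|n|n].
- by rewrite addr_ge0 ?sqr_ge0.
- set M := \int[planeleb]_p `|f p|.
  apply: (@le_rintegrable _ _ _ planeleb _ _ _ _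
    (rintegrableZr (M ^+ 2 + M ^+ 2) (rintegrable_tent2 (scale_inv_gt0 n)))).
    by apply: measurable_funM => //; exact: measurable_tent2.
  move=> k; rewrite normrM (ger0_norm (tent2_ge0 _ _)) ler_wpM2l ?tent2_ge0//.
  rewrite (le_trans (ler_normD _ _))// !normrX lerD// lerXn2r ?nnegrE// ?cosT_le ?sinT_le//.
    exact: le_trans (cosT_le jf k).
  exact: le_trans (sinT_le jf k).
- by rewrite power_spectrum_fejer ?scale_inv_gt0// fejer_mean_pair_le ?scale_inv_gt0.
Qed.

End plancherel.

(** * Identification of [fourier] on integrable and square-integrable functions *)

Section fourier_identification.
Context {R : realType}.
Implicit Types (f : R * R -> R).

Lemma normc_sqr (z : R[i]) : Normc.normc z ^+ 2 = complex.Re z ^+ 2 + complex.Im z ^+ 2.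
Proof. by case: z => a b; rewrite /Normc.normc sqr_sqrtr// addr_ge0// sqr_ge0. Qed.

Definition fourierT f (k : R * R) : R[i] :=
  Complex ((2 * pi)^-1 * cosT f k) (- ((2 * pi)^-1 * sinT f k)).

(** Truncation as a function on the whole plane: [fourier_trunc] becomes the transform of a
    function, to which Plancherel's inequality applies. *)
Definition boxed (n : nat) f (p : R * R) : R :=
  b2r ((- n%:R <= p.1 <= n%:R) && (- n%:R <= p.2 <= n%:R)) * f p.

Lemma measurable_boxed n f : measurable_fun [set: plane R] f ->
  measurable_fun [set: plane R] (boxed n f).
Proof.
move=> mf; apply: measurable_funM => //; apply: measurable_b2r.
by apply: measurable_and; apply: measurable_and; apply: measurable_fun_ler.
Qed.

Lemma fourier_truncE n f k : fourier_trunc n f k = fourierT (boxed n f) k.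
Proof.
rewrite /fourier_trunc /fourierT /=.
have E (h : R * R -> R) :
    \int[planeleb]_(p in `[- n%:R, n%:R] `*` `[- n%:R, n%:R]) (h p * f p) =
    \int[planeleb]_p (h p * boxed n f p).
  rewrite Rintegral_mkcond; apply: eq_Rintegral => p _; rewrite patchE /boxed.
  case: ifPn => [|/negP]; rewrite inE/= !in_itv/=.
    by move=> [-> ->]; rewrite /b2r/= mul1r.
  move=> h0; rewrite (_ : _ && _ = false) ?mul0r ?mulr0//.
  by apply/negbTE/negP => /andP[]; tauto.
congr Complex; first by congr (_ * _); exact: E.
by congr (- (_ * _)); exact: E.
Qed.

Lemma fourierTB f g k : rintegrable planeleb f -> rintegrable planeleb g ->
  Normc.normc (fourierT f k - fourierT g k) ^+ 2 = (2 * pi) ^- 2 *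
  (cosT (fun p => f p - g p) k ^+ 2 + sinT (fun p => f p - g p) k ^+ 2).
Proof.
move=> jf jg.
have -> : cosT (fun p => f p - g p) k = cosT f k - cosT g k.
  rewrite /cosT -RintegralB//; [|exact: rintegrable_cosT..].
  by apply: eq_Rintegral => p _; rewrite mulrBr.
have -> : sinT (fun p => f p - g p) k = sinT f k - sinT g k.
  rewrite /sinT -RintegralB//; [|exact: rintegrable_sinT..].
  by apply: eq_Rintegral => p _; rewrite mulrBr.
by rewrite normc_sqr/= -exprVn; ring.
Qed.

Section square_integrable.
Variable f : R * R -> R.
Hypothesis jf : rintegrable planeleb f.
Hypothesis jf2 : rintegrable planeleb (fun p => f p ^+ 2).

Let mf : measurable_fun [set: plane R] f. Proof. exact: rintegrable_measurable jf. Qed.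

Let boxed_le n p : `|boxed n f p| <= `|f p|.
Proof. by rewrite /boxed /b2r; case: ifP; rewrite ?mul1r// mul0r normr0. Qed.

Lemma rintegrable_boxed n : rintegrable planeleb (boxed n f).
Proof.
exact: (@le_rintegrable _ _ _ planeleb _ _ (measurable_boxed n mf) (boxed_le n)
  (rintegrable_norm jf)).
Qed.

Let err_le n p : `|(boxed n f p - f p) ^+ 2| <= f p ^+ 2.
Proof.
rewrite ger0_norm ?sqr_ge0// /boxed /b2r; case: ifP => _.
  by rewrite mul1r subrr expr0n sqr_ge0.
by rewrite mul0r sub0r sqrrN.
Qed.

Let measurable_err n : measurable_fun [set: plane R] (fun p => (boxed n f p - f p) ^+ 2).
Proof. by apply: measurable_funX; apply: measurable_funB => //; exact: measurable_boxed. Qed.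

Let err_cvg : \int[planeleb]_p ((boxed n f p - f p) ^+ 2) @[n --> \oo] --> (0 : R).
Proof.
have -> : (0 : R) = \int[planeleb]_(p in [set: plane R]) 0 by rewrite Rintegral_cst// mul0r.
apply: (@cvg_Rintegral _ _ _ planeleb _ _ _ measurable_err _ err_le jf2) => p.
apply: cvg_near_cst; near=> n.
have h1 : `|p.1| <= n%:R by near: n; exact: nbhs_infty_ger.
have h2 : `|p.2| <= n%:R by near: n; exact: nbhs_infty_ger.
by rewrite /boxed -!ler_norml h1 h2 /b2r/= mul1r subrr expr0n.
Unshelve. all: by end_near. Qed.

(** Plancherel's inequality for the truncation error [boxed n f - f], which tends to 0 in L^2 by
    dominated convergence. *)
Lemma is_fourier_fourierT : is_fourier f (fourierT f).
Proof.
split.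
- by apply: measurable_funM => //; exact: measurable_cosT.
- by apply: measurableT_comp => //; apply: measurable_funM => //; exact: measurable_sinT.
have c : ((2 * pi) ^- 2 * (fejer_mass ^+ 2 * \int[planeleb]_p ((boxed n f p - f p) ^+ 2)))%:E
    @[n --> \oo] --> (0 : R)%:E.
  apply: cvg_EFin; first exact: nearW.
  rewrite -[X in _ --> X](mulr0 ((2 * pi) ^- 2)).
  apply: cvgM; first exact: cvg_cst.
  rewrite -[X in _ --> X](mulr0 (fejer_mass ^+ 2)).
  by apply: cvgM; [exact: cvg_cst|exact: err_cvg].
apply: (squeeze_cvge _ (cvg_cst 0%E) c); apply: nearW => n.
apply/andP; split; first by apply: integral_ge0 => k _; rewrite lee_fin sqr_ge0.
under eq_integral do rewrite fourier_truncE (fourierTB _ (rintegrable_boxed n) jf).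
have jB := rintegrableB (rintegrable_boxed n) jf.
have jB2 : rintegrable planeleb (fun p => (boxed n f p - f p) ^+ 2).
  exact: (@le_rintegrable _ _ _ planeleb _ _ (measurable_err n) (err_le n) jf2).
have [j h] := plancherel_le jB jB2.
rewrite leb2E -EFin_Rintegral; last exact: rintegrableZ.
by rewrite RintegralZl// lee_fin ler_wpM2l// invr_ge0 sqr_ge0.
Qed.

Let measurable_dist (g h : R * R -> R[i]) :
  measurable_fun [set: plane R] (fun k => complex.Re (g k)) ->
  measurable_fun [set: plane R] (fun k => complex.Im (g k)) ->
  measurable_fun [set: plane R] (fun k => complex.Re (h k)) ->
  measurable_fun [set: plane R] (fun k => complex.Im (h k)) ->
  measurable_fun [set: plane R] (fun k => Normc.normc (g k - h k) ^+ 2).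
Proof.
move=> m1 m2 m3 m4; under eq_fun do rewrite normc_sqr.
have E1 k : complex.Re (g k - h k) = complex.Re (g k) - complex.Re (h k).
  by case: (g k) (h k) => a b [].
have E2 k : complex.Im (g k - h k) = complex.Im (g k) - complex.Im (h k).
  by case: (g k) (h k) => a b [].
under eq_fun do rewrite E1 E2.
by apply: measurable_funD; apply: measurable_funX; exact: measurable_funB.
Qed.

Let normc_triangle (a b c : R[i]) :
  Normc.normc (a - b) ^+ 2 <= 2 * Normc.normc (c - a) ^+ 2 + 2 * Normc.normc (c - b) ^+ 2.
Proof.
rewrite !normc_sqr; case: a b c => a1 a2 [b1 b2] [c1 c2] /=.
by have := sqr_ge0 (2 * c1 - a1 - b1); have := sqr_ge0 (2 * c2 - a2 - b2); lra.
Qed.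

(** The truncated transforms approach both candidates in L^2, so the squared distance of the
    candidates has integral 0. *)
Lemma is_fourier_unique g1 g2 : is_fourier f g1 -> is_fourier f g2 ->
  {ae planeleb, forall k, g1 k = g2 k}.
Proof.
move=> [r1 i1 c1] [r2 i2 c2].
have mt1 n : measurable_fun [set: plane R] (fun k => complex.Re (fourier_trunc n f k)).
  under eq_fun do rewrite fourier_truncE/=.
  by apply: measurable_funM => //; apply: measurable_cosT; exact: rintegrable_boxed.
have mt2 n : measurable_fun [set: plane R] (fun k => complex.Im (fourier_trunc n f k)).
  under eq_fun do rewrite fourier_truncE/=.
  apply: measurableT_comp => //; apply: measurable_funM => //.
  by apply: measurable_sinT; exact: rintegrable_boxed.
have m12 := measurable_dist r1 i1 r2 i2.
have mt n := measurable_dist (mt1 n) (mt2 n) r1 i1.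
have mt' n := measurable_dist (mt1 n) (mt2 n) r2 i2.
have h n : (\int[planeleb]_k (Normc.normc (g1 k - g2 k) ^+ 2)%:E <=
    2%:E * \int[planeleb]_k (Normc.normc (fourier_trunc n f k - g1 k) ^+ 2)%:E +
    2%:E * \int[planeleb]_k (Normc.normc (fourier_trunc n f k - g2 k) ^+ 2)%:E)%E.
  have e0 g k : (0 <= (Normc.normc (fourier_trunc n f k - g k) ^+ 2)%:E)%E.
    by rewrite lee_fin sqr_ge0.
  have /measurable_EFinP m1 := mt n; have /measurable_EFinP m2 := mt' n.
  rewrite -!ge0_integralZl//.
  rewrite -ge0_integralD//; last 4 first.
  - by move=> k _; rewrite mule_ge0// e0.
  - exact: measurable_funeM.
  - by move=> k _; rewrite mule_ge0// e0.
  - exact: measurable_funeM.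
  apply: ge0_le_integral => //.
  - by move=> k _; rewrite lee_fin sqr_ge0.
  - exact/measurable_EFinP.
  - by apply: emeasurable_funD; exact: measurable_funeM.
  - by move=> k _; rewrite -!EFinM -EFinD lee_fin.
have z : (\int[planeleb]_k (Normc.normc (g1 k - g2 k) ^+ 2)%:E = 0)%E.
  apply/eqP; rewrite eq_le integral_ge0 ?andbT => [|k _]; last by rewrite lee_fin sqr_ge0.
  have c : (2%:E * \int[planeleb]_k (Normc.normc (fourier_trunc n f k - g1 k) ^+ 2)%:E +
    2%:E * \int[planeleb]_k (Normc.normc (fourier_trunc n f k - g2 k) ^+ 2)%:E)%E
      @[n --> \oo] --> (2%:E * 0 + 2%:E * 0)%E.
    by apply: cvgeD; [rewrite !mule0|exact: cvgeZl|exact: cvgeZl].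
  move: c; rewrite !mule0 adde0 => c.
  by rewrite -(cvg_lim _ c)//; apply: lime_ge; [apply/cvg_ex; eexists; exact: c|exact: nearW].
have /ae_eq_integral_abs : measurable_fun [set: plane R]
    (fun k => (Normc.normc (g1 k - g2 k) ^+ 2)%:E) by exact/measurable_EFinP.
move=> /(_ planeleb measurableT)[+ _].
under eq_integral do rewrite gee0_abs ?lee_fin ?sqr_ge0//.
move=> /(_ z); apply: filterS => k /(_ I) /=.
rewrite normc_sqr => -[/eqP]; rewrite paddr_eq0 ?sqr_ge0// !sqrf_eq0.
case: (g1 k) (g2 k) => a b [c d] /=; rewrite !subr_eq0.
by move=> /andP[/eqP -> /eqP ->].
Qed.

Definition spectrum (k : R * R) : R := cosT f k ^+ 2 + sinT f k ^+ 2.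

Lemma sobolev_norm2E (s : R) : sobolev_norm2 s f =
  (\int[planeleb]_k (bracket2 k `^ s * ((2 * pi) ^- 2 * spectrum k))%:E)%E.
Proof.
(* [xget] does not fall back on its default, since the set is inhabited by [fourierT f]. *)
have hF : is_fourier f (fourier f).
  by apply: (@xgetPex _ (fun=> 0) [set g | is_fourier f g]); exists (fourierT f);
    exact: is_fourier_fourierT.
have [r1 i1 _] := hF.
have mb : measurable_fun [set: plane R] (fun k : R * R => bracket2 k `^ s).
  exact: (measurableT_comp (measurable_powR s) (@measurable_bracket2 R)).
have E k : Normc.normc (fourierT f k) ^+ 2 = (2 * pi) ^- 2 * spectrum k.
  by rewrite normc_sqr/= /spectrum -exprVn; ring.
rewrite /sobolev_norm2 leb2E; apply: ge0_ae_eq_integral => //.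
- apply/measurable_EFinP; apply: measurable_funM => //.
  under eq_fun do rewrite normc_sqr.
  by apply: measurable_funD; exact: measurable_funX.
- apply/measurable_EFinP; apply: measurable_funM => //; apply: measurable_funM => //.
  by apply: measurable_funD; apply: measurable_funX; [exact: measurable_cosT|exact: measurable_sinT].
- by move=> k _; rewrite lee_fin mulr_ge0 ?powR_ge0// sqr_ge0.
- by move=> k _; rewrite lee_fin -E mulr_ge0 ?powR_ge0// sqr_ge0.
have [N [mN N0 sub]] := is_fourier_unique hF is_fourier_fourierT.
exists N; split => // k /=; apply: contra_notP => h _.
by rewrite (_ : fourier f k = fourierT f k) ?E//; apply: contrapT => e; apply: h; exact: sub.
Qed.

End square_integrable.

(** With w and x the two factors on the left and B the bracket, w x <= (B^4 x^2 + w^2 / B^4) / 2 and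
    w^2 <= 3 B; what is left, at most 3 / (2 B^3), is integrable. So four derivatives in L^2 make 1
    + |k.1| + |k.2| times the transform integrable, which yields a Lipschitz bound. *)
Lemma linear_phase_le (c s : R) (k : R * R) :
  (1 + `|k.1| + `|k.2|) * (`|c| + `|s|) <=
  bracket2 k ^+ 4 * (c ^+ 2 + s ^+ 2) + 3 / 2 * lorentz2 k.
Proof.
set B := bracket2 k; have B1 : 1 <= B by exact: bracket2_ge1.
have B0 : 0 < B by exact: bracket2_gt0.
set w := 1 + _ + _; set x := `|c| + `|s|.
have w2 : w ^+ 2 <= 3 * B.
  rewrite /w /B /bracket2 -(real_normK (num_real k.1)) -(real_normK (num_real k.2)).
  move: `|k.1| `|k.2| => a b.
  have := sqr_ge0 (a - b); have := sqr_ge0 (a - 1); have := sqr_ge0 (b - 1); lra.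
have x2 : x ^+ 2 <= 2 * (c ^+ 2 + s ^+ 2).
  rewrite /x -[in leRHS](real_normK (num_real c)) -[in leRHS](real_normK (num_real s)).
  by have := sqr_ge0 (`|c| - `|s|); lra.
have h2 : (B ^+ 2)^-1 <= lorentz2 k by exact: bracket2_sqrV_le.
have Bn : B != 0 by rewrite gt_eqF.
have i0 : 0 <= (B ^+ 2)^-1 by rewrite invr_ge0 exprn_ge0// ltW.
apply: (@le_trans _ _ (2^-1 * (B ^+ 4 * x ^+ 2) + 2^-1 * (w ^+ 2 * (B ^+ 4)^-1))).
  have := sqr_ge0 (B ^+ 2 * x - w * (B ^+ 2)^-1).
  have -> : (B ^+ 2 * x - w * (B ^+ 2)^-1) ^+ 2 =
      B ^+ 4 * x ^+ 2 + w ^+ 2 * (B ^+ 4)^-1 - 2 * (w * x).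
    by move: (w) (x) (B) Bn => W X y y0; field.
  lra.
apply: lerD.
  by rewrite mulrCA ler_wpM2l ?exprn_ge0 ?(ltW B0)//; lra.
apply: (@le_trans _ _ (2^-1 * (3 * (B ^+ 2)^-1))); last lra.
rewrite ler_wpM2l//; apply: (@le_trans _ _ (3 * B * (B ^+ 4)^-1)).
  by rewrite ler_wpM2r// invr_ge0 exprn_ge0// ltW.
rewrite -mulrA ler_wpM2l// (_ : B * _ = (B ^+ 2)^-1 * B^-1); last first.
  by move: (B) Bn => y y0; field.
by rewrite ler_piMr// invf_le1.
Qed.

End fourier_identification.

Lemma sin_lip {R : realType} (x y : R) : `|sin x - sin y| <= `|x - y|.
Proof.
wlog : x y / y <= x => [h|yx].
  have [yx|/ltW xy] := leP y x; first exact: h.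
  by rewrite distrC [leRHS]distrC; exact: h.
have cs : {within `[y, x], continuous (sin : R -> R)}.
  by apply: continuous_subspaceT; exact: continuous_sin.
have [c _ ->] := MVT_segment yx (fun z _ => is_derive_sin z) cs.
by rewrite normrM ler_piMl// ler_norml cos_geN1 cos_le1.
Qed.

Lemma cos_lip {R : realType} (x y : R) : `|cos x - cos y| <= `|x - y|.
Proof.
by rewrite -!sinDpihalf (le_trans (sin_lip _ _))// opprD addrACA subrr addr0.
Qed.

(** * Fourier inversion *)

Section lipschitz_representative.
Context {R : realType}.
Variable f : R * R -> R.
Hypothesis jf : rintegrable planeleb f.
Hypothesis jS : rintegrable planeleb (fun k => bracket2 k ^+ 4 * spectrum f k).

Let mf : measurable_fun [set: plane R] f. Proof. exact: rintegrable_measurable jf. Qed.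

Definition sobolev_bound : R :=
  \int[planeleb]_k (bracket2 k ^+ 4 * spectrum f k) + 3 / 2 * \int[planeleb]_k lorentz2 k.

Definition absT k := `|cosT f k| + `|sinT f k|.

Let mabsT : measurable_fun [set: plane R] absT.
Proof.
by apply: measurable_funD; apply: measurableT_comp => //;
  [exact: measurable_cosT|exact: measurable_sinT].
Qed.

Let weight (k : R * R) : R := 1 + `|k.1| + `|k.2|.

Let weight_ge1 k : 1 <= weight k.
Proof. by rewrite /weight -addrA lerDl addr_ge0. Qed.

Let absT_ge0 k : 0 <= absT k. Proof. by rewrite addr_ge0. Qed.

Let jdom : rintegrable planeleb
  (fun k => bracket2 k ^+ 4 * spectrum f k + 3 / 2 * lorentz2 k).
Proof. by apply: rintegrableD => //; apply: rintegrableZ; exact: rintegrable_lorentz2. Qed.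

Let jW : rintegrable planeleb (fun k => weight k * absT k).
Proof.
apply: (@le_rintegrable _ _ _ planeleb _ _ _ _ jdom).
  apply: measurable_funM => //; apply: measurable_funD.
    by apply: measurable_funD => //; exact: measurableT_comp.
  exact: measurableT_comp.
move=> k; rewrite ger0_norm; first exact: (linear_phase_le (cosT f k) (sinT f k) k).
by rewrite mulr_ge0// (le_trans ler01)//.
Qed.

Let absT_le_weight k : absT k <= weight k * absT k.
Proof. by rewrite ler_peMl. Qed.

Lemma rintegrable_absT : rintegrable planeleb absT.
Proof.
apply: (@le_rintegrable _ _ _ planeleb _ _ mabsT _ jW) => k.
by rewrite ger0_norm.
Qed.

Let W_le : \int[planeleb]_k (weight k * absT k) <= sobolev_bound.
Proof.
rewrite /sobolev_bound -RintegralZl//; last exact: rintegrable_lorentz2.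
rewrite -RintegralD//; last by apply: rintegrableZ; exact: rintegrable_lorentz2.
by apply: le_Rintegral => // k _; exact: (linear_phase_le (cosT f k) (sinT f k) k).
Qed.

Lemma Rintegral_absT_le : \int[planeleb]_k absT k <= sobolev_bound.
Proof. by apply: le_trans W_le; apply: le_Rintegral => //; exact: rintegrable_absT. Qed.

Definition inverse_integrand z k := cos (phase z k) * cosT f k + sin (phase z k) * sinT f k.

Lemma inverse_integrand_le z k : `|inverse_integrand z k| <= absT k.
Proof.
rewrite (le_trans (ler_normD _ _))// lerD// normrM ler_piMl// ler_norml.
  by rewrite cos_geN1 cos_le1.
by rewrite sin_geN1 sin_le1.
Qed.

Lemma measurable_inverse_integrand z : measurable_fun [set: plane R] (inverse_integrand z).
Proof.
apply: measurable_funD; apply: measurable_funM.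
- apply: measurableT_comp; first exact: continuous_measurable_fun (@continuous_cos R).
  exact: measurable_phase_l.
- exact: measurable_cosT.
- apply: measurableT_comp; first exact: continuous_measurable_fun (@continuous_sin R).
  exact: measurable_phase_l.
- exact: measurable_sinT.
Qed.

Let jG z : rintegrable planeleb (inverse_integrand z).
Proof. exact: (@le_rintegrable _ _ _ planeleb _ _ (measurable_inverse_integrand z) (inverse_integrand_le z) rintegrable_absT). Qed.

(** The inverse transform up to the constant [fejer_mass ^+ 2], which [inversion_ae] takes into
    account. *)
Definition inverse_fourier z : R := \int[planeleb]_k inverse_integrand z k.

Lemma measurable_inverse_fourier : measurable_fun [set: plane R] inverse_fourier.
Proof.
apply: (@measurable_Rintegral_snd _ _ _ _ _ planeleb (fun x =>
  cos (phase x.1 x.2) * cosT f x.2 + sin (phase x.1 x.2) * sinT f x.2)).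
apply: measurable_funD; apply: measurable_funM.
- exact: measurable_cos_phase.
- exact: (measurable_snd_comp (measurable_cosT jf)).
- exact: measurable_sin_phase.
- exact: (measurable_snd_comp (measurable_sinT jf)).
Qed.

Lemma inverse_fourier_le z : `|inverse_fourier z| <= sobolev_bound.
Proof.
apply: le_trans Rintegral_absT_le.
exact: (@le_norm_Rintegral _ _ _ planeleb _ _ (measurable_inverse_integrand z) (inverse_integrand_le z) rintegrable_absT).
Qed.

(** Sine and cosine are 1-Lipschitz, so the change of phase is charged to the factor 1 + |k.1| +
    |k.2| contained in [weight]. *)
Lemma inverse_fourier_lipschitz z z' : `|inverse_fourier z - inverse_fourier z'| <=
  sobolev_bound * (`|z.1 - z'.1| + `|z.2 - z'.2|).
Proof.
set d := `|_| + `|_|; have d0 : 0 <= d by rewrite addr_ge0.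
rewrite /inverse_fourier -RintegralB//; last 2 first; [exact: jG|exact: jG|].
apply: (@le_trans _ _ (\int[planeleb]_k (weight k * absT k * d))); last first.
  by rewrite RintegralZr// ler_wpM2r.
apply: (@le_norm_Rintegral _ _ _ planeleb).
- by apply: measurable_funB; exact: measurable_inverse_integrand.
- move=> k.
  have -> : inverse_integrand z k - inverse_integrand z' k = (cos (phase z k) - cos (phase z' k)) * cosT f k +
      (sin (phase z k) - sin (phase z' k)) * sinT f k by rewrite /inverse_integrand; ring.
  have hp : `|phase z k - phase z' k| <= weight k * d.
    rewrite (_ : _ - _ = (z.1 - z'.1) * k.1 + (z.2 - z'.2) * k.2); last by rewrite /phase; ring.
    rewrite (le_trans (ler_normD _ _))// !normrM /d /weight.
    have := normr_ge0 (z.1 - z'.1); have := normr_ge0 (z.2 - z'.2).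
    have := normr_ge0 k.1; have := normr_ge0 k.2.
    move: `|k.1| `|k.2| `|_ - _| `|_ - _| => a b x y; nra.
  rewrite (le_trans (ler_normD _ _))// !normrM.
  have hc := le_trans (cos_lip (phase z k) (phase z' k)) hp.
  have hs := le_trans (sin_lip (phase z k) (phase z' k)) hp.
  apply: (@le_trans _ _ (weight k * d * `|cosT f k| + weight k * d * `|sinT f k|)).
    by rewrite lerD// ler_wpM2r.
  by rewrite -mulrDr mulrAC.
- exact: rintegrableZr.
Qed.

End lipschitz_representative.

Section fejer_approximation.
Context {R : realType}.
Variable a : R -> R.
Hypotheses (ca : continuous a) (a1 : forall x, `|a x| <= 1).

(** The Fejer mean of a function of one variable. Pairings move the kernel from [f], known only as a
    class, to a continuous function, where the means converge at every point. *)
Definition smear (r x : R) : R := \int[leb]_y (a y * (r^-1 * fejer (r^-1 * (x - y)))).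

Let ma : measurable_fun [set: R] a. Proof. exact: continuous_measurable_fun. Qed.

Let mav (r x : R) : measurable_fun [set: R] (fun v => a (x - r * v) * fejer v).
Proof.
apply: measurable_funM; last exact: measurable_fejer.
by apply: (measurableT_comp ma); apply: measurable_funB => //; exact: measurable_funM.
Qed.

Let av_le (r x v : R) : `|a (x - r * v) * fejer v| <= fejer v.
Proof. by rewrite normrM (ger0_norm (fejer_ge0 v)) ler_piMl ?fejer_ge0. Qed.

Lemma smearE r x : 0 < r -> smear r x = \int[leb]_v (a (x - r * v) * fejer v).
Proof.
move=> r0; have rn : - r^-1 != 0 by rewrite oppr_eq0 invr_eq0 gt_eqF.
have j := @le_rintegrable _ _ _ leb _ _ (mav r x) (av_le r x) rintegrable_fejer.
have := Rintegral_affine (r^-1 * x) rn j.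
rewrite normrN gtr0_norm ?invr_gt0// invrK => h.
have ja := rintegrable_affine (r^-1 * x) rn j.
transitivity (r^-1 * (\int[leb]_v (a (x - r * v) * fejer v) * r)); last first.
  by rewrite mulrC mulfK// gt_eqF.
rewrite -h -(RintegralZl _ measurableT ja); apply: eq_Rintegral => y _.
have -> : x - r * (- r^-1 * y + r^-1 * x) = y by field; rewrite gt_eqF.
by rewrite mulrCA; congr (_ * (_ * fejer _)); ring.
Qed.

Lemma smear_le r x : 0 < r -> `|smear r x| <= fejer_mass.
Proof.
move=> r0; rewrite smearE//.
exact: (@le_norm_Rintegral _ _ _ leb _ _ (mav r x) (av_le r x) rintegrable_fejer).
Qed.

Lemma cvg_smear x : smear (scale_inv n) x @[n --> \oo] --> a x * fejer_mass.
Proof.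
under eq_fun do rewrite smearE ?scale_inv_gt0//.
have -> : a x * fejer_mass = \int[leb]_v (a x * fejer v).
  by rewrite RintegralZl//; exact: rintegrable_fejer.
apply: (@cvg_Rintegral _ _ _ leb _ _ _ (fun n => mav (scale_inv n) x) _
  (fun n => av_le (scale_inv n) x) rintegrable_fejer) => v.
apply: cvgM; last exact: cvg_cst.
have c : x - scale_inv n * v @[n --> \oo] --> x.
  rewrite -[X in _ --> X]subr0 -(mul0r v).
  by apply: cvgB; [exact: cvg_cst|apply: cvgM; [exact: cvg_scale_inv|exact: cvg_cst]].
exact: (cvg_comp _ _ c (@ca x)).
Qed.

End fejer_approximation.

Section inversion.
Context {R : realType}.
Variable f : R * R -> R.
Hypothesis jf : rintegrable planeleb f.
Hypothesis jS : rintegrable planeleb (fun k => bracket2 k ^+ 4 * spectrum f k).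
Variables a b : R -> R.
Hypotheses (ca : continuous a) (cb : continuous b).
Hypotheses (a1 : forall x, `|a x| <= 1) (b1 : forall x, `|b x| <= 1).

Let mf : measurable_fun [set: plane R] f. Proof. exact: rintegrable_measurable jf. Qed.

(** The weight makes bounded factors integrable and keeps them below 1. *)
Let aw x := a x * lorentz x.
Let bw x := b x * lorentz x.

Let lorentz_le1 (x : R) : lorentz x <= 1.
Proof. by rewrite /lorentz invf_le1 ?onesqr_gt0// lerDl sqr_ge0. Qed.

Let caw : continuous aw.
Proof. by move=> x; apply: cvgM; [exact: ca|exact: continuous_lorentz]. Qed.

Let cbw : continuous bw.
Proof. by move=> x; apply: cvgM; [exact: cb|exact: continuous_lorentz]. Qed.

Let aw_le x : `|aw x| <= lorentz x.
Proof. by rewrite normrM (ger0_norm (lorentz_ge0 x)) ler_piMl ?lorentz_ge0. Qed.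

Let bw_le x : `|bw x| <= lorentz x.
Proof. by rewrite normrM (ger0_norm (lorentz_ge0 x)) ler_piMl ?lorentz_ge0. Qed.

Let aw1 x : `|aw x| <= 1. Proof. exact: le_trans (aw_le x) (lorentz_le1 x). Qed.
Let bw1 x : `|bw x| <= 1. Proof. exact: le_trans (bw_le x) (lorentz_le1 x). Qed.

Let phi (z : R * R) := aw z.1 * bw z.2.

Let mphi : measurable_fun [set: plane R] phi.
Proof.
apply: measurable_funM.
  by apply: (measurable_fst_comp (f := aw)); exact: continuous_measurable_fun.
by apply: (measurable_snd_comp (f := bw)); exact: continuous_measurable_fun.
Qed.

Let phi_le z : `|phi z| <= lorentz2 z.
Proof. by rewrite normrM ler_pM. Qed.

Let jphi : rintegrable planeleb phi.
Proof. exact: (@le_rintegrable _ _ _ planeleb _ _ mphi phi_le rintegrable_lorentz2). Qed.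

Let pair_fejer_mean r : 0 < r -> \int[planeleb]_z (phi z * fejer_mean f r z) =
  \int[planeleb]_p (f p * (smear aw r p.1 * smear bw r p.2)).
Proof.
move=> r0; have [B hB] := @fejer2_bounded R r.
pose G (x : (R * R) * (R * R)) := phi x.1 * (f x.2 * fejer2 r (x.1 - x.2)).
have mG : measurable_fun [set: plane R * plane R] G.
  apply: measurable_funM; first exact: (measurable_fst_comp mphi).
  by apply: measurable_funM; [exact: (measurable_snd_comp mf)|exact: measurable_fejer2B].
have jG : rintegrable (planeleb \x planeleb)%E G.
  apply: (rintegrable_prodM mG _ (rintegrable_norm jphi)
    (rintegrableZr B (rintegrable_norm jf))) => z p.
  by rewrite /G/= normrM ler_wpM2l// normrM ler_wpM2l.
transitivity (\int[planeleb]_z \int[planeleb]_p G (z, p)).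
  apply: eq_Rintegral => z _.
  by rewrite /G/= (RintegralZl _ measurableT (rintegrable_fejer_mean jf r z)).
rewrite (Rintegral_swap jG); apply: eq_Rintegral => p _; rewrite /G/=.
have js (c : R -> R) (x : R) : continuous c -> (forall y, `|c y| <= 1) ->
    rintegrable leb (fun y => c y * (r^-1 * fejer (r^-1 * (x - y)))).
  move=> cc c1; have [j _] := fejer_shift x r0.
  apply: (@le_rintegrable _ _ _ leb _ _ _ _ j).
    apply: measurable_funM; first exact: continuous_measurable_fun.
    exact: rintegrable_measurable j.
  move=> y; have h0 : 0 <= r^-1 * fejer (r^-1 * (x - y)).
    by rewrite mulr_ge0 ?fejer_ge0// invr_ge0 ltW.
  by rewrite normrM (ger0_norm h0) ler_piMl.
have [jt et] := rintegrable_plane_prodM (js _ p.1 caw aw1) (js _ p.2 cbw bw1).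
rewrite /smear -et -(RintegralZl _ measurableT jt); apply: eq_Rintegral => z _.
by rewrite fejer2N /fejer2 /phi/=; ring.
Qed.

Let measurable_smear (c : R -> R) r : continuous c -> measurable_fun [set: R] (smear c r).
Proof.
move=> cc; pose H (z : plane R) := c z.2 * (r^-1 * fejer (r^-1 * (z.1 - z.2))).
suff mH : measurable_fun [set: plane R] H by exact: (measurable_Rintegral_snd leb mH).
apply: measurable_funM.
  by apply: (measurable_snd_comp (f := c)); exact: continuous_measurable_fun.
apply: measurable_funM => //; apply: measurableT_comp; first exact: measurable_fejer.
by apply: measurable_funM => //; exact: measurable_funB.
Qed.

Let k0 : 0 <= @fejer_mass R. Proof. exact/ltW/fejer_mass_gt0. Qed.

Let limit1 : \int[planeleb]_z (phi z * fejer_mean f (scale_inv n) z) @[n --> \oo] -->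
  \int[planeleb]_p (f p * (aw p.1 * fejer_mass * (bw p.2 * fejer_mass))).
Proof.
under eq_fun do rewrite pair_fejer_mean ?scale_inv_gt0//.
have jd := rintegrableZr (fejer_mass ^+ 2) (rintegrable_norm jf).
apply: (@cvg_Rintegral _ _ _ planeleb _ _ _ _ _ _ jd).
- move=> n; apply: measurable_funM => //; apply: measurable_funM.
    by apply: (measurable_fst_comp (f := smear aw _)); exact: measurable_smear.
  by apply: (measurable_snd_comp (f := smear bw _)); exact: measurable_smear.
- move=> p; apply: cvgM; first exact: cvg_cst.
  by apply: cvgM; exact: cvg_smear.
- move=> n p; rewrite normrM ler_wpM2l// normrM expr2 ler_pM//.
    by rewrite smear_le// scale_inv_gt0.
  by rewrite smear_le// scale_inv_gt0.
Qed.

Let F := inverse_fourier f.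

Let mF : measurable_fun [set: plane R] F.
Proof. exact: measurable_inverse_fourier. Qed.

Let cvg_fejer_mean z : fejer_mean f (scale_inv n) z @[n --> \oo] --> F z.
Proof.
under eq_fun do rewrite -fejer_mean_inversion ?scale_inv_gt0//.
apply: (@cvg_Rintegral _ _ _ planeleb _ _ _ _ _ _ (rintegrable_absT jf jS)).
- move=> n; apply: measurable_funM; first exact: measurable_tent2.
  exact: measurable_inverse_integrand.
- move=> k; rewrite -[X in _ --> X]mul1r; apply: cvgM; first exact: cvg_tent2.
  exact: cvg_cst.
- move=> n k; rewrite normrM (ger0_norm (tent2_ge0 _ _)).
  rewrite (le_trans _ (inverse_integrand_le f z k))//.
  by rewrite ler_piMl// tent2_le1.
Qed.

Let fejer_mean_le n z : `|fejer_mean f (scale_inv n) z| <= sobolev_bound f.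
Proof.
rewrite -fejer_mean_inversion ?scale_inv_gt0//; apply: le_trans (Rintegral_absT_le jf jS).
apply: (@le_norm_Rintegral _ _ _ planeleb _ _ _ _ (rintegrable_absT jf jS)).
- apply: measurable_funM; first exact: measurable_tent2.
  exact: measurable_inverse_integrand.
- move=> k; rewrite normrM (ger0_norm (tent2_ge0 _ _)).
  rewrite (le_trans _ (inverse_integrand_le f z k))//.
  by rewrite ler_piMl// tent2_le1.
Qed.

Let mfm n : measurable_fun [set: plane R] (fejer_mean f (scale_inv n)).
Proof.
pose H (x : plane R * plane R) := f x.2 * fejer2 (scale_inv n) (x.1 - x.2).
suff mH : measurable_fun setT H by exact: (measurable_Rintegral_snd planeleb mH).
by apply: measurable_funM; [exact: (measurable_snd_comp mf)|exact: measurable_fejer2B].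
Qed.

Let limit2 : \int[planeleb]_z (phi z * fejer_mean f (scale_inv n) z) @[n --> \oo] -->
  \int[planeleb]_z (phi z * F z).
Proof.
have jd := rintegrableZr (sobolev_bound f) rintegrable_lorentz2.
apply: (@cvg_Rintegral _ _ _ planeleb _ _ _ _ _ _ jd).
- by move=> n; exact: measurable_funM.
- by move=> z; apply: cvgM; [exact: cvg_cst|exact: cvg_fejer_mean].
- by move=> n z; rewrite normrM ler_pM.
Qed.

(** One pairing has two limits. With the kernel moved to the test function it tends to
    [fejer_mass ^+ 2] times the pairing with [f]; with the means written as inverse transforms cut
    off by [tent2], to the pairing with [F]. *)
Lemma inversion_tested :
  \int[planeleb]_z ((fejer_mass ^+ 2 * f z - F z) * lorentz2 z * (a z.1 * b z.2)) = 0.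
Proof.
have e := cvg_unique _ limit1 limit2.
have j1 : rintegrable planeleb (fun z => f z * (aw z.1 * fejer_mass * (bw z.2 * fejer_mass))).
  apply: (@le_rintegrable _ _ _ planeleb _ _ _ _
    (rintegrableZr (fejer_mass ^+ 2) (rintegrable_norm jf))).
    apply: measurable_funM => //; apply: measurable_funM; apply: measurable_funM => //.
      by apply: (measurable_fst_comp (f := aw)); exact: continuous_measurable_fun.
    by apply: (measurable_snd_comp (f := bw)); exact: continuous_measurable_fun.
  move=> z; rewrite normrM ler_wpM2l// normrM expr2 ler_pM//.
    by rewrite normrM (ger0_norm k0) ler_piMl.
  by rewrite normrM (ger0_norm k0) ler_piMl.
have j2 : rintegrable planeleb (fun z => phi z * F z).
  apply: (@le_rintegrable _ _ _ planeleb _ _ _ _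
    (rintegrableZr (sobolev_bound f) rintegrable_lorentz2)).
    exact: measurable_funM.
  by move=> z; rewrite normrM ler_pM// inverse_fourier_le.
transitivity (\int[planeleb]_p (f p * (aw p.1 * fejer_mass * (bw p.2 * fejer_mass))) -
   \int[planeleb]_z (phi z * F z)); last first.
  apply/eqP; rewrite subr_eq0; apply/eqP; exact: e.
rewrite -RintegralB//; apply: eq_Rintegral => z _.
by rewrite /phi /aw /bw /lorentz2; ring.
Qed.

End inversion.

(** Sets over which [g] has integral 0 form a Dynkin class, the vanishing total integral taking care
    of complements. The map [p] lets one coordinate be treated at a time. *)
Lemma integral_pi_system_eq0 d d' (T : measurableType d) (T' : measurableType d')
    (R : realType) (mu : {measure set T -> \bar R}) (p : T -> T') (G : set (set T'))
    (g : T -> \bar R) :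
  measurable_fun [set: T] p -> @measurable _ T' = <<s G >> -> setI_closed G ->
  mu.-integrable [set: T] g -> (\int[mu]_x g x = 0)%E ->
  (forall A, G A -> \int[mu]_(x in p @^-1` A) g x = 0)%E ->
  forall A, measurable A -> (\int[mu]_(x in p @^-1` A) g x = 0)%E.
Proof.
move=> mp GE GI ig g0 gG.
have mpre A : measurable A -> measurable (p @^-1` A).
  by move=> mA; rewrite -[X in measurable X]setTI; exact: mp.
suff h A : <<s G >> A -> (\int[mu]_(x in p @^-1` A) g x = 0)%E.
  by move=> A; rewrite GE; exact: h.
apply: (dynkin_induction (P := fun A => (\int[mu]_(x in p @^-1` A) g x = 0)%E) GE GI) => //.
- move=> S mS S0; rewrite preimage_setC.
  have := @integral_setU _ _ _ mu (p @^-1` S) (~` (p @^-1` S)) g.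
  rewrite setUv g0 S0 add0e => <- //.
  - exact: mpre.
  - by apply: measurableC; exact: mpre.
  - exact: measurable_int ig.
  - by apply/disj_setPCl.
- move=> F mF tF h; rewrite preimage_bigcup integral_bigcup//.
  + exact: eseries0.
  + apply/trivIsetP => i j _ _ ij; rewrite -preimage_setI.
    by move/trivIsetP : tF => ->; rewrite ?preimage_set0.
  + by move=> k; exact: mpre.
  + apply: integrableS ig => //; rewrite -preimage_bigcup; apply: mpre.
    exact: bigcup_measurable.
Qed.

(** * Functions annihilated by all tensor products *)

Section tested_functions.
Context {R : realType}.
Variable h : R * R -> R.
Hypothesis jh : rintegrable planeleb h.
Hypothesis h0 : forall a b : R -> R, continuous a -> continuous b ->
  (forall x, `|a x| <= 1) -> (forall x, `|b x| <= 1) ->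
  \int[planeleb]_z (h z * (a z.1 * b z.2)) = 0.

Let ramp (c : R) (n : nat) (x : R) : R := Num.min 1 (n.+1%:R * Num.max 0 (x - c)).

Let ramp_le c n x : `|ramp c n x| <= 1.
Proof.
rewrite ger0_norm; first by rewrite /ramp ge_min lexx.
by rewrite /ramp le_min ler01 mulr_ge0// le_max lexx.
Qed.

Let continuous_ramp c n : continuous (ramp c n).
Proof.
move=> x; apply: (@continuous_min _ _ (fun=> 1) (fun x : R => n.+1%:R * Num.max 0 (x - c))).
  exact: cst_continuous.
apply: cvgM; first exact: cvg_cst.
apply: (@continuous_max _ _ (fun=> 0) (fun x : R => x - c)); first exact: cst_continuous.
by apply: cvgB; [exact: cvg_id|exact: cvg_cst].
Qed.

Let cvg_ramp c x : ramp c n x @[n --> \oo] --> b2r (c < x).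
Proof.
apply: cvg_near_cst; rewrite /b2r; case: ltP => cx; last first.
  by apply: nearW => n; rewrite /ramp (max_idPl _) ?subr_le0// mulr0 (min_idPr _).
have xc : 0 < x - c by rewrite subr_gt0.
near=> n; rewrite /ramp (max_idPr _) ?(ltW xc)// (min_idPl _)//.
rewrite -ler_pdivrMr// div1r (@le_trans _ _ n%:R) ?ler_nat//.
by near: n; exact: nbhs_infty_ger.
Unshelve. all: by end_near. Qed.

Let mh : measurable_fun [set: plane R] h. Proof. exact: rintegrable_measurable jh. Qed.

Let limit_tested (a_ b_ : nat -> R -> R) (a b : R -> R) :
  (forall n, measurable_fun [set: R] (a_ n)) -> (forall n, measurable_fun [set: R] (b_ n)) ->
  (forall n x, `|a_ n x| <= 1) -> (forall n x, `|b_ n x| <= 1) ->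
  (forall x, a_ n x @[n --> \oo] --> a x) -> (forall x, b_ n x @[n --> \oo] --> b x) ->
  (forall n, \int[planeleb]_z (h z * (a_ n z.1 * b_ n z.2)) = 0) ->
  \int[planeleb]_z (h z * (a z.1 * b z.2)) = 0.
Proof.
move=> ma mb a1 b1 ca cb z0.
have c : \int[planeleb]_z (h z * (a_ n z.1 * b_ n z.2)) @[n --> \oo] -->
    \int[planeleb]_z (h z * (a z.1 * b z.2)).
  apply: (@cvg_Rintegral _ _ _ planeleb _ _ _ _ _ _ (rintegrable_norm jh)).
  - move=> n; apply: measurable_funM => //; apply: measurable_funM.
      exact: (measurable_fst_comp (ma n)).
    exact: (measurable_snd_comp (mb n)).
  - by move=> z; apply: cvgM; [exact: cvg_cst|exact: cvgM].
  - move=> n z; rewrite normrM ler_piMr// normrM -[leRHS](mulr1 1).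
    by apply: ler_pM.
have e : (fun n => \int[planeleb]_z (h z * (a_ n z.1 * b_ n z.2))) = fun=> 0.
  by apply/funext => n; exact: z0.
rewrite e in c; exact: (cvg_unique _ c (cvg_cst 0)).
Qed.

(** Each flag replaces an indicator by 1, so that rays and the whole line are handled together; the
    whole line provides the vanishing total integral for the Dynkin argument. *)
Let tested_ray (s t : bool) (c e : R) :
  \int[planeleb]_z (h z * ((if s then b2r (c < z.1) else 1) * (if t then b2r (e < z.2) else 1))) = 0.
Proof.
pose A (s : bool) c n x := if s then ramp c n x else 1.
have cA s' c' n : continuous (A s' c' n).
  by case: s' => [|x]; [exact: continuous_ramp|exact: cvg_cst].
apply: (limit_tested (a_ := A s c) (b_ := A t e)
    (a := fun x => if s then b2r (c < x) else 1) (b := fun x => if t then b2r (e < x) else 1)).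
- by move=> n; exact: continuous_measurable_fun.
- by move=> n; exact: continuous_measurable_fun.
- by move=> n x; rewrite /A; case: s => //; rewrite normr1.
- by move=> n x; rewrite /A; case: t => //; rewrite normr1.
- by move=> x; rewrite /A; case: s; [exact: cvg_ramp|exact: cvg_cst].
- by move=> x; rewrite /A; case: t; [exact: cvg_ramp|exact: cvg_cst].
- move=> n; apply: h0 => // x; rewrite /A; first by case: s => //; rewrite normr1.
  by case: t => //; rewrite normr1.
Qed.

Let rays_setI : setI_closed (@RGenOInfty.G R).
Proof.
move=> _ _ [c ->] [e ->]; exists (Num.max c e); apply/seteqP; split => x /=;
  rewrite !in_itv/= !andbT gt_max.
  by move=> [-> ->].
by move=> /andP[].
Qed.

Let mR : @measurable _ (measurableTypeR R) = <<s @RGenOInfty.G R >>.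
Proof. exact: RGenOInfty.measurableE. Qed.

Let hE : plane R -> \bar R := EFin \o h.

Let ray (s : bool) (c : R) : set R := if s then [set` `]c, +oo[] else setT.

Let mfst (A : set (measurableTypeR R)) : measurable A -> measurable (fst @^-1` A : set (plane R)).
Proof. by move=> mA; rewrite -[X in measurable X]setTI; exact: measurable_fst. Qed.

Let msnd (A : set (measurableTypeR R)) : measurable A -> measurable (snd @^-1` A : set (plane R)).
Proof. by move=> mA; rewrite -[X in measurable X]setTI; exact: measurable_snd. Qed.

Let mray s c : measurable (ray s c : set (measurableTypeR R)).
Proof. by rewrite /ray; case: s. Qed.

Let jpatch (D : set (plane R)) : measurable D -> planeleb.-integrable setT (hE \_ D).
Proof. by move=> mD; apply/(integrable_mkcond _ mD); exact: integrableS jh. Qed.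

Let int_rays s t c e :
  (\int[planeleb]_(z in fst @^-1` ray s c `&` snd @^-1` ray t e) hE z = 0)%E.
Proof.
have m : measurable (fst @^-1` ray s c `&` snd @^-1` ray t e : set (plane R)).
  exact: (measurableI _ _ (mfst (mray s c)) (msnd (mray t e))).
have ii := integrableS measurableT m (@subsetT _ _) jh.
rewrite -[LHS]fineK; last exact: integrable_fin_num.
suff E : \int[planeleb]_(z in fst @^-1` ray s c `&` snd @^-1` ray t e) h z = 0 by congr EFin.
rewrite Rintegral_mkcond -[RHS](tested_ray s t c e); apply: eq_Rintegral => z _; rewrite patchE; case: ifPn.
  rewrite inE/= /ray => -[]; rewrite /b2r; case: (s); case: (t); rewrite /= ?in_itv/= ?andbT.
  - by move=> -> ->; rewrite !mulr1.
  - by move=> -> _; rewrite !mulr1.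
  - by move=> _ ->; rewrite !mulr1.
  - by rewrite !mulr1.
rewrite notin_setE/= /ray /b2r; case: (s); case: (t); rewrite /= ?in_itv/= ?andbT.
- move=> n; case: ifPn => [h1|_]; last by rewrite mul0r mulr0.
  by case: ifPn => [h2|_]; [case: n|rewrite !mulr0].
- by move=> n; case: ifPn => [h1|_]; [case: n|rewrite mul0r mulr0].
- by move=> n; case: ifPn => [h1|_]; [case: n|rewrite mulr0 mulr0].
- by case.
Qed.

Let int_fst (A : set (measurableTypeR R)) t e : measurable A ->
  (\int[planeleb]_(z in fst @^-1` A `&` snd @^-1` ray t e) hE z = 0)%E.
Proof.
move=> mA; rewrite integral_mkcondr.
apply: (integral_pi_system_eq0 (@measurable_fst _ _ _ _) mR rays_setI _ _ _ mA).
- by apply: jpatch; exact: (msnd (mray t e)).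
- by rewrite -integral_mkcond; have := int_rays false t 0 e; rewrite setTI.
- by move=> _ [c ->]; rewrite -integral_mkcondr; exact: (int_rays true t c e).
Qed.

Let int_rect (A B : set (measurableTypeR R)) : measurable A -> measurable B ->
  (\int[planeleb]_(z in fst @^-1` A `&` snd @^-1` B) hE z = 0)%E.
Proof.
move=> mA mB; rewrite setIC integral_mkcondr.
apply: (integral_pi_system_eq0 (@measurable_snd _ _ _ _) mR rays_setI _ _ _ mB).
- by apply: jpatch; exact: (mfst mA).
- by rewrite -integral_mkcond; have := int_fst false 0 mA; rewrite setIT.
- by move=> _ [c ->]; rewrite -integral_mkcondr setIC; exact: (int_fst true c mA).
Qed.

(** Continuous ramps approximate indicators of open rays, rays generate the Borel sets in one
    coordinate after the other, and rectangles generate those of the plane. *)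
Lemma tested_eq0 : {ae planeleb, forall z, h z = 0}.
Proof.
have e0 : ae_eq planeleb setT hE (cst 0%E).
  apply: integral_ae_eq => // E _ mE; rewrite integral_cst// mul0e.
  apply: (integral_pi_system_eq0 (p := id) (mu := planeleb) (G := [set A `*` B | A in measurable & B in measurable]) _ _ _ _ _ _ mE) => //.
  - exact: measurable_prod_measurableType.
  - move=> _ _ [A mA [B mB <-]] [A' mA' [B' mB' <-]].
    by exists (A `&` A'); [exact: measurableI|exists (B `&` B'); [exact: measurableI|rewrite setXI]].
  - by have := int_rays false false 0 0; rewrite setIT.
  - by move=> _ [A mA [B mB <-]]; exact: int_rect.
by move: e0; apply: filterS => z /(_ I) [].
Qed.

End tested_functions.

Section fourier_inversion.
Context {R : realType}.
Variable f : R * R -> R.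
Hypothesis jf : rintegrable planeleb f.
Hypothesis jS : rintegrable planeleb (fun k => bracket2 k ^+ 4 * spectrum f k).

Lemma inversion_ae : {ae planeleb, forall z, f z = (fejer_mass ^+ 2)^-1 * inverse_fourier f z}.
Proof.
have mF := measurable_inverse_fourier jf.
have mf : measurable_fun [set: plane R] f by exact: rintegrable_measurable jf.
pose h z := (fejer_mass ^+ 2 * f z - inverse_fourier f z) * lorentz2 z.
have jh : rintegrable planeleb h.
  have jd := rintegrableD (rintegrableZ (fejer_mass ^+ 2) (rintegrable_norm jf))
    (rintegrableZ (sobolev_bound f) rintegrable_lorentz2).
  apply: (@le_rintegrable _ _ _ planeleb _ _ _ _ jd).
    apply: measurable_funM; last exact: measurable_lorentz2.
    by apply: measurable_funB => //; exact: measurable_funM.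
  move=> z; have l0 := ltW (lorentz2_gt0 z).
  have l1 : lorentz2 z <= 1.
    by rewrite mulr_ile1 ?lorentz_ge0// /lorentz invf_le1 ?onesqr_gt0// lerDl sqr_ge0.
  rewrite normrM (ger0_norm l0) (le_trans (ler_wpM2r l0 (ler_normB _ _)))// mulrDl.
  rewrite normrM (ger0_norm (sqr_ge0 _)) lerD//.
    by rewrite ler_piMr// mulr_ge0 ?sqr_ge0.
  by rewrite ler_wpM2r// inverse_fourier_le.
have [N [mN N0 sub]] := tested_eq0 jh (fun a b ca cb a1 b1 =>
  inversion_tested jf jS ca cb a1 b1).
exists N; split => // z /=; apply: contra_notP => Nz.
have : h z = 0 by apply: contrapT => e; apply: Nz; exact: sub.
move=> /eqP; rewrite mulf_eq0 (gt_eqF (lorentz2_gt0 z)) orbF subr_eq0 => /eqP <-.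
by rewrite mulKf// expf_neq0// gt_eqF// fejer_mass_gt0.
Qed.

End fourier_inversion.

(** * Integrability and Sobolev bounds for weighted functions *)

Section weighted_integrability.
Context {R : realType}.
Implicit Types (f g w : R * R -> R).

Let one_dual : in_dual (fun=> 1 : R).
Proof. by apply: (in_dual_bounded (C := 1)) => // p; rewrite normr1. Qed.

Lemma in_weighted_rintegrable w : in_weighted w -> rintegrable planeleb w.
Proof.
by move=> hw; have := rintegrable_dual hw one_dual; under eq_fun do rewrite mulr1.
Qed.

Lemma in_weighted_rintegrable_sqr w : in_weighted w -> rintegrable planeleb (fun p => w p ^+ 2).
Proof.
move=> [mw jw]; apply: (@le_rintegrable _ _ _ planeleb _ _ _ _ jw).
  exact: measurable_funX.
move=> p; rewrite ger0_norm ?sqr_ge0// exprMn ler_peMl ?sqr_ge0//.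
by rewrite exprn_ege1// bracket2_ge1.
Qed.

(** Cauchy-Schwarz against the constant 1, which lies in the dual space because the inverse square
    of the bracket is integrable. *)
Lemma in_weighted_L1_le w : in_weighted w ->
  \int[planeleb]_p `|w p| <= Num.sqrt (wsq w) * Num.sqrt (dualsq (fun=> 1 : R)).
Proof.
move=> hw; have [mw jw] := hw.
have hn : in_weighted (fun p => `|w p|).
  split; first exact: measurableT_comp.
  by under eq_fun do rewrite exprMn real_normK ?num_real// -exprMn.
have n0 : 0 <= \int[planeleb]_p `|w p| by apply: Rintegral_ge0.
rewrite -sqrtrM ?wsq_ge0// -(ger0_norm n0) -sqrtr_sqr; apply: ler_wsqrtr.
have := dual_CauchySchwarz hn one_dual.
under eq_Rintegral do rewrite mulr1.
rewrite (_ : wsq (fun p => `|w p|) = wsq w)//.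
by apply: eq_Rintegral => p _; rewrite exprMn real_normK ?num_real// -exprMn.
Qed.

(** The squared H^4 norm without its factor (2 pi)^-2; [sobolev4_finite] relates it to
    [sobolev_norm2]. *)
Definition sobolev4 f : R := \int[planeleb]_k (bracket2 k ^+ 4 * spectrum f k).

Lemma spectrum_ge0 f k : 0 <= spectrum f k.
Proof. by rewrite addr_ge0// sqr_ge0. Qed.

Lemma sobolev4_finite f : in_weighted f -> (sobolev_norm2 4 f < +oo)%E ->
  rintegrable planeleb (fun k => bracket2 k ^+ 4 * spectrum f k) /\
  (((2 * pi) ^- 2 * sobolev4 f)%:E = sobolev_norm2 4 f)%E.
Proof.
move=> hf; have jf := in_weighted_rintegrable hf.
have jf2 := in_weighted_rintegrable_sqr hf.
rewrite sobolev_norm2E//.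
have E k : bracket2 k `^ 4 * ((2 * pi) ^- 2 * spectrum f k) =
    (2 * pi) ^- 2 * (bracket2 k ^+ 4 * spectrum f k).
  by rewrite powR_mulrn ?(ltW (bracket2_gt0 _))// mulrCA.
under eq_integral do rewrite E.
have p0 : (2 * pi) ^- 2 != 0 :> R.
  by rewrite invr_neq0// expf_neq0// mulf_neq0// gt_eqF// pi_gt0.
have mS : measurable_fun [set: plane R] (fun k => bracket2 k ^+ 4 * spectrum f k).
  apply: measurable_funM; first by apply: measurable_funX; exact: measurable_bracket2.
  by apply: measurable_funD; apply: measurable_funX; [exact: measurable_cosT|exact: measurable_sinT].
have S0 k : 0 <= bracket2 k ^+ 4 * spectrum f k.
  by rewrite mulr_ge0 ?spectrum_ge0// exprn_ge0// ltW// bracket2_gt0.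
move=> fy.
have j : rintegrable planeleb (fun k => (2 * pi) ^- 2 * (bracket2 k ^+ 4 * spectrum f k)).
  apply: rintegrable_ge0P => //; first exact: measurable_funM.
  by move=> k; rewrite mulr_ge0// invr_ge0 sqr_ge0.
have j' := rintegrableZ ((2 * pi) ^- 2)^-1 j.
have {}j' : rintegrable planeleb (fun k => bracket2 k ^+ 4 * spectrum f k).
  by move: j'; under eq_fun do rewrite mulKf//.
by split => //; rewrite -EFin_Rintegral// RintegralZl.
Qed.

Lemma spectrum_le f g k : rintegrable planeleb f -> rintegrable planeleb g ->
  spectrum f k <= 2 * spectrum (fun p => f p - g p) k + 2 * spectrum g k.
Proof.
move=> jf jg; rewrite /spectrum.
have -> : cosT (fun p => f p - g p) k = cosT f k - cosT g k.
  rewrite /cosT -RintegralB//; [|exact: rintegrable_cosT..].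
  by apply: eq_Rintegral => p _; rewrite mulrBr.
have -> : sinT (fun p => f p - g p) k = sinT f k - sinT g k.
  rewrite /sinT -RintegralB//; [|exact: rintegrable_sinT..].
  by apply: eq_Rintegral => p _; rewrite mulrBr.
move: (cosT f k) (cosT g k) (sinT f k) (sinT g k) => a b c d.
by have := sqr_ge0 (a - 2 * b); have := sqr_ge0 (c - 2 * d); lra.
Qed.

Lemma sobolev4_le f g : in_weighted f -> in_weighted g ->
  (sobolev_norm2 4 f < +oo)%E -> (sobolev_norm2 4 g < +oo)%E ->
  (sobolev_norm2 4 (fun p => (f p - g p)%R) < +oo)%E ->
  sobolev4 f <= 2 * sobolev4 (fun p => f p - g p) + 2 * sobolev4 g.
Proof.
move=> hf hg ff fg ffg.
have [j1 _] := sobolev4_finite hf ff; have [j2 _] := sobolev4_finite hg fg.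
have [j3 _] := sobolev4_finite (in_weightedB hf hg) ffg.
have i2 := rintegrableZ 2 j2; have i3 := rintegrableZ 2 j3.
have le : \int[planeleb]_k (bracket2 k ^+ 4 * spectrum f k) <=
    \int[planeleb]_k (2 * (bracket2 k ^+ 4 * spectrum (fun p => f p - g p) k) +
      2 * (bracket2 k ^+ 4 * spectrum g k)).
  apply: le_Rintegral => [//|//||k _]; first exact: (rintegrableD i3 i2).
  rewrite !(mulrCA 2) -mulrDr ler_wpM2l//.
    by rewrite exprn_ge0// ltW// bracket2_gt0.
  by apply: spectrum_le; exact: in_weighted_rintegrable.
move: le; rewrite (RintegralD measurableT i3 i2).
by rewrite (RintegralZl 2 measurableT j3) (RintegralZl 2 measurableT j2).
Qed.

End weighted_integrability.

(** * Uniform regularity of the solution curve *)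

Section lipschitz_curve.
Context {R : realType}.
Variables (T : R) (u : R -> R * R -> R).
Hypotheses (T0 : 0 < T) (hu : continuous_in_Z T 4 2 u).

Let huc t : in_weighted (uc T u t). Proof. exact: uc_in_weighted. Qed.

Let uc_sobolev t : (sobolev_norm2 4 (uc T u t) < +oo)%E.
Proof. by have [|[[_ hs] _] _] := hu (t0 := clamp T t); first by rewrite in_itv/= clamp_itv. Qed.

Let uc_sobolev_near t0 :
  \forall t \near t0, (sobolev_norm2 4 (fun p => (uc T u t p - uc T u t0 p)%R) < 1%:E)%E.
Proof.
have [|_ hc] := hu (t0 := clamp T t0); first by rewrite in_itv/= clamp_itv.
have c : Z_norm2 4 2 (fun p => uc T u t p - uc T u t0 p) @[t --> t0] --> 0%E.
  have cc : clamp T s @[s --> t0] --> within `[0, T] (nbhs (clamp T t0)).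
    move=> A hA; have : \forall s \near t0, [set` `[0, T]] (clamp T s) -> A (clamp T s).
      exact: (@continuous_clamp _ T t0 _ hA).
    by apply: filterS => s; apply; rewrite /= in_itv/= clamp_itv.
  exact: (cvg_comp _ _ cc hc).
have : \forall t \near t0, (Z_norm2 4 2 (fun p => (uc T u t p - uc T u t0 p)%R) < 1%:E)%E.
  move/fine_cvgP : c => [fin /cvgr_lt/(_ _ ltr01) c1].
  by apply: filterS2 fin c1 => t f1 c1; rewrite -(fineK f1) lte_fin.
apply: filterS => t; apply: le_lt_trans; rewrite /Z_norm2 leeDl//.
by apply: integral_ge0 => p _; rewrite lee_fin mulr_ge0 ?powR_ge0// sqr_ge0.
Qed.

(** Continuity in [Z] bounds the Sobolev norm locally in time, and compactness of [0, T]
    globally. *)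
Lemma uc_sobolev_bounded : exists S : R, forall t, sobolev4 (uc T u t) <= S.
Proof.
have loc (t0 : R) : exists B : R, \forall t \near t0, sobolev4 (uc T u t) <= B.
  (* Near [t0] the increment has [sobolev_norm2] below 1, that is, [sobolev4] below (2 pi)^2. *)
  exists (2 * (2 * pi) ^+ 2 + 2 * sobolev4 (uc T u t0)).
  apply: filterS (uc_sobolev_near t0) => t h1.
  have ffg : (sobolev_norm2 4 (fun p => (uc T u t p - uc T u t0 p)%R) < +oo)%E.
    by apply: lt_trans h1 _; rewrite ltry.
  rewrite (le_trans (sobolev4_le (huc t) (huc t0) (uc_sobolev t) (uc_sobolev t0) ffg))//.
  rewrite lerD2r ler_wpM2l//.
  have [_ e] := sobolev4_finite (in_weightedB (huc t) (huc t0)) ffg.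
  move: h1; rewrite -e lte_fin => /ltW; rewrite -ler_pdivlMl ?invr_gt0 ?exprn_gt0 ?mulr_gt0 ?pi_gt0//.
  by rewrite invrK mulr1.
(* Compactness in its near-covering form: the parameter is an integer bound that only has to be
   large enough, so local bounds merge into one. *)
have /compact_near_coveringP cov := @segment_compact R 0 T.
have [|n _ h] := cov nat \oo (fun n t => sobolev4 (uc T u t) <= n%:R) _.
  move=> t _; have [B hB] := loc t.
  have [N _ hN] := nbhs_infty_ger B.
  exists ([set s | sobolev4 (uc T u s) <= B], [set n : nat | B <= n%:R]).
    by split => //=; exists N.
  by move=> [s m] /= [h1 h2]; exact: le_trans h2.
exists n%:R => t; rewrite /uc; have := h n (leqnn n) (clamp T t).
by rewrite /= in_itv/= clamp_itv// /uc clamp_id ?clamp_itv//; apply.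
Qed.

Lemma ae_eq_Rintegral (f g : R * R -> R) : measurable_fun [set: plane R] f ->
  measurable_fun [set: plane R] g -> {ae planeleb, forall p, f p = g p} ->
  \int[planeleb]_p f p = \int[planeleb]_p g p.
Proof.
move=> mf mg [N [mN N0 sub]]; rewrite /Rintegral; congr fine; apply: ae_eq_integral => //.
- exact/measurable_EFinP.
- exact/measurable_EFinP.
- exists N; split => // p /=; apply: contra_notP => Np _.
  by congr EFin; apply: contrapT => e; apply: Np; exact: sub.
Qed.

Lemma ae_eq_rintegrable (f g : R * R -> R) : rintegrable planeleb f ->
  measurable_fun [set: plane R] g -> {ae planeleb, forall p, f p = g p} ->
  rintegrable planeleb g.
Proof.
move=> /[dup] /rintegrable_measurable mf /integrableP[_ fy] mg [N [mN N0 sub]].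
apply/integrableP; split; first exact/measurable_EFinP.
rewrite -(@ae_eq_integral _ _ _ planeleb setT _ (fun p => `|(EFin \o f) p|%E))//.
- by apply: measurableT_comp => //; exact/measurable_EFinP.
- by apply: measurableT_comp => //; exact/measurable_EFinP.
exists N; split => // p /=; apply: contra_notP => Np _.
by congr (`|_|%:E); apply: contrapT => e; apply: Np; exact: sub.
Qed.

(** The representative is the renormalised inverse transform. Its bounds depend on the solution only
    through [sobolev4] and [wsq], both bounded in time, so [M] and [N] serve all times. *)
Lemma regular_representative : exists (v : R -> R * R -> R) (M N : R), 0 <= M /\
  [/\ forall t, measurable_fun [set: plane R] (v t),
      forall t p, `|v t p| <= M,
      forall t p q, `|v t p - v t q| <= M * (`|p.1 - q.1| + `|p.2 - q.2|),
      forall t, rintegrable planeleb (v t) /\ \int[planeleb]_p `|v t p| <= N &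
      forall t, {ae planeleb, forall p, uc T u t p = v t p}].
Proof.
have [S hS] := uc_sobolev_bounded.
have [V V0 hV] := uc_bounded T0 hu.
have jf t := in_weighted_rintegrable (huc t).
have jS t : rintegrable planeleb (fun k => bracket2 k ^+ 4 * spectrum (uc T u t) k).
  by have [] := sobolev4_finite (huc t) (uc_sobolev t).
pose B := S + 3 / 2 * \int[planeleb]_k (@lorentz2 R k).
have hB t : sobolev_bound (uc T u t) <= B by rewrite /sobolev_bound lerD2r; exact: hS.
have B0 : 0 <= B by apply: le_trans (hB 0); exact: le_trans (inverse_fourier_le (jf 0) (jS 0) 0).
pose m : R := (fejer_mass ^+ 2)^-1.
have m0 : 0 <= m by rewrite invr_ge0 sqr_ge0.
pose v t p := m * inverse_fourier (uc T u t) p.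
have mv t : measurable_fun [set: plane R] (v t).
  by apply: measurable_funM => //; exact: measurable_inverse_fourier.
have ae t : {ae planeleb, forall p, uc T u t p = v t p} by exact: inversion_ae.
exists v, (m * B), (Num.sqrt V * Num.sqrt (dualsq (fun=> 1 : R))).
split; first by rewrite mulr_ge0.
split => //.
- move=> t p; rewrite normrM ger0_norm// ler_wpM2l//.
  exact: le_trans (inverse_fourier_le (jf t) (jS t) p) (hB t).
- move=> t p q; rewrite -mulrBr normrM ger0_norm// -mulrA ler_wpM2l//.
  rewrite (le_trans (inverse_fourier_lipschitz (jf t) (jS t) p q))//.
  by apply: ler_wpM2r; [exact: addr_ge0|exact: hB].
- move=> t; split; first exact: ae_eq_rintegrable (ae t).
  rewrite -(@ae_eq_Rintegral (fun p => `|uc T u t p|)).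
  + rewrite (le_trans (in_weighted_L1_le (huc t)))// ler_wpM2r//.
    by rewrite ler_wsqrtr.
  + by apply: measurableT_comp => //; exact: rintegrable_measurable (jf t).
  + exact: measurableT_comp.
  + have [N [mN N0 sub]] := ae t; exists N; split => // p /=; apply: contra_notP => Np.
    by congr `|_|; apply: contrapT => e; apply: Np; exact: sub.
Qed.

End lipschitz_curve.

(** * Conservation of the L^2 norm *)

Section correlation.
Context {R : realType}.
Implicit Types (f g : R * R -> R).
Variables (Psi : R * R -> R) (C : R).
Hypothesis mPsi : measurable_fun [set: plane R] Psi.
Hypothesis PsiC : forall z, `|Psi z| <= C.

(** For fixed [q] this is a moment of [g] against a translated kernel, hence within reach of the
    evolution equation. *)
Definition corr g q : R := \int[planeleb]_p (g p * Psi (p - q)).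

Definition corr_pair f g : R := \int[planeleb]_q (f q * corr g q).

Lemma measurable_planeB :
  measurable_fun [set: plane R * plane R] (fun x => x.2 - x.1 : plane R).
Proof.
apply: measurable_fun_pair => /=; apply: measurable_funB.
- by apply: (measurable_snd_comp (f := fst)).
- by apply: (measurable_fst_comp (f := fst)).
- by apply: (measurable_snd_comp (f := snd)).
- by apply: (measurable_fst_comp (f := snd)).
Qed.

Lemma measurable_Psi_shift q : measurable_fun [set: plane R] (fun p => Psi (p - q)).
Proof.
by apply: (measurableT_comp mPsi); apply: measurable_fun_pair => /=; exact: measurable_funB.
Qed.

Lemma rintegrable_corr g q : rintegrable planeleb g ->
  rintegrable planeleb (fun p => g p * Psi (p - q)).
Proof.
move=> jg; apply: (@le_rintegrable _ _ _ planeleb _ _ _ _ (rintegrableZr C (rintegrable_norm jg))).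
  by apply: measurable_funM; [exact: rintegrable_measurable jg|exact: measurable_Psi_shift].
by move=> p; rewrite normrM ler_wpM2l.
Qed.

Lemma corr_le g q : rintegrable planeleb g -> `|corr g q| <= C * \int[planeleb]_p `|g p|.
Proof.
move=> jg; have jn := rintegrable_norm jg.
rewrite mulrC -RintegralZr//; apply: (@le_norm_Rintegral _ _ _ planeleb).
- exact: rintegrable_measurable (rintegrable_corr q jg).
- by move=> p; rewrite normrM ler_wpM2l.
- exact: rintegrableZr.
Qed.

Lemma measurable_corr g : rintegrable planeleb g -> measurable_fun [set: plane R] (corr g).
Proof.
move=> jg; pose H (x : plane R * plane R) := g x.2 * Psi (x.2 - x.1).
suff mH : measurable_fun setT H by exact: (measurable_Rintegral_snd planeleb mH).
apply: measurable_funM; first exact: (measurable_snd_comp (rintegrable_measurable jg)).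
exact: (measurableT_comp mPsi measurable_planeB).
Qed.

Lemma rintegrable_corr_pair f g : rintegrable planeleb f -> rintegrable planeleb g ->
  rintegrable planeleb (fun q => f q * corr g q).
Proof.
move=> jf jg.
apply: (@le_rintegrable _ _ _ planeleb _ _ _ _
  (rintegrableZr (C * \int[planeleb]_p `|g p|) (rintegrable_norm jf))).
  by apply: measurable_funM; [exact: rintegrable_measurable jf|exact: measurable_corr].
by move=> q; rewrite normrM ler_wpM2l// corr_le.
Qed.

Lemma rintegrable_corr2 f g : rintegrable planeleb f -> rintegrable planeleb g ->
  rintegrable (planeleb \x planeleb)%E
    (fun x : (R * R) * (R * R) => f x.1 * (g x.2 * Psi (x.2 - x.1))).
Proof.
move=> jf jg; apply: (rintegrable_prodM _ _ (rintegrable_norm jf)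
  (rintegrableZr C (rintegrable_norm jg))).
  apply: measurable_funM; first exact: (measurable_fst_comp (rintegrable_measurable jf)).
  apply: measurable_funM; first exact: (measurable_snd_comp (rintegrable_measurable jg)).
  exact: (measurableT_comp mPsi measurable_planeB).
by move=> q p; rewrite /= !normrM ler_wpM2l// ler_wpM2l.
Qed.

Lemma corr_pairE f g : rintegrable planeleb f -> rintegrable planeleb g ->
  corr_pair f g = \int[(planeleb \x planeleb)%E]_x (f x.1 * (g x.2 * Psi (x.2 - x.1))).
Proof.
move=> jf jg; rewrite -(Rintegral12 (rintegrable_corr2 jf jg)); apply: eq_Rintegral => q _.
by rewrite /corr -RintegralZl//; exact: rintegrable_corr.
Qed.

(** [s] is the parity of the kernel; for [s = -1] and [g = f] the pairing vanishes. *)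
Lemma corr_pair_sym f g (s : R) : (forall z, Psi (- z) = s * Psi z) ->
  rintegrable planeleb f -> rintegrable planeleb g -> corr_pair f g = s * corr_pair g f.
Proof.
move=> Ps jf jg; rewrite corr_pairE// -(Rintegral21 (rintegrable_corr2 jf jg)).
rewrite /corr_pair -RintegralZl//; last exact: rintegrable_corr_pair.
apply: eq_Rintegral => p _; rewrite /corr mulrA -RintegralZl//; last exact: rintegrable_corr.
apply: eq_Rintegral => q _ /=; rewrite -(opprB q p) Ps; ring.
Qed.

Lemma corrB f g q : rintegrable planeleb f -> rintegrable planeleb g ->
  corr (fun p => f p - g p) q = corr f q - corr g q.
Proof.
move=> jf jg; rewrite /corr -RintegralB//; [|exact: rintegrable_corr..].
by apply: eq_Rintegral => p _; rewrite mulrBl.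
Qed.

(** For an even kernel the cross terms cancel, so the increment of the quadratic form is expressed
    through that of the linear map [corr], whose time derivative is known. *)
Lemma corr_pair_diff f g : (forall z, Psi (- z) = Psi z) ->
  rintegrable planeleb f -> rintegrable planeleb g ->
  corr_pair f f - corr_pair g g =
  \int[planeleb]_q ((f q + g q) * (corr f q - corr g q)).
Proof.
move=> Pe jf jg.
have s : corr_pair f g = corr_pair g f.
  by rewrite (@corr_pair_sym f g 1) ?mul1r// => z; rewrite mul1r.
have j1 := rintegrable_corr_pair jf jf; have j2 := rintegrable_corr_pair jf jg.
have j3 := rintegrable_corr_pair jg jf; have j4 := rintegrable_corr_pair jg jg.
transitivity (corr_pair f f - corr_pair f g + corr_pair g f - corr_pair g g).
  by rewrite s subrK.
rewrite /corr_pair -RintegralB// -RintegralD//; last exact: rintegrableB.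
rewrite -RintegralB//; last by apply: rintegrableD => //; exact: rintegrableB.
by apply: eq_Rintegral => q _; ring.
Qed.

End correlation.

Lemma MVT_ball {R : realType} (F D : R -> R) (t d s : R) :
  (forall x : R, `|x - t| <= d -> is_derive x 1 F (D x)) -> `|s - t| <= d ->
  exists2 c, `|c - t| <= d & F s - F t = D c * (s - t).
Proof.
move=> dF sd.
have cF x : `|x - t| <= d -> F w @[w --> x] --> F x.
  by move=> /dF[dFx _]; exact/differentiable_continuous/derivable1_diffP.
have := sd; rewrite ler_norml => /andP[s1 s2].
have [ts|st] := leP t s.
  have inb x : x \in `[t, s] -> `|x - t| <= d.
    by rewrite in_itv/= => /andP[h1 h2]; rewrite ler_norml; apply/andP; split; lra.
  have [|c hc E] := @MVT_segment _ F D t s ts (fun x hx => dF x (inb x (subset_itv_oo_cc hx))).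
    by apply: continuous_in_subspaceT => x; rewrite inE => /inb; exact: cF.
  by exists c => //; exact: inb.
have inb x : x \in `[s, t] -> `|x - t| <= d.
  by rewrite in_itv/= => /andP[h1 h2]; rewrite ler_norml; apply/andP; split; lra.
have [|c hc E] := @MVT_segment _ F D s t (ltW st) (fun x hx => dF x (inb x (subset_itv_oo_cc hx))).
  by apply: continuous_in_subspaceT => x; rewrite inE => /inb; exact: cF.
by exists c; [exact: inb|rewrite -opprB E -mulrN opprB].
Qed.

(** * Evolution of the correlation *)

Section correlation_evolution.
Context {R : realType}.
Variables (T : R) (u : R -> R * R -> R).
Hypotheses (T0 : 0 < T) (hu : continuous_in_Z T 4 2 u) (hsol : weak_solution T u).
Variables (v : R -> R * R -> R) (M N : R).
Hypotheses (M0 : 0 <= M) (mv : forall t, measurable_fun [set: plane R] (v t)).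
Hypothesis vM : forall t p, `|v t p| <= M.
Hypothesis vL : forall t p q, `|v t p - v t q| <= M * (`|p.1 - q.1| + `|p.2 - q.2|).
Hypothesis vN : forall t, rintegrable planeleb (v t) /\ \int[planeleb]_p `|v t p| <= N.
Hypothesis uv : forall t, {ae planeleb, forall p, uc T u t p = v t p}.

Let jv t : rintegrable planeleb (v t). Proof. by have [] := vN t. Qed.

Let huc t : in_weighted (uc T u t). Proof. exact: uc_in_weighted. Qed.

(** Moments see only the class of the solution, so the regular representative may replace it. *)
Let int_uv t (P : R * R -> R) : measurable_fun [set: plane R] P ->
  \int[planeleb]_p (uc T u t p * P p) = \int[planeleb]_p (v t p * P p).
Proof.
move=> mP; apply: ae_eq_Rintegral; [|exact: measurable_funM|].
  by apply: measurable_funM => //; have [] := huc t.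
have [Z [mZ Z0 sub]] := uv t; exists Z; split => // p /=; apply: contra_notP => Zp.
by congr (_ * _); apply: contrapT => e; apply: Zp; exact: sub.
Qed.

Let int_uv2 t (P : R * R -> R) : measurable_fun [set: plane R] P ->
  \int[planeleb]_p (uc T u t p ^+ 2 * P p) = \int[planeleb]_p (v t p ^+ 2 * P p).
Proof.
move=> mP; apply: ae_eq_Rintegral.
- by apply: measurable_funM => //; apply: measurable_funX; have [] := huc t.
- by apply: measurable_funM => //; exact: measurable_funX.
have [Z [mZ Z0 sub]] := uv t; exists Z; split => // p /=; apply: contra_notP => Zp.
by congr (_ ^+ 2 * _); apply: contrapT => e; apply: Zp; exact: sub.
Qed.

Definition L1dist s t : R := \int[planeleb]_p `|v s p - v t p|.

Lemma cvg_L1dist t : L1dist s t @[s --> t] --> (0 : R).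
Proof.
have E s : L1dist s t = \int[planeleb]_p `|uc T u s p - uc T u t p|.
  apply/esym; apply: ae_eq_Rintegral.
  - by apply: measurableT_comp => //; apply: measurable_funB; have [] := huc s; have [] := huc t.
  - by apply: measurableT_comp => //; exact: measurable_funB.
  have [Z1 [mZ1 Z10 sub1]] := uv s; have [Z2 [mZ2 Z20 sub2]] := uv t.
  exists (Z1 `|` Z2); split; first exact: measurableU.
    exact: null_set_setU.
  move=> p /=; apply: contra_notP => /not_orP[n1 n2].
  have -> : uc T u s p = v s p by apply: contrapT => e; apply: n1; exact: sub1.
  by have -> : uc T u t p = v t p by apply: contrapT => e; apply: n2; exact: sub2.
under eq_cvg do rewrite E.
have c : Num.sqrt (wsq (fun p => uc T u s p - uc T u t p)) * Num.sqrt (dualsq (fun=> 1 : R))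
    @[s --> t] --> (0 : R).
  rewrite -[X in _ --> X](mul0r (Num.sqrt (dualsq (fun=> 1 : R)))).
  by apply: cvgM; [apply: cvg_sqrt_wsq; exact: uc_cvg|exact: cvg_cst].
apply: (squeeze_cvgr _ (cvg_cst 0) c); apply: nearW => s.
rewrite in_weighted_L1_le ?andbT; last exact: in_weightedB.
by apply: Rintegral_ge0.
Qed.

Lemma rintegrable_dist s t : rintegrable planeleb (fun p => v s p - v t p).
Proof. exact: rintegrableB. Qed.

Lemma rintegrable_v2 t : rintegrable planeleb (fun p => v t p ^+ 2).
Proof.
apply: (@le_rintegrable _ _ _ planeleb _ _ _ _ (rintegrableZ M (rintegrable_norm (jv t)))).
  exact: measurable_funX.
by move=> p; rewrite normrX expr2 ler_wpM2r.
Qed.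

Lemma L1_v2_dist s t : \int[planeleb]_p `|v s p ^+ 2 - v t p ^+ 2| <= 2 * M * L1dist s t.
Proof.
have jn := rintegrable_norm (rintegrable_dist s t).
rewrite /L1dist -RintegralZl//; apply: le_Rintegral => //.
- by apply: rintegrable_norm; apply: rintegrableB; exact: rintegrable_v2.
- exact: rintegrableZ.
- move=> p _; rewrite subr_sqr normrM mulrC ler_wpM2r//.
  rewrite (le_trans (ler_normD _ _))// mulr_natl mulr2n lerD//; exact: vM.
Qed.


Variables A B : R -> R.
Hypotheses (tA : testfun A) (tB : testfun B).
Hypotheses (eA : forall x, A (- x) = A x) (eB : forall x, B (- x) = B x).

Let H := tens (hilb (D1 (D1 A))) B.
Let K := tens (D1 A) (D1 (D1 B)).
Let L := tens (D1 A) B.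

Let tA1 := testfun_derive tA.
Let tA2 := testfun_derive tA1.
Let tB2 := testfun_derive (testfun_derive tB).

Let gmeas : measurable_fun [set: plane R] (tens A B).
Proof. by apply: measurable_tens; exact: testfun_measurable. Qed.

Let Hmeas : measurable_fun [set: plane R] H.
Proof.
by apply: measurable_tens; [exact: testfun_measurable_hilb|exact: testfun_measurable].
Qed.

Let Kmeas : measurable_fun [set: plane R] K.
Proof. by apply: measurable_tens; exact: testfun_measurable. Qed.

Let Lmeas : measurable_fun [set: plane R] L.
Proof. by apply: measurable_tens; exact: testfun_measurable. Qed.

Let tens_bounded (a b : R -> R) : (exists2 C, 0 <= C & forall x : R, `|a x| <= C) ->
  (exists2 C, 0 <= C & forall x : R, `|b x| <= C) ->
  exists C : R, forall z : R * R, `|tens a b z| <= C.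
Proof.
by move=> [C C0 hC] [D' D0 hD]; exists (C * D') => z; rewrite normrM ler_pM.
Qed.

Let gC : exists C : R, forall z : R * R, `|tens A B z| <= C.
Proof. by apply: tens_bounded; exact: testfun_bounded. Qed.

Let HC : exists C : R, forall z : R * R, `|H z| <= C.
Proof. by apply: tens_bounded; [exact: testfun_hilb_bounded|exact: testfun_bounded]. Qed.

Let KC : exists C : R, forall z : R * R, `|K z| <= C.
Proof. by apply: tens_bounded; exact: testfun_bounded. Qed.

Let LC : exists C : R, forall z : R * R, `|L z| <= C.
Proof. by apply: tens_bounded; exact: testfun_bounded. Qed.

Definition corr_flux t q : R :=
  corr H (v t) q + corr K (v t) q + 2^-1 * corr L (fun p => v t p ^+ 2) q.

(** The kernel translated by [q] is again a tensor product of test functions, and the Hilbert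
    transform commutes with translations. *)
Lemma corr_derive q t : 0 < t < T ->
  is_derive t 1 (fun t => corr (tens A B) (v t) q) (corr_flux t q).
Proof.
move=> tT.
pose Aq (x : R) := A (1 * x + - q.1); pose Bq (x : R) := B (1 * x + - q.2).
have o1 : (1 : R) != 0 := oner_neq0 R.
have tAq : testfun Aq := testfun_affine (- q.1) o1 tA.
have tBq : testfun Bq := testfun_affine (- q.2) o1 tB.
have d1 (a : R -> R) c : testfun a ->
    D1 (fun x => a (1 * x + c)) = (fun x => D1 a (1 * x + c)).
  by move=> ta; rewrite (derive1_affine _ _ (testfun_smooth ta)); apply/funext => x; rewrite !mul1r.
have := moment_derive T0 hu hsol tAq tBq tT.
have E (a b : R -> R) : tens (fun x => a (1 * x + - q.1)) (fun x => b (1 * x + - q.2)) =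
    (fun p => tens a b (p - q)).
  by apply/funext => p; rewrite /tens !mul1r.
rewrite /flux /Aq /Bq !d1//; try exact: testfun_derive.
rewrite (_ : hilb (fun x => D1 (D1 A) (1 * x + - q.1)) =
  (fun x => hilb (D1 (D1 A)) (1 * x + - q.1))); last first.
  apply/funext => x; have := hilb_affine (- q.1) x o1 tA2.
  by rewrite sgr1 [1 * hilb _ _]mul1r.
rewrite !E !int_uv ?int_uv2; try exact: measurable_Psi_shift.
by congr is_derive; apply/funext => s; rewrite int_uv//; exact: measurable_Psi_shift.
Qed.

(** The constant does not involve [q], and this uniformity allows differentiation under the integral
    over [q]. *)
Lemma corr_flux_dist : exists2 C : R, 0 <= C &
  forall s t q, `|corr_flux s q - corr_flux t q| <= C * L1dist s t.
Proof.
have [CH hH] := HC; have [CK hK] := KC; have [CL hL] := LC.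
have H0 : 0 <= CH by exact: le_trans (hH 0).
have K0 : 0 <= CK by exact: le_trans (hK 0).
have L0 : 0 <= CL by exact: le_trans (hL 0).
exists (CH + CK + 2^-1 * (CL * (2 * M))) => [|s t q].
  by rewrite !addr_ge0 ?mulr_ge0// invr_ge0.
have -> : corr_flux s q - corr_flux t q = corr H (fun p => v s p - v t p) q +
    corr K (fun p => v s p - v t p) q +
    2^-1 * corr L (fun p => v s p ^+ 2 - v t p ^+ 2) q.
  rewrite (corrB Hmeas hH)// (corrB Kmeas hK)// (corrB Lmeas hL) ?/corr_flux; last 2 first.
  - exact: rintegrable_v2.
  - exact: rintegrable_v2.
  ring.
rewrite (le_trans (ler_normD _ _))// !mulrDl lerD//.
  rewrite (le_trans (ler_normD _ _))// lerD//.
    by apply: (corr_le Hmeas hH); exact: rintegrable_dist.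
  by apply: (corr_le Kmeas hK); exact: rintegrable_dist.
rewrite normrM ger0_norm ?invr_ge0// -mulrA ler_wpM2l ?invr_ge0// -mulrA.
apply: le_trans (corr_le Lmeas hL _ _) _.
  by apply: rintegrableB; exact: rintegrable_v2.
by rewrite ler_wpM2l// -[1 * M + _]mulrDl L1_v2_dist.
Qed.

Lemma corr_flux_bounded : exists2 C : R, 0 <= C & forall t q, `|corr_flux t q| <= C.
Proof.
have [CH hH] := HC; have [CK hK] := KC; have [CL hL] := LC.
have H0 : 0 <= CH by exact: le_trans (hH 0).
have K0 : 0 <= CK by exact: le_trans (hK 0).
have L0 : 0 <= CL by exact: le_trans (hL 0).
have N0 : 0 <= N.
  by have [_ h] := vN 0; apply: le_trans h; apply: Rintegral_ge0.
exists (CH * N + CK * N + 2^-1 * (CL * (M * N))) => [|t q].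
  by rewrite !addr_ge0 ?mulr_ge0// invr_ge0.
have [_ hN] := vN t.
rewrite (le_trans (ler_normD _ _))// lerD//.
  rewrite (le_trans (ler_normD _ _))// lerD//.
    by rewrite (le_trans (corr_le Hmeas hH _ (jv t)))// ler_wpM2l.
  by rewrite (le_trans (corr_le Kmeas hK _ (jv t)))// ler_wpM2l.
rewrite normrM ger0_norm ?invr_ge0// ler_wpM2l ?invr_ge0//.
rewrite (le_trans (corr_le Lmeas hL _ (rintegrable_v2 t)))// ler_wpM2l//.
have jn := rintegrable_norm (jv t).
apply: (@le_trans _ _ (\int[planeleb]_p (M * `|v t p|))).
  apply: le_Rintegral => //.
  - by apply: rintegrable_norm; exact: rintegrable_v2.
  - exact: rintegrableZ.
  - by move=> p _; rewrite normrX expr2 ler_wpM2r.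
by rewrite RintegralZl// ler_wpM2l.
Qed.

Let Q t := corr_pair (tens A B) (v t) (v t).

Let g := tens A B.

Let ge z : g (- z) = g z. Proof. by rewrite /g /tens/= eA eB. Qed.

Let N0 : 0 <= N.
Proof. by have [_ h] := vN 0; apply: le_trans h; apply: Rintegral_ge0. Qed.

Let jvD s t : rintegrable planeleb (fun q => v s q + v t q).
Proof. exact: rintegrableD. Qed.

Let L1_sum s t : \int[planeleb]_q `|v s q + v t q| <= 2 * N.
Proof.
have [_ h1] := vN s; have [_ h2] := vN t.
have n1 := rintegrable_norm (jv s); have n2 := rintegrable_norm (jv t).
rewrite mulr_natl mulr2n; apply: le_trans (lerD h1 h2); rewrite -RintegralD//.
apply: le_Rintegral => //; [exact: rintegrable_norm|exact: rintegrableD|].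
by move=> q _; exact: ler_normD.
Qed.

Let measurable_corr_g s : measurable_fun [set: plane R] (corr g (v s)).
Proof. exact: (measurable_corr gmeas). Qed.

Let measurable_flux t : measurable_fun [set: plane R] (corr_flux t).
Proof.
apply: measurable_funD; last first.
  by apply: measurable_funM => //; apply: (measurable_corr Lmeas); exact: rintegrable_v2.
by apply: measurable_funD; [exact: (measurable_corr Hmeas)|exact: (measurable_corr Kmeas)].
Qed.

Let bounded_pair (w P : R * R -> R) C : rintegrable planeleb w ->
  measurable_fun [set: plane R] P -> (forall q, `|P q| <= C) ->
  rintegrable planeleb (fun q => w q * P q) /\
  `|\int[planeleb]_q (w q * P q)| <= C * \int[planeleb]_q `|w q|.
Proof.
move=> jw mP PC; have jn := rintegrable_norm jw.
have mw : measurable_fun [set: plane R] (fun q => w q * P q).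
  by apply: measurable_funM => //; exact: rintegrable_measurable jw.
have le q : `|w q * P q| <= `|w q| * C by rewrite normrM ler_wpM2l.
split; first exact: (@le_rintegrable _ _ _ planeleb _ _ mw le (rintegrableZr C jn)).
rewrite mulrC -RintegralZr//.
exact: (@le_norm_Rintegral _ _ _ planeleb _ _ mw le (rintegrableZr C jn)).
Qed.

(** By [corr_pair_diff] the difference quotient is v s + v t integrated against the quotient of
    [corr]. Its distance to the limit has two parts: the error of that quotient, uniform in [q], and
    the L^1 distance between v s and v t. *)
Lemma corr_pair_derive t : 0 < t < T ->
  is_derive t 1 Q (2 * \int[planeleb]_q (v t q * corr_flux t q)).
Proof.
move=> tT; have [C1 C10 hC1] := corr_flux_dist; have [C2 C20 hC2] := corr_flux_bounded.
have [j0 _] := bounded_pair (jv t) (measurable_flux t) (hC2 t).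
have lim : h^-1 *: (Q (h *: 1 + t) - Q t) @[h --> 0^'] -->
    (2 * \int[planeleb]_q (v t q * corr_flux t q) : R).
  apply/cvgrPdist_le => e e0.
  pose e1 := e / (C1 * (2 * N) + C2 + 1).
  have den : 0 < C1 * (2 * N) + C2 + 1 by rewrite ltr_wpDl// addr_ge0// !mulr_ge0.
  have e10 : 0 < e1 by rewrite divr_gt0.
  have [d /= d0 hd] : nbhs t [set s | 0 < s < T /\ L1dist s t <= e1].
    case/andP : tT => t0 tT.
    have n1 : \forall s \near t, 0 < s by exact: lt_nbhsr.
    have n2 : \forall s \near t, s < T by exact: lt_nbhsl.
    have n3 : \forall s \near t, L1dist s t <= e1.
      move/cvgr0Pnorm_le : (cvg_L1dist t) => /(_ _ e10).
      by apply: filterS => s; exact: le_trans (ler_norm _).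
    by near=> s; split; [apply/andP; split; near: s|near: s].
  near=> h.
  have h0 : h != 0 by near: h; exact: nbhs_dnbhs_neq.
  (* Half the radius, so that the closed ball of [MVT_ball] lies inside the open ball of [hd]. *)
  have hd2 : `|h| <= d / 2 by near: h; apply: dnbhs0_le; rewrite divr_gt0.
  have good c : `|c - t| <= d / 2 -> 0 < c < T /\ L1dist c t <= e1.
    move=> ct; apply: hd; rewrite /= distrC (le_lt_trans ct)//.
    by rewrite ltr_pdivrMr// ltr_pMr// ltr1n.
  set s := h *: 1 + t.
  have st : s - t = h by rewrite /s /GRing.scale/= mulr1 addrK.
  have [|_ st1] := good s; first by rewrite st.
  have mD : measurable_fun [set: plane R] (fun q => h^-1 * (corr g (v s) q - corr g (v t) q)).
    by apply: measurable_funM => //; exact: measurable_funB.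
  (* By the mean value theorem in time, uniformly in [q]. *)
  have Dq q : `|h^-1 * (corr g (v s) q - corr g (v t) q) - corr_flux t q| <= C1 * e1.
    have [|c ct] := @MVT_ball _ (fun t => corr g (v t) q) (corr_flux ^~ q) t (d / 2) s
      (fun x hx => corr_derive q (good x hx).1); first by rewrite st.
    rewrite st => ->; rewrite mulrC mulfK// (le_trans (hC1 _ _ _))// ler_wpM2l//.
    by have [] := good c ct.
  have mE : measurable_fun [set: plane R]
      (fun q => h^-1 * (corr g (v s) q - corr g (v t) q) - corr_flux t q).
    exact: measurable_funB.
  have [jE leE] := bounded_pair (jvD s t) mE Dq.
  have [jF leF] := bounded_pair (rintegrable_dist s t) (measurable_flux t) (hC2 t).
  have [CG hG] := gC.
  have js := rintegrableZ h^-1 (rintegrable_corr_pair gmeas hG (jv s) (jv s)).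
  have -> : 2 * \int[planeleb]_q (v t q * corr_flux t q) - h^-1 *: (Q s - Q t) =
      - (\int[planeleb]_q ((v s q + v t q) *
         (h^-1 * (corr g (v s) q - corr g (v t) q) - corr_flux t q)) +
      \int[planeleb]_q ((v s q - v t q) * corr_flux t q)).
    rewrite /Q (corr_pair_diff gmeas hG ge (jv s) (jv t)) /GRing.scale/=.
    have jq : rintegrable planeleb (fun q => (v s q + v t q) * (corr g (v s) q - corr g (v t) q)).
      have mG : measurable_fun [set: plane R] (fun q => corr g (v s) q - corr g (v t) q).
        exact: measurable_funB.
      have bG q : `|corr g (v s) q - corr g (v t) q| <=
          CG * (\int[planeleb]_p `|v s p|) + CG * (\int[planeleb]_p `|v t p|).
        rewrite (le_trans (ler_normB _ _))// lerD//.
          exact: (corr_le gmeas hG _ (jv s)).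
        exact: (corr_le gmeas hG _ (jv t)).
      by have [] := bounded_pair (jvD s t) mG bG.
    rewrite -RintegralZl// -RintegralZl// -RintegralB//; last 2 first.
    - exact: rintegrableZ.
    - exact: rintegrableZ.
    rewrite -RintegralD// -mulN1r -RintegralZl//; last exact: rintegrableD.
    by apply: eq_Rintegral => q _; ring.
  rewrite normrN (le_trans (ler_normD _ _))//.
  apply: (@le_trans _ _ (C1 * e1 * (2 * N) + C2 * e1)).
    apply: lerD; first by apply: (le_trans leE); apply: ler_wpM2l => //; exact: mulr_ge0 C10 (ltW e10).
    by apply: (le_trans leF); rewrite ler_wpM2l.
  rewrite (_ : _ + _ = e1 * (C1 * (2 * N) + C2)); last by ring.
  rewrite -[leRHS](divfK (lt0r_neq0 den)) -/e1 ler_wpM2l ?(ltW e10)//.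
  by rewrite lerDl.
apply: DeriveDef; first by apply/cvg_ex; eexists; exact: lim.
by apply/cvg_lim; [exact: Rhausdorff|exact: lim].
Unshelve. all: by end_near. Qed.

Lemma continuous_corr_pair : continuous Q.
Proof.
have [CG hG] := gC; have CG0 : 0 <= CG by exact: le_trans (hG 0).
move=> t; apply/cvgrPdist_le => e e0.
have c : CG * L1dist s t * (2 * N) @[s --> t] --> (0 : R).
  rewrite -[X in _ --> X](mul0r (2 * N)) -(mulr0 CG).
  by apply: cvgM; [apply: cvgM; [exact: cvg_cst|exact: cvg_L1dist]|exact: cvg_cst].
move/cvgr0Pnorm_le : c => /(_ _ e0); apply: filterS => s h.
rewrite distrC (corr_pair_diff gmeas hG ge (jv s) (jv t)) (le_trans _ (le_trans (ler_norm _) h))//.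
have mG : measurable_fun [set: plane R] (fun q => corr g (v s) q - corr g (v t) q).
  exact: measurable_funB.
have bG q : `|corr g (v s) q - corr g (v t) q| <= CG * L1dist s t.
  rewrite -(corrB gmeas hG _ (jv s) (jv t)).
  exact: (corr_le gmeas hG _ (rintegrable_dist s t)).
have [_ h2] := bounded_pair (jvD s t) mG bG.
apply: (le_trans h2); apply: ler_wpM2l => //; apply: mulr_ge0 => //.
by apply: Rintegral_ge0.
Qed.

End correlation_evolution.

(** * Integrals of translated tensor kernels *)

Section tensor_shift.
Context {R : realType}.
Variables a b : R -> R.
Hypotheses (ja : rintegrable leb a) (jb : rintegrable leb b).

Let shiftl (f : R -> R) c : rintegrable leb f ->
  rintegrable leb (fun x => f (x - c)) /\ \int[leb]_x f (x - c) = \int[leb]_x f x.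
Proof.
move=> jf; have o1 : (1 : R) != 0 := oner_neq0 R.
have E : (fun x => f (x - c)) = (fun x => f (1 * x + - c)) by apply/funext => x; rewrite mul1r.
rewrite E; split; first exact: (rintegrable_affine _ o1 jf).
by rewrite (Rintegral_affine _ o1 jf) normr1 divr1.
Qed.

Let shiftr (f : R -> R) c : rintegrable leb f ->
  rintegrable leb (fun x => f (c - x)) /\ \int[leb]_x f (c - x) = \int[leb]_x f x.
Proof.
move=> jf; have o1 : (-1 : R) != 0 by rewrite oppr_eq0 oner_neq0.
have E : (fun x => f (c - x)) = (fun x => f (-1 * x + c)).
  by apply/funext => x; rewrite mulN1r addrC.
rewrite E; split; first exact: (rintegrable_affine _ o1 jf).
by rewrite (Rintegral_affine _ o1 jf) normrN1 divr1.
Qed.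

Lemma Rintegral_tens_shiftl q :
  rintegrable planeleb (fun p => tens a b (p - q)) /\
  \int[planeleb]_p tens a b (p - q) = \int[leb]_x a x * \int[leb]_x b x.
Proof.
have [j1 e1] := shiftl q.1 ja; have [j2 e2] := shiftl q.2 jb.
by have [j e] := rintegrable_plane_prodM j1 j2; rewrite e1 e2 in e.
Qed.

Lemma Rintegral_tens_shiftr p :
  rintegrable planeleb (fun q => tens a b (p - q)) /\
  \int[planeleb]_q tens a b (p - q) = \int[leb]_x a x * \int[leb]_x b x.
Proof.
have [j1 e1] := shiftr p.1 ja; have [j2 e2] := shiftr p.2 jb.
by have [j e] := rintegrable_plane_prodM j1 j2; rewrite e1 e2 in e.
Qed.

End tensor_shift.

Section tensor_convolution.
Context {R : realType}.
Variables a b : R -> R.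
Hypotheses (ja : rintegrable leb a) (jb : rintegrable leb b).

Let mt : measurable_fun [set: plane R * plane R] (fun x => tens a b (x.2 - x.1)).
Proof.
have mab : measurable_fun [set: plane R] (tens a b).
  by apply: measurable_tens; [exact: rintegrable_measurable ja|exact: rintegrable_measurable jb].
exact: (measurableT_comp mab (@measurable_planeB R)).
Qed.

Let norm_tens z : `|tens a b z| = tens (fun x => `|a x|) (fun x => `|b x|) z.
Proof. by rewrite normrM. Qed.

Lemma rintegrable_tens_convl f : rintegrable planeleb f ->
  rintegrable (planeleb \x planeleb)%E
    (fun x : (R * R) * (R * R) => f x.1 * tens a b (x.2 - x.1)).
Proof.
move=> jf; pose m := (\int[leb]_x `|a x|) * \int[leb]_x `|b x|.
apply: (rintegrable_prodl _ _ _ (rintegrableZr m (rintegrable_norm jf))).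
- by apply: measurable_funM => //; exact: (measurable_fst_comp (rintegrable_measurable jf)).
- by move=> q; have [j _] := Rintegral_tens_shiftl ja jb q; exact: (rintegrableZ (f q) j).
- move=> q /=; under eq_Rintegral do rewrite normrM norm_tens.
  have [j e] := Rintegral_tens_shiftl (rintegrable_norm ja) (rintegrable_norm jb) q.
  by rewrite RintegralZl// e.
Qed.

Lemma Rintegral_tens_convl f : rintegrable planeleb f ->
  \int[(planeleb \x planeleb)%E]_x (f x.1 * tens a b (x.2 - x.1)) =
  \int[planeleb]_p f p * (\int[leb]_x a x * \int[leb]_x b x).
Proof.
move=> jf; rewrite -(Rintegral12 (rintegrable_tens_convl jf))/= -RintegralZr//.
apply: eq_Rintegral => q _; have [j e] := Rintegral_tens_shiftl ja jb q.
by rewrite RintegralZl// e.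
Qed.

Lemma rintegrable_tens_convr f : rintegrable planeleb f ->
  rintegrable (planeleb \x planeleb)%E
    (fun x : (R * R) * (R * R) => f x.2 * tens a b (x.2 - x.1)).
Proof.
move=> jf; pose m := (\int[leb]_x `|a x|) * \int[leb]_x `|b x|.
apply: (rintegrable_prodr _ _ _ (rintegrableZr m (rintegrable_norm jf))).
- by apply: measurable_funM => //; exact: (measurable_snd_comp (rintegrable_measurable jf)).
- by move=> p; have [j _] := Rintegral_tens_shiftr ja jb p; exact: (rintegrableZ (f p) j).
- move=> p /=; under eq_Rintegral do rewrite normrM norm_tens.
  have [j e] := Rintegral_tens_shiftr (rintegrable_norm ja) (rintegrable_norm jb) p.
  by rewrite RintegralZl// e.
Qed.

Lemma Rintegral_tens_convr f : rintegrable planeleb f ->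
  \int[(planeleb \x planeleb)%E]_x (f x.2 * tens a b (x.2 - x.1)) =
  \int[planeleb]_p f p * (\int[leb]_x a x * \int[leb]_x b x).
Proof.
move=> jf; rewrite -(Rintegral21 (rintegrable_tens_convr jf))/= -RintegralZr//.
apply: eq_Rintegral => p _; have [j e] := Rintegral_tens_shiftr ja jb p.
by rewrite RintegralZl// e.
Qed.

End tensor_convolution.

(** * Estimates for a concentrated kernel *)

Section correlation_estimates.
Context {R : realType}.
Variables (w : R * R -> R) (M N rho : R).
Hypotheses (M0 : 0 <= M) (rho0 : 0 <= rho).
Hypothesis wM : forall p, `|w p| <= M.
Hypothesis wL : forall p q, `|w p - w q| <= M * (`|p.1 - q.1| + `|p.2 - q.2|).
Hypotheses (jw : rintegrable planeleb w) (wN : \int[planeleb]_p `|w p| <= N).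
Variables a b : R -> R.
Hypotheses (ta : testfun a) (tb : testfun b).
Hypotheses (a0 : forall x, rho < `|x| -> a x = 0) (b0 : forall x, rho < `|x| -> b x = 0).

Let mw : measurable_fun [set: plane R] w. Proof. exact: rintegrable_measurable jw. Qed.

Let ja := testfun_rintegrable ta.
Let jb := testfun_rintegrable tb.

Let mP : measurable_fun [set: plane R] (tens a b).
Proof. by apply: measurable_tens; exact: testfun_measurable. Qed.

Let PC : exists C : R, forall z : R * R, `|tens a b z| <= C.
Proof.
have [C C0 hC] := testfun_bounded ta; have [D D0 hD] := testfun_bounded tb.
by exists (C * D) => z; rewrite normrM ler_pM.
Qed.

Definition tens_mass : R := \int[leb]_x `|a x| * \int[leb]_x `|b x|.

Let normP z : `|tens a b z| = tens (fun x => `|a x|) (fun x => `|b x|) z.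
Proof. by rewrite normrM. Qed.

Let near_diag p q : `|(w p - w q) * tens a b (p - q)| <=
  2 * rho * M * `|tens a b (p - q)|.
Proof.
rewrite normrM; have [z1|z1] := ltP rho `|p.1 - q.1|.
  by rewrite /tens (a0 z1) mul0r normr0 !mulr0.
have [z2|z2] := ltP rho `|p.2 - q.2|.
  by rewrite /tens (b0 z2) mulr0 normr0 !mulr0.
rewrite ler_wpM2r// (le_trans (wL p q))// mulrC ler_wpM2r//; lra.
Qed.

(** On the support of the kernel both coordinates of p - q are at most [rho] in absolute value, so
    there |w p - w q| <= 2 rho M. *)
Lemma corr_approx_mass : `|corr_pair (tens a b) w w -
  (\int[leb]_x a x * \int[leb]_x b x) * \int[planeleb]_p (w p ^+ 2)| <=
  2 * rho * M * tens_mass * N.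
Proof.
set m := (\int[leb]_x a x) * \int[leb]_x b x; have [C hC] := PC.
have mc := measurable_corr mP jw.
have cE q : corr (tens a b) w q - m * w q =
    \int[planeleb]_p ((w p - w q) * tens a b (p - q)).
  have [j e] := Rintegral_tens_shiftl ja jb q.
  rewrite /corr /m -e mulrC -RintegralZl// -RintegralB//.
  - by apply: eq_Rintegral => p _; rewrite mulrBl.
  - exact: (rintegrable_corr mP hC).
  - exact: rintegrableZ.
have D q : `|corr (tens a b) w q - m * w q| <= 2 * rho * M * tens_mass.
  rewrite cE.
  have [j e] := Rintegral_tens_shiftl (rintegrable_norm ja) (rintegrable_norm jb) q.
  rewrite /tens_mass -e -RintegralZl//; apply: (@le_norm_Rintegral _ _ _ planeleb).
  - apply: measurable_funM; first exact: measurable_funB.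
    exact: (measurable_Psi_shift mP).
  - by move=> p; rewrite -normP near_diag.
  - exact: rintegrableZ.
have jn := rintegrable_norm jw.
have jp := rintegrable_corr_pair mP hC jw jw.
have j2 : rintegrable planeleb (fun p => w p ^+ 2).
  apply: (@le_rintegrable _ _ _ planeleb _ _ _ _ (rintegrableZ M jn)).
    exact: measurable_funX.
  by move=> p; rewrite normrX expr2 ler_wpM2r.
rewrite /corr_pair -RintegralZl// -RintegralB//; last exact: rintegrableZ.
have -> : \int[planeleb]_q (w q * corr (tens a b) w q - m * w q ^+ 2) =
    \int[planeleb]_q (w q * (corr (tens a b) w q - m * w q)).
  by apply: eq_Rintegral => q _; ring.
have tm0 : 0 <= tens_mass by apply: mulr_ge0; apply: Rintegral_ge0.
have c0 : 0 <= 2 * rho * M * tens_mass by do 3![apply: mulr_ge0 => //].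
apply: (@le_trans _ _ (2 * rho * M * tens_mass * \int[planeleb]_p `|w p|)); last first.
  by rewrite ler_wpM2l.
rewrite mulrC -RintegralZr//; apply: (@le_norm_Rintegral _ _ _ planeleb).
- apply: measurable_funM => //; apply: measurable_funB => //; exact: measurable_funM.
- by move=> q; rewrite normrM ler_wpM2l.
- exact: rintegrableZr.
Qed.

(** Up to sign, six times the pairing is the double integral of (w p - w q)^3 against the kernel.
    Two of the three factors are at most 2 rho M and the third at most |w p| + |w q|, whence a bound
    quadratic in [rho]. *)
Lemma corr_cubic_le : (forall x, a (- x) = - a x) -> (forall x, b (- x) = b x) ->
  `|corr_pair (tens a b) w (fun p => w p ^+ 2)| <= (2 * rho * M) ^+ 2 * tens_mass * N.
Proof.
move=> oa eb; have [C hC] := PC; set d := 2 * rho * M.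
have aux (j x y : R) : 0 <= j -> 6 * j <= 2 * x -> 0 <= x -> x <= y -> j <= y by lra.
have d0 : 0 <= d by rewrite !mulr_ge0.
have jn := rintegrable_norm jw.
have j2 : rintegrable planeleb (fun p => w p ^+ 2).
  apply: (@le_rintegrable _ _ _ planeleb _ _ _ _ (rintegrableZ M jn)).
    exact: measurable_funX.
  by move=> p; rewrite normrX expr2 ler_wpM2r.
have j3 : rintegrable planeleb (fun p => w p ^+ 3).
  apply: (@le_rintegrable _ _ _ planeleb _ _ _ _ (rintegrableZ (M ^+ 2) jn)).
    exact: measurable_funX.
  by move=> p; rewrite normrX exprSr ler_wpM2r// lerXn2r ?nnegrE.
have a_int : \int[leb]_x a x = 0 by exact: Rintegral_odd.
set P := tens a b.
have Pod z : P (- z) = -1 * P z by rewrite /P /tens/= oa eb mulN1r mulNr.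
pose J := corr_pair P w (fun p => w p ^+ 2).
have JE := corr_pairE mP hC jw j2; rewrite -/P -/J in JE.
have JE' := corr_pairE mP hC j2 jw; rewrite -/P in JE'.
rewrite (corr_pair_sym mP hC Pod j2 jw) -/P -/J mulN1r in JE'.
have z1 := Rintegral_tens_convl ja jb j3; rewrite a_int mul0r mulr0 -/P in z1.
have z2 := Rintegral_tens_convr ja jb j3; rewrite a_int mul0r mulr0 -/P in z2.
have k1 := rintegrable_tens_convl ja jb j3; rewrite -/P in k1.
have k2 := rintegrable_tens_convr ja jb j3; rewrite -/P in k2.
have k3 := rintegrableZ 3 (rintegrable_corr2 mP hC jw j2); rewrite -/P in k3.
have k4 := rintegrableZ 3 (rintegrable_corr2 mP hC j2 jw); rewrite -/P in k4.
(* The pure cubes vanish as [P] has integral 0, and the mixed terms agree by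
   antisymmetry. *)
have cube : \int[(planeleb \x planeleb)%E]_x ((w x.2 - w x.1) ^+ 3 * P (x.2 - x.1)) = - 6 * J.
  transitivity (\int[(planeleb \x planeleb)%E]_x (w x.2 ^+ 3 * P (x.2 - x.1)) -
    \int[(planeleb \x planeleb)%E]_x (3 * (w x.1 * (w x.2 ^+ 2 * P (x.2 - x.1)))) +
    \int[(planeleb \x planeleb)%E]_x (3 * (w x.1 ^+ 2 * (w x.2 * P (x.2 - x.1)))) -
    \int[(planeleb \x planeleb)%E]_x (w x.1 ^+ 3 * P (x.2 - x.1))).
    rewrite -RintegralB// -RintegralD//; last exact: rintegrableB.
    rewrite -RintegralB//; last by apply: rintegrableD => //; exact: rintegrableB.
    by apply: eq_Rintegral => x _; ring.
  rewrite z1 z2 RintegralZl//; last exact: (rintegrable_corr2 mP hC jw j2).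
  rewrite -JE RintegralZl//; last exact: (rintegrable_corr2 mP hC j2 jw).
  by rewrite -JE'; ring.
have n1 := rintegrable_tens_convl (rintegrable_norm ja) (rintegrable_norm jb) jn.
have n2 := rintegrable_tens_convr (rintegrable_norm ja) (rintegrable_norm jb) jn.
have e1 := Rintegral_tens_convl (rintegrable_norm ja) (rintegrable_norm jb) jn.
have e2 := Rintegral_tens_convr (rintegrable_norm ja) (rintegrable_norm jb) jn.
have bound : `|- 6 * J| <= d ^+ 2 * (\int[planeleb]_p `|w p| * tens_mass +
    \int[planeleb]_p `|w p| * tens_mass).
  rewrite -cube -{1}e2 -e1 -RintegralD// -RintegralZl//; last exact: rintegrableD.
  apply: (@le_norm_Rintegral _ _ _ (planeleb \x planeleb)%E).
  - apply: measurable_funM.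
      by apply: measurable_funX; apply: measurable_funB;
        [exact: (measurable_snd_comp mw)|exact: (measurable_fst_comp mw)].
    exact: (measurableT_comp mP (@measurable_planeB R)).
  - move=> [q p] /=; rewrite -!normP -/P.
    have h := near_diag p q; rewrite -/P -/d normrM in h.
    have s := ler_normB (w p) (w q).
    rewrite exprSr -mulrA normrM normrX [`|_ * P _|]normrM.
    (* The Lipschitz bound is available only after multiplication by the kernel; where the kernel is
       nonzero one may divide by it. *)
    have [P0|P0] := eqVneq `|P (p - q)| 0; first by rewrite P0 !mulr0 addr0 mulr0.
    have Pp : 0 < `|P (p - q)| by rewrite lt_neqAle eq_sym P0/=.
    rewrite ler_pM2r// in h.
    rewrite -mulrDl mulrA [leRHS]mulrA ler_pM2r//.
    by apply: ler_pM => //; rewrite lerXn2r ?nnegrE.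
  - exact: (rintegrableZ (d ^+ 2) (rintegrableD n2 n1)).
have tm0 : 0 <= tens_mass by apply: mulr_ge0; apply: Rintegral_ge0.
rewrite -/J; have n6 : `|- 6 * J| = 6 * `|J| by rewrite mulNr normrN normrM normr_nat.
rewrite n6 in bound; have wN' := wN.
set W := \int[planeleb]_p `|w p| in bound wN' *.
have W0 : 0 <= W by apply: Rintegral_ge0.
have c0 : 0 <= d ^+ 2 * tens_mass by apply: mulr_ge0 => //; exact: sqr_ge0.
have cW := mulr_ge0 c0 W0; have cN := ler_wpM2l c0 wN'.
have e : d ^+ 2 * (W * tens_mass + W * tens_mass) = 2 * (d ^+ 2 * tens_mass * W) by ring.
rewrite e in bound; exact: aux (normr_ge0 J) bound cW cN.
Qed.

End correlation_estimates.

(** * Parity of derivatives and of the Hilbert transform *)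

Section parity.
Context {R : realType}.
Implicit Types f : R -> R.

Lemma derive1_support f (K : R) : (forall x, K < `|x| -> f x = 0) ->
  forall x, K < `|x| -> D1 f x = 0.
Proof.
move=> fK x Kx; rewrite derive1E; suff : is_derive x 1 f 0 by move=> /@derive_val.
apply: (near_eq_is_derive _ (is_derive1_cst 0 x)).
by have := near_norm_gt Kx; apply: filterS => z /fK ->.
Qed.

Lemma derive1_opp f : smooth1 f -> D1 (fun x => f (- x)) = (fun x => - D1 f (- x)).
Proof.
move=> sf; have := derive1_affine (-1) 0 sf.
rewrite (_ : (fun x => f (-1 * x + 0)) = (fun x => f (- x))); last first.
  by apply/funext => x; rewrite addr0 mulN1r.
by move=> ->; apply/funext => x; rewrite addr0 !mulN1r.
Qed.

Lemma derive1_even f : smooth1 f -> (forall x, f (- x) = f x) ->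
  forall x, D1 f (- x) = - D1 f x.
Proof.
move=> sf ef x; have := derive1_opp sf.
have -> : (fun x => f (- x)) = f by apply/funext.
by move=> /(congr1 (fun h => h (- x))); rewrite opprK.
Qed.

Lemma derive1_odd f : smooth1 f -> (forall x, f (- x) = - f x) ->
  forall x, D1 f (- x) = D1 f x.
Proof.
move=> sf ef x; have := derive1_opp sf.
have -> : (fun x => f (- x)) = (fun x => -1 * f x) by apply/funext => y; rewrite ef mulN1r.
rewrite derive1Z// => /(congr1 (fun h => h x)); by rewrite mulN1r => /oppr_inj ->.
Qed.

Lemma hilb_even f : testfun f -> (forall x, f (- x) = f x) ->
  forall x, hilb f (- x) = - hilb f x.
Proof.
move=> tf ef x; have o1 : (-1 : R) != 0 by rewrite oppr_eq0 oner_neq0.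
have := hilb_affine 0 x o1 tf.
rewrite (_ : (fun x => f (-1 * x + 0)) = f); last first.
  by apply/funext => y; rewrite addr0 mulN1r ef.
by rewrite addr0 mulN1r sgrN sgr1 mulN1r => ->; rewrite opprK.
Qed.

End parity.

(** [Qs] and [Qt] stand for smeared energies with a kernel of mass (r b)^2. The errors of
    approximation and the drift in time are all of order r^3, so dividing by r^2 leaves a bound
    linear in r. *)
Lemma gap_of_approximation {R : realType} (Qs Qt Es Et r b c M N T : R) : 0 < r ->
  `|Qs - (r * b) ^+ 2 * Es| <= 2 * r * M * (r * b) ^+ 2 * N ->
  `|Qt - (r * b) ^+ 2 * Et| <= 2 * r * M * (r * b) ^+ 2 * N ->
  `|Qt - Qs| <= (2 * r * M) ^+ 2 * (c * (r * b)) * N * T ->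
  b ^+ 2 * `|Et - Es| <= (4 * M * b ^+ 2 * N + 4 * M ^+ 2 * b * c * N * T) * r.
Proof.
move=> r0 hs ht hst.
have : `|(r * b) ^+ 2 * (Et - Es)| <=
    2 * (2 * r * M * (r * b) ^+ 2 * N) + (2 * r * M) ^+ 2 * (c * (r * b)) * N * T.
  have -> : (r * b) ^+ 2 * (Et - Es) = - (Qt - (r * b) ^+ 2 * Et) +
    (Qs - (r * b) ^+ 2 * Es) + (Qt - Qs) by ring.
  rewrite (le_trans (ler_normD _ _))// lerD//.
  rewrite (le_trans (ler_normD _ _))// normrN; lra.
rewrite normrM (ger0_norm (sqr_ge0 _)).
rewrite [leLHS](_ : _ = r ^+ 2 * (b ^+ 2 * `|Et - Es|)); last by ring.
have r2 : 0 < r ^+ 2 by rewrite exprn_gt0.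
rewrite [leRHS](_ : _ = r ^+ 2 * ((4 * M * b ^+ 2 * N + 4 * M ^+ 2 * b * c * N * T) * r)).
  by rewrite ler_pM2l.
by ring.
Qed.

Section mass_conservation.
Context {R : realType}.
Variables (T : R) (u : R -> R * R -> R).
Hypotheses (T0 : 0 < T) (hu : continuous_in_Z T 4 2 u) (hsol : weak_solution T u).

(** The bump recentred at 0 and hence even, as the cancellation of the linear terms requires. *)
Let beta (x : R) : R := bump01 (1 * x + 2^-1).

Let tbeta : testfun beta.
Proof. by apply: testfun_affine; [exact: oner_neq0|exact: testfun_bump01]. Qed.

Let ebeta x : beta (- x) = beta x.
Proof.
rewrite /beta /bump01 mulrC; congr (flat 1 _ * flat 1 _); lra.
Qed.

Let beta0 x : 1 < `|x| -> beta x = 0.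
Proof.
move=> x1; apply: bump01_eq0; apply: contraL x1 => /andP[h1 h2].
by rewrite -leNgt ler_norml; apply/andP; split; lra.
Qed.

Let beta_ge0 x : 0 <= beta x. Proof. exact: bump01_ge0. Qed.

Let b1 : R := \int[leb]_x beta x.

Let b1_gt0 : 0 < b1.
Proof.
have j := testfun_rintegrable tbeta.
have cb : {within `[(4^-1 : R), 3 / 4], continuous bump01}.
  by apply: continuous_subspaceT; apply: smooth1_continuous; exact: smooth1_bump01.
have [|c c01 hc] := EVT_min _ cb; first by lra.
have c0 : 0 < (bump01 c : R).
  by apply: bump01_gt0; move: c01; rewrite in_itv/= => /andP[? ?]; apply/andP; split; lra.
have jn := rintegrable_near (0 : R) 4^-1.
have q0 : (0 : R) <= 4^-1 by rewrite invr_ge0.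
have h : 0 < \int[leb]_x (bump01 c * b2r (`|0 - x| <= 4^-1)).
  by rewrite RintegralZl// Rintegral_near// mulr_gt0// divr_gt0.
rewrite (lt_le_trans h)//; apply: le_Rintegral => //; first exact: rintegrableZ.
move=> x _; rewrite /b2r; case: ifPn; rewrite ?mulr0 ?beta_ge0// mulr1 sub0r normrN.
rewrite ler_norml => /andP[h1 h2]; apply: hc; rewrite in_itv/=.
by apply/andP; split; lra.
Qed.

Let b2 : R := \int[leb]_x `|D1 beta x|.

Section scaled_kernel.
Variable r : R.
Hypothesis r0 : 0 < r.

Let rn : r^-1 != 0. Proof. by rewrite invr_eq0 gt_eqF. Qed.

Let A (x : R) : R := beta (r^-1 * x + 0).

Let tA : testfun A. Proof. exact: testfun_affine. Qed.

Let eA x : A (- x) = A x.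
Proof. by rewrite /A !addr0 mulrN ebeta. Qed.

Let A0 x : r < `|x| -> A x = 0.
Proof.
move=> rx; apply: beta0; rewrite addr0 normrM gtr0_norm ?invr_gt0// mulrC ltr_pdivlMr//.
by rewrite mul1r.
Qed.

Let D1A : D1 A = fun x => r^-1 * D1 beta (r^-1 * x + 0).
Proof. exact: (derive1_affine r^-1 0 (testfun_smooth tbeta)). Qed.

Let int_scaled (f : R -> R) : rintegrable leb f ->
  \int[leb]_x f (r^-1 * x + 0) = r * \int[leb]_x f x.
Proof.
by move=> jf; rewrite (Rintegral_affine 0 rn jf) gtr0_norm ?invr_gt0// invrK mulrC.
Qed.

Let intA : \int[leb]_x A x = r * b1.
Proof. by rewrite /A int_scaled//; exact: testfun_rintegrable. Qed.

Let int_normA : \int[leb]_x `|A x| = r * b1.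
Proof. by rewrite -intA; apply: eq_Rintegral => x _; rewrite ger0_norm//; exact: beta_ge0. Qed.

Let int_normD1A : \int[leb]_x `|D1 A x| = b2.
Proof.
have jd := rintegrable_norm (testfun_rintegrable (testfun_derive tbeta)).
have ri : 0 < r^-1 by rewrite invr_gt0.
rewrite D1A; under eq_Rintegral do rewrite normrM (gtr0_norm ri).
rewrite (RintegralZl _ measurableT (rintegrable_affine 0 rn jd)).
by rewrite (int_scaled jd) mulrA mulVf ?mul1r// gt_eqF.
Qed.

Variables (v : R -> R * R -> R) (M N : R).
Hypotheses (M0 : 0 <= M) (mv : forall t, measurable_fun [set: plane R] (v t)).
Hypothesis vM : forall t p, `|v t p| <= M.
Hypothesis vL : forall t p q, `|v t p - v t q| <= M * (`|p.1 - q.1| + `|p.2 - q.2|).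
Hypothesis vN : forall t, rintegrable planeleb (v t) /\ \int[planeleb]_p `|v t p| <= N.
Hypothesis uv : forall t, {ae planeleb, forall p, uc T u t p = v t p}.

Let jv t : rintegrable planeleb (v t). Proof. by have [] := vN t. Qed.

Let Q t := corr_pair (tens A A) (v t) (v t).

Let tA1 := testfun_derive tA.
Let tA2 := testfun_derive tA1.

Let oA1 := derive1_even (testfun_smooth tA) eA.
Let eA2 := derive1_odd (testfun_smooth tA1) oA1.
Let oH := hilb_even tA2 eA2.

Let pair_odd (a b : R -> R) : measurable_fun [set: R] a -> measurable_fun [set: R] b ->
  (exists2 C, 0 <= C & forall x : R, `|a x| <= C) ->
  (exists2 C, 0 <= C & forall x : R, `|b x| <= C) ->
  (forall x, a (- x) = - a x) -> (forall x, b (- x) = b x) ->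
  forall t, rintegrable planeleb (fun q => v t q * corr (tens a b) (v t) q) /\
    corr_pair (tens a b) (v t) (v t) = 0.
Proof.
move=> ma mb [C1 C10 h1] [C2 C20 h2] oa eb t.
have mP : measurable_fun [set: plane R] (tens a b) by exact: measurable_tens.
have PC z : `|tens a b z| <= C1 * C2 by rewrite normrM ler_pM.
split; first exact: (rintegrable_corr_pair mP PC).
have Pod z : tens a b (- z) = -1 * tens a b z by rewrite /tens/= oa eb mulN1r mulNr.
by have := corr_pair_sym mP PC Pod (jv t) (jv t); lra.
Qed.

Let v2 t : rintegrable planeleb (fun p => v t p ^+ 2) := rintegrable_v2 mv vM vN t.

(** A' is odd, and so is the Hilbert transform of the even function A''. Both linear terms therefore
    have odd kernels and pair to 0; in the quadratic term the factors 2 and 1/2 cancel. *)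
Let flux_pair t : 2 * \int[planeleb]_q (v t q * corr_flux v A A t q) =
  corr_pair (tens (D1 A) A) (v t) (fun p => v t p ^+ 2).
Proof.
have [jH zH] := pair_odd (testfun_measurable_hilb tA2) (testfun_measurable tA)
  (testfun_hilb_bounded tA2) (testfun_bounded tA) oH eA t.
have [jK zK] := pair_odd (testfun_measurable tA1) (testfun_measurable tA2)
  (testfun_bounded tA1) (testfun_bounded tA2) oA1 eA2 t.
have mP : measurable_fun [set: plane R] (tens (D1 A) A).
  by apply: measurable_tens; exact: testfun_measurable.
have [C1 C10 h1] := testfun_bounded tA1; have [C2 C20 h2] := testfun_bounded tA.
have PC z : `|tens (D1 A) A z| <= C1 * C2 by rewrite normrM ler_pM.
have jL := rintegrable_corr_pair mP PC (jv t) (v2 t).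
set h1' := corr (tens (hilb (D1 (D1 A))) A) (v t) in jH.
set h2' := corr (tens (D1 A) (D1 (D1 A))) (v t) in jK.
set h3' := corr (tens (D1 A) A) (fun p => v t p ^+ 2) in jL.
have E q : v t q * corr_flux v A A t q = v t q * h1' q + v t q * h2' q + 2^-1 * (v t q * h3' q).
  by rewrite /corr_flux -/(h1' q) -/(h2' q) -/(h3' q); ring.
under eq_Rintegral do rewrite E.
have jHK := rintegrableD jH jK; have jL2 := rintegrableZ 2^-1 jL.
rewrite (RintegralD measurableT jHK jL2) (RintegralD measurableT jH jK).
rewrite (RintegralZl _ measurableT jL).
move: zH zK; rewrite /corr_pair -/h1' -/h2' -/h3' => -> ->; rewrite !add0r mulrA mulfV ?mul1r//.
Qed.

Let C3 : R := (2 * r * M) ^+ 2 * (b2 * (r * b1)) * N.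

Let Q_lipschitz s t : 0 <= s <= T -> 0 <= t <= T -> `|Q t - Q s| <= C3 * `|t - s|.
Proof.
apply: (@derive_bound_lipschitz _ Q
  (fun t => 2 * \int[planeleb]_q (v t q * corr_flux v A A t q))).
- apply: continuous_subspaceT.
  exact: (continuous_corr_pair T0 hu mv vN uv tA tA eA eA).
- by move=> x xT; apply: (corr_pair_derive T0 hu hsol M0 mv vM vN uv tA tA eA eA).
- move=> x xT; rewrite flux_pair.
  have [jx Nx] := vN x.
  have := corr_cubic_le M0 (ltW r0) (vM x) (vL x) jx Nx tA1 tA (derive1_support A0) A0 oA1 eA.
  by rewrite /tens_mass int_normD1A int_normA.
Qed.

Lemma energy_gap s t : 0 <= s <= T -> 0 <= t <= T ->
  b1 ^+ 2 * `|\int[planeleb]_p (v t p ^+ 2) - \int[planeleb]_p (v s p ^+ 2)| <=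
  (4 * M * b1 ^+ 2 * N + 4 * M ^+ 2 * b1 * b2 * N * T) * r.
Proof.
move=> sT tT.
have approx x : `|Q x - (r * b1) ^+ 2 * \int[planeleb]_p (v x p ^+ 2)| <=
    2 * r * M * (r * b1) ^+ 2 * N.
  have [jx Nx] := vN x.
  have := corr_approx_mass M0 (ltW r0) (vM x) (vL x) jx Nx tA tA A0 A0.
  by rewrite /tens_mass int_normA intA -expr2.
have lip := Q_lipschitz sT tT.
have ts : `|t - s| <= T.
  by case/andP : sT => s0 sT; case/andP : tT => t0 tT; rewrite ler_norml; apply/andP; split; lra.
have C30 : 0 <= C3.
  have N0 : 0 <= N by have [_ h] := vN 0; apply: le_trans h; apply: Rintegral_ge0.
  have b20 : 0 <= b2 by apply: Rintegral_ge0.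
  exact: mulr_ge0 (mulr_ge0 (sqr_ge0 _) (mulr_ge0 b20 (mulr_ge0 (ltW r0) (ltW b1_gt0)))) N0.
have {}lip := le_trans lip (ler_wpM2l C30 ts).
exact: gap_of_approximation r0 (approx s) (approx t) lip.
Qed.

End scaled_kernel.

(** In [energy_gap] the left-hand side does not depend on the scale [r] of the kernel, and the
    right-hand side tends to 0 with it. *)
Lemma energy_conserved s t : 0 <= s <= T -> 0 <= t <= T ->
  \int[planeleb]_p (uc T u t p ^+ 2) = \int[planeleb]_p (uc T u s p ^+ 2).
Proof.
move=> sT tT.
have [v [M [N [M0 [mv vM vL vN uv]]]]] := regular_representative T0 hu.
have E x : \int[planeleb]_p (uc T u x p ^+ 2) = \int[planeleb]_p (v x p ^+ 2).
  apply: ae_eq_Rintegral.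
  - by apply: measurable_funX; have [] := uc_in_weighted T0 hu x.
  - exact: measurable_funX.
  have [Z [mZ Z0 sub]] := uv x; exists Z; split => // p /=; apply: contra_notP => Zp.
  by congr (_ ^+ 2); apply: contrapT => e; apply: Zp; exact: sub.
rewrite !E; set Et := \int[planeleb]_p (v t p ^+ 2); set Es := \int[planeleb]_p (v s p ^+ 2).
pose C := 4 * M * b1 ^+ 2 * N + 4 * M ^+ 2 * b1 * b2 * N * T.
have h n : b1 ^+ 2 * `|Et - Es| <= C * scale_inv n.
  exact: (energy_gap (scale_inv_gt0 n) M0 mv vM vL vN uv sT tT).
have c : C * scale_inv n @[n --> \oo] --> (0 : R).
  by rewrite -[X in _ --> X](mulr0 C); apply: cvgM; [exact: cvg_cst|exact: cvg_scale_inv].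
have le0 : b1 ^+ 2 * `|Et - Es| <= 0.
  rewrite -(cvg_lim _ c)//; apply: limr_ge; first by apply/cvg_ex; exists 0.
  by apply: nearW.
move: le0; rewrite pmulr_rle0; last by rewrite exprn_gt0.
by rewrite normr_le0 subr_eq0 => /eqP.
Qed.

End mass_conservation.

(** * From vanishing energy to a vanishing solution *)

Section conclusion.
Context {R : realType}.

Lemma box_measure_gt0 (x y e : R) : 0 < e ->
  (0%:E < planeleb (`](x - e)%R, (x + e)%R[ `*` `](y - e)%R, (y + e)%R[))%E.
Proof.
move=> e0; rewrite /planeleb /leb2/= product_measure1E//.
have L (z : R) : leb [set` `]z - e, z + e[] = (2 * e)%:E.
  have h : z - e < z + e by lra.
  by rewrite lebesgue_measure_itv/= lte_fin h -EFinB; congr EFin; ring.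
rewrite [X in (_ < X * _)%E](L x) [X in (_ < _ * X)%E](L y) -EFinM lte_fin.
by rewrite mulr_gt0// mulr_gt0.
Qed.

(** A nonzero value would persist on an open box, whose measure is positive. *)
Lemma ae0_continuous_eq0 (v : R * R -> R) : continuous v ->
  {ae leb2 R, forall p, v p = 0} -> forall x y, v (x, y) = 0.
Proof.
move=> cv [Z [mZ Z0 sub]] x y; apply: contrapT => /eqP vn0.
have near0 : \forall p \near (x, y), v p != 0.
  have c : `|v p| @[p --> (x, y)] --> `|v (x, y)| by apply: cvg_norm; exact: cv.
  have := cvgr_gt _ c; rewrite -normr_gt0 in vn0.
  by move=> /(_ _ _ vn0); apply: filterS => p; rewrite normr_gt0.
have /nbhs_ballP[e /= e0 he] := near0.
have box : `]x - e, x + e[ `*` `]y - e, y + e[ `<=` Z.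
  move=> [a b] /= []; rewrite !in_itv/= => /andP[a1 a2] /andP[b1 b2].
  apply: sub => /=; apply/eqP; apply: he; split; rewrite /ball/= ltr_norml; apply/andP; split; lra.
have := box_measure_gt0 x y e0; rewrite lt_neqAle => /andP[/eqP + _]; apply.
apply/esym; apply: (@subset_measure0 _ _ _ planeleb _ Z _ mZ box Z0).
exact: measurableX.
Qed.

Lemma exists_strong_triple (P : R -> Prop) (t1 t2 t3 : R) :
  t1 <> t2 -> t1 <> t3 -> t2 <> t3 -> P t1 -> P t2 -> P t3 ->
  exists s1 s2 s3, [/\ s1 < s2, s2 < s3, P s1, P s2 & P s3].
Proof.
move=> /eqP n12 /eqP n13 /eqP n23 p1 p2 p3.
case: (ltgtP t1 t2) n12 => // h12 _; case: (ltgtP t1 t3) n13 => // h13 _;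
  case: (ltgtP t2 t3) n23 => // h23 _.
- by exists t1, t2, t3.
- by exists t1, t3, t2.
- by have := lt_trans (lt_trans h13 h12) h23; rewrite ltxx.
- by exists t3, t1, t2.
- by exists t2, t1, t3.
- by have := lt_trans (lt_trans h12 h13) h23; rewrite ltxx.
- by exists t2, t3, t1.
- by exists t3, t2, t1.
Qed.

Variables (T : R) (u : R -> R * R -> R).
Hypotheses (T0 : 0 < T) (hu : continuous_in_Z T 4 2 u) (hsol : weak_solution T u).

Let E t : R := \int[planeleb]_p (uc T u t p ^+ 2).

(** For |y| <= N the local energy dominates the square of the solution; beyond, the squared bracket
    is at least N^2, and the weighted norm pays. *)
Lemma energy_small (b : R -> R) (V N t : R) : testfun b -> 0 < N ->
  (forall y, 0 <= b y) -> (forall y, `|y| <= N -> 1 <= b y) ->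
  wsq (uc T u t) <= V -> energy T u b t = 0 -> E t <= N ^- 2 * V.
Proof.
move=> tb N0 b0 b1 hV e0; have huc := uc_in_weighted T0 hu t; have [mu_ ju] := huc.
have [K hK] := energy_quad tb.
have mb : measurable_fun [set: plane R] (tens (fun=> 1) b).
  by apply: measurable_tens => //; exact: testfun_measurable.
have jq := rintegrable_quad mb hK huc.
have N2 : 0 <= N ^- 2 by rewrite invr_ge0 sqr_ge0.
apply: (@le_trans _ _ (energy T u b t + N ^- 2 * wsq (uc T u t))); last first.
  by rewrite e0 add0r ler_wpM2l.
rewrite /wsq -RintegralZl// /energy -RintegralD//; last exact: rintegrableZ.
apply: le_Rintegral => //; [exact: in_weighted_rintegrable_sqr|
  by apply: rintegrableD => //; exact: rintegrableZ|].
move=> p _; rewrite /tens mul1r exprMn.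
have u2 := sqr_ge0 (uc T u t p); have [yN|yN] := leP `|p.2| N.
  rewrite -[leLHS]addr0 lerD//; first by rewrite ler_peMr// b1.
  exact: mulr_ge0 N2 (mulr_ge0 (sqr_ge0 _) u2).
have h : 1 <= N ^- 2 * bracket2 p ^+ 2.
  rewrite ler_pdivlMl ?exprn_gt0// mulr1 (@le_trans _ _ (bracket2 p))//; last first.
    by rewrite expr2 ler_peMl ?bracket2_ge1// ltW// bracket2_gt0.
  rewrite /bracket2 -(real_normK (num_real p.2)) (@le_trans _ _ (`|p.2| ^+ 2))//.
    by rewrite lerXn2r ?nnegrE// ltW.
  by rewrite lerDr addr_ge0// sqr_ge0.
rewrite -[leLHS]add0r lerD//; first exact: mulr_ge0.
by rewrite mulrA ler_peMl.
Qed.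

(** The time at which the local energy vanishes depends on the cutoff; conservation carries the
    bound obtained there to the fixed time [t], before the cutoff is removed. *)
Lemma energy_eq0 (s1 s2 s3 : R) : 0 <= s1 -> s1 < s2 -> s2 < s3 -> s3 <= T ->
  weighted_L2 (7 / 2) (uc T u s1) -> weighted_L2 (7 / 2) (uc T u s2) ->
  weighted_L2 (7 / 2) (uc T u s3) -> forall t, 0 <= t <= T -> E t = 0.
Proof.
move=> a1 a2 a3 a4 w1 w2 w3 t tT; have [V V0 hV] := uc_bounded T0 hu.
have [chi [_ _ cut]] := @exists_cutoff R.
have h n : E t <= scale_inv n ^+ 2 * V.
  have [|b [tb b0 b1]] := cut n.+1%:R; first by rewrite ltr0n.
  have [s sT es] := energy_vanishes T0 hu hsol tb a1 a2 a3 a4 w1 w2 w3.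
  rewrite /E (energy_conserved T0 hu hsol sT tT) /scale_inv exprVn.
  by apply: energy_small tb _ b0 b1 (hV s) es; rewrite ltr0n.
apply/eqP; rewrite eq_le; apply/andP; split; last first.
  by apply: Rintegral_ge0 => p _; exact: sqr_ge0.
have c : scale_inv n ^+ 2 * V @[n --> \oo] --> (0 : R).
  rewrite -[X in _ --> X](mul0r V) -{1}(mul0r (0 : R)).
  by apply: cvgM; [apply: cvgM; exact: cvg_scale_inv|exact: cvg_cst].
rewrite -(cvg_lim _ c)//; apply: limr_ge; first by apply/cvg_ex; exists 0.
exact: nearW.
Qed.

Lemma energy_eq0_ae t : 0 <= t <= T -> E t = 0 -> {ae leb2 R, forall p, u t p = 0}.
Proof.
move=> tT e0; have huc := uc_in_weighted T0 hu t; have [mu_ ju] := huc.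
have j2 := in_weighted_rintegrable_sqr huc.
rewrite /E in e0; move: e0 mu_ j2; rewrite uc_id// => e0 mu_ j2.
have m2 : measurable_fun [set: plane R] (EFin \o (fun p => u t p ^+ 2)).
  exact/measurable_EFinP/measurable_funX.
have /(ae_eq_integral_abs planeleb measurableT)[+ _] := m2.
have z : (\int[planeleb]_p `|(EFin \o (fun p => u t p ^+ 2)%R) p| = 0)%E.
  under eq_integral do rewrite gee0_abs ?lee_fin ?sqr_ge0//.
  by rewrite -EFin_Rintegral// e0.
move=> /(_ z)[Z [mZ Z0 sub]]; exists Z; split => // p /= h; apply: sub => /=.
by apply: contra_not h => /(_ I) [] /eqP; rewrite sqrf_eq0 => /eqP.
Qed.

End conclusion.

Theorem theorem1p6 (R : realType) (T : R) (u : R -> R * R -> R)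
  (phi : R * R -> R) (hT : 0 < T)
  (hu : continuous_in_Z T 4 2 u)
  (hsol : ivp_solution T u phi)
  (t1 t2 t3 : R)
  (ht1 : t1 \in `[0, T]) (ht2 : t2 \in `[0, T]) (ht3 : t3 \in `[0, T])
  (h12 : t1 <> t2) (h13 : t1 <> t3) (h23 : t2 <> t3)
  (hZ1 : Z 7 (7 / 2) (u t1))
  (hZ2 : Z 7 (7 / 2) (u t2))
  (hZ3 : Z 7 (7 / 2) (u t3)) :
  forall t, t \in `[0, T] ->
    {ae leb2 R, forall p, u t p = 0} /\
    (forall v : R * R -> R, continuous v ->
       {ae leb2 R, forall p, v p = u t p} -> forall x y, v (x, y) = 0).
Proof.
case: hsol => hweak _.
pose P s := 0 <= s <= T /\ weighted_L2 (7 / 2) (uc T u s).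
have PZ s : s \in `[0, T] -> Z 7 (7 / 2) (u s) -> P s.
  by rewrite in_itv/= => sT [_ w]; split => //; rewrite uc_id.
have [s1 [s2 [s3 [s12 s23 [/andP[s1_ _] w1] [_ w2] [/andP[_ s3T] w3]]]]] :=
  exists_strong_triple h12 h13 h23 (PZ _ ht1 hZ1) (PZ _ ht2 hZ2) (PZ _ ht3 hZ3).
move=> t; rewrite in_itv/= => tT.
have e0 := energy_eq0 hT hu hweak s1_ s12 s23 s3T w1 w2 w3 tT.
have ut0 := energy_eq0_ae hT hu tT e0.
split => // v cv [Z1 [mZ1 Z10 sub1]].
apply: ae0_continuous_eq0 => //; have [Z2 [mZ2 Z20 sub2]] := ut0.
exists (Z1 `|` Z2); split; first exact: measurableU.
  exact: null_set_setU.
move=> p /=; apply: contra_notP => /not_orP[n1 n2].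
have -> : v p = u t p by apply: contrapT => e; apply: n1; exact: sub1.
by apply: contrapT => e; apply: n2; exact: sub2.
Qed.
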